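(* Let $b_1\in]0,1[$. For an integer $n\ge1$ and $b_2\in]0,b_1[$ let $P_n(\lambda)=\det M_n(\lambda)$, where $$M_{n}(\lambda)=\begin{pmatrix} b_1\Big[n\lambda-1+b_1^{2n}-n\Big(\dfrac{b_2}{b_1}\Big)^2\Big] & b_2\Big[\Big(\dfrac{b_2}{b_1}\Big)^{n}-(b_1b_2)^{n}\Big] \\ -b_1\Big[\Big(\dfrac{b_2}{b_1}\Big)^{n}-(b_1b_2)^{n}\Big] & b_2\Big[n\lambda-n+1-b_2^{2n}\Big]\end{pmatrix},$$ and let $$\mathcal{E}_{b_1}=\Big\{b_2\in]0,b_1[\;:\;\exists\, n\geq2 \text{ such that } P_n\big(1+b_2^2-b_1^2\big)=0\Big\}.$$ Then for any $b_2\in]0,b_1[$ with $b_2\notin\mathcal{E}_{b_1}$, there exists a curve of nontrivial $1$-fold doubly-connected $V$-states of the Euler equations in the unit disc bifurcating from the annulus $\{z\in\mathbb{C}: b_2<|z|<b_1\}$ at the angular velocity $$\Omega_1=\frac{b_1^2-b_2^2}{2}.$$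
   Context: $\mathbb{D}$ is the open unit disc of $\mathbb{C}$ and $\mathbb{T}=\partial\mathbb{D}$. The 2D incompressible Euler equations in $\mathbb{D}$ in vorticity form are $\partial_t\omega+v\cdot\nabla\omega=0$, $v=\nabla^\perp\Psi$, $\Delta\Psi=\omega$ in $\mathbb{D}$, $\Psi=0$ on $\partial\mathbb{D}$. For a domain $D$ with $\overline D\subset\mathbb{D}$, the patch $\chi_D$ (or $D$ itself) is called a $V$-state (rotating patch) with angular velocity $\Omega\in\mathbb{R}$ if the solution with initial vorticity $\chi_D$ is $\chi_{D_t}$ with $D_t=e^{it\Omega}D$. For $D$ bounded by finitely many disjoint $C^1$ Jordan curves and symmetric with respect to the real axis, being a $V$-state is characterized by (and in this statement means) the boundary equation $$\operatorname{Re}\Big\{\Big(2\Omega\,\overline z+\frac1{2i\pi}\int_\Gamma\frac{\overline z-\overline\xi}{z-\xi}\,d\xi-\frac1{2i\pi}\int_\Gamma\frac{|\xi|^2}{1-z\xi}\,d\xi\Big)z'\Big\}=0\qquad\text{for all } z\in\Gamma=\partial D,$$ where $\Gamma$ carries the positive orientation as boundary of $D$ and $z'$ is a tangent vector to $\Gamma$ at $z$. Doubly-connected means $D=D_1\setminus \overline{D_2}$ with $D_1,D_2$ simply-connected domains, $\overline{D_2}\subset D_1$; then $\int_\Gamma=\int_{\partial D_1}-\int_{\partial D_2}$ with both curves counterclockwise. Annuli centered at $0$ satisfy the equation for every $\Omega$ (trivial solutions). ''$1$-fold'' means that no rotational symmetry is imposed (only symmetry with respect to the real axis). Meaning of ''a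 curve of nontrivial $V$-states bifurcating from the annulus at angular velocity $\Omega_1$'': fix $\alpha\in]0,1[$. There are $a>0$ and continuous maps $s\in(-a,a)\mapsto\Omega(s)\in\mathbb{R}$, $s\mapsto(f_{1,s},f_{2,s})\in C^{1+\alpha}(\mathbb{T})^2$ with $\Omega(0)=\Omega_1$, $(f_{1,0},f_{2,0})=(0,0)$, $(f_{1,s},f_{2,s})\neq(0,0)$ for $s\ne0$, each $f_{j,s}$ of the form $\sum_{n\ge0}a_{j,n}(s)\overline w^{\,n}$ with $a_{j,n}(s)\in\mathbb{R}$, such that $\phi_{j,s}(w)=b_jw+f_{j,s}(w)$ extends to a conformal map from $\{|w|>1\}$ onto the exterior of a simply-connected domain $D_{j,s}$ with boundary $\phi_{j,s}(\mathbb{T})$, $\overline{D_{2,s}}\subset D_{1,s}$, $\overline{D_{1,s}}\subset\mathbb{D}$, and $D_{1,s}\setminus\overline{D_{2,s}}$ is a $V$-state with angular velocity $\Omega(s)$. *)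

(* Defs.v *)
From Stdlib Require Import Reals List.
From Coquelicot Require Import Coquelicot.

Open Scope R_scope.

(** * Plane topology *)

Definition closure (A : C -> Prop) (z : C) : Prop :=
  forall eps : posreal, exists y : C, A y /\ Cmod (y - z) < eps.

Definition boundary (A : C -> Prop) (z : C) : Prop :=
  closure A z /\ closure (fun y => ~ A y) z.

Definition connected (A : C -> Prop) : Prop :=
  forall U V : C -> Prop,
    open (U : C_UniformSpace -> Prop) -> open (V : C_UniformSpace -> Prop) ->
    (forall z, A z -> U z \/ V z) ->
    (exists z, A z /\ U z) -> (exists z, A z /\ V z) ->
    exists z, A z /\ U z /\ V z.

Definition domain (A : C -> Prop) : Prop :=
  (exists z, A z) /\ open (A : C_UniformSpace -> Prop) /\ connected A.

Definition unit_interval (t : R) : Prop := 0 <= t <= 1.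

Definition unit_square (p : R * R) : Prop :=
  unit_interval (fst p) /\ unit_interval (snd p).

(** Every closed path in [A] is homotopic in [A], through closed paths, to a
    constant path; the first coordinate of [H] is the path parameter. *)
Definition simply_connected_domain (A : C -> Prop) : Prop :=
  domain A /\
  forall c : R -> C,
    @continuous_on R_UniformSpace C_UniformSpace unit_interval c ->
    (forall t, unit_interval t -> A (c t)) ->
    c 0 = c 1 ->
    exists H : R * R -> C,
      @continuous_on (prod_UniformSpace R_UniformSpace R_UniformSpace)
        C_UniformSpace unit_square H /\
      (forall p, unit_square p -> A (H p)) /\
      (forall t, unit_interval t -> H (t, 0) = c t) /\
      (forall s, unit_interval s -> H (0, s) = H (1, s)) /\
      (forall t, unit_interval t -> H (t, 1) = H (0, 1)).

Definition unit_disc (z : C) : Prop := Cmod z < 1.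

(** * Closed curves and contour integrals *)

Definition curve_derive (c : R -> C) (t : R) : C :=
  (Derive (fun u => Re (c u)) t, Derive (fun u => Im (c u)) t).

Definition C1_Jordan_curve (c : R -> C) : Prop :=
  (forall t, c (t + 2 * PI) = c t) /\
  (forall t, @ex_derive R_AbsRing C_R_NormedModule c t) /\
  (forall t, @continuous R_UniformSpace C_UniformSpace (curve_derive c) t) /\
  (forall t, curve_derive c t <> 0) /\
  (forall t u, 0 <= t < 2 * PI -> 0 <= u < 2 * PI -> c t = c u -> t = u).

Definition contour_integral (c : R -> C) (F : C -> C) : C :=
  @RInt C_R_CompleteNormedModule
    (fun t => (F (c t) * curve_derive c t)%C) 0 (2 * PI).

Definition contours_integral (G : list (R -> C)) (F : C -> C) : C :=
  fold_right Cplus (RtoC 0) (map (fun c => contour_integral c F) G).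

(** [D] is bounded by the disjoint [C^1] Jordan curves of [G], each positively
    oriented as part of the boundary of [D]: the normal [i c'(t)] to the left
    of the curve points into [D]. In particular the inner boundary component
    of a doubly-connected domain is traversed clockwise, so that the integral
    over [G] is the difference of the two counterclockwise integrals. *)
Definition positive_boundary (D : C -> Prop) (G : list (R -> C)) : Prop :=
  (forall c, In c G -> C1_Jordan_curve c) /\
  ForallOrdPairs (fun c1 c2 => forall t u, c1 t <> c2 u) G /\
  (forall z, boundary D z <-> exists c, In c G /\ exists t, z = c t) /\
  (forall c, In c G -> forall t, exists eps0 : posreal,
     forall eps, 0 < eps < eps0 -> D (c t + eps * (Ci * curve_derive c t))%C).

(** * V-states in the unit disc *)

(** The two Cauchy-type integrands are bounded on the boundary curves; the first
    one is undefined only at [xi = z], which does not affect its integral. *)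
Definition V_state_equation (Omega : R) (G : list (R -> C)) : Prop :=
  forall c, In c G -> forall t : R,
    let z := c t in
    Re ((2 * Omega * Cconj z
         + 1 / (2 * Ci * PI)
           * contours_integral G (fun xi => (Cconj z - Cconj xi) / (z - xi))
         - 1 / (2 * Ci * PI)
           * contours_integral G (fun xi => RtoC (Cmod xi ^ 2) / (1 - z * xi)))
        * curve_derive c t)%C = 0.

Definition V_state (Omega : R) (D : C -> Prop) : Prop :=
  domain D /\
  (forall z, closure D z -> unit_disc z) /\
  (forall z, D z -> D (Cconj z)) /\
  exists G : list (R -> C), positive_boundary D G /\ V_state_equation Omega G.

(** * Hölder functions on the unit circle *)

Definition cis (t : R) : C := (cos t, sin t).

(** The derivative [df/dw] at [w = cis t] of a function on the unit circle;
    [f : C -> C] is only evaluated on the circle. *)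
Definition circle_derive (f : C -> C) (t : R) : C :=
  (curve_derive (fun u => f (cis u)) t / (Ci * cis t))%C.

Definition sup_norm (g : R -> C) : Rbar :=
  Lub_Rbar (fun r => exists t, r = Cmod (g t)).

Definition holder_seminorm (alpha : R) (g : R -> C) : Rbar :=
  Lub_Rbar (fun r => exists t u, cis t <> cis u /\
    r = Cmod (g t - g u) / Rpower (Cmod (cis t - cis u)) alpha).

Definition in_C1_holder (alpha : R) (f : C -> C) : Prop :=
  (forall t, @ex_derive R_AbsRing C_R_NormedModule (fun u => f (cis u)) t) /\
  is_finite (sup_norm (fun t => f (cis t))) /\
  is_finite (sup_norm (circle_derive f)) /\
  is_finite (holder_seminorm alpha (circle_derive f)).

(** A norm only on [in_C1_holder alpha], where the three suprema are finite. *)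
Definition C1_holder_norm (alpha : R) (f : C -> C) : R :=
  real (sup_norm (fun t => f (cis t)))
  + real (sup_norm (circle_derive f))
  + real (holder_seminorm alpha (circle_derive f)).

Definition C1_holder_curve (alpha a : R) (f : R -> C -> C) : Prop :=
  (forall s, - a < s < a -> in_C1_holder alpha (f s)) /\
  (forall s0, - a < s0 < a ->
     filterlim (fun s => C1_holder_norm alpha (fun w => (f s w - f s0 w)%C))
       (locally s0) (locally 0)).

(** [f w] is the sum of [a_n * conj(w)^n], [n >= 0], with [a_n] real. *)
Definition real_conj_series (f : C -> C) : Prop :=
  exists a : nat -> R, forall w : C, Cmod w = 1 ->
    @is_series C_AbsRing C_NormedModule
      (fun n => (a n * Cconj w ^ n)%C) (f w).

(** * Bifurcating curves *)

Definition extends_conformally_onto_exterior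
    (phi : C -> C) (D : C -> Prop) : Prop :=
  exists Phi : C -> C,
    (forall w, Cmod w = 1 -> Phi w = phi w) /\
    @continuous_on C_UniformSpace C_UniformSpace (fun w => 1 <= Cmod w) Phi /\
    (forall w, 1 < Cmod w -> @ex_derive C_AbsRing C_NormedModule Phi w) /\
    (forall w1 w2, 1 < Cmod w1 -> 1 < Cmod w2 -> Phi w1 = Phi w2 -> w1 = w2) /\
    (forall z, ~ closure D z <-> exists w, 1 < Cmod w /\ z = Phi w).

Definition exterior_parametrization (phi : C -> C) (D : C -> Prop) : Prop :=
  simply_connected_domain D /\
  (forall z, boundary D z <-> exists w, Cmod w = 1 /\ z = phi w) /\
  extends_conformally_onto_exterior phi D.

(** A curve of nontrivial doubly-connected V-states issued, at angular velocity
    [Omega1], from the annulus [b2 < |z| < b1]. *)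
Definition V_states_bifurcate (alpha b1 b2 Omega1 : R) : Prop :=
  exists (a : R) (Omega : R -> R) (f1 f2 : R -> C -> C),
    0 < a /\
    (forall s, - a < s < a -> continuous Omega s) /\
    C1_holder_curve alpha a f1 /\ C1_holder_curve alpha a f2 /\
    Omega 0 = Omega1 /\
    (forall w, Cmod w = 1 -> f1 0 w = 0 /\ f2 0 w = 0) /\
    (forall s, - a < s < a -> s <> 0 ->
       exists w, Cmod w = 1 /\ (f1 s w <> 0 \/ f2 s w <> 0)) /\
    (forall s, - a < s < a ->
       real_conj_series (f1 s) /\ real_conj_series (f2 s) /\
       exists D1 D2 : C -> Prop,
         exterior_parametrization (fun w => (b1 * w + f1 s w)%C) D1 /\
         exterior_parametrization (fun w => (b2 * w + f2 s w)%C) D2 /\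
         (forall z, closure D2 z -> D1 z) /\
         (forall z, closure D1 z -> unit_disc z) /\
         V_state (Omega s) (fun z => D1 z /\ ~ closure D2 z)).

(** * The linearized operator at the annulus *)

Definition M (b1 b2 : R) (n : nat) (lambda : R) : matrix 2 2 :=
  mk_matrix 2 2 (fun i j =>
    match i, j with
    | O, O => b1 * (INR n * lambda - 1 + b1 ^ (2 * n) - INR n * (b2 / b1) ^ 2)
    | O, _ => b2 * ((b2 / b1) ^ n - (b1 * b2) ^ n)
    | _, O => - b1 * ((b2 / b1) ^ n - (b1 * b2) ^ n)
    | _, _ => b2 * (INR n * lambda - INR n + 1 - b2 ^ (2 * n))
    end).

Definition det2 (A : @matrix R 2 2) : R :=
  coeff_mat 0 A 0 0 * coeff_mat 0 A 1 1 - coeff_mat 0 A 0 1 * coeff_mat 0 A 1 0.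

Definition P (b1 b2 : R) (n : nat) (lambda : R) : R := det2 (M b1 b2 n lambda).

Definition exceptional_set (b1 b2 : R) : Prop :=
  0 < b2 < b1 /\
  exists n : nat, (2 <= n)%nat /\ P b1 b2 n (1 + b2 ^ 2 - b1 ^ 2) = 0.

(* Main.v *)
From Stdlib Require Import Reals Lra Lia Psatz ZArith List ClassicalEpsilon FunctionalExtensionality PropExtensionality.
From Coquelicot Require Import Coquelicot.
Require Import Defs.
Import ListNotations.

(** Write the boundary curves as phi_j(w) = b_j w + sum_n a_{j,n} conj(w)^n and
    measure the coefficients in a weighted l1 norm. In the Wiener algebra of the
    torus the two Cauchy-type integrals depend differentiably, with quadratic
    remainder, on the coefficients: the factor w - tau cancels in the singular
    kernel, and everything else is a geometric series. The Fourier coefficients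
    of index n + 1 of the linearization at the annulus are M_{n+1}, applied to
    (a_{1,n}, a_{2,n}).

    At Omega_1 the matrix M_1 is singular with kernel spanned by (1, 1), which
    is the translation mode, whereas for n >= 2 the matrix M_n is invertible
    because b_2 is not exceptional, and its inverse is O(1/n). Dividing the
    equation for s (1, 1) + s y by s makes it a contraction in the remaining
    coefficients and the speed; its fixed point is Lipschitz in s, which gives
    the branch.

    For small s the two boundary parametrizations are restrictions of one
    homeomorphism z + h(z) of the plane with h of small Lipschitz constant, so
    that all topological properties of the patch are transported from the
    annulus. *)

(** * Sums and series of complex numbers *)

(** The boundary equation contains phi', so it loses one derivative. The unknowns carry the weight
    (n+1)(1+d(n+1)), the sine modes of the equation only 1+d(n+1); the O(1/n) inverses recover
    exactly this loss, so that the iterated map acts in one space. The larger weight also controls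
    n^2, hence f' is Lipschitz on the circle and all Hölder exponents are covered at once. Real
    coefficients express the symmetry in the real axis: conjugation on the circle becomes w -> 1/w,
    which stays inside the algebra, and the boundary equation becomes a pure sine series. The number
    d > 0 has to be small because the geometric kernels, of ratios b2/b1 and b_j b_k, must converge
    in the weighted norm, where each factor w^(+-1) tau^(+-1) costs 1+2d. In mode 1, one column of
    the singular M_1 is replaced by the derivative in the speed; the new determinant
    b2(1-b1^2)(b1^2-b2^2)/b1 is positive for every b2 in ]0,b1[, which is the transversality
    condition. Norms occur only through upper bounds, as relations, since a sequence may have
    infinite norm. *)

Lemma Cmod_minus_sym (a b : C) : Cmod (a - b) = Cmod (b - a).
Proof. rewrite <- Cmod_opp. f_equal. ring. Qed.

Lemma Cmod_minus_triangle (a b c : C) : Cmod (a - c) <= Cmod (a - b) + Cmod (b - c).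
Proof. replace (a - c)%C with ((a - b) + (b - c))%C by ring. apply Cmod_triangle. Qed.

Lemma Cmod_minus_le (a b : C) : Cmod (a - b) <= Cmod a + Cmod b.
Proof.
  replace (a - b)%C with (a + - b)%C by ring.
  rewrite <- (Cmod_opp b). apply Cmod_triangle.
Qed.

Lemma Cmod_triangle_rev (a b : C) : Cmod a - Cmod b <= Cmod (a - b).
Proof.
  pose proof (Cmod_triangle (a - b) b) as H.
  replace (a - b + b)%C with a in H by ring. lra.
Qed.

Lemma im_le_Cmod (c : C) : Rabs (Im c) <= Cmod c.
Proof.
  eapply Rle_trans; [ apply (Rmax_r (Rabs (fst c))) | apply (Rmax_Cmod c) ].
Qed.

Lemma Cmod_le_re_im (c : C) : Cmod c <= Rabs (Re c) + Rabs (Im c).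
Proof.
  destruct c as [x y]. simpl.
  replace ((x, y) : C) with (RtoC x + RtoC y * Ci)%C
    by (unfold Cplus, Cmult, RtoC, Ci; simpl; f_equal; ring).
  eapply Rle_trans; [ apply Cmod_triangle | ].
  rewrite Cmod_mult, Cmod_Ci, !Cmod_R. lra.
Qed.

Lemma C_eq_of_small (a b : C) : (forall eps, 0 < eps -> Cmod (a - b) <= eps) -> a = b.
Proof.
  intros H.
  assert (E : (a - b)%C = 0).
  { apply Cmod_eq_0. apply Rle_antisym; [ | apply Cmod_ge_0 ].
    apply Rnot_lt_le. intros Hp. specialize (H (Cmod (a - b) / 2)). lra. }
  replace a with ((a - b) + b)%C by ring. rewrite E. ring.
Qed.

Fixpoint rsum (u : nat -> R) (n : nat) : R :=
  match n with O => 0 | S k => rsum u k + u k end.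

Fixpoint csum (u : nat -> C) (n : nat) : C :=
  match n with O => 0 | S k => (csum u k + u k)%C end.

Lemma csum_S (u : nat -> C) (n : nat) : csum u (S n) = (csum u n + u n)%C.
Proof. reflexivity. Qed.

Lemma rsum_sum_n (u : nat -> R) (n : nat) : rsum u (S n) = sum_n u n.
Proof.
  induction n as [|n IH].
  - rewrite sum_O. simpl. ring.
  - rewrite sum_Sn, <- IH. reflexivity.
Qed.

Lemma csum_sum_n (u : nat -> C) (n : nat) : csum u (S n) = @sum_n C_R_NormedModule u n.
Proof.
  induction n as [|n IH].
  - rewrite sum_O. simpl. ring.
  - rewrite sum_Sn, <- IH. reflexivity.
Qed.

Lemma rsum_le (u v : nat -> R) (n : nat) :
  (forall k, (k < n)%nat -> u k <= v k) -> rsum u n <= rsum v n.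
Proof.
  induction n as [|n IH]; simpl; intros H; [ lra | ].
  pose proof (H n ltac:(lia)). specialize (IH (fun k hk => H k ltac:(lia))). lra.
Qed.

Lemma rsum_nonneg (u : nat -> R) (n : nat) : (forall k, 0 <= u k) -> 0 <= rsum u n.
Proof. intros H. induction n as [|n IH]; simpl; [ lra | specialize (H n); lra ]. Qed.

Lemma rsum_mono (u : nat -> R) (n m : nat) :
  (forall k, 0 <= u k) -> (n <= m)%nat -> rsum u n <= rsum u m.
Proof. intros H Hnm. induction Hnm; simpl; [ lra | specialize (H m); lra ]. Qed.

Lemma rsum_plus (u v : nat -> R) (n : nat) :
  rsum (fun k => u k + v k) n = rsum u n + rsum v n.
Proof. induction n as [|n IH]; simpl; [ | rewrite IH ]; ring. Qed.

Lemma rsum_scal (c : R) (u : nat -> R) (n : nat) :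
  rsum (fun k => c * u k) n = c * rsum u n.
Proof. induction n as [|n IH]; simpl; [ | rewrite IH ]; ring. Qed.

Lemma rsum_ext (u v : nat -> R) (n : nat) :
  (forall k, (k < n)%nat -> u k = v k) -> rsum u n = rsum v n.
Proof.
  intros H. apply Rle_antisym; apply rsum_le; intros; rewrite H; auto; lra.
Qed.

Lemma rsum_ge_term (u : nat -> R) (n k : nat) :
  (forall k, 0 <= u k) -> (k < n)%nat -> u k <= rsum u n.
Proof.
  intros H Hk. apply Rle_trans with (rsum u (S k)).
  - simpl. pose proof (rsum_nonneg u k H). lra.
  - apply rsum_mono; auto.
Qed.

Lemma csum_ext (u v : nat -> C) (n : nat) :
  (forall k, (k < n)%nat -> u k = v k) -> csum u n = csum v n.
Proof.
  induction n as [|n IH]; simpl; intros H; auto.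
  rewrite IH, H; auto.
Qed.

Lemma csum_plus (u v : nat -> C) (n : nat) :
  csum (fun k => u k + v k)%C n = (csum u n + csum v n)%C.
Proof. induction n as [|n IH]; simpl; [ | rewrite IH ]; ring. Qed.

Lemma csum_scal (c : C) (u : nat -> C) (n : nat) :
  csum (fun k => c * u k)%C n = (c * csum u n)%C.
Proof. induction n as [|n IH]; simpl; [ | rewrite IH ]; ring. Qed.

Lemma csum_diff_le (u : nat -> C) (m : nat -> R) (n p : nat) :
  (forall k, Cmod (u k) <= m k) -> (n <= p)%nat ->
  Cmod (csum u p - csum u n) <= rsum m p - rsum m n.
Proof.
  intros H Hnp. induction Hnp as [|p Hnp IH].
  - replace (csum u n - csum u n)%C with (RtoC 0) by ring. rewrite Cmod_0. lra.
  - simpl. replace (csum u p + u p - csum u n)%C with ((csum u p - csum u n) + u p)%C by ring.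
    eapply Rle_trans; [ apply Cmod_triangle | ]. specialize (H p). lra.
Qed.

Lemma csum_le (u : nat -> C) (m : nat -> R) (n : nat) :
  (forall k, Cmod (u k) <= m k) -> Cmod (csum u n) <= rsum m n.
Proof.
  intros H. pose proof (csum_diff_le u m 0 n H ltac:(lia)) as H1.
  change (Cmod (csum u n - 0) <= rsum m n - 0) in H1.
  replace (csum u n - 0)%C with (csum u n) in H1 by ring. lra.
Qed.

Definition Csum (u : nat -> C) (s : C) : Prop :=
  forall eps, 0 < eps -> exists N, forall n, (N <= n)%nat -> Cmod (csum u n - s) <= eps.

(** [epsilon] makes the sum a total function; its value carries information only together with a
    convergence proof, through [Cser_unique]. *)
Definition Cser (u : nat -> C) : C := epsilon (inhabits (RtoC 0)) (Csum u).

Lemma Csum_unique (u : nat -> C) (s s' : C) : Csum u s -> Csum u s' -> s = s'.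
Proof.
  intros H H'. apply C_eq_of_small. intros eps He.
  destruct (H (eps / 2)) as [N HN]; [ lra | ].
  destruct (H' (eps / 2)) as [N' HN']; [ lra | ].
  specialize (HN (N + N')%nat ltac:(lia)). specialize (HN' (N + N')%nat ltac:(lia)).
  pose proof (Cmod_minus_triangle s (csum u (N + N')) s').
  rewrite (Cmod_minus_sym s (csum _ _)) in H0. lra.
Qed.

Lemma Cser_unique (u : nat -> C) (s : C) : Csum u s -> Cser u = s.
Proof.
  intros H. apply (Csum_unique u); auto.
  apply (epsilon_spec (inhabits (RtoC 0)) (Csum u)). exists s; auto.
Qed.

Lemma Csum_ext (u v : nat -> C) (s : C) : (forall n, u n = v n) -> Csum u s -> Csum v s.
Proof.
  intros H Hu eps He. destruct (Hu eps He) as [N HN]. exists N. intros n Hn.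
  rewrite <- (csum_ext u v); auto.
Qed.

Lemma Cser_ext (u v : nat -> C) : (forall n, u n = v n) -> Cser u = Cser v.
Proof. intros H. f_equal. apply functional_extensionality. auto. Qed.

Lemma Csum_plus (u v : nat -> C) (s t : C) :
  Csum u s -> Csum v t -> Csum (fun n => u n + v n)%C (s + t)%C.
Proof.
  intros H H' eps He.
  destruct (H (eps / 2)) as [N HN]; [ lra | ].
  destruct (H' (eps / 2)) as [N' HN']; [ lra | ].
  exists (N + N')%nat. intros n Hn. rewrite csum_plus.
  replace (csum u n + csum v n - (s + t))%C with ((csum u n - s) + (csum v n - t))%C by ring.
  eapply Rle_trans; [ apply Cmod_triangle | ].
  specialize (HN n ltac:(lia)). specialize (HN' n ltac:(lia)). lra.
Qed.

Lemma Csum_scal (c : C) (u : nat -> C) (s : C) :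
  Csum u s -> Csum (fun n => c * u n)%C (c * s)%C.
Proof.
  intros H eps He.
  pose proof (Cmod_ge_0 c) as Hc.
  destruct (H (eps / (Cmod c + 1))) as [N HN].
  { apply Rdiv_lt_0_compat; lra. }
  exists N. intros n Hn. rewrite csum_scal.
  replace (c * csum u n - c * s)%C with (c * (csum u n - s))%C by ring.
  rewrite Cmod_mult. specialize (HN n Hn).
  apply Rle_trans with ((Cmod c + 1) * (eps / (Cmod c + 1))).
  - apply Rmult_le_compat; try lra. apply Cmod_ge_0.
  - right. field. lra.
Qed.

Lemma Csum_single (u : nat -> C) (k : nat) :
  (forall n, n <> k -> u n = 0) -> Csum u (u k).
Proof.
  intros H.
  assert (H1 : forall n, (n <= k)%nat -> csum u n = 0).
  { induction n as [|n IH]; simpl; intros Hn; auto.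
    rewrite IH, H by lia. ring. }
  assert (H2 : forall n, (k < n)%nat -> csum u n = u k).
  { intros n Hn. induction Hn as [|n Hn IH]; simpl.
    - rewrite H1 by lia. ring.
    - rewrite IH, (H n) by lia. ring. }
  intros eps He. exists (S k). intros n Hn. rewrite H2 by lia.
  replace (u k - u k)%C with (RtoC 0) by ring. rewrite Cmod_0. lra.
Qed.

Lemma Csum_zero (u : nat -> C) : (forall n, u n = 0) -> Csum u 0.
Proof. intros H. rewrite <- (H O). apply (Csum_single u O). auto. Qed.

(** Stands for a bound on the sum of a series. In the applications the terms are nonnegative, so
    bounded partial sums mean convergence and the sum itself never has to be named. *)
Definition sum_le (m : nat -> R) (S : R) : Prop := forall N, rsum m N <= S.

(** Passing to the least bound makes the tails S' - [rsum m N] arbitrarily small, which an arbitrary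
    bound S does not give. *)
Lemma sum_le_sup (m : nat -> R) (S : R) :
  sum_le m S ->
  exists S', S' <= S /\ sum_le m S' /\ forall eps, 0 < eps -> exists N, S' - eps <= rsum m N.
Proof.
  intros H.
  destruct (completeness (fun r => exists N, r = rsum m N)) as [S' [H1 H2]].
  - exists S. intros r [N ->]. apply H.
  - exists 0, O. reflexivity.
  - exists S'. split; [ | split ].
    + apply H2. intros r [N ->]. apply H.
    + intros N. apply H1. exists N; auto.
    + intros eps He. apply NNPP. intros Hn.
      assert (Hc : S' <= S' - eps); [ | lra ].
      apply H2. intros r [N ->]. apply Rnot_lt_le. intros Hlt. apply Hn. exists N. lra.
Qed.

Lemma Csum_of_dominated (u : nat -> C) (m : nat -> R) (S : R) :
  (forall n, Cmod (u n) <= m n) -> sum_le m S -> exists s, Csum u s.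
Proof.
  intros Hu Hm.
  assert (Hex : forall f : nat -> R, (forall n, Rabs (f n) <= m n) -> ex_series f).
  { intros f Hf. apply ex_series_Rabs.
    destruct (ex_finite_lim_seq_incr (fun n => sum_n (fun k => Rabs (f k)) n) S) as [l Hl].
    - intros n. rewrite sum_Sn. unfold plus; simpl. pose proof (Rabs_pos (f (Datatypes.S n))). lra.
    - intros n. rewrite <- rsum_sum_n. eapply Rle_trans; [ | apply Hm ].
      apply rsum_le. intros; apply Hf.
    - exists l. exact Hl. }
  destruct (Hex (fun n => Re (u n))) as [x Hx].
  { intros n. eapply Rle_trans; [ apply re_le_Cmod | apply Hu ]. }
  destruct (Hex (fun n => Im (u n))) as [y Hy].
  { intros n. eapply Rle_trans; [ apply im_le_Cmod | apply Hu ]. }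
  exists (x, y). intros eps He.
  assert (Hlim : forall f l, is_series f l -> exists N, forall n, (N <= n)%nat -> Rabs (rsum f n - l) <= eps / 2).
  { intros f l Hf. assert (Hf' : is_lim_seq (sum_n f) l) by exact Hf. apply is_lim_seq_spec in Hf'.
    destruct (Hf' (mkposreal (eps / 2) ltac:(lra))) as [N HN]. simpl in HN.
    exists (Datatypes.S N). intros [|n] Hn; [ lia | ].
    rewrite rsum_sum_n. left. apply HN. lia. }
  destruct (Hlim _ _ Hx) as [N1 H1]. destruct (Hlim _ _ Hy) as [N2 H2].
  exists (N1 + N2)%nat. intros n Hn.
  eapply Rle_trans; [ apply Cmod_le_re_im | ].
  assert (E : csum u n = (rsum (fun k => Re (u k)) n, rsum (fun k => Im (u k)) n)).
  { clear. induction n as [|n IH]; simpl; auto. rewrite IH. reflexivity. }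
  rewrite E. specialize (H1 n ltac:(lia)). specialize (H2 n ltac:(lia)).
  unfold Cminus, Cplus, Copp, Re, Im in *. simpl in *.
  unfold Rminus in *. lra.
Qed.

Lemma Csum_Cser (u : nat -> C) (m : nat -> R) (S : R) :
  (forall n, Cmod (u n) <= m n) -> sum_le m S -> Csum u (Cser u).
Proof.
  intros Hu Hm. destruct (Csum_of_dominated u m S Hu Hm) as [s Hs].
  rewrite (Cser_unique u s Hs). exact Hs.
Qed.

Lemma Csum_tail (u : nat -> C) (m : nat -> R) (S : R) (s : C) (N : nat) :
  (forall n, Cmod (u n) <= m n) -> sum_le m S -> Csum u s ->
  Cmod (s - csum u N) <= S - rsum m N.
Proof.
  intros Hu Hm Hs. apply Rle_plus_epsilon. intros eps He.
  destruct (Hs eps He) as [N1 H1]. specialize (H1 (N1 + N)%nat ltac:(lia)).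
  pose proof (csum_diff_le u m N (N1 + N) Hu ltac:(lia)) as H2.
  pose proof (Cmod_minus_triangle s (csum u (N1 + N)) (csum u N)) as H3.
  rewrite (Cmod_minus_sym s (csum _ (N1 + N))) in H3. specialize (Hm (N1 + N)%nat). lra.
Qed.

Lemma Csum_bound (u : nat -> C) (m : nat -> R) (S : R) (s : C) :
  (forall n, Cmod (u n) <= m n) -> sum_le m S -> Csum u s -> Cmod s <= S.
Proof.
  intros Hu Hm Hs. pose proof (Csum_tail u m S s 0 Hu Hm Hs) as H.
  change (Cmod (s - 0) <= S - 0) in H.
  replace (s - 0)%C with s in H by ring. lra.
Qed.

Lemma Cser_bound (u : nat -> C) (m : nat -> R) (S : R) :
  (forall n, Cmod (u n) <= m n) -> sum_le m S -> Cmod (Cser u) <= S.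
Proof. intros Hu Hm. apply (Csum_bound u m); auto. apply (Csum_Cser u m S); auto. Qed.

Lemma Csum_is_series (u : nat -> C) (s : C) :
  Csum u s -> @is_series C_AbsRing C_NormedModule u s.
Proof.
  intros H.
  change (filterlim (@sum_n C_R_NormedModule u) eventually (@locally C_R_NormedModule s)).
  apply filterlim_locally. intros [eps He].
  destruct (H (eps / 2)) as [N HN]; [ lra | ].
  exists N. intros n Hn. simpl.
  apply C_NormedModule_mixin_compat1. rewrite <- csum_sum_n.
  specialize (HN (S n) ltac:(lia)).
  change (Cmod (csum u (S n) - s) < eps). lra.
Qed.

Lemma sum_le_ext (m m' : nat -> R) (S : R) :
  (forall n, m n <= m' n) -> sum_le m' S -> sum_le m S.
Proof. intros H Hs N. eapply Rle_trans; [ apply rsum_le | apply Hs ]; auto. Qed.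

Lemma sum_le_scal (m : nat -> R) (S c : R) :
  0 <= c -> sum_le m S -> sum_le (fun n => c * m n) (c * S).
Proof. intros Hc Hs N. rewrite rsum_scal. apply Rmult_le_compat_l; auto. Qed.

Lemma sum_le_plus (m m' : nat -> R) (S S' : R) :
  sum_le m S -> sum_le m' S' -> sum_le (fun n => m n + m' n) (S + S').
Proof. intros H H' N. rewrite rsum_plus. apply Rplus_le_compat; auto. Qed.

(** * Powers and the exponential [cis] *)

Lemma Cmod_cis (t : R) : Cmod (cis t) = 1.
Proof.
  unfold cis, Cmod. simpl fst. simpl snd.
  replace (cos t ^ 2 + sin t ^ 2) with 1; [ apply sqrt_1 | ].
  pose proof (sin2_cos2 t) as H. unfold Rsqr in H. lra.
Qed.

Lemma cis_plus (a b : R) : cis (a + b) = (cis a * cis b)%C.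
Proof. unfold cis, Cmult. simpl. rewrite cos_plus, sin_plus. f_equal; ring. Qed.

Lemma cis_0 : cis 0 = 1.
Proof. unfold cis. rewrite cos_0, sin_0. reflexivity. Qed.

Lemma cis_opp (a : R) : cis (- a) = Cconj (cis a).
Proof. unfold cis, Cconj. simpl. rewrite cos_neg, sin_neg. reflexivity. Qed.

Lemma cis_mult_opp (a : R) : (cis a * cis (- a))%C = 1.
Proof. rewrite <- cis_plus, Rplus_opp_r. apply cis_0. Qed.

Lemma cis_neq_0 (a : R) : cis a <> 0.
Proof. intros H. pose proof (Cmod_cis a) as H1. rewrite H, Cmod_0 in H1. lra. Qed.

Lemma cis_opp_inv (a : R) : cis (- a) = (/ cis a)%C.
Proof.
  pose proof (cis_mult_opp a) as H. pose proof (cis_neq_0 a) as H0.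
  replace (cis (- a)) with (/ cis a * (cis a * cis (- a)))%C by (field; auto).
  rewrite H. field; auto.
Qed.

Lemma cis_INR (n : nat) (a : R) : cis (INR n * a) = (cis a ^ n)%C.
Proof.
  induction n as [|n IH].
  - simpl. rewrite Rmult_0_l. apply cis_0.
  - rewrite S_INR, Cpow_S, <- IH, <- cis_plus. f_equal. ring.
Qed.

Lemma cis_2PI (a : R) : cis (a + 2 * PI) = cis a.
Proof. unfold cis. rewrite cos_plus, sin_plus, cos_2PI, sin_2PI. f_equal; ring. Qed.

Lemma Cmod_conj_cis (t : R) : Cmod (Cconj (cis t)) = 1.
Proof. rewrite Cmod_conj. apply Cmod_cis. Qed.

Lemma unit_circle_cis (w : C) : Cmod w = 1 -> exists t, 0 <= t < 2 * PI /\ w = cis t.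
Proof.
  intros H. pose proof (Cmod2_alt w) as H2. rewrite H in H2.
  destruct w as [x y]. simpl in H2.
  assert (Hx : -1 <= x <= 1) by nra.
  pose proof PI_RGT_0 as Hpi. pose proof (acos_bound x) as [Ha Hb].
  pose proof (cos_acos x Hx) as Hc.
  pose proof (sin_acos x Hx) as Hs.
  pose proof (sin_ge_0 (acos x) Ha Hb) as Hs0.
  assert (Hs2 : sin (acos x) * sin (acos x) = y * y).
  { pose proof (sin2_cos2 (acos x)) as E. unfold Rsqr in E. rewrite Hc in E. nra. }
  destruct (Rle_dec 0 y) as [Hy|Hy].
  - exists (acos x). split; [ lra | ]. unfold cis. rewrite Hc. f_equal. nra.
  - exists (- acos x + 2 * PI). split.
    + split; [ lra | ]. destruct (Rle_lt_or_eq_dec 0 (acos x) Ha) as [|E]; [ lra | ].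
      rewrite <- E, sin_0 in Hs2. nra.
    + rewrite cis_2PI. unfold cis. rewrite cos_neg, sin_neg, Hc. f_equal. nra.
Qed.

Lemma cis_inj (t u : R) : 0 <= t < 2 * PI -> 0 <= u < 2 * PI -> cis t = cis u -> t = u.
Proof.
  assert (W : forall t u, 0 <= t < 2 * PI -> 0 <= u < 2 * PI -> t < u -> cis t = cis u -> False).
  { clear. intros t u Ht Hu Hlt H.
    assert (E : cis (u - t) = 1).
    { unfold Rminus. rewrite cis_plus, <- H. apply cis_mult_opp. }
    unfold cis in E. injection E as Ec Es.
    assert (Hs : sin ((u - t) / 2) * sin ((u - t) / 2) = 0).
    { replace (u - t) with (2 * ((u - t) / 2)) in Ec by field.
      rewrite cos_2a_sin in Ec. lra. }
    pose proof (sin_gt_0 ((u - t) / 2)). nra. }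
  intros Ht Hu H. destruct (Rtotal_order t u) as [|[|]]; auto.
  - exfalso. eauto.
  - exfalso. apply (W u t); auto.
Qed.

Lemma Cpow_diff_le (a b : C) (n : nat) :
  Cmod a <= 1 -> Cmod b <= 1 -> Cmod (a ^ n - b ^ n) <= INR n * Cmod (a - b).
Proof.
  intros Ha Hb. induction n as [|n IH].
  - simpl. replace (RtoC 1 - RtoC 1)%C with (RtoC 0) by ring. rewrite Cmod_0. lra.
  - rewrite S_INR, !Cpow_S.
    replace (a * a ^ n - b * b ^ n)%C with (a * (a ^ n - b ^ n) + (a - b) * b ^ n)%C by ring.
    eapply Rle_trans; [ apply Cmod_triangle | ]. rewrite !Cmod_mult, Cmod_pow.
    pose proof (pow_incr (Cmod b) 1 n (conj (Cmod_ge_0 b) Hb)) as Hp. rewrite pow1 in Hp.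
    pose proof (Cmod_ge_0 (a - b)). pose proof (Cmod_ge_0 (a ^ n - b ^ n)).
    pose proof (Cmod_ge_0 a). nra.
Qed.

Lemma cis_diff_le (a b : R) : Cmod (cis a - cis b) <= Rabs (a - b).
Proof.
  (* The chord is factored at the midpoint of the two angles; its length is 2 |sin((a - b) / 2)|. *)
  assert (E : (cis a - cis b)%C = (cis ((a + b) / 2) * (2 * Ci * sin ((a - b) / 2)))%C).
  { assert (Ea : a = (a + b) / 2 + (a - b) / 2) by field.
    assert (Eb : b = (a + b) / 2 + - ((a - b) / 2)) by field.
    set (x := (a + b) / 2) in *. set (y := (a - b) / 2) in *. clearbody x y. subst a b.
    rewrite !cis_plus. unfold cis. rewrite cos_neg, sin_neg.
    unfold Cminus, Cplus, Cmult, Copp, Ci, RtoC; simpl; f_equal; ring. }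
  rewrite E, !Cmod_mult, Cmod_cis, Cmod_Ci, !Cmod_R, (Rabs_pos_eq 2) by lra.
  assert (H : forall x, 0 <= x -> Rabs (sin x) <= x).
  { intros x Hx. destruct (Rle_lt_or_eq_dec 0 x Hx) as [Hp|<-].
    - destruct (Rle_dec x 1) as [H1|H1].
      + pose proof PI_RGT_0. pose proof PI2_1. rewrite Rabs_pos_eq.
        * left. apply sin_lt_x; auto.
        * apply sin_ge_0; lra.
      + pose proof (SIN_bound x). apply Rabs_le. lra.
    - rewrite sin_0, Rabs_R0. lra. }
  assert (H' : Rabs (sin ((a - b) / 2)) <= Rabs ((a - b) / 2)).
  { destruct (Rle_dec 0 ((a - b) / 2)) as [Hp|Hp].
    - rewrite (Rabs_pos_eq ((a - b) / 2)) by auto. auto.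
    - rewrite <- (Rabs_Ropp (sin _)), <- sin_neg, <- (Rabs_Ropp ((a - b) / 2)),
        (Rabs_pos_eq (- ((a - b) / 2))) by lra. apply H. lra. }
  unfold Rdiv in H' at 2. rewrite Rabs_mult, (Rabs_pos_eq (/ 2)) in H' by lra. lra.
Qed.

(** * Geometric series *)

Lemma pow_vanishes (q eps : R) : 0 <= q < 1 -> 0 < eps ->
  exists N, forall n, (N <= n)%nat -> q ^ n <= eps.
Proof.
  intros Hq He. destruct (pow_lt_1_zero q) with (y := eps) as [N HN]; auto.
  { rewrite Rabs_pos_eq; lra. }
  exists N. intros n Hn. specialize (HN n Hn).
  rewrite Rabs_pos_eq in HN; [ lra | apply pow_le; lra ].
Qed.

(** n q^n is at most 1 + q + ... + q^(n-1), because each of these n powers is at least q^n. *)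
Lemma INR_pow_bounded (q : R) : 0 <= q < 1 -> exists B, 0 <= B /\ forall n, INR n * q ^ n <= B.
Proof.
  intros Hq. exists (1 / (1 - q)). split.
  { apply Rlt_le, Rdiv_lt_0_compat; lra. }
  assert (H : forall n, rsum (fun k => q ^ k) n <= 1 / (1 - q)).
  { intros n. assert (E : rsum (fun k => q ^ k) n = (1 - q ^ n) / (1 - q)).
    { induction n as [|n IH]; simpl; [ field; lra | rewrite IH; field; lra ]. }
    rewrite E. apply Rmult_le_compat_r; [ apply Rlt_le, Rinv_0_lt_compat; lra | ].
    pose proof (pow_le q n). lra. }
  intros n. eapply Rle_trans; [ | apply (H n) ].
  assert (H1 : forall m, (m <= n)%nat -> INR m * q ^ n <= rsum (fun k => q ^ k) m).
  { induction m as [|m IH]; intros Hm; [ simpl; lra | ].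
    rewrite S_INR. simpl rsum. specialize (IH ltac:(lia)).
    assert (q ^ n <= q ^ m).
    { replace n with (m + (n - m))%nat by lia. rewrite pow_add.
      pose proof (pow_le q m ltac:(lra)).
      pose proof (pow_incr q 1 (n - m) ltac:(lra)) as Hp. rewrite pow1 in Hp. nra. }
    lra. }
  apply H1; auto.
Qed.

(** With p = sqrt q, the product n q^n = (n p^n) p^n has a bounded and a vanishing factor. *)
Lemma INR_pow_vanishes (q eps : R) : 0 <= q < 1 -> 0 < eps ->
  exists N, forall n, (N <= n)%nat -> INR n * q ^ n <= eps.
Proof.
  intros Hq He. set (p := sqrt q).
  assert (Hp : 0 <= p < 1).
  { split; [ apply sqrt_pos | ]. unfold p. rewrite <- sqrt_1. apply sqrt_lt_1; lra. }
  assert (Epq : q = p * p) by (unfold p; rewrite sqrt_sqrt; lra).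
  destruct (INR_pow_bounded p Hp) as [B [HB1 HB2]].
  destruct (pow_vanishes p (eps / (B + 1)) Hp) as [N HN].
  { apply Rdiv_lt_0_compat; lra. }
  exists N. intros n Hn. specialize (HN n Hn). specialize (HB2 n).
  rewrite Epq, Rpow_mult_distr, <- Rmult_assoc.
  pose proof (pow_le p n ltac:(lra)).
  apply Rle_trans with (B * (eps / (B + 1))).
  - apply Rmult_le_compat; auto. apply Rmult_le_pos; auto. apply pos_INR.
  - apply (Rmult_le_reg_r (B + 1)); [ lra | ]. field_simplify; [ | lra ]. nra.
Qed.

Lemma rsum_geom_le (q : R) (n : nat) : 0 <= q < 1 -> rsum (fun k => q ^ k) n <= / (1 - q).
Proof.
  intros Hq. assert (E : rsum (fun k => q ^ k) n = (1 - q ^ n) / (1 - q)).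
  { induction n as [|n IH]; simpl; [ field; lra | rewrite IH; field; lra ]. }
  rewrite E. unfold Rdiv. rewrite <- (Rmult_1_l (/ (1 - q))) at 2.
  apply Rmult_le_compat_r; [ apply Rlt_le, Rinv_0_lt_compat; lra | ].
  pose proof (pow_le q n). lra.
Qed.

Lemma one_minus_neq_0 (z : C) : Cmod z < 1 -> (1 - z)%C <> 0.
Proof.
  intros H E. assert (E' : z = 1) by (replace z with (1 - (1 - z))%C by ring; rewrite E; ring).
  rewrite E', Cmod_1 in H. lra.
Qed.

Lemma Cmod_one_minus (z : C) : 1 - Cmod z <= Cmod (1 - z).
Proof. pose proof (Cmod_triangle_rev 1 z) as H. rewrite Cmod_1 in H. exact H. Qed.

Lemma Csum_geom (z : C) : Cmod z < 1 -> Csum (fun n => z ^ n)%C (/ (1 - z))%C.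
Proof.
  intros Hz eps He. pose proof (Cmod_ge_0 z) as H0.
  pose proof (one_minus_neq_0 z Hz) as Hne. pose proof (Cmod_one_minus z) as H1.
  destruct (pow_vanishes (Cmod z) (eps * (1 - Cmod z))) as [N HN]; [ lra | nra | ].
  exists N. intros n Hn. specialize (HN n Hn).
  assert (E : forall n, csum (fun k => z ^ k)%C n = ((1 - z ^ n) / (1 - z))%C).
  { clear - Hne. induction n as [|n IH]; [ simpl; field; auto | ].
    rewrite csum_S, IH, Cpow_S. field; auto. }
  rewrite E. replace ((1 - z ^ n) / (1 - z) - / (1 - z))%C with (- (z ^ n / (1 - z)))%C by (field; auto).
  rewrite Cmod_opp, Cmod_div, Cmod_pow by auto.
  apply (Rmult_le_reg_r (Cmod (1 - z))); [ lra | ].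
  unfold Rdiv. rewrite Rmult_assoc, Rinv_l by lra. nra.
Qed.

Lemma Csum_geom2 (z : C) : Cmod z < 1 ->
  Csum (fun n => INR (S n) * z ^ n)%C (/ ((1 - z) * (1 - z)))%C.
Proof.
  intros Hz eps He. pose proof (Cmod_ge_0 z) as H0.
  pose proof (one_minus_neq_0 z Hz) as Hne. pose proof (Cmod_one_minus z) as H1.
  set (c := (1 - Cmod z) * (1 - Cmod z)). assert (Hc : 0 < c) by (unfold c; nra).
  destruct (pow_vanishes (Cmod z) (eps * c / 4)) as [N1 HN1]; [ lra | nra | ].
  destruct (INR_pow_vanishes (Cmod z) (eps * c / 4)) as [N2 HN2]; [ lra | nra | ].
  exists (N1 + N2)%nat. intros n Hn. specialize (HN1 n ltac:(lia)). specialize (HN2 n ltac:(lia)).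
  assert (E : forall n, csum (fun k => INR (S k) * z ^ k)%C n =
     ((1 - (1 + INR n) * z ^ n + INR n * (z * z ^ n)) / ((1 - z) * (1 - z)))%C).
  { clear - Hne. induction n as [|n IH].
    - change (csum (fun k => INR (S k) * z ^ k)%C 0) with (RtoC 0).
      change (INR 0) with 0. simpl Cpow. field; auto.
    - rewrite csum_S, IH, !S_INR, !Cpow_S, !RtoC_plus. field; auto. }
  rewrite E.
  replace ((1 - (1 + INR n) * z ^ n + INR n * (z * z ^ n)) / ((1 - z) * (1 - z)) - / ((1 - z) * (1 - z)))%C
    with (- ((z ^ n + (INR n * z ^ n) * (1 - z)) / ((1 - z) * (1 - z))))%C by (field; auto).
  rewrite Cmod_opp, Cmod_div by (apply Cmult_neq_0; auto).
  rewrite Cmod_mult.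
  assert (Hcc : c <= Cmod (1 - z) * Cmod (1 - z)) by (unfold c; apply Rmult_le_compat; lra).
  apply (Rmult_le_reg_r (Cmod (1 - z) * Cmod (1 - z))); [ lra | ].
  unfold Rdiv. rewrite Rmult_assoc, Rinv_l by lra. rewrite Rmult_1_r.
  eapply Rle_trans; [ apply Cmod_triangle | ].
  rewrite !Cmod_mult, Cmod_pow, Cmod_R, (Rabs_pos_eq (INR n)) by apply pos_INR.
  pose proof (Cmod_minus_le 1 z) as H2. rewrite Cmod_1 in H2.
  assert (0 <= INR n * Cmod z ^ n) by (apply Rmult_le_pos; [ apply pos_INR | apply pow_le; lra ]).
  apply Rle_trans with (eps * c); [ | apply Rmult_le_compat_l; lra ]. nra.
Qed.

(** * The Wiener algebra of the torus *)

(** Functions of two angles; [t] and [u] stand for [w = cis t] and [tau = cis u]. *)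
Definition tfun := R -> R -> C.

Definition weight (d : R) (i j : Z) : R := 1 + d * IZR (Z.abs i + Z.abs j).

(** [wiener d F M]: the weighted l1 norm of the Fourier coefficients of [F],
    which are real, is at most [M]. Closing trigonometric polynomials under
    uniform limits at bounded norm makes every property of the class provable
    by induction, without ever naming the coefficients. *)
Inductive wiener (d : R) : tfun -> R -> Prop :=
| wiener_atom c i j :
    wiener d (fun t u => RtoC c * cis (IZR i * t + IZR j * u))%C (Rabs c * weight d i j)
| wiener_add F G A B : wiener d F A -> wiener d G B ->
    wiener d (fun t u => F t u + G t u)%C (A + B)
| wiener_weaken F A B : wiener d F A -> A <= B -> wiener d F B
| wiener_lim (Fn : nat -> tfun) F A :
    (forall n, wiener d (Fn n) A) ->
    (forall eps, 0 < eps -> exists n, forall t u, Cmod (Fn n t u - F t u) <= eps) ->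
    wiener d F A.

Section Wiener.
Context (d : R) (Hd : 0 < d).

Lemma weight_ge_1 (i j : Z) : 1 <= weight d i j.
Proof.
  unfold weight. assert (0 <= IZR (Z.abs i + Z.abs j)) by (apply IZR_le; lia). nra.
Qed.

Lemma weight_mult (i j k l : Z) : weight d (i + k) (j + l) <= weight d i j * weight d k l.
Proof.
  unfold weight.
  assert (H : IZR (Z.abs (i + k) + Z.abs (j + l)) <= IZR (Z.abs i + Z.abs j) + IZR (Z.abs k + Z.abs l)).
  { rewrite <- plus_IZR. apply IZR_le. lia. }
  assert (0 <= IZR (Z.abs i + Z.abs j)) by (apply IZR_le; lia).
  assert (0 <= IZR (Z.abs k + Z.abs l)) by (apply IZR_le; lia).
  set (a := IZR (Z.abs i + Z.abs j)) in *. set (b := IZR (Z.abs k + Z.abs l)) in *.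
  assert (0 <= d * a * (d * b)) by (repeat apply Rmult_le_pos; lra).
  assert (d * IZR (Z.abs (i + k) + Z.abs (j + l)) <= d * (a + b)) by (apply Rmult_le_compat_l; lra).
  lra.
Qed.

(** The constructors do not transfer along pointwise equality; a constant sequence in [wiener_lim]
    does. *)
Lemma wiener_ext (F G : tfun) (A B : R) :
  wiener d F A -> (forall t u, F t u = G t u) -> A <= B -> wiener d G B.
Proof.
  intros HF HE HAB. apply wiener_lim with (fun _ => F).
  - intros _. eapply wiener_weaken; eauto.
  - intros eps He. exists O. intros t u. rewrite HE.
    replace (G t u - G t u)%C with (RtoC 0) by ring. rewrite Cmod_0. lra.
Qed.

Lemma wiener_bound (F : tfun) (A : R) : wiener d F A -> forall t u, Cmod (F t u) <= A.
Proof.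
  induction 1 as [c i j|F G A B HF IF HG IG|F A B HF IF HAB|Fn F A HF IF HL]; intros t u.
  - rewrite Cmod_mult, Cmod_cis, Cmod_R. pose proof (weight_ge_1 i j).
    pose proof (Rabs_pos c). nra.
  - eapply Rle_trans; [ apply Cmod_triangle | ]. specialize (IF t u). specialize (IG t u). lra.
  - specialize (IF t u). lra.
  - apply Rle_plus_epsilon. intros eps He. destruct (HL eps He) as [n Hn].
    specialize (Hn t u). specialize (IF n t u).
    pose proof (Cmod_triangle_rev (F t u) (Fn n t u)). rewrite Cmod_minus_sym in H. lra.
Qed.

Lemma wiener_nonneg (F : tfun) (A : R) : wiener d F A -> 0 <= A.
Proof.
  intros H. eapply Rle_trans; [ apply Cmod_ge_0 | apply (wiener_bound F A H 0 0) ].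
Qed.

Lemma wiener_scal (F : tfun) (A : R) (c : R) :
  wiener d F A -> wiener d (fun t u => c * F t u)%C (Rabs c * A).
Proof.
  induction 1 as [b i j|F G A B HF IF HG IG|F A B HF IF HAB|Fn F A HF IF HL].
  - eapply wiener_ext; [ apply (wiener_atom d (c * b) i j) | | ].
    + intros t u. rewrite RtoC_mult. ring.
    + rewrite Rabs_mult. right. ring.
  - eapply wiener_ext; [ apply wiener_add; [ apply IF | apply IG ] | | ].
    + intros t u. simpl. ring.
    + right. ring.
  - eapply wiener_weaken; [ apply IF | ]. apply Rmult_le_compat_l; auto. apply Rabs_pos.
  - apply wiener_lim with (fun n t u => c * Fn n t u)%C; [ apply IF | ].
    intros eps He. pose proof (Rabs_pos c) as Hc.
    destruct (HL (eps / (Rabs c + 1))) as [n Hn]; [ apply Rdiv_lt_0_compat; lra | ].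
    exists n. intros t u. specialize (Hn t u).
    replace (c * Fn n t u - c * F t u)%C with (c * (Fn n t u - F t u))%C by ring.
    rewrite Cmod_mult, Cmod_R.
    apply Rle_trans with ((Rabs c + 1) * (eps / (Rabs c + 1))).
    + apply Rmult_le_compat; try lra. apply Cmod_ge_0.
    + right. field. lra.
Qed.

Lemma wiener_opp (F : tfun) (A : R) : wiener d F A -> wiener d (fun t u => - F t u)%C A.
Proof.
  intros H. eapply wiener_ext; [ apply (wiener_scal F A (-1) H) | | ].
  - intros t u. replace (RtoC (-1)) with (- (1))%C by (apply injective_projections; simpl; ring). ring.
  - replace (-1) with (- (1)) by ring. rewrite Rabs_Ropp, Rabs_R1. lra.
Qed.

Lemma wiener_sub (F G : tfun) (A B : R) : wiener d F A -> wiener d G B ->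
  wiener d (fun t u => F t u - G t u)%C (A + B).
Proof. intros HF HG. apply (wiener_add d F (fun t u => - G t u)%C); auto. apply wiener_opp; auto. Qed.

Lemma wiener_const (c : R) : wiener d (fun _ _ => RtoC c) (Rabs c).
Proof.
  eapply wiener_ext; [ apply (wiener_atom d c 0 0) | | ].
  - intros t u. cbv beta. rewrite !Rmult_0_l, Rplus_0_l, cis_0. ring.
  - unfold weight. simpl. lra.
Qed.

Lemma wiener_zero : wiener d (fun _ _ => RtoC 0) 0.
Proof. eapply wiener_weaken; [ apply wiener_const | rewrite Rabs_R0; lra ]. Qed.

(** Submultiplicativity of the weight settles two monomials. An induction on G for a fixed monomial,
    then one on F, extend this to the whole class. *)
Lemma wiener_mult (F G : tfun) (A B : R) : wiener d F A -> wiener d G B ->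
  wiener d (fun t u => F t u * G t u)%C (A * B).
Proof.
  intros HF HG. pose proof (wiener_nonneg G B HG) as HB.
  revert F A HF.
  assert (Hatom : forall c i j, wiener d
    (fun t u => (RtoC c * cis (IZR i * t + IZR j * u)) * G t u)%C (Rabs c * weight d i j * B)).
  { intros c i j. clear HB.
    pose proof (weight_ge_1 i j) as Hw. pose proof (Rabs_pos c) as Hc.
    induction HG as [b k l|G H A B HG IG HH IH|G A B HG IG HAB|Gn G A HG IG HL].
    - eapply wiener_ext; [ apply (wiener_atom d (c * b) (i + k) (j + l)) | | ].
      + intros t u. rewrite RtoC_mult, !plus_IZR.
        replace ((IZR i + IZR k) * t + (IZR j + IZR l) * u)
          with ((IZR i * t + IZR j * u) + (IZR k * t + IZR l * u)) by ring.
        rewrite (cis_plus (IZR i * t + IZR j * u)). ring.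
      + rewrite Rabs_mult. pose proof (weight_mult i j k l) as Hm. pose proof (Rabs_pos b) as Hb.
        apply Rle_trans with (Rabs c * Rabs b * (weight d i j * weight d k l)).
        * apply Rmult_le_compat_l; auto. apply Rmult_le_pos; auto.
        * right; ring.
    - eapply wiener_ext; [ apply wiener_add; [ apply IG | apply IH ] | | ].
      + intros t u. simpl. ring.
      + right; ring.
    - eapply wiener_weaken; [ apply IG | ]. apply Rmult_le_compat_l; auto. apply Rmult_le_pos; lra.
    - apply wiener_lim with (fun n t u => c * cis (IZR i * t + IZR j * u) * Gn n t u)%C; [ apply IG | ].
      intros eps He.
      destruct (HL (eps / (Rabs c + 1))) as [n Hn]; [ apply Rdiv_lt_0_compat; lra | ].
      exists n. intros t u. specialize (Hn t u).
      replace (c * cis (IZR i * t + IZR j * u) * Gn n t u - c * cis (IZR i * t + IZR j * u) * G t u)%C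
        with (c * cis (IZR i * t + IZR j * u) * (Gn n t u - G t u))%C by ring.
      rewrite !Cmod_mult, Cmod_cis, Cmod_R.
      apply Rle_trans with ((Rabs c + 1) * (eps / (Rabs c + 1))).
      + apply Rmult_le_compat; try lra. apply Cmod_ge_0.
      + right. field. lra. }
  induction 1 as [c i j|F F' A A' HF IF HF' IF'|F A A' HF IF HAB|Fn F A HF IF HL].
  - apply Hatom.
  - eapply wiener_ext; [ apply wiener_add; [ apply IF | apply IF' ] | | ].
    + intros t u. simpl. ring.
    + right; ring.
  - eapply wiener_weaken; [ apply IF | ]. apply Rmult_le_compat_r; auto.
  - apply wiener_lim with (fun n t u => Fn n t u * G t u)%C; [ apply IF | ].
    intros eps He.
    destruct (HL (eps / (B + 1))) as [n Hn]; [ apply Rdiv_lt_0_compat; lra | ].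
    exists n. intros t u. specialize (Hn t u).
    replace (Fn n t u * G t u - F t u * G t u)%C with ((Fn n t u - F t u) * G t u)%C by ring.
    rewrite Cmod_mult. pose proof (wiener_bound G B HG t u).
    apply Rle_trans with (eps / (B + 1) * (B + 1)).
    + apply Rmult_le_compat; try lra; apply Cmod_ge_0.
    + right. field. lra.
Qed.

Lemma wiener_pow (F : tfun) (A : R) (n : nat) :
  wiener d F A -> wiener d (fun t u => F t u ^ n)%C (A ^ n).
Proof.
  intros H. induction n as [|n IH].
  - eapply wiener_weaken; [ apply wiener_const | simpl; rewrite Rabs_R1; lra ].
  - apply (wiener_mult F (fun t u => F t u ^ n)%C); auto.
Qed.

Lemma wiener_csum (F : nat -> tfun) (m : nat -> R) (N : nat) :
  (forall n, wiener d (F n) (m n)) -> wiener d (fun t u => csum (fun n => F n t u) N) (rsum m N).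
Proof.
  intros H. induction N as [|N IH]; [ apply wiener_zero | ].
  apply (wiener_add d (fun t u => csum (fun n => F n t u) N)); auto.
Qed.

Lemma wiener_series (F : nat -> tfun) (m : nat -> R) (S : R) (G : tfun) :
  (forall n, wiener d (F n) (m n)) -> sum_le m S ->
  (forall t u, Csum (fun n => F n t u) (G t u)) -> wiener d G S.
Proof.
  intros HF Hm HG. destruct (sum_le_sup m S Hm) as [S' [HS [Hm' Hsup]]].
  apply wiener_weaken with S'; auto.
  apply wiener_lim with (fun N t u => csum (fun n => F n t u) N).
  - intros N. eapply wiener_weaken; [ apply wiener_csum; eauto | apply Hm' ].
  - intros eps He. destruct (Hsup eps He) as [N HN]. exists N. intros t u.
    rewrite Cmod_minus_sym. eapply Rle_trans; [ apply (Csum_tail _ m S'); auto | lra ].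
    intros n. apply wiener_bound; auto.
Qed.

(** Neumann series in the algebra. This is the source of every reciprocal in the proof. *)
Lemma wiener_inv_one_minus (F : tfun) (q : R) :
  wiener d F q -> q < 1 -> wiener d (fun t u => / (1 - F t u))%C (/ (1 - q)).
Proof.
  intros HF Hq. pose proof (wiener_nonneg F q HF) as Hq0.
  apply wiener_series with (fun n t u => F t u ^ n)%C (fun n => q ^ n).
  - intros n. apply wiener_pow; auto.
  - intros N. apply rsum_geom_le. lra.
  - intros t u. apply Csum_geom. eapply Rle_lt_trans; [ apply (wiener_bound F q HF) | auto ].
Qed.

Lemma wiener_swap (F : tfun) (A : R) : wiener d F A -> wiener d (fun t u => F u t) A.
Proof.
  induction 1 as [c i j|F G A B HF IF HG IG|F A B HF IF HAB|Fn F A HF IF HL].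
  - eapply wiener_ext; [ apply (wiener_atom d c j i) | | ].
    + intros t u. rewrite Rplus_comm. reflexivity.
    + unfold weight. rewrite Z.add_comm. lra.
  - apply (wiener_add d (fun t u => F u t)); auto.
  - eapply wiener_weaken; eauto.
  - apply wiener_lim with (fun n t u => Fn n u t); auto.
    intros eps He. destruct (HL eps He) as [n Hn]. exists n. auto.
Qed.

Lemma wiener_neg (F : tfun) (A : R) : wiener d F A -> wiener d (fun t u => F (- t) (- u)) A.
Proof.
  induction 1 as [c i j|F G A B HF IF HG IG|F A B HF IF HAB|Fn F A HF IF HL].
  - eapply wiener_ext; [ apply (wiener_atom d c (- i) (- j)) | | ].
    + intros t u. cbv beta. rewrite !opp_IZR.
      replace (- IZR i * t + - IZR j * u) with (IZR i * - t + IZR j * - u) by ring. reflexivity.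
    + unfold weight. rewrite !Z.abs_opp. lra.
  - apply (wiener_add d (fun t u => F (- t) (- u))); auto.
  - eapply wiener_weaken; eauto.
  - apply wiener_lim with (fun n t u => Fn n (- t) (- u)); auto.
    intros eps He. destruct (HL eps He) as [n Hn]. exists n. auto.
Qed.

(** A frequency j in u costs at least d |j| in the weight, so one derivative in u is paid by the
    factor 1/d. The estimate makes all functions of the class integrable in u. *)
Lemma wiener_lipschitz (F : tfun) (A : R) : wiener d F A ->
  forall t u u', Cmod (F t u - F t u') <= A / d * Rabs (u - u').
Proof.
  induction 1 as [c i j|F G A B HF IF HG IG|F A B HF IF HAB|Fn F A HF IF HL]; intros t u u'.
  - replace (c * cis (IZR i * t + IZR j * u) - c * cis (IZR i * t + IZR j * u'))%C
      with (c * (cis (IZR i * t + IZR j * u) - cis (IZR i * t + IZR j * u')))%C by ring.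
    rewrite Cmod_mult, Cmod_R. unfold Rdiv. rewrite !Rmult_assoc.
    apply Rmult_le_compat_l; [ apply Rabs_pos | ].
    eapply Rle_trans; [ apply cis_diff_le | ].
    replace (IZR i * t + IZR j * u - (IZR i * t + IZR j * u')) with (IZR j * (u - u')) by ring.
    rewrite Rabs_mult, <- Rmult_assoc. apply Rmult_le_compat_r; [ apply Rabs_pos | ].
    rewrite <- abs_IZR. apply (Rmult_le_reg_r d); auto. rewrite Rmult_assoc, Rinv_l, Rmult_1_r by lra.
    unfold weight. assert (IZR (Z.abs j) <= IZR (Z.abs i + Z.abs j)) by (apply IZR_le; lia). nra.
  - replace (F t u + G t u - (F t u' + G t u'))%C with ((F t u - F t u') + (G t u - G t u'))%C by ring.
    eapply Rle_trans; [ apply Cmod_triangle | ]. specialize (IF t u u'). specialize (IG t u u').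
    unfold Rdiv in *. lra.
  - eapply Rle_trans; [ apply IF | ]. apply Rmult_le_compat_r; [ apply Rabs_pos | ].
    apply Rmult_le_compat_r; auto. apply Rlt_le, Rinv_0_lt_compat; auto.
  - apply Rle_plus_epsilon. intros eps He. destruct (HL (eps / 2)) as [n Hn]; [ lra | ].
    pose proof (Hn t u) as H1. pose proof (Hn t u') as H2. specialize (IF n t u u').
    pose proof (Cmod_minus_triangle (F t u) (Fn n t u) (F t u')) as H3.
    pose proof (Cmod_minus_triangle (Fn n t u) (Fn n t u') (F t u')) as H4.
    rewrite (Cmod_minus_sym (F t u) (Fn n t u)) in H3. lra.
Qed.

End Wiener.

(** * Averages over the circle and sine coefficients *)

Lemma ex_RInt_lipschitz (f : R -> R) (L a b : R) :
  (forall u v, Rabs (f u - f v) <= L * Rabs (u - v)) -> ex_RInt f a b.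
Proof.
  intros H. apply (@ex_RInt_continuous R_CompleteNormedModule). intros z _.
  apply continuity_pt_filterlim. intros eps He.
  exists (eps / (Rabs L + 1)). pose proof (Rabs_pos L) as HL.
  split; [ apply Rdiv_lt_0_compat; lra | ].
  intros x [_ Hx]. unfold R_dist in *. simpl in *. unfold R_dist in *.
  eapply Rle_lt_trans; [ apply H | ].
  apply Rle_lt_trans with (Rabs L * Rabs (x - z)).
  - apply Rmult_le_compat_r; [ apply Rabs_pos | apply Rle_abs ].
  - apply Rle_lt_trans with (Rabs L * (eps / (Rabs L + 1))).
    + apply Rmult_le_compat_l; lra.
    + apply (Rmult_lt_reg_r (Rabs L + 1)); [ lra | ]. field_simplify; [ nra | lra ].
Qed.

Lemma RInt_abs_le (f : R -> R) (a b B : R) :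
  a <= b -> ex_RInt f a b -> (forall u, Rabs (f u) <= B) -> Rabs (RInt f a b) <= (b - a) * B.
Proof. intros Hab Hf HB. apply abs_RInt_le_const; auto. Qed.

Lemma is_RInt_cos (a : R) (j : Z) :
  is_RInt (fun u => cos (a + IZR j * u)) 0 (2 * PI) (if Z.eq_dec j 0 then 2 * PI * cos a else 0).
Proof.
  destruct (Z.eq_dec j 0) as [->|Hj].
  - apply (is_RInt_ext (fun _ => cos a)).
    + intros x _. f_equal. ring.
    + replace (2 * PI * cos a) with (scal (2 * PI - 0) (cos a)) by (unfold scal; simpl; unfold mult; simpl; ring).
      apply (is_RInt_const (V := R_NormedModule)).
  - assert (Hj' : IZR j <> 0) by (apply not_0_IZR; auto).
    replace 0 with (minus (sin (a + IZR j * (2 * PI)) / IZR j) (sin (a + IZR j * 0) / IZR j)) at 2.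
    + apply (is_RInt_derive (fun u => sin (a + IZR j * u) / IZR j)).
      * intros x _. auto_derive; auto. field; auto.
      * intros x _. apply continuity_pt_filterlim. apply derivable_continuous_pt.
        auto_derive. auto.
    + assert (E : sin (a + IZR j * (2 * PI)) = sin a).
      { assert (Hn : forall n x, sin (x + 2 * INR n * PI) = sin x) by (intros; apply sin_period).
        destruct (Z_le_dec 0 j).
        - rewrite <- (Hn (Z.to_nat j) a). f_equal. rewrite INR_IZR_INZ, Z2Nat.id by lia. ring.
        - rewrite <- (Hn (Z.to_nat (- j)) (a + IZR j * (2 * PI))). f_equal.
          rewrite INR_IZR_INZ, Z2Nat.id, opp_IZR by lia. ring. }
      rewrite E. unfold minus, plus, opp; simpl. rewrite Rmult_0_r, Rplus_0_r. ring.
Qed.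

Lemma is_RInt_sin (a : R) (j : Z) :
  is_RInt (fun u => sin (a + IZR j * u)) 0 (2 * PI) (if Z.eq_dec j 0 then 2 * PI * sin a else 0).
Proof.
  pose proof (is_RInt_cos (a - PI / 2) j) as H.
  assert (E : forall x, cos (x - PI / 2) = sin x).
  { intros x. rewrite <- (cos_neg (x - PI / 2)). replace (- (x - PI / 2)) with (PI / 2 - x) by ring.
    apply cos_shift. }
  rewrite E in H. eapply is_RInt_ext; [ | exact H ].
  intros x _. simpl. replace (a - PI / 2 + IZR j * x) with (a + IZR j * x - PI / 2) by ring. apply E.
Qed.

Definition cint (f : R -> C) : Prop :=
  ex_RInt (fun u => Re (f u)) 0 (2 * PI) /\ ex_RInt (fun u => Im (f u)) 0 (2 * PI).

Definition rint (f : R -> R) : R := RInt f 0 (2 * PI).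

Lemma rint_plus (f g : R -> R) : ex_RInt f 0 (2 * PI) -> ex_RInt g 0 (2 * PI) ->
  rint (fun u => f u + g u) = rint f + rint g.
Proof. apply (RInt_plus (V := R_CompleteNormedModule)). Qed.

Lemma rint_minus (f g : R -> R) : ex_RInt f 0 (2 * PI) -> ex_RInt g 0 (2 * PI) ->
  rint (fun u => f u - g u) = rint f - rint g.
Proof. apply (RInt_minus (V := R_CompleteNormedModule)). Qed.

Lemma rint_scal (c : R) (f : R -> R) : ex_RInt f 0 (2 * PI) -> rint (fun u => c * f u) = c * rint f.
Proof. apply (RInt_scal (V := R_CompleteNormedModule)). Qed.

Lemma rint_ext (f g : R -> R) : (forall u, f u = g u) -> rint f = rint g.
Proof. intros H. apply RInt_ext. auto. Qed.

Definition cavg (f : R -> C) : C :=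
  (rint (fun u => Re (f u)) / (2 * PI), rint (fun u => Im (f u)) / (2 * PI)).

(** The average over u is kept as a function of two angles, constant in the second one, so that it
    stays in the same algebra. *)
Definition avg (F : tfun) : tfun := fun t _ => cavg (F t).

Lemma is_RInt_cavg (f : R -> C) : cint f ->
  @is_RInt C_R_NormedModule f 0 (2 * PI) (2 * PI * cavg f)%C.
Proof.
  intros [H1 H2]. pose proof PI_RGT_0.
  replace (2 * PI * cavg f)%C with
    ((rint (fun u => Re (f u)), rint (fun u => Im (f u))) : C).
  - apply (is_RInt_fct_extend_pair (U := R_NormedModule) (V := R_NormedModule)).
    + apply (RInt_correct (V := R_CompleteNormedModule)). exact H1.
    + apply (RInt_correct (V := R_CompleteNormedModule)). exact H2.
  - unfold cavg, Cmult, RtoC; simpl. f_equal; (match goal with |- @eq _ ?a ?b => change (@eq R a b) end); field; lra.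
Qed.

Lemma cint_lipschitz (f : R -> C) (L : R) :
  (forall u v, Cmod (f u - f v) <= L * Rabs (u - v)) -> cint f.
Proof.
  intros H. split; apply ex_RInt_lipschitz with L; intros u v;
    (eapply Rle_trans; [ | apply H ]).
  - apply (re_le_Cmod (f u - f v)).
  - apply (im_le_Cmod (f u - f v)).
Qed.

Lemma cint_plus (f g : R -> C) : cint f -> cint g -> cint (fun u => f u + g u)%C.
Proof.
  intros [H1 H2] [H3 H4].
  split; [ apply (ex_RInt_plus (V := R_NormedModule) (fun u => Re (f u)) (fun u => Re (g u)))
         | apply (ex_RInt_plus (V := R_NormedModule) (fun u => Im (f u)) (fun u => Im (g u))) ]; auto.
Qed.

Lemma cint_scal (c : C) (f : R -> C) : cint f -> cint (fun u => c * f u)%C.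
Proof.
  intros [H1 H2].
  assert (S : forall (a : R) h, ex_RInt h 0 (2 * PI) -> ex_RInt (fun u => a * h u) 0 (2 * PI)).
  { intros a h Hh. apply (ex_RInt_scal (V := R_NormedModule)); auto. }
  split.
  - apply (ex_RInt_minus (V := R_NormedModule) (fun u => Re c * Re (f u)) (fun u => Im c * Im (f u))); auto.
  - apply (ex_RInt_plus (V := R_NormedModule) (fun u => Re c * Im (f u)) (fun u => Im c * Re (f u))); auto.
Qed.

Lemma cavg_ext (f g : R -> C) : (forall u, f u = g u) -> cavg f = cavg g.
Proof. intros H. f_equal. apply functional_extensionality. auto. Qed.

Lemma cavg_plus (f g : R -> C) : cint f -> cint g ->
  cavg (fun u => f u + g u)%C = (cavg f + cavg g)%C.
Proof.
  intros [H1 H2] [H3 H4]. unfold cavg, Cplus, Re, Im in *. simpl. pose proof PI_RGT_0.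
  rewrite (rint_plus (fun u => fst (f u)) (fun u => fst (g u))) by auto.
  rewrite (rint_plus (fun u => snd (f u)) (fun u => snd (g u))) by auto.
  f_equal; field; lra.
Qed.

Lemma cavg_scal (c : C) (f : R -> C) : cint f -> cavg (fun u => c * f u)%C = (c * cavg f)%C.
Proof.
  intros [H1 H2]. unfold cavg, Cmult, Re, Im in *. simpl. pose proof PI_RGT_0.
  assert (S : forall (a : R) h, ex_RInt h 0 (2 * PI) -> ex_RInt (fun u => a * h u) 0 (2 * PI)).
  { intros a h Hh. apply (ex_RInt_scal (V := R_NormedModule)); auto. }
  rewrite (rint_minus (fun u => fst c * fst (f u)) (fun u => snd c * snd (f u))) by (apply S; auto).
  rewrite (rint_plus (fun u => fst c * snd (f u)) (fun u => snd c * fst (f u))) by (apply S; auto).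
  rewrite !rint_scal by auto. f_equal; field; lra.
Qed.

Lemma cavg_opp (f : R -> C) : cint f -> cavg (fun u => - f u)%C = (- cavg f)%C.
Proof.
  intros H. rewrite (cavg_ext (fun u => - f u)%C (fun u => - (1) * f u)%C) by (intros; ring).
  rewrite cavg_scal by auto. ring.
Qed.

Lemma cint_opp (f : R -> C) : cint f -> cint (fun u => - f u)%C.
Proof.
  intros H. replace (fun u => - f u)%C with (fun u => - (1) * f u)%C
    by (apply functional_extensionality; intros; ring).
  apply cint_scal; auto.
Qed.

Lemma cavg_sub (f g : R -> C) : cint f -> cint g ->
  cavg (fun u => f u - g u)%C = (cavg f - cavg g)%C.
Proof.
  intros Hf Hg. unfold Cminus. rewrite (cavg_plus f (fun u => - g u)%C); auto using cint_opp.
  rewrite cavg_opp; auto.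
Qed.

(** The factor 2 comes from bounding real and imaginary parts separately; it is harmless, because
    the bound is applied to errors that tend to 0. *)
Lemma cavg_bound (f : R -> C) (B : R) : cint f -> (forall u, Cmod (f u) <= B) -> Cmod (cavg f) <= 2 * B.
Proof.
  intros [H1 H2] HB. eapply Rle_trans; [ apply Cmod_le_re_im | ]. unfold cavg. simpl.
  pose proof PI_RGT_0 as Hpi.
  assert (S : forall h, ex_RInt h 0 (2 * PI) -> (forall u, Rabs (h u) <= B) -> Rabs (rint h / (2 * PI)) <= B).
  { intros h Hh Hb. unfold Rdiv. rewrite Rabs_mult, (Rabs_pos_eq (/ (2 * PI)))
      by (apply Rlt_le, Rinv_0_lt_compat; lra).
    apply (Rmult_le_reg_r (2 * PI)); [ lra | ]. rewrite Rmult_assoc, Rinv_l by lra.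
    pose proof (RInt_abs_le h 0 (2 * PI) B ltac:(lra) Hh Hb) as H0. fold (rint h) in H0. lra. }
  pose proof (S _ H1 (fun u => Rle_trans _ _ _ (re_le_Cmod (f u)) (HB u))).
  pose proof (S _ H2 (fun u => Rle_trans _ _ _ (im_le_Cmod (f u)) (HB u))). lra.
Qed.

Lemma cint_cis (a : R) (j : Z) : cint (fun u => cis (a + IZR j * u)).
Proof.
  split; eexists; [ apply is_RInt_cos | apply is_RInt_sin ].
Qed.

Lemma cavg_cis (a : R) (j : Z) :
  cavg (fun u => cis (a + IZR j * u)) = if Z.eq_dec j 0 then cis a else 0.
Proof.
  unfold cavg, rint. pose proof PI_RGT_0.
  change (fun u => Re (cis (a + IZR j * u))) with (fun u => cos (a + IZR j * u)).
  change (fun u => Im (cis (a + IZR j * u))) with (fun u => sin (a + IZR j * u)).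
  rewrite (is_RInt_unique _ _ _ _ (is_RInt_cos a j)), (is_RInt_unique _ _ _ _ (is_RInt_sin a j)).
  destruct (Z.eq_dec j 0); unfold cis, RtoC; f_equal; field; lra.
Qed.

Lemma cavg_Csum (f : nat -> R -> C) (g : R -> C) (m : nat -> R) (S : R) :
  (forall n, cint (f n)) -> cint g -> (forall n u, Cmod (f n u) <= m n) -> sum_le m S ->
  (forall u, Csum (fun n => f n u) (g u)) -> Csum (fun n => cavg (f n)) (cavg g).
Proof.
  intros Hf Hg Hm HS Hs eps He.
  destruct (sum_le_sup m S HS) as [S' [_ [HS' Hsup]]].
  destruct (Hsup (eps / 2)) as [N HN]; [ lra | ].
  exists N. intros n Hn.
  assert (E : cint (fun u => csum (fun k => f k u) n) /\
    cavg (fun u => csum (fun k => f k u) n) = csum (fun k => cavg (f k)) n).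
  { clear Hn. induction n as [|n [IH1 IH2]].
    - assert (H0 : cint (fun _ => RtoC 0)).
      { apply (cint_lipschitz _ 0). intros. replace (RtoC 0 - RtoC 0)%C with (RtoC 0) by ring.
        rewrite Cmod_0. lra. }
      split; [ exact H0 | ]. simpl. rewrite (cavg_ext _ (fun _ => 0 * 0)%C) by (intros; ring).
      rewrite (cavg_scal 0 (fun _ => RtoC 0)); auto. ring.
    - split; [ apply (cint_plus (fun u => csum (fun k => f k u) n)); auto | ].
      simpl. rewrite (cavg_plus (fun u => csum (fun k => f k u) n)), IH2; auto. }
  destruct E as [E1 E2]. rewrite <- E2, <- cavg_sub by auto.
  replace eps with (2 * (eps / 2)) by field. apply cavg_bound.
  - apply (cint_plus _ (fun u => - g u)%C); auto using cint_opp.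
  - intros u. rewrite Cmod_minus_sym.
    eapply Rle_trans; [ apply (Csum_tail _ m S'); auto | ].
    pose proof (rsum_mono m N n (fun k => Rle_trans _ _ _ (Cmod_ge_0 _) (Hm k 0)) Hn). lra.
Qed.

(** If F(t, 0) is the sum of c_i e^(i I t) over the integers i, with I the imaginary unit and c_i
    real, this is c_(n+1) - c_(-n-1), the coefficient of sin((n+1) t) in the imaginary part. The
    constant mode is real, which is why the index starts at frequency 1. *)
Definition ycoef (F : tfun) (n : nat) : R :=
  rint (fun t => Im (F t 0) * sin (INR (S n) * t)) / PI.

Section Coefficients.
Context (d : R) (Hd : 0 < d).

Lemma wiener_cint (F : tfun) (A : R) (t : R) : wiener d F A -> cint (F t).
Proof. intros H. apply (cint_lipschitz _ (A / d)). intros u v. apply wiener_lipschitz; auto. Qed.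

(** Averaging deletes the monomials with j <> 0 and keeps the others, so it cannot increase the
    norm. In the limit case uniform convergence is enough, the bound coming from the induction. *)
Lemma wiener_avg (F : tfun) (A : R) : wiener d F A -> wiener d (avg F) A.
Proof.
  induction 1 as [c i j|F G A B HF IF HG IG|F A B HF IF HAB|Fn F A HF IF HL].
  - assert (E : forall t u, avg (fun t u => c * cis (IZR i * t + IZR j * u))%C t u =
      (c * (if Z.eq_dec j 0 then cis (IZR i * t) else 0))%C).
    { intros t u. unfold avg. rewrite cavg_scal by apply cint_cis. rewrite cavg_cis. reflexivity. }
    destruct (Z.eq_dec j 0) as [->|Hj].
    + eapply wiener_ext; [ apply (wiener_atom d c i 0) | | lra ].
      intros t u. rewrite E. cbv beta. rewrite Rmult_0_l, Rplus_0_r. reflexivity.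
    + eapply wiener_ext; [ apply (wiener_zero d) | | ].
      * intros t u. rewrite E. ring.
      * apply Rmult_le_pos; [ apply Rabs_pos | pose proof (weight_ge_1 d Hd i j); lra ].
  - eapply wiener_ext; [ apply (wiener_add d _ _ _ _ IF IG) | | lra ].
    intros t u. unfold avg. rewrite cavg_plus; auto; eapply wiener_cint; eauto.
  - eapply wiener_weaken; eauto.
  - apply wiener_lim with (fun n => avg (Fn n)); auto.
    intros eps He. destruct (HL (eps / 2)) as [n Hn]; [ lra | ].
    exists n. intros t u. unfold avg.
    assert (Hc : cint (F t)).
    { apply (wiener_cint F A t). apply wiener_lim with Fn; auto. }
    assert (Hc' : cint (Fn n t)) by (eapply wiener_cint; eauto).
    rewrite <- cavg_sub by auto.
    replace eps with (2 * (eps / 2)) by field. apply cavg_bound; auto.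
    apply (cint_plus _ (fun u => - F t u)%C); auto using cint_opp.
Qed.

Lemma ycoef_integrable (F : tfun) (A : R) (n : nat) : wiener d F A ->
  ex_RInt (fun t => Im (F t 0) * sin (INR (S n) * t)) 0 (2 * PI).
Proof.
  intros H. apply ex_RInt_lipschitz with (A / d + A * INR (S n)).
  intros u v. pose proof (wiener_swap d F A H) as Hs.
  pose proof (wiener_lipschitz d Hd _ _ Hs 0 u v) as HL. simpl in HL.
  pose proof (wiener_bound d Hd F A H v 0) as HB.
  set (m := INR (S n)). assert (Hm : 0 <= m) by apply pos_INR.
  replace (Im (F u 0) * sin (m * u) - Im (F v 0) * sin (m * v))
    with (Im (F u 0 - F v 0) * sin (m * u) + Im (F v 0) * (sin (m * u) - sin (m * v)))
    by (unfold Im; simpl; ring).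
  eapply Rle_trans; [ apply Rabs_triang | ]. rewrite !Rabs_mult.
  pose proof (im_le_Cmod (F u 0 - F v 0)) as H1. pose proof (im_le_Cmod (F v 0)) as H2.
  assert (H3 : Rabs (sin (m * u)) <= 1).
  { pose proof (im_le_Cmod (cis (m * u))) as Hx. rewrite Cmod_cis in Hx. exact Hx. }
  assert (H4 : Rabs (sin (m * u) - sin (m * v)) <= m * Rabs (u - v)).
  { pose proof (im_le_Cmod (cis (m * u) - cis (m * v))) as Hx.
    pose proof (cis_diff_le (m * u) (m * v)) as Hy.
    replace (m * u - m * v) with (m * (u - v)) in Hy by ring.
    rewrite Rabs_mult, (Rabs_pos_eq m) in Hy by auto.
    change (Rabs (sin (m * u) - sin (m * v)) <= Cmod (cis (m * u) - cis (m * v))) in Hx. lra. }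
  rewrite Rmult_plus_distr_r. apply Rplus_le_compat.
  - rewrite <- (Rmult_1_r (A / d * _)). apply Rmult_le_compat; try apply Rabs_pos; lra.
  - rewrite Rmult_assoc. apply Rmult_le_compat; try apply Rabs_pos; lra.
Qed.

Lemma ycoef_plus (F G : tfun) (A B : R) (n : nat) : wiener d F A -> wiener d G B ->
  ycoef (fun t u => F t u + G t u)%C n = ycoef F n + ycoef G n.
Proof.
  intros HF HG. unfold ycoef. rewrite <- Rdiv_plus_distr. f_equal.
  rewrite <- rint_plus by (eapply ycoef_integrable; eauto).
  apply rint_ext. intros x. unfold Im. simpl. ring.
Qed.

Lemma ycoef_scal (F : tfun) (A c : R) (n : nat) : wiener d F A ->
  ycoef (fun t u => c * F t u)%C n = c * ycoef F n.
Proof.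
  intros HF. unfold ycoef, Rdiv. rewrite <- Rmult_assoc. f_equal.
  rewrite <- rint_scal by (eapply ycoef_integrable; eauto).
  apply rint_ext. intros x. unfold Im. simpl. ring.
Qed.

Lemma ycoef_ext (F G : tfun) (n : nat) : (forall t, F t 0 = G t 0) -> ycoef F n = ycoef G n.
Proof. intros H. unfold ycoef. f_equal. apply rint_ext. intros x. rewrite H. reflexivity. Qed.

Lemma ycoef_sub (F G : tfun) (A B : R) (n : nat) : wiener d F A -> wiener d G B ->
  ycoef (fun t u => F t u - G t u)%C n = ycoef F n - ycoef G n.
Proof.
  intros HF HG.
  rewrite (ycoef_ext _ (fun t u => F t u + RtoC (-1) * G t u)%C).
  - rewrite (ycoef_plus F (fun t u => RtoC (-1) * G t u)%C A (Rabs (-1) * B)); auto.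
    + rewrite (ycoef_scal G B); auto. ring.
    + apply wiener_scal; auto.
  - intros t. apply injective_projections; simpl; ring.
Qed.

Lemma ycoef_atom (c : R) (i j : Z) (n : nat) :
  ycoef (fun t u => c * cis (IZR i * t + IZR j * u))%C n =
  c * ((if Z.eq_dec i (Z.of_nat (S n)) then 1 else 0) - (if Z.eq_dec i (- Z.of_nat (S n)) then 1 else 0)).
Proof.
  unfold ycoef, rint. pose proof PI_RGT_0.
  pose proof (is_RInt_cos 0 (i - Z.of_nat (S n))) as H1.
  pose proof (is_RInt_cos 0 (i + Z.of_nat (S n))) as H2.
  pose proof (is_RInt_scal (V := R_NormedModule) _ _ _ (c / 2) _
    (is_RInt_minus (V := R_NormedModule) _ _ _ _ _ _ H1 H2)) as H3.
  erewrite is_RInt_unique; [ | eapply is_RInt_ext; [ | exact H3 ] ].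
  - unfold scal, minus, plus, opp; simpl. unfold mult; simpl. rewrite cos_0.
    destruct (Z.eq_dec (i - Z.pos (Pos.of_succ_nat n)) 0), (Z.eq_dec i (Z.pos (Pos.of_succ_nat n))); try lia;
    destruct (Z.eq_dec (i + Z.pos (Pos.of_succ_nat n)) 0), (Z.eq_dec i (Z.neg (Pos.of_succ_nat n))); try lia;
    field; lra.
  - intros x _. unfold scal, minus, plus, opp; simpl. unfold mult; simpl.
    rewrite minus_IZR, plus_IZR, Rmult_0_r, !Rplus_0_r, !Rplus_0_l, Rmult_0_l, Rplus_0_r.
    change (IZR (Z.pos (Pos.of_succ_nat n))) with (IZR (Z.of_nat (S n))).
    rewrite <- INR_IZR_INZ. change (match n with O => 1 | S _ => INR n + 1 end) with (INR (S n)).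
    rewrite Rmult_minus_distr_r, Rmult_plus_distr_r, cos_minus, cos_plus. field.
Qed.

Lemma rsum_single (u : nat -> R) (k : nat) (N : nat) :
  (forall n, n <> k -> u n = 0) -> rsum u N = if le_lt_dec N k then 0 else u k.
Proof.
  intros H1. induction N as [|N IH]; simpl rsum; [ destruct (le_lt_dec 0 k); [ auto | lia ] | ].
  rewrite IH. destruct (le_lt_dec N k), (le_lt_dec (S N) k); try lia.
  - rewrite H1 by lia. ring.
  - replace N with k by lia. ring.
  - rewrite (H1 N) by lia. ring.
Qed.

Lemma rsum_single_le (u : nat -> R) (k : nat) (B : R) (N : nat) :
  (forall n, n <> k -> u n = 0) -> u k <= B -> 0 <= B -> rsum u N <= B.
Proof. intros H1 H2 H3. rewrite (rsum_single u k N H1). destruct (le_lt_dec N k); auto. Qed.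

Lemma rsum_mult_diff_le (a b s : nat -> R) (e : R) (N : nat) :
  (forall k, Rabs (a k - b k) <= e) -> (forall k, Rabs (s k) <= 1) ->
  Rabs (rsum (fun k => a k * s k) N - rsum (fun k => b k * s k) N) <= INR N * e.
Proof.
  intros He Hs. induction N as [|N IH].
  - simpl. rewrite Rminus_0_r, Rabs_R0. lra.
  - rewrite S_INR. simpl rsum. specialize (He N). specialize (Hs N).
    replace (rsum (fun k => a k * s k) N + a N * s N - (rsum (fun k => b k * s k) N + b N * s N))
      with ((rsum (fun k => a k * s k) N - rsum (fun k => b k * s k) N) + (a N - b N) * s N) by ring.
    eapply Rle_trans; [ apply Rabs_triang | ]. rewrite Rabs_mult.
    pose proof (Rabs_pos (s N)). pose proof (Rabs_pos (a N - b N)). nra.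
Qed.

(** A uniform error eps/2 changes a sine coefficient by at most 2 pi (eps/2) / pi = eps, whatever
    its index. *)
Lemma ycoef_lim (Fn : nat -> tfun) (F : tfun) (A : R) :
  (forall n, wiener d (Fn n) A) ->
  (forall eps, 0 < eps -> exists n, forall t u, Cmod (Fn n t u - F t u) <= eps) ->
  forall eps, 0 < eps -> exists n,
   (forall t u, Cmod (Fn n t u - F t u) <= eps) /\ forall k, Rabs (ycoef F k - ycoef (Fn n) k) <= eps.
Proof.
  intros HF HL eps He. destruct (HL (eps / 2)) as [n Hn]; [ lra | ].
  exists n. split; [ intros t u; specialize (Hn t u); lra | ].
  intros k. assert (HFl : wiener d F A) by (apply wiener_lim with Fn; auto).
  rewrite <- (ycoef_sub F (Fn n) A A) by auto.
  unfold ycoef, Rdiv. pose proof PI_RGT_0 as Hpi.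
  rewrite Rabs_mult, (Rabs_pos_eq (/ PI)) by (apply Rlt_le, Rinv_0_lt_compat; lra).
  apply (Rmult_le_reg_r PI); [ lra | ]. rewrite Rmult_assoc, Rinv_l by lra. rewrite Rmult_1_r.
  replace (eps * PI) with ((2 * PI - 0) * (eps / 2)) by field.
  apply RInt_abs_le; [ lra | | ].
  - apply (ycoef_integrable (fun t u => F t u - Fn n t u)%C (A + A)). apply wiener_sub; auto.
  - intros t. rewrite Rabs_mult.
    pose proof (im_le_Cmod (F t 0 - Fn n t 0)). rewrite Cmod_minus_sym in H. specialize (Hn t 0).
    pose proof (im_le_Cmod (cis (INR (S k) * t))) as Hx. rewrite Cmod_cis in Hx.
    change (Im (cis (INR (S k) * t))) with (sin (INR (S k) * t)) in Hx.
    rewrite <- (Rmult_1_r (eps / 2)). apply Rmult_le_compat; try apply Rabs_pos; lra.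
Qed.

(** A monomial w^i tau^j feeds at most the single index |i| - 1, whose weight 1 + d |i| does not
    exceed that of the monomial. Bounds on finitely many terms then survive uniform limits. *)
Lemma ycoef_sum_le (F : tfun) (A : R) : wiener d F A ->
  sum_le (fun n => (1 + d * INR (S n)) * Rabs (ycoef F n)) A.
Proof.
  induction 1 as [c i j|F G A B HF IF HG IG|F A B HF IF HAB|Fn F A HF IF HL]; intros N.
  - pose proof (weight_ge_1 d Hd i j). pose proof (Rabs_pos c).
    apply rsum_single_le with (Z.to_nat (Z.abs i - 1)).
    + intros n Hn. rewrite ycoef_atom.
      destruct (Z.eq_dec i (Z.of_nat (S n))); [ lia | ].
      destruct (Z.eq_dec i (- Z.of_nat (S n))); [ lia | ]. rewrite Rminus_0_r, Rmult_0_r, Rabs_R0. ring.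
    + rewrite ycoef_atom, Rabs_mult, Rmult_comm, Rmult_assoc. apply Rmult_le_compat_l; auto.
      set (k := Z.to_nat (Z.abs i - 1)).
      pose proof (pos_INR (S k)) as Hk.
      destruct (Z.eq_dec i (Z.of_nat (S k))), (Z.eq_dec i (- Z.of_nat (S k))); try lia.
      * rewrite Rminus_0_r, Rabs_R1, Rmult_1_l. unfold weight.
        apply Rplus_le_compat_l, Rmult_le_compat_l; [ lra | ]. rewrite INR_IZR_INZ. apply IZR_le. lia.
      * rewrite Rminus_0_l, Rabs_Ropp, Rabs_R1, Rmult_1_l. unfold weight.
        apply Rplus_le_compat_l, Rmult_le_compat_l; [ lra | ]. rewrite INR_IZR_INZ. apply IZR_le. lia.
      * rewrite Rminus_0_r, Rabs_R0. lra.
    + nra.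
  - eapply Rle_trans; [ apply (rsum_le _ (fun n => (1 + d * INR (S n)) * Rabs (ycoef F n) + (1 + d * INR (S n)) * Rabs (ycoef G n))) | ].
    + intros k _. rewrite <- Rmult_plus_distr_l. pose proof (pos_INR (S k)).
      apply Rmult_le_compat_l; [ nra | ]. rewrite (ycoef_plus F G A B) by auto. apply Rabs_triang.
    + rewrite rsum_plus. specialize (IF N). specialize (IG N). lra.
  - specialize (IF N). lra.
  - apply Rle_plus_epsilon. intros eps He.
    (* The coefficients converge uniformly in the index, so a tolerance divided by the total weight
       of the N terms suffices. *)
    set (W := rsum (fun n => 1 + d * INR (S n)) N).
    assert (HW : 0 <= W) by (apply rsum_nonneg; intros k; pose proof (pos_INR (S k)); nra).
    destruct (ycoef_lim Fn F A HF HL (eps / (W + 1))) as [n [_ Hn]]; [ apply Rdiv_lt_0_compat; lra | ].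
    eapply Rle_trans; [ apply (rsum_le _ (fun k => (1 + d * INR (S k)) * Rabs (ycoef (Fn n) k) + eps / (W + 1) * (1 + d * INR (S k)))) | ].
    + intros k _. pose proof (pos_INR (S k)). specialize (Hn k).
      pose proof (Rabs_triang (ycoef F k - ycoef (Fn n) k) (ycoef (Fn n) k)) as Ht.
      replace (ycoef F k - ycoef (Fn n) k + ycoef (Fn n) k) with (ycoef F k) in Ht by ring.
      rewrite (Rmult_comm (eps / (W + 1))), <- Rmult_plus_distr_l. apply Rmult_le_compat_l; [ nra | lra ].
    + rewrite rsum_plus, rsum_scal. fold W. specialize (IF n N).
      assert (eps / (W + 1) * W <= eps); [ | lra ].
      apply (Rmult_le_reg_r (W + 1)); [ lra | ]. field_simplify; [ nra | lra ].
Qed.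

(** What the first N sine terms leave out has frequencies |i| > N, hence weights of at least 1 + d
    N, and its sup norm is at most its weighted norm divided by 1 + d N. *)
Lemma Im_sine_series (F : tfun) (A : R) : wiener d F A -> forall t N,
  Rabs (Im (F t 0) - rsum (fun n => ycoef F n * sin (INR (S n) * t)) N) <= A / (1 + d * INR N).
Proof.
  intros H t N. pose proof (pos_INR N) as HN0.
  assert (HN : 0 < 1 + d * INR N) by nra.
  assert (Hi : 0 < / (1 + d * INR N)) by (apply Rinv_0_lt_compat; auto).
  induction H as [c i j|F G A B HF IF HG IG|F A B HF IF HAB|Fn F A HF IF HL].
  - pose proof (Rabs_pos c) as Hc. pose proof (weight_ge_1 d Hd i j) as Hw.
    assert (Hpos : 0 <= Rabs c * weight d i j / (1 + d * INR N)).
    { apply Rmult_le_pos; [ apply Rmult_le_pos; lra | lra ]. }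
    replace (Im (c * cis (IZR i * t + IZR j * 0))) with (c * sin (IZR i * t))
      by (rewrite Rmult_0_r, Rplus_0_r; simpl; ring).
    set (k := Z.to_nat (Z.abs i - 1)).
    rewrite (rsum_single _ k).
    2:{ intros n Hn. rewrite ycoef_atom.
        destruct (Z.eq_dec i (Z.of_nat (S n))); [ lia | ].
        destruct (Z.eq_dec i (- Z.of_nat (S n))); [ lia | ]. ring. }
    destruct (Z.eq_dec i 0) as [Hi0|Hi0].
    { rewrite ycoef_atom. destruct (Z.eq_dec i (Z.of_nat (S k))); [ lia | ].
      destruct (Z.eq_dec i (- Z.of_nat (S k))); [ lia | ].
      rewrite Hi0, Rmult_0_l, sin_0.
      replace (c * 0 - _) with 0 by (destruct (le_lt_dec N k); ring). rewrite Rabs_R0. rewrite Hi0 in Hpos. auto. }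
    destruct (le_lt_dec N k) as [Hk|Hk].
    + rewrite Rminus_0_r, Rabs_mult.
      pose proof (im_le_Cmod (cis (IZR i * t))) as Hx. rewrite Cmod_cis in Hx.
      change (Im (cis (IZR i * t))) with (sin (IZR i * t)) in Hx.
      apply (Rmult_le_reg_r (1 + d * INR N)); auto.
      unfold Rdiv. rewrite (Rmult_assoc (_ * weight _ _ _)), Rinv_l, Rmult_1_r by lra.
      rewrite Rmult_assoc. apply Rmult_le_compat_l; auto.
      assert (1 + d * INR N <= weight d i j).
      { unfold weight. apply Rplus_le_compat_l, Rmult_le_compat_l; [ lra | ].
        rewrite INR_IZR_INZ. apply IZR_le. lia. }
      pose proof (Rabs_pos (sin (IZR i * t))). nra.
    + rewrite ycoef_atom.
      replace (c * sin (IZR i * t) - _) with 0; [ rewrite Rabs_R0; auto | ].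
      destruct (Z.eq_dec i (Z.of_nat (S k))) as [E|E], (Z.eq_dec i (- Z.of_nat (S k))) as [E'|E']; try lia.
      * rewrite INR_IZR_INZ, <- E. ring.
      * rewrite INR_IZR_INZ. replace (Z.of_nat (S k)) with (- i)%Z by lia.
        rewrite opp_IZR. replace (- IZR i * t) with (- (IZR i * t)) by ring. rewrite sin_neg. ring.
  - rewrite (rsum_ext _ (fun n => ycoef F n * sin (INR (S n) * t) + ycoef G n * sin (INR (S n) * t))).
    2:{ intros k _. rewrite (ycoef_plus F G A B) by auto. ring. }
    rewrite rsum_plus.
    replace (Im (F t 0 + G t 0) - _) with
      ((Im (F t 0) - rsum (fun n => ycoef F n * sin (INR (S n) * t)) N)
       + (Im (G t 0) - rsum (fun n => ycoef G n * sin (INR (S n) * t)) N)) by (unfold Im; simpl; ring).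
    eapply Rle_trans; [ apply Rabs_triang | ]. unfold Rdiv in *. lra.
  - eapply Rle_trans; [ apply IF | ]. apply Rmult_le_compat_r; lra.
  - apply Rle_plus_epsilon. intros eps He.
    destruct (ycoef_lim Fn F A HF HL (eps / (1 + INR N))) as [n [Hn1 Hn2]]; [ apply Rdiv_lt_0_compat; lra | ].
    specialize (IF n). specialize (Hn1 t 0).
    set (h := fun k => ycoef F k * sin (INR (S k) * t)) in *.
    set (hn := fun k => ycoef (Fn n) k * sin (INR (S k) * t)) in *.
    assert (Hd1 : Rabs (rsum h N - rsum hn N) <= INR N * (eps / (1 + INR N))).
    { apply rsum_mult_diff_le; auto. intros k.
      pose proof (im_le_Cmod (cis (INR (S k) * t))) as Hx. rewrite Cmod_cis in Hx. exact Hx. }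
    pose proof (im_le_Cmod (F t 0 - Fn n t 0)) as H1. rewrite Cmod_minus_sym in H1.
    replace (Im (F t 0) - rsum h N) with
      ((Im (Fn n t 0) - rsum hn N) + (Im (F t 0 - Fn n t 0) - (rsum h N - rsum hn N))) by (unfold Im; simpl; ring).
    eapply Rle_trans; [ apply Rabs_triang | ]. apply Rplus_le_compat; auto.
    unfold Rminus at 1. eapply Rle_trans; [ apply Rabs_triang | ]. rewrite Rabs_Ropp.
    replace eps with (eps / (1 + INR N) + INR N * (eps / (1 + INR N))) by (field; lra).
    apply Rplus_le_compat; lra.
Qed.

(** When all coefficients vanish, the tail estimate bounds the imaginary part itself by A / (1 + d
    N) for every N. This turns the mode equations back into the pointwise boundary equation. *)
Lemma Im_eq_0 (F : tfun) (A : R) : wiener d F A -> (forall n, ycoef F n = 0) -> forall t, Im (F t 0) = 0.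
Proof.
  intros H H0 t.
  assert (E : forall N, Rabs (Im (F t 0)) <= A / (1 + d * INR N)).
  { intros N. pose proof (Im_sine_series F A H t N) as HN.
    rewrite (rsum_ext _ (fun _ => 0 * 0)), rsum_scal in HN by (intros; rewrite H0; ring).
    rewrite Rmult_0_l, Rminus_0_r in HN. exact HN. }
  pose proof (wiener_nonneg d Hd F A H) as HA.
  apply NNPP. intros Hne. pose proof (Rabs_pos_lt _ Hne) as Hp.
  set (x := Rabs (Im (F t 0))) in *.
  destruct (nfloor_ex (A / (d * x) + 1)) as [N [_ HN]].
  { pose proof (Rdiv_le_0_compat A (d * x) HA ltac:(nra)). lra. }
  specialize (E (S N)). rewrite S_INR in E. pose proof (pos_INR N).
  apply (Rmult_le_compat_r (1 + d * (INR N + 1))) in E; [ | nra ].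
  unfold Rdiv in E. rewrite Rmult_assoc, Rinv_l, Rmult_1_r in E by nra.
  assert (A < x * (d * (INR N + 1))).
  { apply (Rmult_lt_reg_r (/ (d * x))); [ apply Rinv_0_lt_compat; nra | ].
    replace (x * (d * (INR N + 1)) * / (d * x)) with (INR N + 1) by (field; split; lra).
    unfold Rdiv in HN. lra. }
  nra.
Qed.

End Coefficients.

(** * Differentiable maps into the Wiener algebra *)

(** The pair of coefficient sequences of [(f_1, f_2)]; [true] is the outer curve. *)
Definition seqs := bool -> nat -> R.

Definition zeros : seqs := fun _ _ => 0.
Definition sub (x y : seqs) : seqs := fun j n => x j n - y j n.
Definition scl (c : R) (x : seqs) : seqs := fun j n => c * x j n.

(** One factor n + 1 more than the weight of the sine coefficients in [ycoef_sum_le]: it pays for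
    the derivative phi' in the equation. *)
Definition kappa (d : R) (n : nat) : R := INR (S n) * (1 + d * INR (S n)).

Definition bnd (d : R) (x : seqs) (A : R) : Prop :=
  sum_le (fun n => kappa d n * (Rabs (x true n) + Rabs (x false n))) A.

(** [D] is the derivative at [0] of [E], with [E 0 = E0], and the remainder
    [E - D] is Lipschitz near [0] with a constant vanishing linearly at [0]. *)
Definition nice_with (d L r : R) (E : seqs -> tfun) (E0 : tfun) (D : seqs -> tfun) : Prop :=
  wiener d E0 L /\
  (forall x A, bnd d x A -> wiener d (D x) (L * A)) /\
  (forall x A, A <= r -> bnd d x A -> wiener d (E x) L) /\
  (forall x A, A <= r -> bnd d x A -> wiener d (fun t u => E x t u - E0 t u)%C (L * A)) /\
  (forall x y A e, A <= r -> bnd d x A -> bnd d y A -> bnd d (sub x y) e ->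
     wiener d (fun t u => E x t u - E y t u)%C (L * e)) /\
  (forall x y A e, A <= r -> bnd d x A -> bnd d y A -> bnd d (sub x y) e ->
     wiener d (fun t u => E x t u - E y t u - D (sub x y) t u)%C (L * A * e)).

Definition nice (d : R) (E : seqs -> tfun) (E0 : tfun) (D : seqs -> tfun) : Prop :=
  exists L r, 0 < L /\ 0 < r /\ nice_with d L r E E0 D.

Section Nice.
Context (d : R) (Hd : 0 < d).

Lemma kappa_ge_1 (n : nat) : 1 <= kappa d n.
Proof.
  unfold kappa. rewrite S_INR. pose proof (pos_INR n).
  assert (0 <= d * (INR n + 1)) by (apply Rmult_le_pos; lra). nra.
Qed.

Lemma bnd_nonneg (x : seqs) (A : R) : bnd d x A -> 0 <= A.
Proof. intros H. apply (H O). Qed.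

Lemma bnd_component (x : seqs) (A : R) (j : bool) :
  bnd d x A -> sum_le (fun n => kappa d n * Rabs (x j n)) A.
Proof.
  intros H. eapply sum_le_ext; [ | exact H ]. intros n. simpl.
  apply Rmult_le_compat_l; [ pose proof (kappa_ge_1 n); lra | ].
  pose proof (Rabs_pos (x true n)). pose proof (Rabs_pos (x false n)). destruct j; lra.
Qed.

Lemma bnd_weaken (x : seqs) (A B : R) : bnd d x A -> A <= B -> bnd d x B.
Proof. intros H HAB N. eapply Rle_trans; [ apply H | auto ]. Qed.

Lemma bnd_zeros (A : R) : 0 <= A -> bnd d zeros A.
Proof.
  intros HA N. rewrite (rsum_ext _ (fun _ => 0 * 0)).
  - rewrite rsum_scal. lra.
  - intros k _. unfold zeros. rewrite Rabs_R0. ring.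
Qed.

Lemma bnd_triangle (x y z : seqs) (A B : R) :
  (forall j n, Rabs (z j n) <= Rabs (x j n) + Rabs (y j n)) ->
  bnd d x A -> bnd d y B -> bnd d z (A + B).
Proof.
  intros H Hx Hy. eapply sum_le_ext; [ | apply (sum_le_plus _ _ _ _ Hx Hy) ].
  intros n. simpl. rewrite <- Rmult_plus_distr_l.
  apply Rmult_le_compat_l; [ pose proof (kappa_ge_1 n); lra | ].
  pose proof (H true n). pose proof (H false n). lra.
Qed.

Lemma bnd_sub (x y : seqs) (A B : R) : bnd d x A -> bnd d y B -> bnd d (sub x y) (A + B).
Proof.
  apply bnd_triangle. intros j n. unfold sub, Rminus.
  rewrite <- (Rabs_Ropp (y j n)). apply Rabs_triang.
Qed.

Lemma bnd_sub_triangle (x y z : seqs) (A B : R) :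
  bnd d (sub x y) A -> bnd d (sub y z) B -> bnd d (sub x z) (A + B).
Proof.
  apply bnd_triangle. intros j n. unfold sub.
  replace (x j n - z j n) with ((x j n - y j n) + (y j n - z j n)) by ring. apply Rabs_triang.
Qed.

Lemma bnd_sub_sym (x y : seqs) (A : R) : bnd d (sub x y) A -> bnd d (sub y x) A.
Proof.
  intros H. eapply sum_le_ext; [ | exact H ]. intros n. simpl. unfold sub.
  rewrite (Rabs_minus_sym (y true n)), (Rabs_minus_sym (y false n)). lra.
Qed.

Lemma bnd_scl (c : R) (x : seqs) (A : R) : bnd d x A -> bnd d (scl c x) (Rabs c * A).
Proof.
  intros H. eapply sum_le_ext; [ | apply (sum_le_scal _ _ (Rabs c) (Rabs_pos c) H) ].
  intros n. simpl. unfold scl. rewrite !Rabs_mult. right. ring.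
Qed.

Lemma nice_with_mono (L L' r r' : R) E E0 D :
  0 < L -> L <= L' -> r' <= r -> nice_with d L r E E0 D -> nice_with d L' r' E E0 D.
Proof.
  intros HL HLL Hr [H0 [H1 [H2 [H3 [H4 H5]]]]].
  repeat split.
  - eapply wiener_weaken; eauto.
  - intros x A Hx. pose proof (bnd_nonneg x A Hx). eapply wiener_weaken; [ apply H1; eauto | ].
    apply Rmult_le_compat_r; auto.
  - intros x A HA Hx. eapply wiener_weaken; [ apply (H2 x A) | ]; auto; lra.
  - intros x A HA Hx. pose proof (bnd_nonneg x A Hx).
    eapply wiener_weaken; [ apply (H3 x A) | ]; auto; try lra. apply Rmult_le_compat_r; auto.
  - intros x y A e HA Hx Hy Hxy. pose proof (bnd_nonneg _ _ Hxy).
    eapply wiener_weaken; [ apply (H4 x y A e) | ]; auto; try lra. apply Rmult_le_compat_r; auto.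
  - intros x y A e HA Hx Hy Hxy. pose proof (bnd_nonneg _ _ Hxy). pose proof (bnd_nonneg _ _ Hx).
    eapply wiener_weaken; [ apply (H5 x y A e) | ]; auto; try lra.
    apply Rmult_le_compat_r; auto. apply Rmult_le_compat_r; auto.
Qed.

Lemma nice_common E E0 D F F0 D' : nice d E E0 D -> nice d F F0 D' ->
  exists L r, 1 <= L /\ 0 < r <= 1 /\ nice_with d L r E E0 D /\ nice_with d L r F F0 D'.
Proof.
  intros [L [r [HL [Hr H]]]] [L' [r' [HL' [Hr' H']]]].
  exists (L + L' + 1), (Rmin 1 (Rmin r r')).
  pose proof (Rmin_l r r'). pose proof (Rmin_r r r'). pose proof (Rmin_pos r r' Hr Hr').
  pose proof (Rmin_l 1 (Rmin r r')). pose proof (Rmin_r 1 (Rmin r r')).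
  pose proof (Rmin_pos 1 (Rmin r r') Rlt_0_1 ltac:(auto)).
  split; [ lra | ]. split; [ split; lra | ].
  split; [ apply (nice_with_mono L _ r) | apply (nice_with_mono L' _ r') ]; auto; lra.
Qed.

Lemma nice_const (C0 : tfun) (K : R) : wiener d C0 K -> nice d (fun _ => C0) C0 (fun _ _ _ => RtoC 0).
Proof.
  intros H. pose proof (wiener_nonneg d Hd _ _ H) as HK.
  exists (K + 1), 1. split; [ lra | ]. split; [ lra | ].
  assert (Z : forall B, 0 <= B -> wiener d (fun _ _ => RtoC 0) B).
  { intros B HB. eapply wiener_weaken; [ apply wiener_zero | auto ]. }
  repeat split.
  - eapply wiener_weaken; eauto. lra.
  - intros x A Hx. apply Z. pose proof (bnd_nonneg x A Hx). apply Rmult_le_pos; lra.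
  - intros. eapply wiener_weaken; eauto. lra.
  - intros x A HA Hx. eapply wiener_ext; [ apply Z | | apply Rle_refl ].
    + pose proof (bnd_nonneg x A Hx). apply Rmult_le_pos; lra.
    + intros. simpl. ring.
  - intros x y A e HA Hx Hy Hxy. eapply wiener_ext; [ apply Z | | apply Rle_refl ].
    + pose proof (bnd_nonneg _ _ Hxy). apply Rmult_le_pos; lra.
    + intros. simpl. ring.
  - intros x y A e HA Hx Hy Hxy. eapply wiener_ext; [ apply Z | | apply Rle_refl ].
    + pose proof (bnd_nonneg _ _ Hxy). pose proof (bnd_nonneg _ _ Hx).
      apply Rmult_le_pos; auto. apply Rmult_le_pos; lra.
    + intros. simpl. ring.
Qed.

Lemma nice_linear (Lam : seqs -> tfun) (K : R) : 0 <= K ->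
  (forall x A, bnd d x A -> wiener d (Lam x) (K * A)) ->
  (forall x y A B, bnd d x A -> bnd d y B -> forall t u, (Lam x t u - Lam y t u)%C = Lam (sub x y) t u) ->
  nice d Lam (fun _ _ => RtoC 0) Lam.
Proof.
  intros HK HB HL. exists (K + 1), 1. split; [ lra | ]. split; [ lra | ].
  assert (HB' : forall x A, bnd d x A -> wiener d (Lam x) ((K + 1) * A)).
  { intros x A Hx. eapply wiener_weaken; [ apply HB; eauto | ].
    apply Rmult_le_compat_r; [ apply (bnd_nonneg x A Hx) | lra ]. }
  repeat split; auto.
  - eapply wiener_weaken; [ apply wiener_zero | lra ].
  - intros x A HA Hx. eapply wiener_weaken; [ apply HB'; eauto | ].
    pose proof (bnd_nonneg x A Hx). nra.
  - intros x A HA Hx. eapply wiener_ext; [ apply HB'; eauto | | apply Rle_refl ].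
    intros. simpl. ring.
  - intros x y A e HA Hx Hy Hxy. eapply wiener_ext; [ apply HB'; eauto | | apply Rle_refl ].
    intros t u. simpl. rewrite (HL x y A A); auto.
  - intros x y A e HA Hx Hy Hxy. eapply wiener_ext; [ apply wiener_zero | | ].
    + intros t u. simpl. rewrite (HL x y A A); auto. ring.
    + pose proof (bnd_nonneg _ _ Hxy). pose proof (bnd_nonneg _ _ Hx).
      apply Rmult_le_pos; auto. apply Rmult_le_pos; lra.
Qed.

Lemma nice_ext E E' E0 E0' D D' :
  nice d E E0 D ->
  (exists r, 0 < r /\ forall x A, A <= r -> bnd d x A -> forall t u, E' x t u = E x t u) ->
  (forall t u, E0' t u = E0 t u) ->
  (forall x A, bnd d x A -> forall t u, D' x t u = D x t u) ->
  nice d E' E0' D'.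
Proof.
  intros [L [r [HL [Hr [H0 [H1 [H2 [H3 [H4 H5]]]]]]]]] [r' [Hr' HE]] HE0 HD.
  exists L, (Rmin r r'). split; auto. split; [ apply Rmin_pos; auto | ].
  pose proof (Rmin_l r r'). pose proof (Rmin_r r r').
  repeat split.
  - apply (wiener_ext d E0 _ L L); auto using Rle_refl.
  - intros x A Hx. apply (wiener_ext d (D x) _ (L * A) (L * A)); auto using Rle_refl.
    intros t u. symmetry. apply (HD x A Hx).
  - intros x A HA Hx. eapply wiener_ext; [ apply (H2 x A) | | apply Rle_refl ]; auto; try lra.
    intros. symmetry. apply (HE x A); auto; lra.
  - intros x A HA Hx. eapply wiener_ext; [ apply (H3 x A) | | apply Rle_refl ]; auto; try lra.
    intros t u. simpl. rewrite HE0, (HE x A); auto; lra.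
  - intros x y A e HA Hx Hy Hxy.
    eapply wiener_ext; [ apply (H4 x y A e) | | apply Rle_refl ]; auto; try lra.
    intros t u. simpl. rewrite (HE x A), (HE y A); auto; lra.
  - intros x y A e HA Hx Hy Hxy.
    eapply wiener_ext; [ apply (H5 x y A e) | | apply Rle_refl ]; auto; try lra.
    intros t u. simpl. rewrite (HE x A), (HE y A), (HD _ e); auto; lra.
Qed.

Lemma nice_add E E0 D F F0 D' : nice d E E0 D -> nice d F F0 D' ->
  nice d (fun x t u => E x t u + F x t u)%C (fun t u => E0 t u + F0 t u)%C
    (fun x t u => D x t u + D' x t u)%C.
Proof.
  intros HE HF. destruct (nice_common _ _ _ _ _ _ HE HF)
    as [L [r [HL [Hr [[H0 [H1 [H2 [H3 [H4 H5]]]]] [G0 [G1 [G2 [G3 [G4 G5]]]]]]]]]].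
  exists (2 * L), r. split; [ lra | ]. split; [ lra | ].
  repeat split.
  - eapply wiener_ext; [ apply (wiener_add d _ _ _ _ H0 G0) | reflexivity | lra ].
  - intros x A Hx. eapply wiener_ext; [ apply (wiener_add d _ _ _ _ (H1 x A Hx) (G1 x A Hx)) | reflexivity | lra ].
  - intros x A HA Hx. eapply wiener_ext; [ apply (wiener_add d _ _ _ _ (H2 x A HA Hx) (G2 x A HA Hx)) | reflexivity | lra ].
  - intros x A HA Hx. eapply wiener_ext; [ apply (wiener_add d _ _ _ _ (H3 x A HA Hx) (G3 x A HA Hx)) | | lra ].
    intros; simpl; ring.
  - intros x y A e HA Hx Hy Hxy.
    eapply wiener_ext; [ apply (wiener_add d _ _ _ _ (H4 x y A e HA Hx Hy Hxy) (G4 x y A e HA Hx Hy Hxy)) | | lra ].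
    intros; simpl; ring.
  - intros x y A e HA Hx Hy Hxy.
    eapply wiener_ext; [ apply (wiener_add d _ _ _ _ (H5 x y A e HA Hx Hy Hxy) (G5 x y A e HA Hx Hy Hxy)) | | lra ].
    intros; simpl; ring.
Qed.

(** With D and D' taken at x - y, the remainder of the product is E_x (F_x - F_y - D') + (E_x - E_0)
    D' + (E_x - E_y - D) F_y + D (F_y - F_0). Each of the four terms is bounded by L^2 A e, hence
    the constant 4 L^2. *)
Lemma nice_mult E E0 D F F0 D' : nice d E E0 D -> nice d F F0 D' ->
  nice d (fun x t u => E x t u * F x t u)%C (fun t u => E0 t u * F0 t u)%C
    (fun x t u => E0 t u * D' x t u + D x t u * F0 t u)%C.
Proof.
  intros HE HF. destruct (nice_common _ _ _ _ _ _ HE HF)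
    as [L [r [HL [Hr [[H0 [H1 [H2 [H3 [H4 H5]]]]] [G0 [G1 [G2 [G3 [G4 G5]]]]]]]]]].
  exists (4 * (L * L)), r. split; [ nra | ]. split; [ lra | ].
  assert (HLL : 0 <= L * L) by nra.
  repeat split.
  - eapply wiener_ext; [ apply (wiener_mult d Hd _ _ _ _ H0 G0) | reflexivity | lra ].
  - intros x A Hx. pose proof (bnd_nonneg x A Hx).
    eapply wiener_ext; [ apply (wiener_add d _ _ _ _ (wiener_mult d Hd _ _ _ _ H0 (G1 x A Hx))
      (wiener_mult d Hd _ _ _ _ (H1 x A Hx) G0)) | reflexivity | nra ].
  - intros x A HA Hx.
    eapply wiener_ext; [ apply (wiener_mult d Hd _ _ _ _ (H2 x A HA Hx) (G2 x A HA Hx)) | reflexivity | lra ].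
  - intros x A HA Hx. pose proof (bnd_nonneg x A Hx).
    eapply wiener_ext; [ apply (wiener_add d _ _ _ _ (wiener_mult d Hd _ _ _ _ (H3 x A HA Hx) (G2 x A HA Hx))
      (wiener_mult d Hd _ _ _ _ H0 (G3 x A HA Hx))) | | nra ].
    intros; simpl; ring.
  - intros x y A e HA Hx Hy Hxy. pose proof (bnd_nonneg _ e Hxy).
    eapply wiener_ext; [ apply (wiener_add d _ _ _ _
      (wiener_mult d Hd _ _ _ _ (H2 x A HA Hx) (G4 x y A e HA Hx Hy Hxy))
      (wiener_mult d Hd _ _ _ _ (H4 x y A e HA Hx Hy Hxy) (G2 y A HA Hy))) | | nra ].
    intros; simpl; ring.
  - intros x y A e HA Hx Hy Hxy. pose proof (bnd_nonneg _ e Hxy). pose proof (bnd_nonneg x A Hx).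
    eapply wiener_ext; [ apply (wiener_add d _ _ _ _
      (wiener_add d _ _ _ _
        (wiener_mult d Hd _ _ _ _ (H2 x A HA Hx) (G5 x y A e HA Hx Hy Hxy))
        (wiener_mult d Hd _ _ _ _ (H3 x A HA Hx) (G1 _ e Hxy)))
      (wiener_add d _ _ _ _
        (wiener_mult d Hd _ _ _ _ (H5 x y A e HA Hx Hy Hxy) (G2 y A HA Hy))
        (wiener_mult d Hd _ _ _ _ (H1 _ e Hxy) (G3 y A HA Hy)))) | | ].
    + intros; simpl; ring.
    + right. ring.
Qed.

(** E_x = E_0 (1 - V) with V = - U_0 (E_x - E_0), of norm at most 1/2 on a small ball; the Neumann
    series then costs a factor 2. The use of K + 1 keeps the radius well defined when the bound K is
    0. *)
Lemma nice_inv_aux E E0 D U0 K : nice d E E0 D -> wiener d U0 K ->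
  (forall t u, (E0 t u * U0 t u)%C = 1) ->
  exists r, 0 < r /\ forall x A, A <= r -> bnd d x A ->
    wiener d (fun t u => / E x t u)%C (2 * K) /\ forall t u, E x t u <> 0.
Proof.
  intros [L [r [HL [Hr [H0 [H1 [H2 [H3 [H4 H5]]]]]]]]] HU HE.
  pose proof (wiener_nonneg d Hd _ _ HU) as HK.
  exists (Rmin r (/ (2 * (K + 1) * L))).
  assert (Hp : 0 < / (2 * (K + 1) * L)) by (apply Rinv_0_lt_compat; nra).
  split; [ apply Rmin_pos; auto | ].
  intros x A HA Hx. pose proof (Rmin_l r (/ (2 * (K + 1) * L))). pose proof (Rmin_r r (/ (2 * (K + 1) * L))).
  pose proof (bnd_nonneg x A Hx) as HA0.
  set (V := fun t u => (- (U0 t u * (E x t u - E0 t u)))%C).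
  assert (HV : wiener d V (/ 2)).
  { eapply wiener_weaken; [ apply wiener_opp; apply (wiener_mult d Hd _ _ _ _ HU (H3 x A ltac:(lra) Hx)) | ].
    assert (HA' : A <= / (2 * (K + 1) * L)) by lra.
    apply (Rmult_le_compat_l ((K + 1) * L)) in HA'; [ | nra ].
    replace ((K + 1) * L * / (2 * (K + 1) * L)) with (/ 2) in HA' by (field; split; lra). nra. }
  assert (HV1 : forall t u, (1 - V t u)%C <> 0).
  { intros t u. apply one_minus_neq_0. pose proof (wiener_bound d Hd _ _ HV t u). lra. }
  assert (HE0 : forall t u, E0 t u <> 0).
  { intros t u Hz. specialize (HE t u). rewrite Hz, Cmult_0_l in HE.
    apply (f_equal fst) in HE. simpl in HE. lra. }
  assert (HEx : forall t u, E x t u = (E0 t u * (1 - V t u))%C).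
  { intros t u. unfold V. replace (E0 t u * (1 - - (U0 t u * (E x t u - E0 t u))))%C with
      (E0 t u + (E0 t u * U0 t u) * (E x t u - E0 t u))%C by ring. rewrite HE. ring. }
  assert (HU0 : forall t u, U0 t u = (/ E0 t u)%C).
  { intros t u. replace (U0 t u) with (/ E0 t u * (E0 t u * U0 t u))%C by (field; auto).
    rewrite HE. ring. }
  split.
  - eapply wiener_ext; [ apply (wiener_mult d Hd _ _ _ _ HU (wiener_inv_one_minus d Hd _ _ HV ltac:(lra))) | | ].
    + intros t u. cbv beta. rewrite HEx, HU0. field. auto.
    + right. field.
  - intros t u. rewrite HEx. apply Cmult_neq_0; auto.
Qed.

(** With D taken at x - y, the remainder is - (E_x - E_y - D) / (E_x E_y) - (1 / (E_x E_y) - U_0^2)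
    D, and the bracket 1 / (E_x E_y) - U_0^2 = (1/E_x - U_0) / E_y + U_0 (1/E_y - U_0) is of size
    A. *)
Lemma nice_inv E E0 D U0 K : nice d E E0 D -> wiener d U0 K ->
  (forall t u, (E0 t u * U0 t u)%C = 1) ->
  nice d (fun x t u => / E x t u)%C U0 (fun x t u => - (U0 t u * U0 t u * D x t u))%C.
Proof.
  intros HN HU HE. destruct (nice_inv_aux _ _ _ _ _ HN HU HE) as [r1 [Hr1 HI]].
  assert (HU0 : forall t u, U0 t u = (/ E0 t u)%C /\ E0 t u <> 0).
  { intros t u. assert (Hz : E0 t u <> 0).
    { intros Hz. specialize (HE t u). rewrite Hz, Cmult_0_l in HE.
      apply (f_equal fst) in HE. simpl in HE. lra. }
    split; auto. replace (U0 t u) with (/ E0 t u * (E0 t u * U0 t u))%C by (field; auto).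
    rewrite HE. ring. }
  destruct HN as [L [r [HL [Hr [H0 [H1 [H2 [H3 [H4 H5]]]]]]]]].
  pose proof (wiener_nonneg d Hd _ _ HU) as HK.
  set (Q := 2 * K + 1). assert (HQ : 1 <= Q) by (unfold Q; lra).
  assert (HUQ : wiener d U0 Q) by (eapply wiener_weaken; eauto; unfold Q; lra).
  set (r2 := Rmin r r1). assert (Hr2 : 0 < r2) by (apply Rmin_pos; auto).
  pose proof (Rmin_l r r1) as Hra. pose proof (Rmin_r r r1) as Hrb. fold r2 in Hra, Hrb.
  assert (HIQ : forall x A, A <= r2 -> bnd d x A -> wiener d (fun t u => / E x t u)%C Q).
  { intros x A HA Hx. eapply wiener_weaken; [ apply (HI x A) | ]; auto; unfold Q; lra. }
  assert (Hnz : forall x A, A <= r2 -> bnd d x A -> forall t u, E x t u <> 0).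
  { intros x A HA Hx. apply (HI x A); auto. lra. }
  set (P := Q * Q * L). assert (HP : 0 <= P) by (unfold P; repeat apply Rmult_le_pos; lra).
  clearbody Q r2. clear HE.
  assert (HQ2 : 1 <= Q * (2 * L + 1)).
  { rewrite <- (Rmult_1_l 1). apply Rmult_le_compat; lra. }
  assert (HQL1 : P <= P * (Q * (2 * L + 1))).
  { rewrite <- (Rmult_1_r P) at 1. apply Rmult_le_compat_l; lra. }
  set (T := Q + P * (Q * (2 * L + 1))). assert (HT : Q <= T /\ P <= T) by (unfold T; split; lra).
  assert (B4 : forall x A, A <= r2 -> bnd d x A ->
    wiener d (fun t u => / E x t u - U0 t u)%C (P * A)).
  { intros x A HA Hx.
    eapply wiener_ext; [ apply wiener_opp; apply (wiener_mult d Hd _ _ _ _ (wiener_mult d Hd _ _ _ _ (HIQ x A HA Hx) HUQ) (H3 x A ltac:(lra) Hx)) | | right; unfold P; ring ].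
    intros t u. cbv beta. destruct (HU0 t u) as [-> Hz]. field. split; auto. apply (Hnz x A); auto. }
  exists T, r2. split; [ lra | ]. split; auto.
  repeat split.
  - eapply wiener_weaken; eauto. lra.
  - intros x A Hx. pose proof (bnd_nonneg x A Hx).
    eapply wiener_weaken; [ apply wiener_opp; apply (wiener_mult d Hd _ _ _ _ (wiener_mult d Hd _ _ _ _ HUQ HUQ) (H1 x A Hx)) | ].
    replace (Q * Q * (L * A)) with (P * A) by (unfold P; ring). apply Rmult_le_compat_r; lra.
  - intros x A HA Hx. eapply wiener_weaken; [ apply (HIQ x A) | ]; auto; lra.
  - intros x A HA Hx. pose proof (bnd_nonneg x A Hx).
    eapply wiener_weaken; [ apply (B4 x A) | ]; auto. apply Rmult_le_compat_r; lra.
  - intros x y A e HA Hx Hy Hxy. pose proof (bnd_nonneg _ e Hxy).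
    eapply wiener_ext; [ apply wiener_opp; apply (wiener_mult d Hd _ _ _ _
       (wiener_mult d Hd _ _ _ _ (HIQ x A HA Hx) (HIQ y A HA Hy)) (H4 x y A e ltac:(lra) Hx Hy Hxy)) | | ].
    + intros t u. cbv beta. field. split; [ apply (Hnz y A) | apply (Hnz x A) ]; auto.
    + replace (Q * Q * (L * e)) with (P * e) by (unfold P; ring). apply Rmult_le_compat_r; lra.
  - intros x y A e HA Hx Hy Hxy. pose proof (bnd_nonneg _ e Hxy). pose proof (bnd_nonneg x A Hx).
    eapply wiener_ext; [ apply (wiener_sub d _ _ _ _
       (wiener_opp d _ _ (wiener_mult d Hd _ _ _ _
         (wiener_mult d Hd _ _ _ _ (HIQ x A HA Hx) (HIQ y A HA Hy)) (H5 x y A e ltac:(lra) Hx Hy Hxy)))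
       (wiener_mult d Hd _ _ _ _
         (wiener_add d _ _ _ _
           (wiener_mult d Hd _ _ _ _ (B4 x A HA Hx) (HIQ y A HA Hy))
           (wiener_mult d Hd _ _ _ _ HUQ (B4 y A HA Hy)))
         (H1 _ e Hxy))) | | ].
    + intros t u. cbv beta. field. split; [ apply (Hnz y A) | apply (Hnz x A) ]; auto.
    + replace (Q * Q * (L * A * e) + (P * A * Q + Q * (P * A)) * (L * e))
        with ((P + P * (Q * (2 * L))) * A * e) by (unfold P; ring).
      apply Rmult_le_compat_r; auto. apply Rmult_le_compat_r; auto. unfold T.
      replace (P * (Q * (2 * L + 1))) with (P * (Q * (2 * L)) + P * Q) by ring.
      assert (P * 1 <= P * Q) by (apply Rmult_le_compat_l; lra). lra.
Qed.

Lemma nice_avg E E0 D : nice d E E0 D ->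
  nice d (fun x => avg (E x)) (avg E0) (fun x => avg (D x)).
Proof.
  intros [L [r [HL [Hr [H0 [H1 [H2 [H3 [H4 H5]]]]]]]]].
  exists L, r. split; auto. split; auto.
  assert (Ci : forall F A t, wiener d F A -> cint (F t)) by (intros F A t HF; exact (wiener_cint d Hd F A t HF)).
  assert (W : forall F A, wiener d F A -> wiener d (avg F) A) by (intros F A HF; apply wiener_avg; auto).
  split; [ apply W, H0 | ]. split; [ intros; apply W, H1; auto | ].
  split; [ intros x A HA Hx; apply W, (H2 x A); auto | ]. split; [ | split ].
  - intros x A HA Hx. apply (wiener_ext d _ _ _ _ (W _ _ (H3 x A HA Hx))); [ | apply Rle_refl ].
    intros t u. exact (cavg_sub (E x t) (E0 t) (Ci _ _ t (H2 x A HA Hx)) (Ci _ _ t H0)).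
  - intros x y A e HA Hx Hy Hxy.
    apply (wiener_ext d _ _ _ _ (W _ _ (H4 x y A e HA Hx Hy Hxy))); [ | apply Rle_refl ].
    intros t u. exact (cavg_sub (E x t) (E y t) (Ci _ _ t (H2 x A HA Hx)) (Ci _ _ t (H2 y A HA Hy))).
  - intros x y A e HA Hx Hy Hxy.
    apply (wiener_ext d _ _ _ _ (W _ _ (H5 x y A e HA Hx Hy Hxy))); [ | apply Rle_refl ].
    intros t u. unfold avg.
    rewrite <- (cavg_sub (E x t) (E y t) (Ci _ _ t (H2 x A HA Hx)) (Ci _ _ t (H2 y A HA Hy))).
    exact (cavg_sub (fun u => E x t u - E y t u)%C (D (sub x y) t)
      (Ci _ _ t (H4 x y A e HA Hx Hy Hxy)) (Ci _ _ t (H1 _ e Hxy))).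
Qed.

Definition lin (e : nat -> tfun) (j : bool) (x : seqs) : tfun :=
  fun t u => Cser (fun n => x j n * e n t u)%C.

Lemma lin_Csum (e : nat -> tfun) (j : bool) (K A : R) (x : seqs) : 0 <= K ->
  (forall n, wiener d (e n) (K * kappa d n)) -> bnd d x A ->
  forall t u, Csum (fun n => x j n * e n t u)%C (lin e j x t u).
Proof.
  intros HK He Hx t u.
  apply (Csum_Cser _ (fun n => K * (kappa d n * Rabs (x j n))) (K * A)).
  - intros n. rewrite Cmod_mult, Cmod_R. pose proof (wiener_bound d Hd _ _ (He n) t u).
    pose proof (Rabs_pos (x j n)). nra.
  - apply sum_le_scal; auto. apply bnd_component; auto.
Qed.

Lemma lin_wiener (e : nat -> tfun) (j : bool) (K A : R) (x : seqs) : 0 <= K ->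
  (forall n, wiener d (e n) (K * kappa d n)) -> bnd d x A -> wiener d (lin e j x) (K * A).
Proof.
  intros HK He Hx.
  apply wiener_series with (fun n t u => x j n * e n t u)%C (fun n => K * (kappa d n * Rabs (x j n))); auto.
  - intros n. eapply wiener_weaken; [ apply wiener_scal; apply He | right; ring ].
  - apply sum_le_scal; auto. apply bnd_component; auto.
  - apply (lin_Csum e j K A); auto.
Qed.

Lemma nice_lin (e : nat -> tfun) (j : bool) (K : R) : 0 <= K ->
  (forall n, wiener d (e n) (K * kappa d n)) ->
  nice d (lin e j) (fun _ _ => RtoC 0) (lin e j).
Proof.
  intros HK He. apply nice_linear with K; auto.
  - intros x A. apply lin_wiener; auto.
  - intros x y A B Hx Hy t u. symmetry. apply Cser_unique.
    replace (lin e j x t u - lin e j y t u)%C with (lin e j x t u + - (1) * lin e j y t u)%C by ring.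
    eapply Csum_ext; [ | apply (Csum_plus _ _ _ _ (lin_Csum e j K A x HK He Hx t u)
      (Csum_scal (- (1))%C _ _ (lin_Csum e j K B y HK He Hy t u))) ].
    intros n. cbv beta. unfold sub. rewrite RtoC_minus. ring.
Qed.

End Nice.

Definition e (m : Z) (s : R) : C := cis (IZR m * s).

Lemma e_add (m k : Z) (s : R) : (e m s * e k s)%C = e (m + k) s.
Proof. unfold e. rewrite plus_IZR, Rmult_plus_distr_r, cis_plus. reflexivity. Qed.

Lemma e_0 (s : R) : e 0 s = 1.
Proof. unfold e. rewrite Rmult_0_l. apply cis_0. Qed.

Lemma e_opp (m : Z) (s : R) : e m (- s) = e (- m) s.
Proof. unfold e. rewrite opp_IZR. f_equal. ring. Qed.

Lemma e_neq_0 (m : Z) (s : R) : e m s <> 0.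
Proof. apply cis_neq_0. Qed.

Lemma e_inv (m : Z) (s : R) : e (- m) s = (/ e m s)%C.
Proof.
  unfold e. rewrite opp_IZR. replace (- IZR m * s) with (- (IZR m * s)) by ring. apply cis_opp_inv.
Qed.

Lemma Cmod_e (m : Z) (s : R) : Cmod (e m s) = 1.
Proof. apply Cmod_cis. Qed.

Lemma e_1 (s : R) : e 1 s = cis s.
Proof. unfold e. rewrite Rmult_1_l. reflexivity. Qed.

Lemma e_pow (m : Z) (n : nat) (s : R) : (e m s ^ n)%C = e (m * Z.of_nat n) s.
Proof.
  unfold e. rewrite <- cis_INR, mult_IZR, <- INR_IZR_INZ. f_equal. ring.
Qed.

(** * Averages of geometric kernels *)

Lemma cint_mult_e (m : Z) (f : R -> C) (L B : R) :
  (forall u v, Cmod (f u - f v) <= L * Rabs (u - v)) -> (forall u, Cmod (f u) <= B) ->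
  cint (fun u => e m u * f u)%C.
Proof.
  intros HL HB. apply (cint_lipschitz _ (L + Rabs (IZR m) * B)). intros u v.
  replace (e m u * f u - e m v * f v)%C with (e m u * (f u - f v) + (e m u - e m v) * f v)%C by ring.
  eapply Rle_trans; [ apply Cmod_triangle | ]. rewrite !Cmod_mult, Cmod_e.
  assert (H : Cmod (e m u - e m v) <= Rabs (IZR m) * Rabs (u - v)).
  { rewrite <- Rabs_mult, Rmult_minus_distr_l. apply cis_diff_le. }
  specialize (HL u v). specialize (HB v). pose proof (Cmod_ge_0 (f v)).
  pose proof (Cmod_ge_0 (e m u - e m v)). pose proof (Rabs_pos (IZR m)). pose proof (Rabs_pos (u - v)).
  rewrite Rmult_plus_distr_r, Rmult_1_l. apply Rplus_le_compat; auto.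
  replace (Rabs (IZR m) * B * Rabs (u - v)) with (Rabs (IZR m) * Rabs (u - v) * B) by ring.
  apply Rmult_le_compat; auto.
Qed.

Section Geometric.
Context (z : C) (Hz : Cmod z < 1) (s : Z) (Hs : (s = 1 \/ s = -1)%Z).

Lemma geom_lt_1 (u : R) : Cmod (z * e s u) < 1.
Proof. rewrite Cmod_mult, Cmod_e. lra. Qed.

Lemma geom_neq_0 (u : R) : (1 - z * e s u)%C <> 0.
Proof. apply one_minus_neq_0, geom_lt_1. Qed.

Lemma geom_inv_bound (u : R) : Cmod (/ (1 - z * e s u)) <= / (1 - Cmod z).
Proof.
  rewrite Cmod_inv by apply geom_neq_0. apply Rinv_le_contravar; [ lra | ].
  pose proof (Cmod_one_minus (z * e s u)) as H. rewrite Cmod_mult, Cmod_e in H. lra.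
Qed.

Lemma geom_inv_lipschitz (u v : R) :
  Cmod (/ (1 - z * e s u) - / (1 - z * e s v)) <= / (1 - Cmod z) * / (1 - Cmod z) * Rabs (u - v).
Proof.
  replace (/ (1 - z * e s u) - / (1 - z * e s v))%C with
    (/ (1 - z * e s u) * / (1 - z * e s v) * (z * (e s u - e s v)))%C
    by (field; split; apply geom_neq_0).
  rewrite !Cmod_mult. pose proof (geom_inv_bound u). pose proof (geom_inv_bound v).
  pose proof (Cmod_ge_0 z). pose proof (Cmod_ge_0 (e s u - e s v)).
  assert (H3 : Cmod (e s u - e s v) <= Rabs (u - v)).
  { replace (Rabs (u - v)) with (Rabs (IZR s * u - IZR s * v)); [ apply cis_diff_le | ].
    rewrite <- Rmult_minus_distr_l, Rabs_mult.
    destruct Hs as [-> | ->]; rewrite <- abs_IZR; simpl; ring. }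
  apply Rmult_le_compat; try apply Rmult_le_pos; try apply Cmod_ge_0.
  - apply Rmult_le_compat; auto; apply Cmod_ge_0.
  - rewrite <- (Rmult_1_l (Rabs _)). apply Rmult_le_compat; auto. lra.
Qed.

Lemma cint_geom (m : Z) : cint (fun u => e m u * / (1 - z * e s u))%C.
Proof. eapply cint_mult_e; [ apply geom_inv_lipschitz | apply geom_inv_bound ]. Qed.

Lemma cint_geom2 (m : Z) : cint (fun u => e m u * (/ ((1 - z * e s u) * (1 - z * e s u))))%C.
Proof.
  set (K := / (1 - Cmod z)).
  eapply (cint_mult_e m _ (2 * K * K * K) (K * K)).
  - intros u v.
    replace (/ ((1 - z * e s u) * (1 - z * e s u)) - / ((1 - z * e s v) * (1 - z * e s v)))%C with
     ((/ (1 - z * e s u) - / (1 - z * e s v)) * (/ (1 - z * e s u) + / (1 - z * e s v)))%C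
     by (field; split; apply geom_neq_0).
    rewrite Cmod_mult. pose proof (geom_inv_bound u). pose proof (geom_inv_bound v).
    pose proof (Cmod_triangle (/ (1 - z * e s u)) (/ (1 - z * e s v))).
    replace (2 * K * K * K * Rabs (u - v)) with (K * K * Rabs (u - v) * (2 * K)) by ring.
    apply Rmult_le_compat; try apply Cmod_ge_0; [ apply geom_inv_lipschitz | fold K in H, H0; lra ].
  - intros u. pose proof (geom_neq_0 u) as Hn.
    replace (/ ((1 - z * e s u) * (1 - z * e s u)))%C with (/ (1 - z * e s u) * / (1 - z * e s u))%C by (field; auto).
    rewrite Cmod_mult.
    pose proof (geom_inv_bound u). apply Rmult_le_compat; auto; apply Cmod_ge_0.
Qed.

Lemma geom_term (m : Z) (n : nat) (u : R) :
  (e m u * (z * e s u) ^ n)%C = (z ^ n * e (m + s * Z.of_nat n) u)%C.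
Proof. rewrite Cpow_mult_l, e_pow, <- e_add. ring. Qed.

Lemma cavg_e (m : Z) : cavg (e m) = if Z.eq_dec m 0 then 1 else 0.
Proof.
  rewrite (cavg_ext _ (fun u => cis (0 + IZR m * u))).
  - rewrite cavg_cis, cis_0. reflexivity.
  - intros u. unfold e. f_equal. ring.
Qed.

Lemma cint_e (m : Z) : cint (e m).
Proof.
  replace (e m) with (fun u => cis (0 + IZR m * u)); [ apply cint_cis | ].
  apply functional_extensionality. intros u. unfold e. f_equal. ring.
Qed.

Lemma Csum_cavg_geom (m : Z) :
  Csum (fun n => z ^ n * (if Z.eq_dec (m + s * Z.of_nat n) 0 then 1 else 0))%C
    (cavg (fun u => e m u * / (1 - z * e s u))%C).
Proof.
  eapply Csum_ext; [ | apply (cavg_Csum (fun n u => z ^ n * e (m + s * Z.of_nat n) u)%C _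
    (fun n => Cmod z ^ n) (/ (1 - Cmod z))) ].
  - intros n. cbv beta. rewrite cavg_scal by apply cint_e. rewrite cavg_e. reflexivity.
  - intros n. apply cint_scal, cint_e.
  - apply cint_geom.
  - intros n u. rewrite Cmod_mult, Cmod_e, Cmod_pow. lra.
  - intros N. apply rsum_geom_le. split; [ apply Cmod_ge_0 | auto ].
  - intros u. eapply Csum_ext; [ | apply (Csum_scal (e m u) _ _ (Csum_geom _ (geom_lt_1 u))) ].
    intros n. apply geom_term.
Qed.

Lemma Csum_cavg_geom2 (m : Z) :
  Csum (fun n => INR (S n) * (z ^ n * (if Z.eq_dec (m + s * Z.of_nat n) 0 then 1 else 0)))%C
    (cavg (fun u => e m u * / ((1 - z * e s u) * (1 - z * e s u)))%C).
Proof.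
  pose proof (Cmod_ge_0 z) as H0.
  assert (Hq : 0 <= sqrt (Cmod z) < 1).
  { split; [ apply sqrt_pos | ]. rewrite <- sqrt_1. apply sqrt_lt_1; lra. }
  (* Half of the power |z|^n absorbs the factor n + 1, the other half is a geometric majorant. *)
  destruct (INR_pow_bounded (sqrt (Cmod z)) Hq) as [B [HB1 HB2]].
  eapply Csum_ext; [ | apply (cavg_Csum (fun n u => INR (S n) * (z ^ n * e (m + s * Z.of_nat n) u))%C _
    (fun n => (B + 1) * sqrt (Cmod z) ^ n) ((B + 1) * / (1 - sqrt (Cmod z)))) ].
  - intros n. cbv beta. rewrite cavg_scal by apply cint_scal, cint_e.
    rewrite cavg_scal by apply cint_e. rewrite cavg_e. reflexivity.
  - intros n. apply cint_scal, cint_scal, cint_e.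
  - apply cint_geom2.
  - intros n u. rewrite !Cmod_mult, Cmod_e, Cmod_pow, Cmod_R, (Rabs_pos_eq (INR (S n))) by apply pos_INR.
    rewrite <- (sqrt_sqrt (Cmod z)) at 1 by auto. rewrite Rpow_mult_distr, S_INR.
    specialize (HB2 n). pose proof (pow_le (sqrt (Cmod z)) n (proj1 Hq)) as Hp.
    pose proof (pow_incr (sqrt (Cmod z)) 1 n ltac:(lra)) as Hp1. rewrite pow1 in Hp1.
    set (q := sqrt (Cmod z) ^ n) in *. pose proof (pos_INR n).
    replace ((INR n + 1) * (q * q * 1)) with ((INR n * q + q) * q) by ring.
    apply Rmult_le_compat_r; lra.
  - intros N. rewrite rsum_scal. apply Rmult_le_compat_l; [ lra | ]. apply rsum_geom_le. auto.
  - intros u. eapply Csum_ext; [ | apply (Csum_scal (e m u) _ _ (Csum_geom2 _ (geom_lt_1 u))) ].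
    intros n. cbv beta. rewrite <- geom_term. ring.
Qed.

(** Expanded in powers of z, the integrand has frequencies m + s n; only the one equal to 0 has a
    nonzero average. *)
Lemma cavg_geom_val (m : Z) (k : nat) : (m + s * Z.of_nat k = 0)%Z ->
  cavg (fun u => e m u * / (1 - z * e s u))%C = (z ^ k)%C.
Proof.
  intros H. eapply Csum_unique; [ apply Csum_cavg_geom | ].
  replace (z ^ k)%C with (z ^ k * (if Z.eq_dec (m + s * Z.of_nat k) 0 then 1 else 0))%C.
  - apply (Csum_single (fun n => z ^ n * (if Z.eq_dec (m + s * Z.of_nat n) 0 then 1 else 0))%C).
    intros n Hn. destruct (Z.eq_dec _ _); [ destruct Hs; subst s; lia | ring ].
  - destruct (Z.eq_dec _ _); [ ring | lia ].
Qed.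

Lemma cavg_geom_zero (m : Z) : (forall n, m + s * Z.of_nat n <> 0)%Z ->
  cavg (fun u => e m u * / (1 - z * e s u))%C = 0.
Proof.
  intros H. eapply Csum_unique; [ apply Csum_cavg_geom | ].
  apply Csum_zero. intros n. destruct (Z.eq_dec _ _) as [E|E]; [ destruct (H n E) | ring ].
Qed.

Lemma cavg_geom2_val (m : Z) (k : nat) : (m + s * Z.of_nat k = 0)%Z ->
  cavg (fun u => e m u * / ((1 - z * e s u) * (1 - z * e s u)))%C = (INR (S k) * z ^ k)%C.
Proof.
  intros H. eapply Csum_unique; [ apply Csum_cavg_geom2 | ].
  set (g := fun n => (INR (S n) * (z ^ n * (if Z.eq_dec (m + s * Z.of_nat n) 0 then 1 else 0)))%C).
  replace (INR (S k) * z ^ k)%C with (g k).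
  - apply (Csum_single g). intros n Hn. unfold g.
    destruct (Z.eq_dec _ _); [ destruct Hs; subst s; lia | ring ].
  - unfold g. destruct (Z.eq_dec _ _); [ ring | lia ].
Qed.

Lemma cavg_geom2_zero (m : Z) : (forall n, m + s * Z.of_nat n <> 0)%Z ->
  cavg (fun u => e m u * / ((1 - z * e s u) * (1 - z * e s u)))%C = 0.
Proof.
  intros H. eapply Csum_unique; [ apply Csum_cavg_geom2 | ].
  apply Csum_zero. intros n. destruct (Z.eq_dec _ _) as [E|E]; [ destruct (H n E) | ring ].
Qed.

End Geometric.

(** * Derivatives given by their values on monomials *)

(** For a kernel [c], the entry [c j n] is the derivative in the direction of the n-th coefficient
    of curve j. *)
Definition kernel := bool -> nat -> tfun.

Definition repr (d : R) (D : seqs -> tfun) (c : kernel) : Prop :=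
  (exists K, 0 <= K /\ forall j n, wiener d (c j n) (K * kappa d n)) /\
  forall x A, bnd d x A -> forall t u,
    Csum (fun n => x true n * c true n t u + x false n * c false n t u)%C (D x t u).

(** Differentiability together with the derivative on each coordinate direction, so that the
    calculus rules produce the linearization as explicit functions of the two angles. *)
Definition nicec (d : R) (E : seqs -> tfun) (E0 : tfun) (c : kernel) : Prop :=
  exists D, nice d E E0 D /\ repr d D c.

Section Nicec.
Context (d : R) (Hd : 0 < d).

Lemma kappa_pos (n : nat) : 0 < kappa d n.
Proof. pose proof (kappa_ge_1 d Hd n). lra. Qed.

Lemma repr_dominated (c : kernel) (K A : R) (x : seqs) : 0 <= K ->
  (forall j n, wiener d (c j n) (K * kappa d n)) -> bnd d x A ->
  (forall n t u, Cmod (x true n * c true n t u + x false n * c false n t u) <=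
    K * (kappa d n * (Rabs (x true n) + Rabs (x false n)))) /\
  (forall n, wiener d (fun t u => x true n * c true n t u + x false n * c false n t u)%C
    (K * (kappa d n * (Rabs (x true n) + Rabs (x false n))))) /\
  sum_le (fun n => K * (kappa d n * (Rabs (x true n) + Rabs (x false n)))) (K * A).
Proof.
  intros HK Hc Hx.
  assert (W : forall n, wiener d (fun t u => x true n * c true n t u + x false n * c false n t u)%C
    (K * (kappa d n * (Rabs (x true n) + Rabs (x false n))))).
  { intros n. eapply wiener_weaken; [ apply (wiener_add d _ _ _ _
      (wiener_scal d _ _ (x true n) (Hc true n)) (wiener_scal d _ _ (x false n) (Hc false n))) | ].
    right. ring. }
  split; [ | split; auto ].
  - intros n t u. apply (wiener_bound d Hd _ _ (W n)).
  - apply sum_le_scal; auto.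
Qed.

Lemma nicec_const (C0 : tfun) (K : R) : wiener d C0 K -> nicec d (fun _ => C0) C0 (fun _ _ _ _ => RtoC 0).
Proof.
  intros H. exists (fun _ _ _ => RtoC 0). split; [ eapply nice_const; eauto | ].
  split.
  - exists 0. split; [ lra | ]. intros j n. eapply wiener_weaken; [ apply wiener_zero | lra ].
  - intros x A _ t u. eapply Csum_ext; [ | apply (Csum_single (fun _ => RtoC 0) O); auto ].
    intros n. cbv beta. ring.
Qed.

Lemma nicec_lin (g : nat -> tfun) (j0 : bool) (K : R) : 0 <= K ->
  (forall n, wiener d (g n) (K * kappa d n)) ->
  nicec d (lin g j0) (fun _ _ => RtoC 0) (fun j n t u => if Bool.eqb j j0 then g n t u else 0).
Proof.
  intros HK Hg. exists (lin g j0). split; [ eapply nice_lin; eauto | ]. split.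
  - exists K. split; auto. intros j n. destruct (Bool.eqb j j0).
    + exact (Hg n).
    + eapply wiener_weaken; [ apply wiener_zero | ].
      apply Rmult_le_pos; auto. pose proof (kappa_pos n); lra.
  - intros x A Hx t u. eapply Csum_ext; [ | apply (lin_Csum d Hd g j0 K A x HK Hg Hx t u) ].
    intros n. destruct j0; simpl; ring.
Qed.

Lemma nicec_ext E E' E0 E0' c c' :
  nicec d E E0 c ->
  (exists r, 0 < r /\ forall x A, A <= r -> bnd d x A -> forall t u, E' x t u = E x t u) ->
  (forall t u, E0' t u = E0 t u) ->
  (forall j n t u, c' j n t u = c j n t u) ->
  nicec d E' E0' c'.
Proof.
  intros [D [HD [[K [HK HR]] HS]]] HE HE0 Hc. exists D. split.
  - eapply nice_ext; eauto.
  - split.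
    + exists K. split; auto. intros j n.
      apply (wiener_ext d (c j n) _ (K * kappa d n) (K * kappa d n)); auto using Rle_refl.
    + intros x A Hx t u. eapply Csum_ext; [ | apply (HS x A Hx) ].
      intros n. cbv beta. rewrite !Hc. reflexivity.
Qed.

Lemma nicec_add E E0 c F F0 c' : nicec d E E0 c -> nicec d F F0 c' ->
  nicec d (fun x t u => E x t u + F x t u)%C (fun t u => E0 t u + F0 t u)%C
    (fun j n t u => c j n t u + c' j n t u)%C.
Proof.
  intros [D [HD [[K [HK HR]] HS]]] [D' [HD' [[K' [HK' HR']] HS']]].
  eexists. split; [ apply (nice_add d _ _ _ _ _ _ HD HD') | ]. split.
  - exists (K + K'). split; [ lra | ]. intros j n.
    eapply wiener_weaken; [ apply (wiener_add d _ _ _ _ (HR j n) (HR' j n)) | right; ring ].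
  - intros x A Hx t u. eapply Csum_ext; [ | apply (Csum_plus _ _ _ _ (HS x A Hx t u) (HS' x A Hx t u)) ].
    intros n. cbv beta. ring.
Qed.

Lemma repr_mult_fun (D : seqs -> tfun) (c : kernel) (V : tfun) (B : R) : wiener d V B -> repr d D c ->
  repr d (fun x t u => V t u * D x t u)%C (fun j n t u => V t u * c j n t u)%C.
Proof.
  intros HV [[K [HK HR]] HS]. pose proof (wiener_nonneg d Hd _ _ HV). split.
  - exists (B * K). split; [ apply Rmult_le_pos; auto | ]. intros j n.
    eapply wiener_weaken; [ apply (wiener_mult d Hd _ _ _ _ HV (HR j n)) | right; ring ].
  - intros x A Hx t u. eapply Csum_ext; [ | apply (Csum_scal (V t u) _ _ (HS x A Hx t u)) ].
    intros n. cbv beta. ring.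
Qed.

Lemma nice_wiener_0 E E0 D : nice d E E0 D -> exists K, wiener d E0 K.
Proof. intros [L [r [_ [_ [H _]]]]]. exists L. exact H. Qed.

Lemma repr_add D D' c c' : repr d D c -> repr d D' c' ->
  repr d (fun x t u => D x t u + D' x t u)%C (fun j n t u => c j n t u + c' j n t u)%C.
Proof.
  intros [[K [HK HR]] HS] [[K' [HK' HR']] HS']. split.
  - exists (K + K'). split; [ lra | ]. intros j n.
    eapply wiener_weaken; [ apply (wiener_add d _ _ _ _ (HR j n) (HR' j n)) | right; ring ].
  - intros x A Hx t u. eapply Csum_ext; [ | apply (Csum_plus _ _ _ _ (HS x A Hx t u) (HS' x A Hx t u)) ].
    intros n. cbv beta. ring.
Qed.

Lemma repr_ext D D' c c' : repr d D c -> (forall x t u, D' x t u = D x t u) ->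
  (forall j n t u, c' j n t u = c j n t u) -> repr d D' c'.
Proof.
  intros [[K [HK HR]] HS] HD Hc. split.
  - exists K. split; auto. intros j n.
    apply (wiener_ext d (c j n) _ (K * kappa d n) (K * kappa d n)); auto using Rle_refl.
  - intros x A Hx t u. rewrite HD. eapply Csum_ext; [ | apply (HS x A Hx) ].
    intros n. cbv beta. rewrite !Hc. reflexivity.
Qed.

Lemma nicec_mult E E0 c F F0 c' : nicec d E E0 c -> nicec d F F0 c' ->
  nicec d (fun x t u => E x t u * F x t u)%C (fun t u => E0 t u * F0 t u)%C
    (fun j n t u => E0 t u * c' j n t u + c j n t u * F0 t u)%C.
Proof.
  intros [D [HD HR]] [D' [HD' HR']].
  eexists. split; [ apply (nice_mult d Hd _ _ _ _ _ _ HD HD') | ].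
  destruct (nice_wiener_0 _ _ _ HD) as [K HK]. destruct (nice_wiener_0 _ _ _ HD') as [K' HK'].
  eapply repr_ext; [ apply (repr_add _ _ _ _ (repr_mult_fun _ _ _ _ HK HR') (repr_mult_fun _ _ _ _ HK' HR)) | | ].
  - intros. simpl. ring.
  - intros. simpl. ring.
Qed.

Lemma nicec_scal (a : R) E E0 c : nicec d E E0 c ->
  nicec d (fun x t u => a * E x t u)%C (fun t u => a * E0 t u)%C (fun j n t u => a * c j n t u)%C.
Proof.
  intros H. eapply nicec_ext; [ apply (nicec_mult _ _ _ _ _ _ (nicec_const _ _ (wiener_const d a)) H) | | | ].
  - exists 1. split; [ lra | reflexivity ].
  - reflexivity.
  - intros. simpl. ring.
Qed.

Lemma nicec_opp E E0 c : nicec d E E0 c ->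
  nicec d (fun x t u => - E x t u)%C (fun t u => - E0 t u)%C (fun j n t u => - c j n t u)%C.
Proof.
  assert (E1 : RtoC (-1) = (- (1))%C) by (apply injective_projections; simpl; ring).
  intros H. eapply nicec_ext; [ apply (nicec_scal (-1) _ _ _ H) | | | ].
  - exists 1. split; [ lra | ]. intros. simpl. rewrite E1. ring.
  - intros. simpl. rewrite E1. ring.
  - intros. simpl. rewrite E1. ring.
Qed.

Lemma nicec_sub E E0 c F F0 c' : nicec d E E0 c -> nicec d F F0 c' ->
  nicec d (fun x t u => E x t u - F x t u)%C (fun t u => E0 t u - F0 t u)%C
    (fun j n t u => c j n t u - c' j n t u)%C.
Proof. intros HE HF. apply (nicec_add E E0 c _ _ _ HE (nicec_opp _ _ _ HF)). Qed.

Lemma nicec_inv E E0 c U0 K : nicec d E E0 c -> wiener d U0 K ->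
  (forall t u, (E0 t u * U0 t u)%C = 1) ->
  nicec d (fun x t u => / E x t u)%C U0 (fun j n t u => - (U0 t u * U0 t u * c j n t u))%C.
Proof.
  intros [D [HD HR]] HU HE.
  eexists. split; [ apply (nice_inv d Hd _ _ _ _ _ HD HU HE) | ].
  eapply repr_ext; [ apply (repr_mult_fun _ _ _ _ (wiener_opp d _ _ (wiener_mult d Hd _ _ _ _ HU HU)) HR) | | ].
  - intros. simpl. ring.
  - intros. simpl. ring.
Qed.

Lemma nicec_avg E E0 c : nicec d E E0 c -> nicec d (fun x => avg (E x)) (avg E0) (fun j n => avg (c j n)).
Proof.
  intros [D [HD HR]]. eexists. split; [ apply (nice_avg d Hd _ _ _ HD) | ].
  destruct HR as [[K [HK HR]] HS]. split.
  - exists K. split; auto. intros j n. apply wiener_avg; auto.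
  - intros x A Hx t u. unfold avg.
    destruct (repr_dominated c K A x HK HR Hx) as [B1 [B2 B3]].
    eapply Csum_ext; [ | apply (cavg_Csum (fun n u => x true n * c true n t u + x false n * c false n t u)%C _
      (fun n => K * (kappa d n * (Rabs (x true n) + Rabs (x false n)))) (K * A)) ]; auto.
    + intros n. cbv beta. pose proof (wiener_cint d Hd _ _ t (HR true n)) as C1.
      pose proof (wiener_cint d Hd _ _ t (HR false n)) as C2.
      rewrite (cavg_plus (fun u => x true n * c true n t u)%C) by (apply cint_scal; auto).
      rewrite !cavg_scal by auto. reflexivity.
    + intros n. apply (wiener_cint d Hd _ _ t (B2 n)).
    + destruct HD as [L [r [_ [_ [_ [H1 _]]]]]]. apply (wiener_cint d Hd _ _ t (H1 x A Hx)).
    + apply (HS x A Hx).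
Qed.

(** Concerns integrands before averaging: the identification of contour integrals with averages
    later requires the integrand itself to be in the algebra. *)
Definition integrable (E : seqs -> tfun) : Prop :=
  exists r, 0 < r /\ forall x A, A <= r -> bnd d x A -> exists L, wiener d (E x) L.

Lemma nicec_integrable E E0 c : nicec d E E0 c -> integrable E.
Proof.
  intros [D [[L [r [HL [Hr [_ [_ [H2 _]]]]]]] _]]. exists r. split; auto.
  intros x A HA Hx. exists L. apply (H2 x A HA Hx).
Qed.

Lemma ycoef_le (F : tfun) (A : R) (n : nat) : wiener d F A -> Rabs (ycoef F n) <= A.
Proof.
  intros H. pose proof (ycoef_sum_le d Hd F A H (S n)) as HS.
  eapply Rle_trans; [ | apply HS ]. pose proof (Rabs_pos (ycoef F n)).
  assert (W : forall k, 1 <= 1 + d * INR (S k)).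
  { intros k. pose proof (pos_INR (S k)). assert (0 <= d * INR (S k)) by (apply Rmult_le_pos; lra). lra. }
  apply Rle_trans with ((1 + d * INR (S n)) * Rabs (ycoef F n)).
  - rewrite <- (Rmult_1_l (Rabs _)) at 1. apply Rmult_le_compat_r; auto.
  - apply (rsum_ge_term (fun n => (1 + d * INR (S n)) * Rabs (ycoef F n))); auto.
    intros k. apply Rmult_le_pos; [ specialize (W k); lra | apply Rabs_pos ].
Qed.

Lemma Csum_drop (u : nat -> C) (s : C) (N : nat) :
  Csum u s -> Csum (fun n => u (N + n)%nat) (s - csum u N)%C.
Proof.
  intros H eps He. destruct (H eps He) as [N0 HN]. exists N0. intros n Hn.
  specialize (HN (N + n)%nat ltac:(lia)).
  assert (E : csum u (N + n) = (csum u N + csum (fun k => u (N + k)%nat) n)%C).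
  { clear. induction n as [|n IH]; [ rewrite Nat.add_0_r; simpl; ring | ].
    rewrite Nat.add_succ_r, !csum_S, IH. ring. }
  rewrite E in HN. replace (csum (fun k => u (N + k)%nat) n - (s - csum u N))%C with
    (csum u N + csum (fun k => u (N + k)%nat) n - s)%C by ring. exact HN.
Qed.

Lemma rsum_drop (m : nat -> R) (N n : nat) :
  rsum m (N + n) = rsum m N + rsum (fun k => m (N + k)%nat) n.
Proof.
  induction n as [|n IH]; [ rewrite Nat.add_0_r; simpl; ring | ].
  rewrite Nat.add_succ_r. simpl. rewrite IH. ring.
Qed.

(** Diagonalization: direction n produces only the frequencies n + 1 and - (n + 1), so sine mode m +
    1 sees only the m-th coefficients. Exchanging the coefficient with the infinite sum is justified
    by bounding the coefficient of a tail by the norm of the tail. *)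
Lemma ycoef_repr (D : seqs -> tfun) (c : kernel) (al be : bool -> nat -> R) (x : seqs) (A : R) (m : nat) :
  repr d D c -> bnd d x A ->
  (forall j n t u, c j n t u = al j n * e (Z.of_nat (S n)) t + be j n * e (- Z.of_nat (S n)) t)%C ->
  ycoef (D x) m = x true m * (al true m - be true m) + x false m * (al false m - be false m).
Proof.
  intros [[K [HK HR]] HS] Hx Hc.
  destruct (repr_dominated c K A x HK HR Hx) as [B1 [B2 B3]].
  set (g := fun n t u => (x true n * c true n t u + x false n * c false n t u)%C) in *.
  set (mm := fun n => K * (kappa d n * (Rabs (x true n) + Rabs (x false n)))) in *.
  set (v := x true m * (al true m - be true m) + x false m * (al false m - be false m)).
  assert (Hat : forall (a : R) (i : Z), wiener d (fun t u => a * e i t)%C (Rabs a * weight d i 0)).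
  { intros a i. eapply wiener_ext; [ apply (wiener_atom d a i 0) | | apply Rle_refl ].
    intros t u. cbv beta. unfold e. rewrite Rmult_0_l, Rplus_0_r. reflexivity. }
  assert (Hya : forall (a : R) (i : Z), ycoef (fun t u => a * e i t)%C m =
     a * ((if Z.eq_dec i (Z.of_nat (S m)) then 1 else 0) - (if Z.eq_dec i (- Z.of_nat (S m)) then 1 else 0))).
  { intros a i. rewrite <- (ycoef_atom a i 0). apply ycoef_ext. intros t. unfold e.
    rewrite Rmult_0_l, Rplus_0_r. reflexivity. }
  assert (Hterm : forall n, ycoef (g n) m = if Nat.eq_dec n m then v else 0).
  { intros n.
    rewrite (ycoef_ext _ (fun t u => RtoC (x true n * al true n + x false n * al false n) * e (Z.of_nat (S n)) t
       + RtoC (x true n * be true n + x false n * be false n) * e (- Z.of_nat (S n)) t)%C).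
    - rewrite (ycoef_plus d Hd _ _ _ _ m (Hat _ _) (Hat _ _)), !Hya.
      destruct (Nat.eq_dec n m) as [->|Hn].
      + destruct (Z.eq_dec (Z.of_nat (S m)) (Z.of_nat (S m))), (Z.eq_dec (Z.of_nat (S m)) (- Z.of_nat (S m))),
          (Z.eq_dec (- Z.of_nat (S m)) (Z.of_nat (S m))), (Z.eq_dec (- Z.of_nat (S m)) (- Z.of_nat (S m))); try lia.
        unfold v. ring.
      + destruct (Z.eq_dec (Z.of_nat (S n)) (Z.of_nat (S m))), (Z.eq_dec (Z.of_nat (S n)) (- Z.of_nat (S m))),
          (Z.eq_dec (- Z.of_nat (S n)) (Z.of_nat (S m))), (Z.eq_dec (- Z.of_nat (S n)) (- Z.of_nat (S m))); try lia.
        ring.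
    - intros t. unfold g. rewrite !Hc, !RtoC_plus, !RtoC_mult. ring. }
  assert (Hpart : forall N, (m < N)%nat -> ycoef (fun t u => csum (fun n => g n t u) N) m = v).
  { assert (HP : forall N, ycoef (fun t u => csum (fun n => g n t u) N) m = rsum (fun n => if Nat.eq_dec n m then v else 0) N).
    { induction N as [|N IH].
      - rewrite (ycoef_ext _ (fun t u => RtoC 0 * RtoC 0)%C) by (intros; simpl; ring).
        rewrite (ycoef_scal d Hd (fun _ _ => RtoC 0) 0 0) by apply wiener_zero. simpl. ring.
      - simpl rsum. rewrite <- IH, <- Hterm.
        apply (ycoef_plus d Hd (fun t u => csum (fun n => g n t u) N) (g N) (rsum mm N) (mm N)).
        + exact (wiener_csum d g mm N B2).
        + exact (B2 N). }
    intros N HN. rewrite HP. rewrite (rsum_single _ m).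
    - destruct (le_lt_dec N m); [ lia | ]. destruct (Nat.eq_dec m m); [ auto | lia ].
    - intros n Hn. destruct (Nat.eq_dec n m); [ lia | auto ]. }
  destruct (sum_le_sup mm _ B3) as [S' [HS1 [HS2 HS3]]].
  assert (Hmm : forall n, 0 <= mm n).
  { intros n. eapply Rle_trans; [ apply Cmod_ge_0 | apply (B1 n 0 0) ]. }
  assert (HDx : wiener d (D x) S').
  { apply wiener_series with g mm; auto. intros t u. apply (HS x A Hx). }
  apply Rminus_diag_uniq. apply NNPP. intros Hne. pose proof (Rabs_pos_lt _ Hne) as Hpos.
  destruct (HS3 (Rabs (ycoef (D x) m - v) / 2)) as [N0 HN0]; [ lra | ].
  set (N := (N0 + S m)%nat).
  assert (HN : S' - Rabs (ycoef (D x) m - v) / 2 <= rsum mm N).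
  { eapply Rle_trans; [ apply HN0 | ]. apply rsum_mono; auto. unfold N; lia. }
  assert (Htail : wiener d (fun t u => D x t u - csum (fun n => g n t u) N)%C (S' - rsum mm N)).
  { apply wiener_series with (fun n => g (N + n)%nat) (fun n => mm (N + n)%nat); auto.
    - intros n. exact (B2 (N + n)%nat).
    - intros n. pose proof (HS2 (N + n)%nat) as Hd2. rewrite rsum_drop in Hd2. lra.
    - intros t u. apply (Csum_drop (fun n => g n t u)). apply (HS x A Hx). }
  pose proof (ycoef_le _ _ m Htail) as Hle.
  rewrite (ycoef_sub d Hd (D x) (fun t u => csum (fun n => g n t u) N) S' (rsum mm N)) in Hle; auto.
  - rewrite Hpart in Hle by (unfold N; lia). lra.
  - exact (wiener_csum d g mm N B2).
Qed.

End Nicec.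

(** * The boundary equation as a map between sequence spaces *)

(** On the circle and for real coefficients, the three series are f(w), its conjugate, and w f'(w).
    Giving the conjugate a series of its own replaces conjugation by the change of frequency n ->
    -n. *)
Definition fser (x : seqs) (j : bool) (s : R) : C := Cser (fun n => x j n * e (- Z.of_nat n) s)%C.
Definition fbser (x : seqs) (j : bool) (s : R) : C := Cser (fun n => x j n * e (Z.of_nat n) s)%C.
Definition fsser (x : seqs) (j : bool) (s : R) : C :=
  Cser (fun n => x j n * (RtoC (- INR n) * e (- Z.of_nat n) s))%C.

Section Functional.
Context (d b1 b2 : R).

Definition rad (j : bool) : R := if j then b1 else b2.

Definition phi (x : seqs) (j : bool) (s : R) : C := (rad j * e 1 s + fser x j s)%C.
Definition phib (x : seqs) (j : bool) (s : R) : C := (rad j * e (-1) s + fbser x j s)%C.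
(** [w phi'(w)] at [w = cis s]. *)
Definition phis (x : seqs) (j : bool) (s : R) : C := (rad j * e 1 s + fsser x j s)%C.

(** [(w^n - tau^n) / (w - tau)] *)
Definition dpow (n : nat) : tfun := fun t u =>
  csum (fun k => e (Z.of_nat k) t * e (Z.of_nat (n - 1 - k)) u)%C n.
(** Difference quotients by w - tau: [dfb] that of conj f, and [df] that of f, the latter through
    1/w - 1/tau = - (w - tau) / (w tau). *)
Definition dfb (x : seqs) (j : bool) (t u : R) : C := Cser (fun n => x j n * dpow n t u)%C.
Definition df (x : seqs) (j : bool) (t u : R) : C :=
  Cser (fun n => x j n * - (e (-1) t * e (-1) u * dpow n (- t)%R (- u)%R))%C.

(** [(conj z - conj xi) / (z - xi)] for [z = phi_j(w)], [xi = phi_k(tau)]; when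
    [j = k] the factor [w - tau] is cancelled. *)
Definition ker (x : seqs) (j k : bool) (t u : R) : C :=
  if Bool.eqb j k then
    ((dfb x j t u - rad j * (e (-1) t * e (-1) u)) * / (rad j + df x j t u))%C
  else ((phib x j t - phib x k u) * / (phi x j t - phi x k u))%C.

(** Along a counterclockwise curve d xi = i [phis] du, so that 1/(2 i pi) times the contour integral
    is a plain average over u. In [Jop] the product of [phi] and [phib] is |xi|^2. *)
Definition Iop (x : seqs) (j k : bool) (t : R) : C :=
  cavg (fun u => ker x j k t u * phis x k u)%C.
Definition Jop (x : seqs) (j k : bool) (t : R) : C :=
  cavg (fun u => phi x k u * phib x k u * phis x k u * / (1 - phi x j t * phi x k u))%C.

(** The tangent is i times [phis], and Re (i X) = - Im X: the boundary equation says that [Aop] + 2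
    Omega [Bop] is real. The signs of the four integrals are those of the outer minus the inner
    curve. *)
Definition Aop (x : seqs) (j : bool) : tfun := fun t _ =>
  (phis x j t * (Iop x j true t - Iop x j false t - Jop x j true t + Jop x j false t))%C.
Definition Bop (x : seqs) (j : bool) : tfun := fun t _ => (phis x j t * phib x j t)%C.

Context (Hd : 0 < d) (Hb2 : 0 < b2) (Hb12 : b2 < b1) (Hb1 : b1 < 1)
  (Hq1 : b2 / b1 * (1 + 2 * d) < 1) (Hq2 : b1 * b1 * (1 + 2 * d) < 1).

Lemma wiener_ee (i j : Z) : wiener d (fun t u => e i t * e j u)%C (weight d i j).
Proof.
  eapply wiener_ext; [ apply (wiener_atom d 1 i j) | | rewrite Rabs_R1; lra ].
  intros t u. cbv beta. unfold e. rewrite cis_plus. ring.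
Qed.

Lemma wiener_e_t (i : Z) : wiener d (fun t u => e i t) (weight d i 0).
Proof.
  eapply wiener_ext; [ apply (wiener_ee i 0) | | apply Rle_refl ].
  intros t u. cbv beta. rewrite e_0. ring.
Qed.

Lemma wiener_e_u (i : Z) : wiener d (fun t u => e i u) (weight d 0 i).
Proof.
  eapply wiener_ext; [ apply (wiener_ee 0 i) | | apply Rle_refl ].
  intros t u. cbv beta. rewrite e_0. ring.
Qed.

Lemma weight_le_kappa (i : Z) (n : nat) : (Z.abs i <= Z.of_nat n)%Z ->
  weight d i 0 <= 1 * kappa d n /\ weight d 0 i <= 1 * kappa d n.
Proof.
  intros H. unfold weight, kappa. rewrite Z.abs_0, Z.add_0_r, Z.add_0_l.
  assert (H1 : IZR (Z.abs i) <= INR n) by (rewrite INR_IZR_INZ; apply IZR_le; auto).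
  rewrite S_INR. pose proof (pos_INR n).
  assert (d * IZR (Z.abs i) <= d * (INR n + 1)) by (apply Rmult_le_compat_l; lra).
  assert (0 <= INR n * (1 + d * (INR n + 1))).
  { apply Rmult_le_pos; auto. assert (0 <= d * (INR n + 1)) by (apply Rmult_le_pos; lra). lra. }
  lra.
Qed.

Lemma nicec_e_lin (g : nat -> tfun) (j : bool) :
  (forall n, wiener d (g n) (1 * kappa d n)) ->
  nicec d (lin g j) (fun _ _ => RtoC 0) (fun i n t u => if Bool.eqb i j then g n t u else 0).
Proof. intros H. apply (nicec_lin d Hd g j 1); auto. lra. Qed.

Lemma nicec_affine (C0 : tfun) (K : R) (Lam : seqs -> tfun) (c : kernel) :
  wiener d C0 K -> nicec d Lam (fun _ _ => RtoC 0) c ->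
  nicec d (fun x t u => C0 t u + Lam x t u)%C C0 c.
Proof.
  intros HC HL. eapply nicec_ext; [ apply (nicec_add d _ _ _ _ _ _ (nicec_const d Hd _ _ HC) HL) | | | ].
  - exists 1. split; [ lra | reflexivity ].
  - intros; simpl; ring.
  - intros; simpl; ring.
Qed.

Lemma wiener_rad_t (j : bool) (i : Z) : wiener d (fun t u => rad j * e i t)%C (Rabs (rad j) * weight d i 0).
Proof. apply (wiener_scal d (fun t u => e i t)), wiener_e_t. Qed.

Lemma wiener_rad_u (j : bool) (i : Z) : wiener d (fun t u => rad j * e i u)%C (Rabs (rad j) * weight d 0 i).
Proof. apply (wiener_scal d (fun t u => e i u)), wiener_e_u. Qed.

Lemma nicec_phi_t (j : bool) : nicec d (fun x t u => phi x j t) (fun t u => rad j * e 1 t)%C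
  (fun i n t u => if Bool.eqb i j then e (- Z.of_nat n) t else 0).
Proof.
  apply (nicec_affine _ _ _ _ (wiener_rad_t j 1)), (nicec_e_lin (fun n t u => e (- Z.of_nat n) t)).
  intros n. eapply wiener_weaken; [ apply wiener_e_t | apply weight_le_kappa; lia ].
Qed.

Lemma nicec_phi_u (j : bool) : nicec d (fun x t u => phi x j u) (fun t u => rad j * e 1 u)%C
  (fun i n t u => if Bool.eqb i j then e (- Z.of_nat n) u else 0).
Proof.
  apply (nicec_affine _ _ _ _ (wiener_rad_u j 1)), (nicec_e_lin (fun n t u => e (- Z.of_nat n) u)).
  intros n. eapply wiener_weaken; [ apply wiener_e_u | apply weight_le_kappa; lia ].
Qed.

Lemma nicec_phib_t (j : bool) : nicec d (fun x t u => phib x j t) (fun t u => rad j * e (-1) t)%C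
  (fun i n t u => if Bool.eqb i j then e (Z.of_nat n) t else 0).
Proof.
  apply (nicec_affine _ _ _ _ (wiener_rad_t j (-1))), (nicec_e_lin (fun n t u => e (Z.of_nat n) t)).
  intros n. eapply wiener_weaken; [ apply wiener_e_t | apply weight_le_kappa; lia ].
Qed.

Lemma nicec_phib_u (j : bool) : nicec d (fun x t u => phib x j u) (fun t u => rad j * e (-1) u)%C
  (fun i n t u => if Bool.eqb i j then e (Z.of_nat n) u else 0).
Proof.
  apply (nicec_affine _ _ _ _ (wiener_rad_u j (-1))), (nicec_e_lin (fun n t u => e (Z.of_nat n) u)).
  intros n. eapply wiener_weaken; [ apply wiener_e_u | apply weight_le_kappa; lia ].
Qed.

Lemma INR_weight_le_kappa (n : nat) :
  Rabs (- INR n) * weight d (- Z.of_nat n) 0 <= 1 * kappa d n /\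
  Rabs (- INR n) * weight d 0 (- Z.of_nat n) <= 1 * kappa d n.
Proof.
  unfold weight, kappa. rewrite Z.abs_0, Z.add_0_r, Z.add_0_l.
  rewrite Rabs_Ropp, Rabs_pos_eq, Z.abs_opp, Z.abs_eq, <- INR_IZR_INZ, S_INR by (try apply pos_INR; lia).
  pose proof (pos_INR n).
  assert (INR n * (1 + d * INR n) <= (INR n + 1) * (1 + d * (INR n + 1))).
  { assert (0 <= d * INR n) by (apply Rmult_le_pos; lra). apply Rmult_le_compat; lra. }
  lra.
Qed.

Lemma nicec_phis_t (j : bool) : nicec d (fun x t u => phis x j t) (fun t u => rad j * e 1 t)%C
  (fun i n t u => if Bool.eqb i j then RtoC (- INR n) * e (- Z.of_nat n) t else 0)%C.
Proof.
  apply (nicec_affine _ _ _ _ (wiener_rad_t j 1)),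
    (nicec_e_lin (fun n t u => RtoC (- INR n) * e (- Z.of_nat n) t)%C).
  intros n. eapply wiener_weaken; [ apply (wiener_scal d (fun t u => e (- Z.of_nat n) t)), wiener_e_t | ].
  apply INR_weight_le_kappa.
Qed.

Lemma nicec_phis_u (j : bool) : nicec d (fun x t u => phis x j u) (fun t u => rad j * e 1 u)%C
  (fun i n t u => if Bool.eqb i j then RtoC (- INR n) * e (- Z.of_nat n) u else 0)%C.
Proof.
  apply (nicec_affine _ _ _ _ (wiener_rad_u j 1)),
    (nicec_e_lin (fun n t u => RtoC (- INR n) * e (- Z.of_nat n) u)%C).
  intros n. eapply wiener_weaken; [ apply (wiener_scal d (fun t u => e (- Z.of_nat n) u)), wiener_e_u | ].
  apply INR_weight_le_kappa.
Qed.

Lemma wiener_dpow (n : nat) : wiener d (dpow n) (INR n * (1 + d * INR n)).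
Proof.
  assert (H : forall N, (N <= n)%nat -> wiener d
    (fun t u => csum (fun k => e (Z.of_nat k) t * e (Z.of_nat (n - 1 - k)) u)%C N) (INR N * (1 + d * INR n))).
  { induction N as [|N IH]; intros HN.
    - eapply wiener_weaken; [ apply wiener_zero | simpl; lra ].
    - eapply wiener_ext; [ apply (wiener_add d _ _ _ _ (IH ltac:(lia)) (wiener_ee (Z.of_nat N) (Z.of_nat (n - 1 - N)))) | | ].
      + reflexivity.
      + rewrite S_INR, Rmult_plus_distr_r, Rmult_1_l. apply Rplus_le_compat_l.
        unfold weight. apply Rplus_le_compat_l, Rmult_le_compat_l; [ lra | ].
        rewrite INR_IZR_INZ. apply IZR_le. lia. }
  apply (H n). lia.
Qed.

Lemma INR_le_kappa (n : nat) : INR n * (1 + d * INR n) <= kappa d n.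
Proof.
  unfold kappa. rewrite S_INR. pose proof (pos_INR n).
  assert (0 <= d * INR n) by (apply Rmult_le_pos; lra). apply Rmult_le_compat; lra.
Qed.

Lemma nicec_dfb (j : bool) : nicec d (fun x t u => dfb x j t u) (fun _ _ => RtoC 0)
  (fun i n t u => if Bool.eqb i j then dpow n t u else 0).
Proof.
  apply (nicec_e_lin dpow). intros n. eapply wiener_weaken; [ apply wiener_dpow | ].
  pose proof (INR_le_kappa n). lra.
Qed.

Lemma nicec_df (j : bool) : nicec d (fun x t u => df x j t u) (fun _ _ => RtoC 0)
  (fun i n t u => if Bool.eqb i j then - (e (-1) t * e (-1) u * dpow n (- t)%R (- u)%R) else 0)%C.
Proof.
  apply (nicec_lin d Hd (fun n t u => - (e (-1) t * e (-1) u * dpow n (- t)%R (- u)%R))%C j (weight d (-1) (-1))).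
  - pose proof (weight_ge_1 d Hd (-1) (-1)). lra.
  - intros n. eapply wiener_weaken; [ apply wiener_opp, (wiener_mult d Hd _ _ _ _ (wiener_ee (-1) (-1))
      (wiener_neg d _ _ (wiener_dpow n))) | ].
    apply Rmult_le_compat_l; [ pose proof (weight_ge_1 d Hd (-1) (-1)); lra | apply INR_le_kappa ].
Qed.

Lemma wiener_geom (c : R) (i j : Z) : Rabs c * weight d i j < 1 ->
  wiener d (fun t u => / (1 - c * (e i t * e j u)))%C (/ (1 - Rabs c * weight d i j)).
Proof.
  intros H. apply (wiener_inv_one_minus d Hd (fun t u => c * (e i t * e j u))%C); auto.
  apply (wiener_scal d (fun t u => e i t * e j u)%C), wiener_ee.
Qed.

Lemma rad_bounds (j : bool) : 0 < rad j <= b1.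
Proof. destruct j; simpl; lra. Qed.

Lemma RtoC_neq_0 (r : R) : 0 < r -> RtoC r <> 0.
Proof. intros H E. apply (f_equal fst) in E. simpl in E. lra. Qed.

Lemma ratio_bounds : 0 < b2 / b1 < 1.
Proof.
  split; [ apply Rdiv_lt_0_compat; lra | ].
  apply (Rmult_lt_reg_r b1); [ lra | ]. unfold Rdiv. rewrite Rmult_assoc, Rinv_l; lra.
Qed.

Lemma e_m1 (s : R) : e (-1) s = (/ e 1 s)%C.
Proof. apply (e_inv 1). Qed.

Lemma e_nat (n : nat) (s : R) : e (Z.of_nat n) s = (/ e (- Z.of_nat n) s)%C.
Proof. rewrite e_inv. field. apply e_neq_0. Qed.

End Functional.

(** Linear combinations of the kernels [tau^m / (1 - z tau^s)] ([false]) and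
    [tau^m / (1 - z tau^s)^2] ([true]), whose averages are read off the geometric series. *)
Fixpoint geom_comb (z : C) (s : Z) (l : list (C * bool * Z)) (u : R) : C :=
  match l with
  | nil => 0
  | cons (a, g, m) l' =>
      a * (e m u * (if g then / ((1 - z * e s u) * (1 - z * e s u)) else / (1 - z * e s u)))
      + geom_comb z s l' u
  end%C.

(** Since s is 1 or -1, the frequency m + s k vanishes exactly for k = - s m, which contributes only
    when it is nonnegative. *)
Definition geom_moment (z : C) (s : Z) (g : bool) (m : Z) : C :=
  if Z_le_dec 0 (- (s * m)) then
    let k := Z.to_nat (- (s * m)) in (if g then INR (S k) * z ^ k else z ^ k)%C
  else 0.

Fixpoint geom_comb_moment (z : C) (s : Z) (l : list (C * bool * Z)) : C :=
  match l with
  | nil => 0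
  | cons (a, g, m) l' => a * geom_moment z s g m + geom_comb_moment z s l'
  end%C.

Lemma geom_moment_zero (z : C) (s : Z) (g : bool) (m : Z) : (0 < s * m)%Z -> geom_moment z s g m = 0.
Proof. intros H. unfold geom_moment. destruct (Z_le_dec 0 (- (s * m))); [ lia | reflexivity ]. Qed.

Lemma geom_moment_val (z : C) (s : Z) (g : bool) (m : Z) (k : nat) : (- (s * m) = Z.of_nat k)%Z ->
  geom_moment z s g m = (if g then INR (S k) * z ^ k else z ^ k)%C.
Proof.
  intros H. unfold geom_moment. rewrite H, Nat2Z.id.
  destruct (Z_le_dec 0 (Z.of_nat k)); [ reflexivity | lia ].
Qed.

Lemma cavg_geom_comb (z : C) (s : Z) (l : list (C * bool * Z)) : Cmod z < 1 -> (s = 1 \/ s = -1)%Z ->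
  cint (geom_comb z s l) /\ cavg (geom_comb z s l) = geom_comb_moment z s l.
Proof.
  intros Hz Hs. induction l as [|[[a g] m] l [IH1 IH2]].
  - split.
    + apply (cint_lipschitz _ 0). intros u v. simpl. replace (RtoC 0 - RtoC 0)%C with (RtoC 0) by ring.
      rewrite Cmod_0. lra.
    + rewrite (cavg_ext _ (fun u => 0 * e 0 u)%C) by (intros; simpl; ring).
      rewrite cavg_scal by apply cint_e. simpl. ring.
  - assert (Hg : cint (fun u => e m u * (if g then / ((1 - z * e s u) * (1 - z * e s u)) else / (1 - z * e s u)))%C
      /\ cavg (fun u => e m u * (if g then / ((1 - z * e s u) * (1 - z * e s u)) else / (1 - z * e s u)))%C
        = geom_moment z s g m).
    { unfold geom_moment.
      assert (Hk : forall k : nat, (0 <= - (s * m))%Z -> k = Z.to_nat (- (s * m)) -> (m + s * Z.of_nat k = 0)%Z).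
      { intros k H ->. rewrite Z2Nat.id by auto. destruct Hs as [-> | ->]; lia. }
      assert (Hn : ~ (0 <= - (s * m))%Z -> forall n, (m + s * Z.of_nat n <> 0)%Z).
      { intros H n E. apply H. destruct Hs as [-> | ->]; lia. }
      split.
      { destruct g; [ apply cint_geom2 | apply cint_geom ]; assumption. }
      destruct (Z_le_dec 0 (- (s * m))) as [H|H]; destruct g.
      - apply cavg_geom2_val; auto.
      - apply cavg_geom_val; auto.
      - apply cavg_geom2_zero; auto.
      - apply cavg_geom_zero; auto. }
    destruct Hg as [Hg1 Hg2]. split.
    + apply (cint_plus _ (geom_comb z s l)); auto. apply cint_scal. exact Hg1.
    + change (cavg (fun u => a * (e m u * (if g then / ((1 - z * e s u) * (1 - z * e s u)) else / (1 - z * e s u)))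
        + geom_comb z s l u)%C = (a * geom_moment z s g m + geom_comb_moment z s l)%C).
      rewrite (cavg_plus _ (geom_comb z s l)); [ | apply cint_scal; exact Hg1 | exact IH1 ].
      rewrite cavg_scal, Hg2, IH2 by exact Hg1. reflexivity.
Qed.

(** * Linearization of the integral operators at the annulus *)

Section Derivatives.
Context (d b1 b2 : R) (Hd : 0 < d) (Hb2 : 0 < b2) (Hb12 : b2 < b1) (Hb1 : b1 < 1)
  (Hq1 : b2 / b1 * (1 + 2 * d) < 1) (Hq2 : b1 * b1 * (1 + 2 * d) < 1).

Notation zn n := (Z.of_nat n).

Lemma weight_1_1 : weight d (-1) 1 = 1 + 2 * d /\ weight d 1 (-1) = 1 + 2 * d /\ weight d 1 1 = 1 + 2 * d.
Proof. unfold weight. simpl. repeat split; ring. Qed.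

Lemma Cmod_ratio (t : R) (i : Z) : Cmod (RtoC b2 / b1 * e i t)%C < 1.
Proof.
  rewrite Cmod_mult, Cmod_e, <- RtoC_div, Cmod_R by lra.
  pose proof (ratio_bounds b1 b2 Hb2 Hb12). rewrite Rabs_pos_eq; lra.
Qed.

Lemma den12_neq_0 (t u : R) : (b1 * e 1 t - b2 * e 1 u)%C <> 0.
Proof.
  intros H. pose proof (Cmod_triangle_rev (b1 * e 1 t) (b2 * e 1 u)) as H1.
  rewrite H, Cmod_0, !Cmod_mult, !Cmod_e, !Cmod_R, !Rabs_pos_eq in H1 by lra. lra.
Qed.

(** Here |xi| < |z|: after division by b1 w the kernel is a geometric series in (b2/b1) tau/w, so
    every average is a moment with ratio (b2/b1)/w and s = 1. *)
Lemma nicec_I12 : nicec d (fun x t _ => Iop b1 b2 x true false t)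
  (fun t _ => - (b2 * b2 / b1 * e (-1) t))%C
  (fun j n t _ => if j then (b2 * b2 / (b1 * b1) * (e (-1) t * e (-1) t * e (- zn n) t))%C
                  else (- (RtoC b2 / b1 * e (-1) t) ^ (2 + n))%C) /\
  integrable d (fun x t u => ker b1 b2 x true false t u * phis b1 b2 x false u)%C.
Proof.
  pose proof (ratio_bounds b1 b2 Hb2 Hb12) as Hr. destruct weight_1_1 as [W1 [W2 W3]].
  assert (N1 : RtoC b1 <> 0) by (apply RtoC_neq_0; lra).
  set (U0 := fun t u => (/ b1 * e (-1) t * / (1 - RtoC (b2 / b1) * (e (-1) t * e 1 u)))%C).
  assert (HU : exists K, wiener d U0 K).
  { eexists. apply (wiener_mult d Hd (fun t _ => / b1 * e (-1) t)%C).
    - eapply wiener_ext; [ apply (wiener_scal d _ _ (/ b1) (wiener_e_t d (-1))) | | apply Rle_refl ].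
      intros t u. cbv beta. rewrite RtoC_inv by lra. reflexivity.
    - apply (wiener_geom d Hd). rewrite W1, Rabs_pos_eq by lra. lra. }
  destruct HU as [K HU].
  assert (EU : forall t u, U0 t u = (/ b1 * e (-1) t * / (1 - RtoC b2 / b1 * e (-1) t * e 1 u))%C).
  { intros t u. unfold U0. rewrite RtoC_div, Cmult_assoc by lra. reflexivity. }
  eassert (HN : nicec d (fun x t u => (phib b1 b2 x true t - phib b1 b2 x false u) * / (phi b1 b2 x true t - phi b1 b2 x false u) * phis b1 b2 x false u)%C _ _).
  { eapply (nicec_mult d Hd);
    [ eapply (nicec_mult d Hd);
      [ apply (nicec_sub d Hd); [ apply (nicec_phib_t d b1 b2 Hd true) | apply (nicec_phib_u d b1 b2 Hd false) ]
      | eapply (nicec_inv d Hd);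
        [ apply (nicec_sub d Hd); [ apply (nicec_phi_t d b1 b2 Hd true) | apply (nicec_phi_u d b1 b2 Hd false) ]
        | exact HU | ] ]
    | apply (nicec_phis_u d b1 b2 Hd false) ].
    intros t u. cbv beta. rewrite EU. pose proof (den12_neq_0 t u). simpl rad. rewrite e_m1 in *.
    pose proof (e_neq_0 1 t). field. auto.
  }
  split; [ | exact (nicec_integrable d _ _ _ HN) ].
  eapply nicec_ext; [ apply (nicec_avg d Hd _ _ _ HN) | | | ].
  - exists 1. split; [ lra | ]. intros x A _ _ t u. unfold avg, Iop, ker. simpl. reflexivity.
  - intros t u0. unfold avg. cbv beta.
    rewrite (cavg_ext _ (geom_comb (RtoC b2 / b1 * e (-1) t) 1
      [ (b2 * e (-1) t * e (-1) t, false, 1%Z); (- (b2 * b2 / b1 * e (-1) t), false, 0%Z) ])%C).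
    + rewrite (proj2 (cavg_geom_comb _ 1 _ (Cmod_ratio t (-1)) ltac:(auto))).
      unfold geom_comb_moment, geom_moment. simpl. ring.
    + intros u. cbn [geom_comb]. rewrite EU. pose proof (den12_neq_0 t u). simpl rad. rewrite e_0, !e_m1 in *.
      pose proof (e_neq_0 1 t). pose proof (e_neq_0 1 u). field. auto.
  - intros j n t u0. unfold avg. cbv beta. destruct j; cbn [Bool.eqb].
    (* Direction of an outer coefficient: the denominator produces the two squared kernels, conj z
       the last entry. *)
    + rewrite (cavg_ext _ (geom_comb (RtoC b2 / b1 * e (-1) t) 1
      [ (- (RtoC b2 / b1 * e (-1) t * e (-1) t * e (-1) t * e (- zn n) t), true, 1%Z);
        (RtoC b2 / b1 * (RtoC b2 / b1) * e (-1) t * e (-1) t * e (- zn n) t, true, 0%Z);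
        (RtoC b2 / b1 * e (-1) t * e (zn n) t, false, 1%Z) ])%C).
      * rewrite (proj2 (cavg_geom_comb _ 1 _ (Cmod_ratio t (-1)) ltac:(auto))).
        unfold geom_comb_moment, geom_moment. simpl. field. auto.
      * intros u. cbn [geom_comb]. rewrite EU. pose proof (den12_neq_0 t u). simpl rad.
        rewrite e_0, (e_nat n t), !e_m1 in *.
        pose proof (e_neq_0 1 t). pose proof (e_neq_0 1 u). pose proof (e_neq_0 (- zn n) t). field. auto.
    (* Direction of an inner coefficient, in this order: two terms from [phis], two squared kernels
       from the denominator, one term from conj xi. *)
    + rewrite (cavg_ext _ (geom_comb (RtoC b2 / b1 * e (-1) t) 1
      [ (- (INR n * (e (-1) t * e (-1) t)), false, (- zn n)%Z);
        (INR n * (RtoC b2 / b1 * e (-1) t), false, (- zn n + -1)%Z);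
        (RtoC b2 / b1 * e (-1) t * e (-1) t * e (-1) t, true, (1 + - zn n)%Z);
        (- (RtoC b2 / b1 * (RtoC b2 / b1) * e (-1) t * e (-1) t), true, (- zn n)%Z);
        (- (RtoC b2 / b1 * e (-1) t), false, (zn n + 1)%Z) ])%C).
      * rewrite (proj2 (cavg_geom_comb _ 1 _ (Cmod_ratio t (-1)) ltac:(auto))). cbn [geom_comb_moment].
        rewrite !(geom_moment_val _ _ _ (- zn n) n), (geom_moment_val _ _ _ (- zn n + -1) (S n)),
          (geom_moment_zero _ _ _ (zn n + 1)) by lia.
        (* For n = 0 the exponent 1 - n of the first squared kernel is positive and its moment
           vanishes. *)
        destruct n as [|n].
        -- rewrite geom_moment_zero by lia. simpl. ring.
        -- rewrite (geom_moment_val _ _ _ _ n) by lia. rewrite (S_INR (S n)), RtoC_plus.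
           change (2 + S n)%nat with (S (S (S n))). rewrite !Cpow_S. generalize (INR (S n)). intros a.
           generalize ((RtoC b2 / b1 * e (-1) t) ^ n)%C. intros p. field. auto.
      * intros u. cbn [geom_comb]. rewrite EU. pose proof (den12_neq_0 t u). simpl rad.
        rewrite <- !e_add, RtoC_opp, (e_nat n u), !e_m1 in *.
        pose proof (e_neq_0 1 t). pose proof (e_neq_0 1 u). pose proof (e_neq_0 (- zn n) u). field. auto.
Qed.

(** Now |z| < |xi| and the expansion runs in powers of (b2/b1) w/tau, with s = -1: only nonnegative
    exponents of tau have a nonzero moment, hence the short formulas. *)
Lemma nicec_I21 : nicec d (fun x t _ => Iop b1 b2 x false true t)
  (fun t _ => - (b2 * e (-1) t))%C
  (fun j n t _ => if j then ((RtoC b2 / b1 * e 1 t) ^ n)%C else (- e (zn n) t)%C) /\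
  integrable d (fun x t u => ker b1 b2 x false true t u * phis b1 b2 x true u)%C.
Proof.
  pose proof (ratio_bounds b1 b2 Hb2 Hb12) as Hr. destruct weight_1_1 as [W1 [W2 W3]].
  assert (N1 : RtoC b1 <> 0) by (apply RtoC_neq_0; lra).
  set (U0 := fun t u => (- (/ b1 * e (-1) u * / (1 - RtoC (b2 / b1) * (e 1 t * e (-1) u))))%C).
  assert (HU : exists K, wiener d U0 K).
  { eexists. apply wiener_opp, (wiener_mult d Hd (fun _ u => / b1 * e (-1) u)%C).
    - eapply wiener_ext; [ apply (wiener_scal d _ _ (/ b1) (wiener_e_u d (-1))) | | apply Rle_refl ].
      intros t u. cbv beta. rewrite RtoC_inv by lra. reflexivity.
    - apply (wiener_geom d Hd). rewrite W2, Rabs_pos_eq by lra. lra. }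
  destruct HU as [K HU].
  assert (EU : forall t u, U0 t u = (- (/ b1 * e (-1) u * / (1 - RtoC b2 / b1 * e 1 t * e (-1) u)))%C).
  { intros t u. unfold U0. rewrite RtoC_div, Cmult_assoc by lra. reflexivity. }
  assert (DN : forall t u, (b1 * e 1 u - b2 * e 1 t)%C <> 0) by (intros; apply den12_neq_0).
  eassert (HN : nicec d (fun x t u => (phib b1 b2 x false t - phib b1 b2 x true u) * / (phi b1 b2 x false t - phi b1 b2 x true u) * phis b1 b2 x true u)%C _ _).
  { eapply (nicec_mult d Hd);
    [ eapply (nicec_mult d Hd);
      [ apply (nicec_sub d Hd); [ apply (nicec_phib_t d b1 b2 Hd false) | apply (nicec_phib_u d b1 b2 Hd true) ]
      | eapply (nicec_inv d Hd);
        [ apply (nicec_sub d Hd); [ apply (nicec_phi_t d b1 b2 Hd false) | apply (nicec_phi_u d b1 b2 Hd true) ]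
        | exact HU | ] ]
    | apply (nicec_phis_u d b1 b2 Hd true) ].
    intros t u. cbv beta. rewrite EU. pose proof (DN t u). simpl rad. rewrite !e_m1 in *.
    pose proof (e_neq_0 1 u). field. auto.
  }
  split; [ | exact (nicec_integrable d _ _ _ HN) ].
  eapply nicec_ext; [ apply (nicec_avg d Hd _ _ _ HN) | | | ].
  - exists 1. split; [ lra | ]. intros x A _ _ t u. unfold avg, Iop, ker. simpl. reflexivity.
  - intros t u0. unfold avg. cbv beta.
    rewrite (cavg_ext _ (geom_comb (RtoC b2 / b1 * e 1 t) (-1)
      [ (- (b2 * e (-1) t), false, 0%Z); (RtoC b1, false, (-1)%Z) ])%C).
    + rewrite (proj2 (cavg_geom_comb _ (-1) _ (Cmod_ratio t 1) ltac:(auto))).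
      unfold geom_comb_moment, geom_moment. simpl. ring.
    + intros u. cbn [geom_comb]. rewrite EU. pose proof (DN t u). simpl rad. rewrite e_0, !e_m1 in *.
      pose proof (e_neq_0 1 t). pose proof (e_neq_0 1 u). field. auto.
  - intros j n t u0. unfold avg. cbv beta. destruct j; cbn [Bool.eqb].
    + rewrite (cavg_ext _ (geom_comb (RtoC b2 / b1 * e 1 t) (-1)
      [ (INR n * (RtoC b2 / b1 * e (-1) t), false, (- zn n + -1)%Z);
        (- RtoC (INR n), false, (- zn n + -1 + -1)%Z);
        (RtoC b2 / b1 * e (-1) t, true, (- zn n + -1)%Z);
        (- RtoC 1, true, (- zn n + -1 + -1)%Z);
        (RtoC 1, false, zn n) ])%C).
      * rewrite (proj2 (cavg_geom_comb _ (-1) _ (Cmod_ratio t 1) ltac:(auto))). cbn [geom_comb_moment].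
        rewrite (geom_moment_val _ _ _ (zn n) n), !geom_moment_zero by lia. ring.
      * intros u. cbn [geom_comb]. rewrite EU. pose proof (DN t u). simpl rad.
        rewrite <- !e_add, RtoC_opp, (e_nat n u), !e_m1 in *.
        pose proof (e_neq_0 1 t). pose proof (e_neq_0 1 u). pose proof (e_neq_0 (- zn n) u). field. auto.
    + rewrite (cavg_ext _ (geom_comb (RtoC b2 / b1 * e 1 t) (-1)
      [ (- (RtoC b2 / b1 * e (-1) t * e (- zn n) t), true, (-1)%Z);
        (e (- zn n) t, true, (-1 + -1)%Z);
        (- e (zn n) t, false, 0%Z) ])%C).
      * rewrite (proj2 (cavg_geom_comb _ (-1) _ (Cmod_ratio t 1) ltac:(auto))). cbn [geom_comb_moment].
        rewrite (geom_moment_val _ _ _ 0 0), !geom_moment_zero by lia. ring.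
      * intros u. cbn [geom_comb]. rewrite EU. pose proof (DN t u). simpl rad.
        rewrite <- !e_add, e_0, (e_nat n t), !e_m1 in *.
        pose proof (e_neq_0 1 t). pose proof (e_neq_0 1 u). pose proof (e_neq_0 (- zn n) t). field. auto.
Qed.

Lemma Cmod_prod (j k : bool) (t : R) (i : Z) : Cmod (RtoC (rad b1 b2 j) * RtoC (rad b1 b2 k) * e i t)%C < 1.
Proof.
  rewrite !Cmod_mult, Cmod_e, !Cmod_R.
  pose proof (rad_bounds b1 b2 Hb2 Hb12 j). pose proof (rad_bounds b1 b2 Hb2 Hb12 k).
  rewrite !Rabs_pos_eq by lra. nra.
Qed.

(** At the annulus |xi|^2 is constant and the integrand b_k^3 tau / (1 - b_j b_k w tau) has only
    positive frequencies, so it averages to 0. Moving z again produces only positive frequencies;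
    only the coefficients of curve k enter the derivative. *)
Lemma nicec_J (j k : bool) : nicec d (fun x t _ => Jop b1 b2 x j k t)
  (fun _ _ => RtoC 0)
  (fun i n t _ => if Bool.eqb i k then (RtoC (rad b1 b2 k) * RtoC (rad b1 b2 k) *
      (RtoC (rad b1 b2 j) * RtoC (rad b1 b2 k) * e 1 t) ^ n)%C else 0) /\
  integrable d (fun x t u => phi b1 b2 x k u * phib b1 b2 x k u * phis b1 b2 x k u * / (1 - phi b1 b2 x j t * phi b1 b2 x k u))%C.
Proof.
  destruct weight_1_1 as [W1 [W2 W3]].
  pose proof (rad_bounds b1 b2 Hb2 Hb12 j) as Hj. pose proof (rad_bounds b1 b2 Hb2 Hb12 k) as Hk.
  set (bj := rad b1 b2 j) in *. set (bk := rad b1 b2 k) in *.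
  assert (Hjk : 0 < bj * bk <= b1 * b1) by nra.
  set (U0 := fun t u => (/ (1 - RtoC (bj * bk) * (e 1 t * e 1 u)))%C).
  assert (HU : exists K, wiener d U0 K).
  { eexists. apply (wiener_geom d Hd). rewrite W3, Rabs_pos_eq by lra. nra. }
  destruct HU as [K HU].
  assert (EU : forall t u, U0 t u = (/ (1 - RtoC bj * RtoC bk * e 1 t * e 1 u))%C).
  { intros t u. unfold U0. rewrite RtoC_mult, Cmult_assoc. reflexivity. }
  assert (DN : forall t u, (1 - RtoC bj * RtoC bk * e 1 t * e 1 u)%C <> 0).
  { intros. apply geom_neq_0. apply Cmod_prod. }
  eassert (HN : nicec d (fun x t u => phi b1 b2 x k u * phib b1 b2 x k u * phis b1 b2 x k u * / (1 - phi b1 b2 x j t * phi b1 b2 x k u))%C _ _).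
  { eapply (nicec_mult d Hd);
    [ eapply (nicec_mult d Hd); [ eapply (nicec_mult d Hd);
       [ apply (nicec_phi_u d b1 b2 Hd k) | apply (nicec_phib_u d b1 b2 Hd k) ]
      | apply (nicec_phis_u d b1 b2 Hd k) ]
    | eapply (nicec_inv d Hd);
        [ apply (nicec_sub d Hd);
          [ apply (nicec_const d Hd _ _ (wiener_const d 1))
          | apply (nicec_mult d Hd); [ apply (nicec_phi_t d b1 b2 Hd j) | apply (nicec_phi_u d b1 b2 Hd k) ] ]
        | exact HU | ] ].
    intros t u. cbv beta. rewrite EU. pose proof (DN t u). fold bj bk. field.
    intros Hz. apply H. rewrite <- Hz. ring.
  }
  split; [ | exact (nicec_integrable d _ _ _ HN) ].
  eapply nicec_ext; [ apply (nicec_avg d Hd _ _ _ HN) | | | ].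
  - exists 1. split; [ lra | ]. intros x A _ _ t u. unfold avg, Jop. reflexivity.
  - intros t u0. unfold avg. cbv beta. fold bj bk.
    rewrite (cavg_ext _ (geom_comb (RtoC bj * RtoC bk * e 1 t) 1 [ (RtoC bk * bk * bk, false, 1%Z) ])%C).
    + rewrite (proj2 (cavg_geom_comb _ 1 _ (Cmod_prod j k t 1) ltac:(auto))).
      cbn [geom_comb_moment]. rewrite geom_moment_zero by lia. ring.
    + intros u. cbn [geom_comb]. rewrite EU. pose proof (DN t u). rewrite !e_m1 in *.
      pose proof (e_neq_0 1 t). pose proof (e_neq_0 1 u). field. auto.
  - intros i n t u0. unfold avg. cbv beta. fold bj bk.
    set (dk := if Bool.eqb i k then RtoC 1 else RtoC 0).
    set (dj := if Bool.eqb i j then RtoC 1 else RtoC 0).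
    rewrite (cavg_ext _ (geom_comb (RtoC bj * RtoC bk * e 1 t) 1
      [ (dk * (RtoC bk * bk), false, (zn n + 1 + 1)%Z);
        (dk * (RtoC bk * bk) * (1 - RtoC (INR n)), false, (- zn n)%Z);
        (dk * (RtoC bk * bk * bk * bj * e 1 t), true, (1 + - zn n)%Z);
        (dj * (RtoC bk * bk * bk * bk * e (- zn n) t), true, (1 + 1)%Z) ])%C).
    + rewrite (proj2 (cavg_geom_comb _ 1 _ (Cmod_prod j k t 1) ltac:(auto))). cbn [geom_comb_moment].
      fold bj bk.
      rewrite (geom_moment_val _ _ _ (- zn n) n), (geom_moment_zero _ _ _ (zn n + 1 + 1)),
         (geom_moment_zero _ _ _ (1 + 1)) by lia.
      destruct n as [|n].
      * rewrite geom_moment_zero by lia. unfold dk. destruct (Bool.eqb i k); simpl; ring.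
      * rewrite (geom_moment_val _ _ _ _ n) by lia. rewrite Cpow_S.
        unfold dk. destruct (Bool.eqb i k); ring.
    + intros u. cbn [geom_comb]. rewrite EU. pose proof (DN t u).
      replace (if Bool.eqb i k then RtoC (- INR n) * e (- zn n) u else 0)%C
        with (dk * (RtoC (- INR n) * e (- zn n) u))%C by (unfold dk; destruct (Bool.eqb i k); ring).
      replace (if Bool.eqb i k then e (zn n) u else 0)%C
        with (dk * e (zn n) u)%C by (unfold dk; destruct (Bool.eqb i k); ring).
      replace (if Bool.eqb i k then e (- zn n) u else 0)%C
        with (dk * e (- zn n) u)%C by (unfold dk; destruct (Bool.eqb i k); ring).
      replace (if Bool.eqb i j then e (- zn n) t else 0)%C
        with (dj * e (- zn n) t)%C by (unfold dj; destruct (Bool.eqb i j); ring).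
      rewrite <- !e_add, RtoC_opp, (e_nat n u), !e_m1 in *.
      pose proof (e_neq_0 1 t). pose proof (e_neq_0 1 u). pose proof (e_neq_0 (- zn n) u). field. auto.
Qed.

Lemma cavg_const_e (a : C) (m : Z) : cavg (fun u => a * e m u)%C = (a * if Z.eq_dec m 0 then 1 else 0)%C.
Proof. rewrite cavg_scal by apply cint_e. rewrite cavg_e. reflexivity. Qed.

Lemma cavg_csum_zero (a : nat -> C) (m : nat -> Z) (N : nat) : (forall k, (k < N)%nat -> (m k <> 0)%Z) ->
  cint (fun u => csum (fun k => a k * e (m k) u)%C N) /\
  cavg (fun u => csum (fun k => a k * e (m k) u)%C N) = 0.
Proof.
  induction N as [|N IH]; intros H.
  - simpl. rewrite (cavg_ext _ (fun u => 0 * e 0 u)%C) by (intros; ring).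
    rewrite cavg_scal by apply cint_e. split; [ | ring ].
    apply (cint_lipschitz _ 0). intros u v. replace (RtoC 0 - RtoC 0)%C with (RtoC 0) by ring.
    rewrite Cmod_0. lra.
  - destruct IH as [IH1 IH2]; [ intros k Hk; apply H; lia | ].
    assert (HN : cint (fun u => a N * e (m N) u)%C) by (apply cint_scal, cint_e). split.
    + apply (cint_plus (fun u => csum (fun k => a k * e (m k) u)%C N)); auto.
    + simpl. rewrite (cavg_plus (fun u => csum (fun k => a k * e (m k) u)%C N)); auto.
      rewrite IH2, cavg_const_e. destruct (Z.eq_dec (m N) 0) as [E|E]; [ destruct (H N ltac:(lia) E) | ring ].
Qed.

(** At a circle the cancelled kernel is -1/(w tau), with constant denominator b_j. Every term of the
    derivative then has a nonzero frequency in tau, so the self-interaction contributes nothing to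
    first order. *)
Lemma nicec_Ijj (j : bool) : nicec d (fun x t _ => Iop b1 b2 x j j t)
  (fun t _ => - (rad b1 b2 j * e (-1) t))%C (fun _ _ _ _ => RtoC 0) /\
  integrable d (fun x t u => ker b1 b2 x j j t u * phis b1 b2 x j u)%C.
Proof.
  pose proof (rad_bounds b1 b2 Hb2 Hb12 j) as Hj. set (b := rad b1 b2 j) in *.
  assert (NB : RtoC b <> 0) by (apply RtoC_neq_0; lra).
  assert (HE : wiener d (fun t u => - (b * (e (-1) t * e (-1) u)))%C (Rabs b * weight d (-1) (-1))).
  { apply wiener_opp, (wiener_scal d (fun t u => e (-1) t * e (-1) u)%C), wiener_ee. }
  eassert (HN : nicec d (fun x t u => (- (b * (e (-1) t * e (-1) u)) + dfb x j t u) * / (b + df x j t u) * phis b1 b2 x j u)%C _ _).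
  { eapply (nicec_mult d Hd);
    [ eapply (nicec_mult d Hd);
      [ apply (nicec_affine d Hd _ _ _ _ HE (nicec_dfb d Hd j))
      | eapply (nicec_inv d Hd _ _ _ (fun _ _ => RtoC (/ b)));
        [ apply (nicec_affine d Hd _ _ _ _ (wiener_const d b) (nicec_df d Hd j))
        | apply (wiener_const d (/ b)) | ] ]
    | apply (nicec_phis_u d b1 b2 Hd j) ].
    intros t u. cbv beta. rewrite RtoC_inv by lra. field. auto.
  }
  split; [ | destruct (nicec_integrable d _ _ _ HN) as [r [Hr HI]]; exists r; split; auto;
    intros x A HA Hx; destruct (HI x A HA Hx) as [L HL]; exists L;
    apply (wiener_ext d _ _ _ _ HL); [ | apply Rle_refl ];
    intros t u; unfold ker; rewrite Bool.eqb_reflx; fold b; ring ].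
  eapply nicec_ext; [ apply (nicec_avg d Hd _ _ _ HN) | | | ].
  - exists 1. split; [ lra | ]. intros x A _ _ t u. unfold avg, Iop, ker. rewrite Bool.eqb_reflx.
    fold b. apply cavg_ext. intros u0. do 2 f_equal. ring.
  - intros t u0. unfold avg. cbv beta. fold b.
    rewrite (cavg_ext _ (fun u => - (b * e (-1) t) * e 0 u)%C).
    + rewrite cavg_const_e. simpl. ring.
    + intros u. rewrite e_0, !e_m1, RtoC_inv by lra. pose proof (e_neq_0 1 t). pose proof (e_neq_0 1 u). field. auto.
  - intros i n t u0. unfold avg. cbv beta. fold b.
    set (dk := if Bool.eqb i j then RtoC 1 else RtoC 0).
    set (S1 := fun u => csum (fun k => e (zn k) t * e (zn (n - 1 - k) + 1) u)%C n).
    set (S2 := fun u => csum (fun k => e (- zn k) t * e (- zn (n - 1 - k) + -1) u)%C n).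
    assert (H1 : cint S1 /\ cavg S1 = 0) by (apply cavg_csum_zero; intros; lia).
    assert (H2 : cint S2 /\ cavg S2 = 0) by (apply cavg_csum_zero; intros; lia).
    assert (E1 : forall u, (dpow n t u * e 1 u)%C = S1 u).
    { intros u. unfold dpow, S1. rewrite Cmult_comm, <- csum_scal. apply csum_ext. intros k _.
      rewrite <- e_add. ring. }
    assert (E2 : forall u, (dpow n (- t)%R (- u)%R * e (-1) u)%C = S2 u).
    { intros u. unfold dpow, S2. rewrite Cmult_comm, <- csum_scal. apply csum_ext. intros k _.
      rewrite !e_opp, <- e_add. ring. }
    rewrite (cavg_ext _ (fun u => (dk * (INR n * e (-1) t) * e (- zn n + -1) u + dk * S1 u)
       + - (dk * (e (-1) t * e (-1) t)) * S2 u)%C).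
    + destruct H1 as [H1 H1']. destruct H2 as [H2 H2'].
      assert (C0 : cint (fun u => dk * (INR n * e (-1) t) * e (- zn n + -1) u)%C) by apply cint_scal, cint_e.
      assert (C1 : cint (fun u => dk * S1 u)%C) by (apply cint_scal, H1).
      rewrite (cavg_plus (fun u => dk * (INR n * e (-1) t) * e (- zn n + -1) u + dk * S1 u)%C);
        [ | apply (cint_plus _ (fun u => dk * S1 u)%C); assumption | apply cint_scal, H2 ].
      rewrite (cavg_plus _ (fun u => dk * S1 u)%C) by assumption.
      rewrite !cavg_scal, H1', H2', cavg_e by (assumption || apply cint_e).
      destruct (Z.eq_dec (- zn n + -1) 0); [ lia | ring ].
    + intros u. rewrite <- E1, <- E2, RtoC_inv by lra.
      replace (if Bool.eqb i j then RtoC (- INR n) * e (- zn n) u else 0)%C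
        with (dk * (RtoC (- INR n) * e (- zn n) u))%C by (unfold dk; destruct (Bool.eqb i j); ring).
      replace (if Bool.eqb i j then dpow n t u else 0)%C
        with (dk * dpow n t u)%C by (unfold dk; destruct (Bool.eqb i j); ring).
      replace (if Bool.eqb i j then - (e (-1) t * e (-1) u * dpow n (- t)%R (- u)%R) else 0)%C
        with (dk * - (e (-1) t * e (-1) u * dpow n (- t)%R (- u)%R))%C by (unfold dk; destruct (Bool.eqb i j); ring).
      rewrite <- !e_add, RtoC_opp, !e_m1.
      pose proof (e_neq_0 1 t). pose proof (e_neq_0 1 u). field. auto.
Qed.

End Derivatives.

(** * The modes of the linearization and the matrices M_n *)

Definition row (al be : bool -> nat -> R) (x : seqs) (n : nat) : R :=
  x true n * (al true n - be true n) + x false n * (al false n - be false n).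

(** Passes from functions to sine coefficients, which equal the linear [row] up to a remainder of
    quadratic type. A real constant has no sine coefficients: this is where the annulus appears as a
    solution. *)
Lemma nicec_coefficients (d : R) (Hd : 0 < d) E E0 c (al be : bool -> nat -> R) (a : R) :
  nicec d E E0 c -> (forall t u, E0 t u = RtoC a) ->
  (forall j n t u, c j n t u = al j n * e (Z.of_nat (S n)) t + be j n * e (- Z.of_nat (S n)) t)%C ->
  exists L r, 0 < L /\ 0 < r /\
    (forall x A, A <= r -> bnd d x A -> wiener d (E x) L) /\
    (forall n, ycoef (E zeros) n = 0) /\
    (forall x y A ee, A <= r -> bnd d x A -> bnd d y A -> bnd d (sub x y) ee ->
       sum_le (fun n => (1 + d * INR (S n)) *
         Rabs ((ycoef (E x) n - row al be x n) - (ycoef (E y) n - row al be y n))) (L * A * ee)).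
Proof.
  intros [D [[L [r [HL [Hr [H0 [H1 [H2 [H3 [H4 H5]]]]]]]]] HR]] HE0 Hc.
  exists L, r. split; auto. split; auto. split; auto. split.
  - intros n.
    assert (HZ : wiener d (fun t u => E zeros t u - E0 t u)%C 0).
    { replace 0 with (L * 0) by ring. apply H3; [ lra | apply bnd_zeros; lra ]. }
    rewrite (ycoef_ext _ (fun t u => RtoC a * cis (IZR 0 * t + IZR 0 * u))%C).
    + rewrite ycoef_atom. destruct (Z.eq_dec 0 (Z.of_nat (S n))); [ lia | ].
      destruct (Z.eq_dec 0 (- Z.of_nat (S n))); [ lia | ]. ring.
    + intros t. rewrite !Rmult_0_l, Rplus_0_l, cis_0, <- (HE0 t 0).
      pose proof (wiener_bound d Hd _ _ HZ t 0) as Hb.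
      apply C_eq_of_small. intros eps He.
      replace (E zeros t 0 - E0 t 0 * 1)%C with (E zeros t 0 - E0 t 0)%C by ring. lra.
  - intros x y A ee HA Hx Hy Hxy. specialize (H5 x y A ee HA Hx Hy Hxy).
    eapply sum_le_ext; [ | apply (ycoef_sum_le d Hd _ _ H5) ].
    intros n. cbv beta. right. f_equal. f_equal.
    rewrite (ycoef_sub d Hd (fun t u => E x t u - E y t u)%C (D (sub x y)) (L * ee) (L * ee)); auto.
    + rewrite (ycoef_sub d Hd (E x) (E y) L L) by eauto.
      rewrite (ycoef_repr d Hd D c al be (sub x y) ee n HR Hxy Hc).
      unfold row, sub. ring.
    + apply (H4 x y A ee); auto.
Qed.

Section Rows.
Context (d b1 b2 : R) (Hd : 0 < d) (Hb2 : 0 < b2) (Hb12 : b2 < b1) (Hb1 : b1 < 1)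
  (Hq1 : b2 / b1 * (1 + 2 * d) < 1) (Hq2 : b1 * b1 * (1 + 2 * d) < 1).

(** [alA] and [beA] are the coefficients of frequency n + 1 and - (n + 1) in the derivative of the
    j-th component of [Aop] with respect to the n-th coefficient of curve i; [alB] and [beB] do the
    same for [Bop]. *)
Definition alA (j i : bool) (n : nat) : R :=
  match j, i with
  | true, true => - (b1 * b1 * b1 * (b1 * b1) ^ n)
  | true, false => b1 * b2 * b2 * (b1 * b2) ^ n
  | false, true => b2 * ((b2 / b1) ^ n - b1 * b1 * (b1 * b2) ^ n)
  | false, false => - b2 + b2 * b2 * b2 * (b2 * b2) ^ n
  end.

Definition beA (j i : bool) (n : nat) : R :=
  match j, i with
  | true, true => - (b2 * b2 / b1) + INR n * (b1 - b2 * b2 / b1)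
  | true, false => b1 * (b2 / b1) ^ (2 + n)
  | false, _ => 0
  end.

Definition alB (j i : bool) (n : nat) : R := if Bool.eqb i j then rad b1 b2 j else 0.
Definition beB (j i : bool) (n : nat) : R := if Bool.eqb i j then - (INR n * rad b1 b2 j) else 0.

Lemma Cpow_e1 (a : R) (n : nat) (t : R) (m : Z) :
  ((RtoC a * e m t) ^ n)%C = (RtoC (a ^ n) * e (m * Z.of_nat n) t)%C.
Proof. rewrite Cpow_mult_l, e_pow, RtoC_pow. reflexivity. Qed.

Lemma coef_A_true (n : nat) : forall (j : bool) (t : R),
  (RtoC b1 * e 1 t * (- (if j then b2 * b2 / (b1 * b1) * (e (-1) t * e (-1) t * e (- Z.of_nat n) t)
                  else - (RtoC b2 / b1 * e (-1) t) ^ (2 + n))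
     - (if Bool.eqb j true then RtoC b1 * RtoC b1 * (RtoC b1 * RtoC b1 * e 1 t) ^ n else RtoC 0)
     + (if Bool.eqb j false then RtoC b2 * RtoC b2 * (RtoC b1 * RtoC b2 * e 1 t) ^ n else RtoC 0))
   + (if Bool.eqb j true then RtoC (- INR n) * e (- Z.of_nat n) t else RtoC 0) *
      (- (RtoC b1 * e (-1) t) - - (b2 * b2 / b1 * e (-1) t)))%C
  = (alA true j n * e (Z.of_nat (S n)) t + beA true j n * e (- Z.of_nat (S n)) t)%C.
Proof.
  intros j t. assert (N1 : RtoC b1 <> 0) by (apply RtoC_neq_0; lra).
  rewrite Nat2Z.inj_succ. unfold Z.succ.
  replace (- (Z.of_nat n + 1))%Z with (- Z.of_nat n + -1)%Z by ring. rewrite <- !e_add.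
  pose proof (e_neq_0 1 t). pose proof (e_neq_0 (- Z.of_nat n) t).
  destruct j; cbn [Bool.eqb alA beA].
  - replace (RtoC b1 * RtoC b1 * e 1 t)%C with (RtoC (b1 * b1) * e 1 t)%C by (rewrite RtoC_mult; ring).
    rewrite Cpow_e1, Z.mul_1_l, RtoC_plus, !RtoC_opp, !RtoC_mult, RtoC_minus, RtoC_div, RtoC_mult by lra.
    rewrite (e_nat n t), !e_m1. field. auto.
  - replace (RtoC b1 * RtoC b2 * e 1 t)%C with (RtoC (b1 * b2) * e 1 t)%C by (rewrite RtoC_mult; ring).
    rewrite <- RtoC_div by lra. rewrite !Cpow_e1, Z.mul_1_l, !RtoC_mult.
    replace (-1 * Z.of_nat (2 + n))%Z with (- Z.of_nat n + -1 + -1)%Z by lia. rewrite <- !e_add.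
    rewrite (e_nat n t), !e_m1. field. auto.
Qed.

Lemma coef_A_false (n : nat) : forall (j : bool) (t : R),
  (RtoC b2 * e 1 t * ((if j then (RtoC b2 / b1 * e 1 t) ^ n else - e (Z.of_nat n) t)
     - (if Bool.eqb j true then RtoC b1 * RtoC b1 * (RtoC b2 * RtoC b1 * e 1 t) ^ n else RtoC 0)
     + (if Bool.eqb j false then RtoC b2 * RtoC b2 * (RtoC b2 * RtoC b2 * e 1 t) ^ n else RtoC 0))
   + (if Bool.eqb j false then RtoC (- INR n) * e (- Z.of_nat n) t else RtoC 0) *
      (- (RtoC b2 * e (-1) t) - - (RtoC b2 * e (-1) t)))%C
  = (alA false j n * e (Z.of_nat (S n)) t + beA false j n * e (- Z.of_nat (S n)) t)%C.
Proof.
  intros j t. assert (N1 : RtoC b1 <> 0) by (apply RtoC_neq_0; lra).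
  rewrite Nat2Z.inj_succ. unfold Z.succ.
  replace (- (Z.of_nat n + 1))%Z with (- Z.of_nat n + -1)%Z by ring. rewrite <- !e_add.
  destruct j; cbn [Bool.eqb alA beA].
  - replace (RtoC b2 * RtoC b1 * e 1 t)%C with (RtoC (b1 * b2) * e 1 t)%C by (rewrite RtoC_mult; ring).
    rewrite <- RtoC_div by lra. rewrite !Cpow_e1, !Z.mul_1_l, !RtoC_mult, RtoC_minus, !RtoC_mult. ring.
  - replace (RtoC b2 * RtoC b2 * e 1 t)%C with (RtoC (b2 * b2) * e 1 t)%C by (rewrite RtoC_mult; ring).
    rewrite Cpow_e1, Z.mul_1_l, RtoC_plus, !RtoC_opp, !RtoC_mult. ring.
Qed.

Lemma nicec_A (j : bool) : exists c a,
  nicec d (fun x => Aop b1 b2 x j) (fun _ _ => RtoC a) c /\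
  forall i n t u, c i n t u = (alA j i n * e (Z.of_nat (S n)) t + beA j i n * e (- Z.of_nat (S n)) t)%C.
Proof.
  assert (N1 : RtoC b1 <> 0) by (apply RtoC_neq_0; lra).
  destruct j.
  - eexists. exists (b2 * b2 - b1 * b1). split.
    + eapply nicec_ext; [ apply (nicec_mult d Hd); [ apply (nicec_phis_t d b1 b2 Hd true) |
        apply (nicec_add d); [ apply (nicec_sub d Hd); [ apply (nicec_sub d Hd);
          [ apply (proj1 (nicec_Ijj d b1 b2 Hd Hb2 Hb12 true)) | apply (proj1 (nicec_I12 d b1 b2 Hd Hb2 Hb12 Hq1)) ]
          | apply (proj1 (nicec_J d b1 b2 Hd Hb2 Hb12 Hb1 Hq2 true true)) ]
          | apply (proj1 (nicec_J d b1 b2 Hd Hb2 Hb12 Hb1 Hq2 true false)) ] ] | | | ].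
      * exists 1. split; [ lra | ]. intros. reflexivity.
      * intros t u. cbv beta. simpl rad. rewrite RtoC_minus, !RtoC_mult, !e_m1.
        pose proof (e_neq_0 1 t). field. auto.
      * intros. reflexivity.
    + intros i n t u. rewrite <- (coef_A_true n i t). cbv beta. simpl rad. destruct i; simpl Bool.eqb; cbv iota; ring.
  - eexists. exists 0. split.
    + eapply nicec_ext; [ apply (nicec_mult d Hd); [ apply (nicec_phis_t d b1 b2 Hd false) |
        apply (nicec_add d); [ apply (nicec_sub d Hd); [ apply (nicec_sub d Hd);
          [ apply (proj1 (nicec_I21 d b1 b2 Hd Hb2 Hb12 Hq1)) | apply (proj1 (nicec_Ijj d b1 b2 Hd Hb2 Hb12 false)) ]
          | apply (proj1 (nicec_J d b1 b2 Hd Hb2 Hb12 Hb1 Hq2 false true)) ]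
          | apply (proj1 (nicec_J d b1 b2 Hd Hb2 Hb12 Hb1 Hq2 false false)) ] ] | | | ].
      * exists 1. split; [ lra | ]. intros. reflexivity.
      * intros t u. cbv beta. simpl rad. ring.
      * intros. reflexivity.
    + intros i n t u. rewrite <- (coef_A_false n i t). cbv beta. simpl rad. destruct i; simpl Bool.eqb; cbv iota; ring.
Qed.

Lemma nicec_B (j : bool) : exists c a,
  nicec d (fun x => Bop b1 b2 x j) (fun _ _ => RtoC a) c /\
  forall i n t u, c i n t u = (alB j i n * e (Z.of_nat (S n)) t + beB j i n * e (- Z.of_nat (S n)) t)%C.
Proof.
  eexists. exists (rad b1 b2 j * rad b1 b2 j). split.
  - eapply nicec_ext; [ apply (nicec_mult d Hd); [ apply (nicec_phis_t d b1 b2 Hd j) |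
       apply (nicec_phib_t d b1 b2 Hd j) ] | | | ].
    + exists 1. split; [ lra | ]. intros. reflexivity.
    + intros t u. cbv beta. rewrite RtoC_mult, e_m1. pose proof (e_neq_0 1 t). field. auto.
    + intros. reflexivity.
  - intros i n t u. cbv beta. rewrite Nat2Z.inj_succ. unfold Z.succ, alB, beB.
    replace (- (Z.of_nat n + 1))%Z with (- Z.of_nat n + -1)%Z by ring. rewrite <- !e_add.
    destruct (Bool.eqb i j); rewrite ?RtoC_opp, ?RtoC_mult; ring.
Qed.

(** [M_{n+1}] applied to the [n]-th coefficients: mode [n + 1] of the equation
    involves the coefficients of [w^{-n}]. *)
Definition Mrow (n : nat) (lambda : R) (j i : bool) : R :=
  coeff_mat 0 (M b1 b2 (S n) lambda) (if j then 0 else 1)%nat (if i then 0 else 1)%nat.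

(** Identifies lambda with 1 - 2 Omega, so that Omega_1 corresponds to 1 + b2^2 - b1^2. *)
Lemma row_M (Om : R) (j : bool) (x : seqs) (n : nat) :
  row (alA j) (beA j) x n + 2 * Om * row (alB j) (beB j) x n =
  - (Mrow n (1 - 2 * Om) j true * x true n + Mrow n (1 - 2 * Om) j false * x false n).
Proof.
  assert (E : forall b, b ^ (n + S (n + 0)) = b * (b * b) ^ n).
  { intros b. replace (n + S (n + 0))%nat with (S (n + n)) by lia. simpl. rewrite pow_add, Rpow_mult_distr. ring. }
  unfold row, Mrow, M. destruct j; cbn [alA beA]; unfold alB, beB; cbn [Bool.eqb rad];
    rewrite !coeff_mat_bij by lia; cbn [Nat.eqb]; rewrite S_INR; simpl; rewrite ?E;
    rewrite ?Rpow_mult_distr; unfold Rdiv; rewrite ?Rpow_mult_distr; field_simplify_eq; try lra; try ring.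
  all: try (split; [ | ]; try apply pow_nonzero; lra).
Qed.

End Rows.

(** * Contractions *)

(** [dist x y r] stands for "the distance from [x] to [y] is at most [r]". *)
Lemma banach_fixed_point (X : Type) (dist : X -> X -> R -> Prop) (x0 : X) (rho : R) (T : X -> X) :
  0 <= rho ->
  (forall x, dist x x 0) ->
  (forall x y r, dist x y r -> dist y x r) ->
  (forall x y z r s, dist x y r -> dist y z s -> dist x z (r + s)) ->
  (forall x y r s, dist x y r -> r <= s -> dist x y s) ->
  (forall (u : nat -> X) c, 0 <= c -> (forall k, dist (u k) (u (S k)) (c * (/ 2) ^ k)) ->
     exists l, forall k, dist (u k) l (2 * c * (/ 2) ^ k)) ->
  dist x0 (T x0) (rho / 2) ->
  (forall x y r, dist x0 x rho -> dist x0 y rho -> dist x y r -> dist (T x) (T y) (r / 2)) ->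
  exists z, dist x0 z rho /\ forall eps, 0 < eps -> dist (T z) z eps.
Proof.
  intros Hrho Hrefl Hsym Htri Hmono Hcomp H0 HT.
  set (u := fun k => Nat.iter k T x0).
  assert (Hpow : forall k, 0 < (/ 2) ^ k) by (intros k; apply pow_lt; lra).
  (* The steps rho/2, rho/4, ... add up to rho (1 - 2^(-k)), so the iterates never leave the ball on
     which T contracts. *)
  assert (H1 : forall k, dist x0 (u k) (rho * (1 - (/ 2) ^ k)) /\
    dist (u k) (u (S k)) (rho / 2 * (/ 2) ^ k)).
  { induction k as [|k [IH1 IH2]].
    - split; simpl.
      + replace (rho * (1 - 1)) with 0 by ring. apply Hrefl.
      + rewrite Rmult_1_r. exact H0.
    - assert (H2 : dist x0 (u (S k)) (rho * (1 - (/ 2) ^ S k))).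
      { eapply Hmono; [ apply (Htri _ _ _ _ _ IH1 IH2) | ]. simpl. right. field. }
      split; auto.
      assert (HB : forall m, rho * (1 - (/ 2) ^ m) <= rho) by (intros m; specialize (Hpow m); nra).
      replace (rho / 2 * (/ 2) ^ S k) with (rho / 2 * (/ 2) ^ k / 2) by (simpl; field).
      apply (HT (u k) (u (S k))); auto; eapply Hmono; eauto. }
  destruct (Hcomp u (rho / 2) ltac:(lra) (fun k => proj2 (H1 k))) as [l Hl].
  assert (Hl0 : dist x0 l rho).
  { specialize (Hl O). simpl in Hl. eapply Hmono; [ exact Hl | lra ]. }
  exists l. split; auto. intros eps He.
  destruct (pow_vanishes (/ 2) (eps / (rho + 1))) as [N HN]; [ lra | apply Rdiv_lt_0_compat; lra | ].
  specialize (HN N (le_n N)).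
  assert (HB : dist x0 (u N) rho).
  { eapply Hmono; [ apply (H1 N) | ]. specialize (Hpow N). nra. }
  eapply Hmono.
  - apply (Htri (T l) (u (S N)) l _ _ (Hsym _ _ _ (HT (u N) l _ HB Hl0 (Hl N))) (Hl (S N))).
  - replace (2 * (rho / 2) * (/ 2) ^ N / 2 + 2 * (rho / 2) * (/ 2) ^ S N) with (rho * (/ 2) ^ N) by (simpl; field).
    apply Rle_trans with (rho * (eps / (rho + 1))).
    + apply Rmult_le_compat_l; auto.
    + apply (Rmult_le_reg_r (rho + 1)); [ lra | ]. field_simplify; [ nra | lra ].
Qed.

Lemma geometric_cauchy_limit (v : nat -> R) (c : R) : 0 <= c ->
  (forall k, Rabs (v k - v (S k)) <= c * (/ 2) ^ k) ->
  exists l : R, is_lim_seq v l /\ forall k, Rabs (v k - l) <= 2 * c * (/ 2) ^ k.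
Proof.
  intros Hc H. assert (Hpow : forall k, 0 < (/ 2) ^ k) by (intros k; apply pow_lt; lra).
  assert (Hd : forall k m, Rabs (v k - v (k + m)%nat) <= 2 * c * ((/ 2) ^ k - (/ 2) ^ (k + m))).
  { intros k m. induction m as [|m IH].
    - rewrite Nat.add_0_r, !Rminus_diag, Rabs_R0. lra.
    - replace (v k - v (k + S m)%nat) with ((v k - v (k + m)%nat) + (v (k + m)%nat - v (S (k + m)))).
      + eapply Rle_trans; [ apply Rabs_triang | ]. specialize (H (k + m)%nat).
        rewrite Nat.add_succ_r. simpl. lra.
      + rewrite Nat.add_succ_r. ring. }
  destruct (Rcomplete.R_complete v) as [l Hl].
  { intros eps He. destruct (pow_vanishes (/ 2) (eps / (4 * c + 1) / 2)) as [N HN]; [ lra | | ].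
    { repeat apply Rdiv_lt_0_compat; lra. }
    assert (G : forall n m, (n >= N)%nat -> (n <= m)%nat -> Rabs (v n - v m) < eps).
    { intros n m Hn Hm. specialize (Hd n (m - n)%nat). replace (n + (m - n))%nat with m in Hd by lia.
      eapply Rle_lt_trans; [ exact Hd | ]. specialize (HN n ltac:(lia)). pose proof (Hpow m). pose proof (Hpow n).
      apply Rle_lt_trans with (2 * c * (eps / (4 * c + 1) / 2)); [ apply Rmult_le_compat_l; lra | ].
      apply (Rmult_lt_reg_r (4 * c + 1)); [ lra | ]. field_simplify; [ nra | lra ]. }
    exists N. intros n m Hn Hm. unfold R_dist. destruct (le_lt_dec n m).
    - apply G; auto.
    - rewrite Rabs_minus_sym. apply G; auto. lia. }
  apply is_lim_seq_Reals in Hl. exists l. split; auto. intros k.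
  assert (L : is_lim_seq (fun m => Rabs (v k - v (m + k)%nat)) (Rabs (v k - l))).
  { apply (is_lim_seq_abs _ (Finite (v k - l))). apply is_lim_seq_minus'; [ apply is_lim_seq_const | ].
    apply is_lim_seq_incr_n. exact Hl. }
  apply (is_lim_seq_le _ (fun _ => 2 * c * (/ 2) ^ k) _ _) with (2 := L) (3 := is_lim_seq_const _).
  intros m. rewrite Nat.add_comm. eapply Rle_trans; [ apply Hd | ].
  pose proof (Hpow (k + m)%nat). apply Rmult_le_compat_l; lra.
Qed.

(** * Completeness of the weighted l1 space *)

Section Complete.
Context (d : R) (Hd : 0 < d).

(** Each partial sum of the norm involves finitely many coordinates and is continuous in them, so
    closed balls are closed under coordinatewise limits. *)
Lemma bnd_limit (u : nat -> seqs) (l : seqs) (A : R) :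
  (forall j n, is_lim_seq (fun k => u k j n) (l j n)) -> (forall k, bnd d (u k) A) -> bnd d l A.
Proof.
  intros Hl Hu N.
  assert (L : is_lim_seq (fun k => rsum (fun n => kappa d n * (Rabs (u k true n) + Rabs (u k false n))) N)
     (rsum (fun n => kappa d n * (Rabs (l true n) + Rabs (l false n))) N)).
  { induction N as [|N IH]; simpl; [ apply is_lim_seq_const | ].
    apply is_lim_seq_plus'; auto.
    apply (is_lim_seq_scal_l _ (kappa d N) (Finite (Rabs (l true N) + Rabs (l false N)))).
    apply is_lim_seq_plus'; [ apply (is_lim_seq_abs _ (Finite (l true N))) | apply (is_lim_seq_abs _ (Finite (l false N))) ]; apply Hl. }
  apply (is_lim_seq_le _ (fun _ => A) _ _) with (2 := L) (3 := is_lim_seq_const _).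
  intros k. apply Hu.
Qed.

Lemma bnd_coefficient (x : seqs) (A : R) (j : bool) (n : nat) : bnd d x A -> Rabs (x j n) <= A.
Proof.
  intros H. apply (bnd_component d Hd x A j) in H. specialize (H (S n)).
  eapply Rle_trans; [ | exact H ]. pose proof (Rabs_pos (x j n)). pose proof (kappa_ge_1 d Hd n).
  apply Rle_trans with (kappa d n * Rabs (x j n)); [ nra | ].
  apply (rsum_ge_term (fun n => kappa d n * Rabs (x j n))); auto.
  intros k. apply Rmult_le_pos; [ pose proof (kappa_ge_1 d Hd k); lra | apply Rabs_pos ].
Qed.

(** The limit is taken coordinate by coordinate; the rate follows by applying [bnd_limit] to the
    differences u_k - u_(m+k), whose norms are bounded by a geometric sum. *)
Lemma bnd_complete (u : nat -> seqs) (c : R) : 0 <= c ->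
  (forall k, bnd d (sub (u k) (u (S k))) (c * (/ 2) ^ k)) ->
  exists l, forall k, bnd d (sub (u k) l) (2 * c * (/ 2) ^ k).
Proof.
  intros Hc Hu. assert (Hpow : forall k, 0 < (/ 2) ^ k) by (intros k; apply pow_lt; lra).
  assert (HL : forall j n, exists l : R, is_lim_seq (fun k => u k j n) l).
  { intros j n. destruct (geometric_cauchy_limit (fun k => u k j n) c Hc
      (fun k => bnd_coefficient _ _ j n (Hu k))) as [l [Hl _]]. exists l. exact Hl. }
  set (l := fun j n => epsilon (inhabits 0) (fun l : R => is_lim_seq (fun k => u k j n) l)).
  assert (Hl : forall j n, is_lim_seq (fun k => u k j n) (l j n)).
  { intros j n. apply (epsilon_spec (inhabits 0) (fun l : R => is_lim_seq (fun k => u k j n) l)). apply HL. }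
  exists l. intros k.
  apply (bnd_limit (fun m => sub (u k) (u (m + k)%nat))).
  - intros j n. unfold sub. apply is_lim_seq_minus'; [ apply is_lim_seq_const | ].
    apply (is_lim_seq_incr_n (fun m => u m j n) k (l j n)). apply Hl.
  - intros m. assert (G : bnd d (sub (u k) (u (m + k)%nat)) (2 * c * ((/ 2) ^ k - (/ 2) ^ (m + k)))).
    { induction m as [|m IH].
      - simpl. replace (2 * c * ((/ 2) ^ k - (/ 2) ^ k)) with 0 by ring.
        replace (sub (u k) (u k)) with zeros; [ apply bnd_zeros; lra | ].
        unfold sub, zeros. do 2 (apply functional_extensionality; intros). ring.
      - eapply bnd_weaken; [ apply (bnd_sub_triangle d Hd _ _ _ _ _ IH (Hu (m + k)%nat)) | ].
        simpl. right. field. }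
    eapply bnd_weaken; [ exact G | ]. pose proof (Hpow (m + k)%nat). apply Rmult_le_compat_l; lra.
Qed.

Lemma bnd_closed (x : seqs) (A : R) : (forall eps, 0 < eps -> bnd d x (A + eps)) -> bnd d x A.
Proof. intros H N. apply Rle_plus_epsilon. intros eps He. apply H; auto. Qed.

Lemma sub_self (x : seqs) : sub x x = zeros.
Proof. unfold sub, zeros. do 2 (apply functional_extensionality; intros). ring. Qed.

Lemma sub_zeros_r (x : seqs) : sub x zeros = x.
Proof. unfold sub, zeros. do 2 (apply functional_extensionality; intros). ring. Qed.

Lemma bnd_zero_eq (x : seqs) : (forall eps, 0 < eps -> bnd d x eps) -> forall j n, x j n = 0.
Proof.
  intros H j n. apply NNPP. intros Hn. pose proof (Rabs_pos_lt _ Hn) as Hp.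
  pose proof (bnd_coefficient _ _ j n (H (Rabs (x j n) / 2) ltac:(lra))). lra.
Qed.

Lemma contraction_fixed_point (T : seqs -> seqs) (rho : R) : 0 <= rho -> bnd d (T zeros) (rho / 2) ->
  (forall x y r, bnd d x rho -> bnd d y rho -> bnd d (sub x y) r -> bnd d (sub (T x) (T y)) (r / 2)) ->
  exists z, bnd d z rho /\ forall j n, T z j n = z j n.
Proof.
  intros Hr H0 HT.
  assert (Z : forall x r, bnd d (sub zeros x) r <-> bnd d x r).
  { intros x r. split; intros H; [ rewrite <- (sub_zeros_r x) | ];
      apply (bnd_sub_sym d); rewrite ?sub_zeros_r; auto. }
  destruct (banach_fixed_point seqs (fun x y r => bnd d (sub x y) r) zeros rho T) as [z [H1 H2]]; auto.
  - intros x. rewrite sub_self. apply bnd_zeros. lra.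
  - intros x y r. apply bnd_sub_sym.
  - intros x y z r s. apply (bnd_sub_triangle d Hd).
  - intros x y r s H Hrs. eapply bnd_weaken; eauto.
  - intros u c Hc Hu. apply bnd_complete; auto.
  - apply Z. auto.
  - intros x y r Hx Hy. apply HT; apply Z; auto.
  - exists z. split; [ apply Z; auto | ]. intros j n.
    apply Rminus_diag_uniq. apply (bnd_zero_eq (sub (T z) z) H2 j n).
Qed.

End Complete.

(** * Bifurcation from a simple eigenvalue in weighted l1 *)

(** The norm on the sine modes of the two equations; its weight is [kappa] divided by n + 1. *)
Definition ybnd (d : R) (y : seqs) (B : R) : Prop :=
  sum_le (fun n => (1 + d * INR (S n)) * (Rabs (y true n) + Rabs (y false n))) B.

Definition quadratic (d : R) (N : seqs -> seqs) (L r : R) : Prop :=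
  (forall j n, N zeros j n = 0) /\
  forall x y A ee, A <= r -> bnd d x A -> bnd d y A -> bnd d (sub x y) ee ->
    ybnd d (sub (N x) (N y)) (L * A * ee).

Section YBnd.
Context (d : R) (Hd : 0 < d).

Lemma W_pos (n : nat) : 0 < 1 + d * INR (S n).
Proof. pose proof (pos_INR (S n)). assert (0 <= d * INR (S n)) by (apply Rmult_le_pos; lra). lra. Qed.

Lemma ybnd_weaken (y : seqs) (A B : R) : ybnd d y A -> A <= B -> ybnd d y B.
Proof. intros H HAB N. eapply Rle_trans; [ apply H | auto ]. Qed.

Lemma ybnd_ext (x y : seqs) (A B : R) : ybnd d x A -> (forall j n, x j n = y j n) -> A <= B -> ybnd d y B.
Proof.
  intros H HE HAB. apply ybnd_weaken with A; auto. eapply sum_le_ext; [ | exact H ].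
  intros n. cbv beta. rewrite !HE. lra.
Qed.

Lemma ybnd_combination (x y z : seqs) (a b A B : R) : 0 <= a -> 0 <= b ->
  (forall j n, Rabs (z j n) <= a * Rabs (x j n) + b * Rabs (y j n)) ->
  ybnd d x A -> ybnd d y B -> ybnd d z (a * A + b * B).
Proof.
  intros Ha Hb H Hx Hy.
  eapply sum_le_ext; [ | apply (sum_le_plus _ _ _ _ (sum_le_scal _ _ a Ha Hx) (sum_le_scal _ _ b Hb Hy)) ].
  intros n. cbv beta. pose proof (W_pos n). pose proof (H true n). pose proof (H false n).
  set (W := 1 + d * INR (S n)) in *.
  apply Rle_trans with (W * ((a * Rabs (x true n) + b * Rabs (y true n)) + (a * Rabs (x false n) + b * Rabs (y false n)))).
  - apply Rmult_le_compat_l; lra.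
  - right. ring.
Qed.

(** The factor n + 1 allowed in the hypothesis is exactly the ratio of the weights of [bnd] and
    [ybnd]. *)
Lemma ybnd_of_bnd (x y z : seqs) (a b A B : R) : 0 <= a -> 0 <= b ->
  (forall j n, Rabs (z j n) <= INR (S n) * (a * Rabs (x j n) + b * Rabs (y j n))) ->
  bnd d x A -> bnd d y B -> ybnd d z (a * A + b * B).
Proof.
  intros Ha Hb H Hx Hy.
  eapply sum_le_ext; [ | apply (sum_le_plus _ _ _ _ (sum_le_scal _ _ a Ha Hx) (sum_le_scal _ _ b Hb Hy)) ].
  intros n. cbv beta. pose proof (W_pos n). pose proof (H true n). pose proof (H false n).
  unfold kappa. set (W := 1 + d * INR (S n)) in *. set (m := INR (S n)) in *.
  apply Rle_trans with (W * (m * (a * Rabs (x true n) + b * Rabs (y true n)) + m * (a * Rabs (x false n) + b * Rabs (y false n)))).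
  - apply Rmult_le_compat_l; lra.
  - right. ring.
Qed.

Lemma scl_0 (x : seqs) : scl 0 x = zeros.
Proof. unfold scl, zeros. do 2 (apply functional_extensionality; intros). ring. Qed.

(** At [s = 0] this is [0], since [N 0 = 0] for a quadratic [N]. *)
Definition rescaled (N : seqs -> seqs) (s : R) (x : seqs) : seqs := fun j n => N (scl s x) j n / s.

Context (N : seqs -> seqs) (L r : R) (HL : 0 <= L) (HN : quadratic d N L r).

Lemma rescaled_lipschitz (s X ee : R) (x y : seqs) :
  Rabs s * X <= r -> bnd d x X -> bnd d y X -> bnd d (sub x y) ee ->
  ybnd d (sub (rescaled N s x) (rescaled N s y)) (L * Rabs s * X * ee).
Proof.
  intros Hs Hx Hy Hxy. destruct HN as [HN0 HN1].
  destruct (Req_dec s 0) as [->|Hs0].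
  - eapply ybnd_ext; [ apply (HN1 zeros zeros 0 0) | | ].
    + rewrite Rabs_R0, Rmult_0_l in Hs. auto.
    + apply bnd_zeros; lra.
    + apply bnd_zeros; lra.
    + rewrite sub_self. apply bnd_zeros; lra.
    + intros j n. unfold sub, rescaled. rewrite !scl_0, !HN0. unfold Rdiv. ring.
    + rewrite Rabs_R0. right. ring.
  - pose proof (Rabs_pos_lt s Hs0) as Hp.
    assert (H1 : bnd d (sub (scl s x) (scl s y)) (Rabs s * ee)).
    { replace (sub (scl s x) (scl s y)) with (scl s (sub x y)); [ apply bnd_scl; auto | ].
      unfold scl, sub. do 2 (apply functional_extensionality; intros). ring. }
    pose proof (HN1 _ _ _ _ Hs (bnd_scl d s x X Hx) (bnd_scl d s y X Hy) H1) as H2.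
    eapply ybnd_weaken; [ refine (ybnd_combination _ zeros _ (/ Rabs s) 0 _ 0 _ (Rle_refl 0) _ H2 _) | ].
    + apply Rlt_le, Rinv_0_lt_compat; auto.
    + intros j n. unfold sub, rescaled. rewrite Rmult_0_l, Rplus_0_r.
      replace (N (scl s x) j n / s - N (scl s y) j n / s) with (/ s * (N (scl s x) j n - N (scl s y) j n)) by (field; auto).
      rewrite Rabs_mult, Rabs_inv. apply Rle_refl.
    + intros k. rewrite (rsum_ext _ (fun _ => 0 * 0)), rsum_scal; [ lra | ].
      intros n _. unfold zeros. rewrite Rabs_R0. ring.
    + right. field. lra.
Qed.

Lemma rescaled_bound (s X : R) (x : seqs) : Rabs s * X <= r -> bnd d x X ->
  ybnd d (rescaled N s x) (L * Rabs s * X * X).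
Proof.
  intros Hs Hx. pose proof (bnd_nonneg d x X Hx) as HX.
  eapply ybnd_ext; [ apply (rescaled_lipschitz s X X x zeros); auto | | apply Rle_refl ].
  - apply bnd_zeros; auto.
  - rewrite sub_zeros_r. auto.
  - intros j n. unfold sub at 1, rescaled at 2. replace (scl s zeros) with zeros.
    + rewrite (proj1 HN). unfold Rdiv. ring.
    + unfold scl, zeros. do 2 (apply functional_extensionality; intros). ring.
Qed.

(** By symmetry |s'| <= |s|. Then N(sx)/s - N(s'x)/s' is (N(sx) - N(s'x))/s - ((s - s')/s)
    N(s'x)/s', where only the larger parameter is a new denominator and |s'|/|s| <= 1 bounds the
    second term. *)
Lemma rescaled_parameter (s s' X : R) (x : seqs) :
  Rabs s * X <= r -> Rabs s' * X <= r -> bnd d x X ->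
  ybnd d (sub (rescaled N s x) (rescaled N s' x)) (2 * L * (X * X) * Rabs (s - s')).
Proof.
  assert (W : forall s s', Rabs s' <= Rabs s -> Rabs s * X <= r -> bnd d x X ->
    ybnd d (sub (rescaled N s x) (rescaled N s' x)) (2 * L * (X * X) * Rabs (s - s'))).
  { clear s s'. intros s s' Hss Hs Hx. pose proof (bnd_nonneg d x X Hx) as HX.
    assert (Hs' : Rabs s' * X <= r).
    { eapply Rle_trans; [ apply Rmult_le_compat_r; [ exact HX | exact Hss ] | auto ]. }
    assert (HP : 0 <= L * (X * X) * Rabs (s - s')).
    { apply Rmult_le_pos; [ apply Rmult_le_pos; nra | apply Rabs_pos ]. }
    destruct (Req_dec s' 0) as [->|Hs0'].
    - eapply ybnd_ext; [ apply (rescaled_bound s X x); auto | | ].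
      + intros j n. unfold sub, rescaled at 3. rewrite scl_0, (proj1 HN). unfold Rdiv. ring.
      + rewrite Rminus_0_r in *. lra.
    - pose proof (Rabs_pos_lt s' Hs0') as Hp'.
      assert (Hs0 : s <> 0). { intros ->. rewrite Rabs_R0 in Hss. lra. }
      pose proof (Rabs_pos_lt s Hs0) as Hp.
      assert (H1 : bnd d (sub (scl s x) (scl s' x)) (Rabs (s - s') * X)).
      { replace (sub (scl s x) (scl s' x)) with (scl (s - s') x); [ apply bnd_scl; auto | ].
        unfold scl, sub. do 2 (apply functional_extensionality; intros). ring. }
      assert (Hx' : bnd d (scl s' x) (Rabs s * X)).
      { eapply bnd_weaken; [ apply bnd_scl; eauto | ]. apply Rmult_le_compat_r; auto. }
      pose proof (proj2 HN _ _ _ _ Hs (bnd_scl d s x X Hx) Hx' H1) as H2.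
      pose proof (rescaled_bound s' X x Hs' Hx) as H3.
      eapply ybnd_weaken; [ refine (ybnd_combination _ _ _ (/ Rabs s) (Rabs (s - s') / Rabs s) _ _ _ _ _ H2 H3) | ].
      + apply Rlt_le, Rinv_0_lt_compat; auto.
      + apply Rdiv_le_0_compat; [ apply Rabs_pos | auto ].
      + intros j n. unfold sub, rescaled.
        replace (N (scl s x) j n / s - N (scl s' x) j n / s') with
          (/ s * (N (scl s x) j n - N (scl s' x) j n) + (- (s - s') / s) * (N (scl s' x) j n / s'))
          by (field; auto).
        eapply Rle_trans; [ apply Rabs_triang | ]. unfold Rdiv.
        rewrite !(Rabs_mult (/ s)), !(Rabs_mult (_ * / s)), (Rabs_mult (- (s - s'))), Rabs_Ropp, !Rabs_inv.
        apply Rle_refl.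
      + assert (E : Rabs s' * / Rabs s <= 1).
        { apply (Rmult_le_reg_r (Rabs s)); auto. rewrite Rmult_assoc, Rinv_l; lra. }
        replace (/ Rabs s * (L * (Rabs s * X) * (Rabs (s - s') * X))) with (L * (X * X) * Rabs (s - s')) by (field; lra).
        replace (Rabs (s - s') / Rabs s * (L * Rabs s' * X * X)) with
          (L * (X * X) * Rabs (s - s') * (Rabs s' * / Rabs s)) by (field; lra).
        nra. }
  intros Hs Hs' Hx. destruct (Rle_dec (Rabs s') (Rabs s)) as [H|H].
  - apply W; auto.
  - pose proof (W s' s ltac:(lra) Hs' Hx) as H1.
    eapply sum_le_ext; [ | rewrite Rabs_minus_sym; exact H1 ].
    intros n. cbv beta. unfold sub.
    rewrite (Rabs_minus_sym (rescaled N s x true n)), (Rabs_minus_sym (rescaled N s x false n)). lra.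
Qed.

End YBnd.

Section Bifurcation.
(** In the application m n is M_(n+1) at the bifurcation value, D holds the two radii, w1 is 2
    Omega_1, and NA, NB are the nonlinear parts of [Aop] and [Bop]. With 2 Omega = w1 - nu, the
    equation reads NA x + (w1 - nu) NB x = m x + nu (n+1) D x in each mode. *)
Context (d : R) (Hd : 0 < d) (m : nat -> bool -> bool -> R) (D : bool -> R) (w1 : R)
  (NA NB : seqs -> seqs) (L r : R) (HL : 0 < L) (Hr : 0 < r)
  (HNA : quadratic d NA L r) (HNB : quadratic d NB L r)
  (Hm0 : forall j, m O j true + m O j false = 0)
  (HD : forall j, 0 <= D j <= 1).

(** The linearization in the unknowns (speed, mu) for mode 0, where the
    eigenvector is [(1, 1)] and the ansatz [(1, 1 + mu)], and in the coefficients otherwise. *)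
Definition lmat (n : nat) (j i : bool) : R :=
  match n with O => if i then D j else m O j false | S _ => m n j i end.

Definition ldet (n : nat) : R := lmat n true true * lmat n false false - lmat n true false * lmat n false true.

Context (C1 c0 : R) (HC1 : 0 < C1) (Hc0 : 0 < c0)
  (HC : forall n j i, Rabs (lmat n j i) <= C1 * INR (S n))
  (Hdet : forall n, c0 * (INR (S n) * INR (S n)) <= Rabs (ldet n)).

Lemma ldet_neq_0 (n : nat) : ldet n <> 0.
Proof.
  intros H. specialize (Hdet n). rewrite H, Rabs_R0 in Hdet.
  pose proof (lt_0_INR (S n) ltac:(lia)). assert (0 < c0 * (INR (S n) * INR (S n))) by (repeat apply Rmult_lt_0_compat; auto). lra.
Qed.

(** Cramer's rule, mode by mode. *)
Definition lsol (y : seqs) : seqs := fun j n =>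
  (if j then lmat n false false * y true n - lmat n true false * y false n
   else lmat n true true * y false n - lmat n false true * y true n) / ldet n.

Lemma lsol_spec (y : seqs) (j : bool) (n : nat) :
  lmat n j true * lsol y true n + lmat n j false * lsol y false n = y j n.
Proof.
  pose proof (ldet_neq_0 n) as H. unfold lsol. unfold ldet in *. destruct j; field; auto.
Qed.

Lemma lsol_sub (y y' : seqs) : sub (lsol y) (lsol y') = lsol (sub y y').
Proof.
  unfold sub, lsol. do 2 (apply functional_extensionality; intros).
  pose proof (ldet_neq_0 x0) as H. destruct x; field; auto.
Qed.

(** Entries of size n + 1 over a determinant of size (n + 1)^2 gain a factor 1/(n + 1), which lifts
    the weight of [ybnd] to that of [bnd]. *)
Lemma lsol_bnd (y : seqs) (B : R) : ybnd d y B -> bnd d (lsol y) (2 * C1 / c0 * B).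
Proof.
  intros Hy. assert (Hcc : 0 <= 2 * C1 / c0) by (apply Rdiv_le_0_compat; lra).
  eapply sum_le_ext; [ | apply (sum_le_scal _ _ _ Hcc Hy) ].
  intros n. cbv beta. pose proof (W_pos d Hd n) as HW. unfold kappa.
  set (W := 1 + d * INR (S n)) in *. pose proof (lt_0_INR (S n) ltac:(lia)) as Hn.
  set (k := INR (S n)) in *. set (Y := Rabs (y true n) + Rabs (y false n)).
  pose proof (Rabs_pos (y true n)) as Y1. pose proof (Rabs_pos (y false n)) as Y2.
  assert (G : forall j, Rabs (lsol y j n) <= C1 / c0 * / k * Y).
  { intros j. unfold lsol, Rdiv. rewrite Rabs_mult, Rabs_inv.
    assert (H1 : Rabs (if j then lmat n false false * y true n - lmat n true false * y false n
      else lmat n true true * y false n - lmat n false true * y true n) <= C1 * k * Y).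
    { assert (G2 : forall a b u v, Rabs a <= C1 * k -> Rabs b <= C1 * k -> Rabs (a * u - b * v) <= C1 * k * (Rabs u + Rabs v)).
      { intros a b u v Ha Hb. unfold Rminus. eapply Rle_trans; [ apply Rabs_triang | ].
        rewrite Rabs_Ropp, !Rabs_mult. pose proof (Rabs_pos u). pose proof (Rabs_pos v). nra. }
      unfold Y. destruct j; [ apply G2; apply HC | rewrite (Rplus_comm (Rabs (y true n))); apply G2; apply HC ]. }
    assert (H2 : / Rabs (ldet n) <= / (c0 * (k * k))).
    { apply Rinv_le_contravar; [ repeat apply Rmult_lt_0_compat; auto | apply Hdet ]. }
    replace (C1 * / c0 * / k * Y) with (C1 * k * Y * / (c0 * (k * k))) by (field; lra).
    apply Rmult_le_compat; auto; try apply Rabs_pos.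
    apply Rlt_le, Rinv_0_lt_compat, Rabs_pos_lt, ldet_neq_0. }
  pose proof (G true) as G1. pose proof (G false) as G2.
  replace (2 * C1 / c0 * (W * Y)) with (k * W * (C1 / c0 * / k * Y + C1 / c0 * / k * Y)) by (field; lra).
  apply Rmult_le_compat_l; [ nra | lra ].
Qed.

(** The unknown z keeps the speed in the slot ([true], 0), left free by fixing the amplitude s. The
    coefficients sought are s times [ansatz z], and [perturbation z] is [ansatz z] minus the
    eigenvector. *)
Definition perturbation (z : seqs) : seqs := fun j n =>
  match n with O => if j then 0 else z false O | S _ => z j n end.
Definition ansatz (z : seqs) : seqs := fun j n =>
  match n with O => if j then 1 else 1 + z false O | S _ => z j n end.
Definition speed (z : seqs) : R := z true O.

(** The bilinear part of speed (n+1) D [ansatz z]; the other part, with the eigenvector, is linear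
    in the speed and forms the first column of [lmat 0]. *)
Definition quad (z : seqs) : seqs := fun j n => speed z * (INR (S n) * D j * perturbation z j n).
Definition rem (s : R) (z : seqs) : seqs := fun j n =>
  rescaled NA s (ansatz z) j n + (w1 - speed z) * rescaled NB s (ansatz z) j n.
Definition fixmap (s : R) (z : seqs) : seqs := lsol (sub (rem s z) (quad z)).

(** Bound for [ansatz z]: the eigenvector has norm 2 (1 + d), that is twice [kappa d 0], and z at
    most 1. Likewise [W1] bounds |w1 - nu| when |nu| <= 1. *)
Definition X0 : R := 2 * (1 + d) + 1.
Definition W1 : R := Rabs w1 + 1.

Lemma perturbation_bnd (z : seqs) (A : R) : bnd d z A -> bnd d (perturbation z) A.
Proof.
  intros H. eapply sum_le_ext; [ | exact H ]. intros n. cbv beta.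
  apply Rmult_le_compat_l; [ pose proof (kappa_ge_1 d Hd n); lra | ].
  destruct n; simpl; [ | lra ]. rewrite Rabs_R0. pose proof (Rabs_pos (z true O)). lra.
Qed.

Lemma perturbation_sub (z z' : seqs) : sub (perturbation z) (perturbation z') = perturbation (sub z z').
Proof.
  unfold sub, perturbation. do 2 (apply functional_extensionality; intros).
  destruct x0, x; ring.
Qed.

Lemma ansatz_sub (z z' : seqs) : sub (ansatz z) (ansatz z') = perturbation (sub z z').
Proof.
  unfold sub, ansatz, perturbation. do 2 (apply functional_extensionality; intros).
  destruct x0, x; ring.
Qed.

Lemma ansatz_bnd (z : seqs) (A : R) : A <= 1 -> bnd d z A -> bnd d (ansatz z) X0.
Proof.
  intros HA Hz.
  assert (H0 : bnd d (ansatz zeros) (2 * (1 + d))).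
  { intros N. apply rsum_single_le with O.
    - intros [|n] Hn; [ lia | ]. simpl. unfold zeros. rewrite Rabs_R0. ring.
    - unfold kappa, ansatz, zeros. simpl. rewrite Rplus_0_r, Rabs_R1. lra.
    - lra. }
  assert (H1 : bnd d (sub (ansatz z) (ansatz zeros)) 1).
  { rewrite ansatz_sub, sub_zeros_r. apply perturbation_bnd. eapply bnd_weaken; eauto. }
  unfold X0. rewrite Rplus_comm. eapply bnd_triangle; [ auto | | exact H1 | exact H0 ].
  intros j n. unfold sub. replace (ansatz z j n) with ((ansatz z j n - ansatz zeros j n) + ansatz zeros j n) at 1 by ring.
  apply Rabs_triang.
Qed.

(** The factor n + 1 in [quad] is absorbed by the weaker norm of the target. Being bilinear, [quad]
    is made contractive by a small ball, independently of s. *)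
Lemma quad_lipschitz (z z' : seqs) (rho ee : R) :
  bnd d z rho -> bnd d z' rho -> bnd d (sub z z') ee ->
  ybnd d (sub (quad z) (quad z')) (2 * rho * ee).
Proof.
  intros Hz Hz' Hzz. pose proof (bnd_nonneg d z rho Hz). pose proof (bnd_nonneg d _ ee Hzz).
  replace (2 * rho * ee) with (rho * ee + ee * rho) by ring.
  apply (ybnd_of_bnd d Hd (sub (perturbation z) (perturbation z')) (perturbation z')); auto.
  - intros j n. unfold quad, sub at 1.
    replace (speed z * (INR (S n) * D j * perturbation z j n) - speed z' * (INR (S n) * D j * perturbation z' j n))
      with (INR (S n) * (D j * (speed z * sub (perturbation z) (perturbation z') j n + (speed z - speed z') * perturbation z' j n)))
      by (unfold sub; ring).
    pose proof (pos_INR (S n)) as Hn. rewrite Rabs_mult, (Rabs_pos_eq (INR (S n))) by auto.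
    apply Rmult_le_compat_l; auto. destruct (HD j) as [D1 D2].
    rewrite Rabs_mult, (Rabs_pos_eq (D j)) by auto.
    pose proof (bnd_coefficient d Hd z rho true O Hz) as B1. fold (speed z) in B1.
    pose proof (bnd_coefficient d Hd (sub z z') ee true O Hzz) as B2.
    change (sub z z' true O) with (speed z - speed z') in B2.
    pose proof (Rabs_triang (speed z * sub (perturbation z) (perturbation z') j n) ((speed z - speed z') * perturbation z' j n)) as T.
    rewrite !Rabs_mult in T.
    pose proof (Rabs_pos (sub (perturbation z) (perturbation z') j n)) as P1. pose proof (Rabs_pos (perturbation z' j n)) as P2.
    assert (T2 : Rabs (speed z * sub (perturbation z) (perturbation z') j n + (speed z - speed z') * perturbation z' j n) <=
      rho * Rabs (sub (perturbation z) (perturbation z') j n) + ee * Rabs (perturbation z' j n)).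
    { eapply Rle_trans; [ exact T | ]. apply Rplus_le_compat; apply Rmult_le_compat_r; auto. }
    rewrite <- (Rmult_1_l (rho * _ + _)). apply Rmult_le_compat; auto. apply Rabs_pos.
  - rewrite perturbation_sub. apply perturbation_bnd; auto.
  - apply perturbation_bnd; auto.
Qed.

(** The remainders are quadratic, so dividing by s still leaves a factor |s|: this term is made
    contractive by a small s. *)
Lemma rem_lipschitz (s : R) (z z' : seqs) (ee : R) :
  Rabs s * X0 <= r -> bnd d z 1 -> bnd d z' 1 -> bnd d (sub z z') ee ->
  ybnd d (sub (rem s z) (rem s z')) (L * Rabs s * X0 * (1 + W1 + X0) * ee).
Proof.
  intros Hs Hz Hz' Hzz. pose proof (bnd_nonneg d _ ee Hzz) as He.
  assert (Ha : bnd d (sub (ansatz z) (ansatz z')) ee) by (rewrite ansatz_sub; apply perturbation_bnd; auto).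
  pose proof (ansatz_bnd z 1 (Rle_refl 1) Hz) as B1. pose proof (ansatz_bnd z' 1 (Rle_refl 1) Hz') as B2.
  pose proof (rescaled_lipschitz d Hd NA L r HNA s X0 ee _ _ Hs B1 B2 Ha) as E1.
  pose proof (rescaled_lipschitz d Hd NB L r HNB s X0 ee _ _ Hs B1 B2 Ha) as E2.
  pose proof (rescaled_bound d Hd NB L r HNB s X0 _ Hs B2) as E3.
  pose proof (bnd_coefficient d Hd z 1 true O Hz) as S1. fold (speed z) in S1.
  pose proof (bnd_coefficient d Hd (sub z z') ee true O Hzz) as S2.
  change (sub z z' true O) with (speed z - speed z') in S2.
  assert (HW : 0 <= W1) by (unfold W1; pose proof (Rabs_pos w1); lra).
  assert (HX : 0 <= X0) by (unfold X0; lra).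
  assert (G1 : ybnd d (fun j n => (w1 - speed z) * sub (rescaled NB s (ansatz z)) (rescaled NB s (ansatz z')) j n
       + - (speed z - speed z') * rescaled NB s (ansatz z') j n) (W1 * (L * Rabs s * X0 * ee) + ee * (L * Rabs s * X0 * X0))).
  { refine (ybnd_combination d Hd _ _ _ _ _ _ _ HW He _ E2 E3).
    intros j n. eapply Rle_trans; [ apply Rabs_triang | ]. rewrite !Rabs_mult, Rabs_Ropp.
    apply Rplus_le_compat; apply Rmult_le_compat_r; try apply Rabs_pos; auto.
    unfold Rminus. eapply Rle_trans; [ apply Rabs_triang | ]. rewrite Rabs_Ropp. unfold W1. lra. }
  eapply ybnd_weaken; [ refine (ybnd_combination d Hd _ _ _ 1 1 _ _ Rle_0_1 Rle_0_1 _ E1 G1) | ].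
  - intros j n. rewrite !Rmult_1_l. unfold sub at 1, rem.
    eapply Rle_trans; [ | apply Rabs_triang ]. right. f_equal. unfold sub. ring.
  - right. ring.
Qed.

Lemma rem_parameter (s s' : R) (z : seqs) :
  Rabs s * X0 <= r -> Rabs s' * X0 <= r -> bnd d z 1 ->
  ybnd d (sub (rem s z) (rem s' z)) (2 * L * (X0 * X0) * (1 + W1) * Rabs (s - s')).
Proof.
  intros Hs Hs' Hz. pose proof (ansatz_bnd z 1 (Rle_refl 1) Hz) as B1.
  pose proof (rescaled_parameter d Hd NA L r (Rlt_le _ _ HL) HNA s s' X0 _ Hs Hs' B1) as E1.
  pose proof (rescaled_parameter d Hd NB L r (Rlt_le _ _ HL) HNB s s' X0 _ Hs Hs' B1) as E2.
  pose proof (bnd_coefficient d Hd z 1 true O Hz) as S1. fold (speed z) in S1.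
  assert (HW : 0 <= W1) by (unfold W1; pose proof (Rabs_pos w1); lra).
  eapply ybnd_weaken; [ refine (ybnd_combination d Hd _ _ _ 1 W1 _ _ Rle_0_1 HW _ E1 E2) | right; ring ].
  intros j n. unfold sub at 1, rem.
  replace (rescaled NA s (ansatz z) j n + (w1 - speed z) * rescaled NB s (ansatz z) j n -
    (rescaled NA s' (ansatz z) j n + (w1 - speed z) * rescaled NB s' (ansatz z) j n)) with
    (sub (rescaled NA s (ansatz z)) (rescaled NA s' (ansatz z)) j n
     + (w1 - speed z) * sub (rescaled NB s (ansatz z)) (rescaled NB s' (ansatz z)) j n) by (unfold sub; ring).
  eapply Rle_trans; [ apply Rabs_triang | ]. rewrite Rmult_1_l. apply Rplus_le_compat_l.
  rewrite Rabs_mult. apply Rmult_le_compat_r; [ apply Rabs_pos | ].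
  unfold Rminus. eapply Rle_trans; [ apply Rabs_triang | ]. rewrite Rabs_Ropp. unfold W1. lra.
Qed.

(** Replaces the absorption of N/2 in N <= N/2 + c. Norms being relations, the implication is
    iterated from any finite bound E0, which disappears in the limit. *)
Lemma bnd_absorb (x : seqs) (E0 c : R) : 0 <= c -> bnd d x E0 ->
  (forall ee, bnd d x ee -> bnd d x (ee / 2 + c)) -> bnd d x (2 * c).
Proof.
  intros Hc H0 H. pose proof (bnd_nonneg d x E0 H0) as HE.
  assert (G : forall k, bnd d x (E0 * (/ 2) ^ k + 2 * c)).
  { induction k as [|k IH]; [ simpl; eapply bnd_weaken; eauto; lra | ].
    eapply bnd_weaken; [ apply H; exact IH | ]. simpl. lra. }
  apply bnd_closed. intros eps He.
  destruct (pow_vanishes (/ 2) (eps / (E0 + 1))) as [k Hk]; [ lra | apply Rdiv_lt_0_compat; lra | ].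
  eapply bnd_weaken; [ apply (G k) | ]. specialize (Hk k (le_n k)).
  assert (E0 * (/ 2) ^ k <= E0 * (eps / (E0 + 1))) by (apply Rmult_le_compat_l; auto).
  assert (E0 * (eps / (E0 + 1)) <= eps).
  { apply (Rmult_le_reg_r (E0 + 1)); [ lra | ]. field_simplify; [ nra | lra ]. }
  lra.
Qed.

Lemma bnd_add (x y z : seqs) (A B : R) : (forall j n, z j n = x j n + y j n) ->
  bnd d x A -> bnd d y B -> bnd d z (A + B).
Proof. intros H. apply bnd_triangle; auto. intros j n. rewrite H. apply Rabs_triang. Qed.

Lemma bifurcation : exists s0 K (xs : R -> seqs) (nu : R -> R),
  0 < s0 /\ 0 <= K /\ nu 0 = 0 /\
  (forall s, Rabs s <= s0 ->
     bnd d (xs s) (K * Rabs s) /\ xs s true O = s /\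
     bnd d (fun j n => match n with O => 0 | S _ => xs s j n end) (Rabs s / 2) /\
     forall j n, NA (xs s) j n + (w1 - nu s) * NB (xs s) j n =
       m n j true * xs s true n + m n j false * xs s false n + nu s * INR (S n) * D j * xs s j n) /\
  (forall s s', Rabs s <= s0 -> Rabs s' <= s0 ->
     bnd d (sub (xs s) (xs s')) (K * Rabs (s - s')) /\ Rabs (nu s - nu s') <= K * Rabs (s - s')).
Proof.
  set (Cs := 2 * C1 / c0). assert (HCs : 0 < Cs) by (unfold Cs; apply Rdiv_lt_0_compat; lra).
  assert (HX : 1 <= X0) by (unfold X0; lra).
  assert (HW : 0 <= W1) by (unfold W1; pose proof (Rabs_pos w1); lra).
  set (K1 := L * X0 * (1 + W1 + X0)). assert (HK1 : 0 < K1) by (unfold K1; repeat apply Rmult_lt_0_compat; lra).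
  set (K2 := K1 * (1 + X0)). assert (HK2 : 0 < K2) by (unfold K2; apply Rmult_lt_0_compat; lra).
  (* The bound 1/(8 Cs) lets [quad] contribute at most 1/4 to the contraction; 1/2 keeps the higher
     coefficients below half of the amplitude, which later gives nontriviality. *)
  set (rho := Rmin (/ 2) (/ (8 * Cs))).
  assert (Hrho : 0 < rho) by (apply Rmin_pos; [ lra | apply Rinv_0_lt_compat; lra ]).
  assert (Hrho1 : rho <= / 2) by apply Rmin_l.
  assert (Hrho2 : Cs * (2 * rho) <= / 4).
  { assert (H : rho <= / (8 * Cs)) by apply Rmin_r.
    apply (Rmult_le_compat_l (2 * Cs)) in H; [ | lra ].
    replace (2 * Cs * / (8 * Cs)) with (/ 4) in H by (field; lra). lra. }
  (* The first bound keeps s [ansatz z] in the ball where NA and NB are controlled; the second gives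
     another 1/4 of contraction and sends 0 into the ball of radius rho/2. *)
  set (s0 := Rmin (r / X0) (rho / 2 / (Cs * K2))).
  assert (HCK : 0 < Cs * K2) by (apply Rmult_lt_0_compat; auto).
  assert (Hs0 : 0 < s0) by (apply Rmin_pos; repeat apply Rdiv_lt_0_compat; lra).
  assert (Hs0r : forall s, Rabs s <= s0 -> Rabs s * X0 <= r).
  { intros s Hs. assert (H : Rabs s <= r / X0) by (eapply Rle_trans; [ exact Hs | apply Rmin_l ]).
    apply (Rmult_le_compat_r X0) in H; [ | lra ]. replace (r / X0 * X0) with r in H by (field; lra). exact H. }
  assert (Hs0k : forall s, Rabs s <= s0 -> Cs * (K2 * Rabs s) <= rho / 2).
  { intros s Hs. assert (H : Rabs s <= rho / 2 / (Cs * K2)) by (eapply Rle_trans; [ exact Hs | apply Rmin_r ]).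
    apply (Rmult_le_compat_l (Cs * K2)) in H; [ | lra ].
    replace (Cs * K2 * (rho / 2 / (Cs * K2))) with (rho / 2) in H by (field; split; lra). lra. }
  assert (HK12 : K1 <= K2) by (unfold K2; nra).
  assert (HT0 : forall s, Rabs s <= s0 -> bnd d (fixmap s zeros) (Cs * (K2 * Rabs s))).
  { intros s Hs. apply lsol_bnd.
    assert (Hz : bnd d zeros 1) by (apply bnd_zeros; lra).
    pose proof (ansatz_bnd zeros 1 (Rle_refl 1) Hz) as B1.
    pose proof (rescaled_bound d Hd NA L r HNA s X0 _ (Hs0r s Hs) B1) as E1.
    pose proof (rescaled_bound d Hd NB L r HNB s X0 _ (Hs0r s Hs) B1) as E2.
    eapply ybnd_weaken; [ refine (ybnd_combination d Hd _ _ _ 1 W1 _ _ Rle_0_1 HW _ E1 E2) | ].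
    - intros j n. unfold sub, rem, quad.
      replace (speed zeros) with 0 by reflexivity. rewrite Rmult_0_l, !Rminus_0_r, Rmult_1_l.
      eapply Rle_trans; [ apply Rabs_triang | ]. apply Rplus_le_compat_l. rewrite Rabs_mult.
      apply Rmult_le_compat_r; [ apply Rabs_pos | unfold W1; lra ].
    - unfold K2, K1. pose proof (Rabs_pos s).
      assert (0 <= L * X0 * Rabs s) by (repeat apply Rmult_le_pos; lra).
      replace (1 * (L * Rabs s * X0 * X0) + W1 * (L * Rabs s * X0 * X0)) with (L * X0 * Rabs s * ((1 + W1) * X0)) by ring.
      replace (L * X0 * (1 + W1 + X0) * (1 + X0) * Rabs s) with (L * X0 * Rabs s * ((1 + W1 + X0) * (1 + X0))) by ring.
      apply Rmult_le_compat_l; auto. apply Rmult_le_compat; lra. }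
  assert (HTc : forall s x y ee, Rabs s <= s0 -> bnd d x rho -> bnd d y rho -> bnd d (sub x y) ee ->
    bnd d (sub (fixmap s x) (fixmap s y)) (ee / 2)).
  { intros s x y ee Hs Hx Hy Hxy. pose proof (bnd_nonneg d _ ee Hxy) as He.
    unfold fixmap. rewrite lsol_sub.
    assert (Hx1 : bnd d x 1) by (eapply bnd_weaken; eauto; lra).
    assert (Hy1 : bnd d y 1) by (eapply bnd_weaken; eauto; lra).
    pose proof (rem_lipschitz s x y ee (Hs0r s Hs) Hx1 Hy1 Hxy) as E1.
    pose proof (quad_lipschitz x y rho ee Hx Hy Hxy) as E2.
    eapply bnd_weaken; [ apply lsol_bnd | ].
    - refine (ybnd_combination d Hd _ _ _ 1 1 _ _ Rle_0_1 Rle_0_1 _ E1 E2).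
      intros j n. rewrite !Rmult_1_l, <- (Rabs_Ropp (sub (quad x) (quad y) j n)).
      eapply Rle_trans; [ | apply Rabs_triang ]. right. f_equal. unfold sub. ring.
    - fold Cs. pose proof (Hs0k s Hs) as Hk. pose proof (Rabs_pos s).
      assert (Hk1 : Cs * (K1 * Rabs s) <= / 4).
      { apply Rle_trans with (Cs * (K2 * Rabs s)); [ | lra ].
        apply Rmult_le_compat_l; [ lra | ]. apply Rmult_le_compat_r; auto. }
      replace (Cs * (1 * (L * Rabs s * X0 * (1 + W1 + X0) * ee) + 1 * (2 * rho * ee)))
        with ((Cs * (K1 * Rabs s) + Cs * (2 * rho)) * ee) by (unfold K1; ring).
      unfold Rdiv. rewrite (Rmult_comm ee). apply Rmult_le_compat_r; lra. }
  (* Stated for every s, with the smallness of s as a premise inside, so that [epsilon] yields a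
     total function of s. *)
  assert (HZ : forall s, exists z, Rabs s <= s0 -> bnd d z rho /\ forall j n, fixmap s z j n = z j n).
  { intros s. destruct (Rle_dec (Rabs s) s0) as [Hs|Hs].
    - destruct (contraction_fixed_point d Hd (fixmap s) rho ltac:(lra)) as [z Hz].
      + eapply bnd_weaken; [ apply (HT0 s Hs) | apply (Hs0k s Hs) ].
      + intros x y ee. apply HTc; auto.
      + exists z. auto.
    - exists zeros. intros; contradiction. }
  set (zs := fun s => epsilon (inhabits zeros) (fun z => Rabs s <= s0 -> bnd d z rho /\ forall j n, fixmap s z j n = z j n)).
  assert (Hzs : forall s, Rabs s <= s0 -> bnd d (zs s) rho /\ fixmap s (zs s) = zs s).
  { intros s Hs. destruct (epsilon_spec (inhabits zeros) _ (HZ s) Hs) as [H1 H2]. split; auto.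
    apply functional_extensionality. intros j. apply functional_extensionality. intros n. apply H2. }
  (* The map contracts by 1/2 and moves 0 by O(|s|), so its fixed point is O(|s|) as well; in
     particular the speed vanishes at s = 0. *)
  assert (Hzs0 : forall s, Rabs s <= s0 -> bnd d (zs s) (2 * (Cs * (K2 * Rabs s)))).
  { intros s Hs. destruct (Hzs s Hs) as [H1 H2].
    apply bnd_absorb with rho; auto.
    - apply Rmult_le_pos; [ lra | ]. apply Rmult_le_pos; [ lra | apply Rabs_pos ].
    - intros ee Hee. apply (bnd_add (sub (fixmap s (zs s)) (fixmap s zeros)) (fixmap s zeros)).
      + intros j n. unfold sub. rewrite H2. ring.
      + apply HTc; auto; [ apply bnd_zeros; lra | rewrite sub_zeros_r; auto ].
      + apply HT0; auto. }
  set (K3 := Cs * (2 * L * (X0 * X0) * (1 + W1))).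
  assert (HK3 : 0 <= K3).
  { unfold K3. apply Rmult_le_pos; [ lra | ]. repeat apply Rmult_le_pos; lra. }
  (* The same absorption, the constant term now being the effect of changing the parameter at a
     fixed argument. *)
  assert (HzL : forall s s', Rabs s <= s0 -> Rabs s' <= s0 ->
     bnd d (sub (zs s) (zs s')) (2 * (K3 * Rabs (s - s')))).
  { intros s s' Hs Hs'. destruct (Hzs s Hs) as [H1 H2]. destruct (Hzs s' Hs') as [H1' H2'].
    apply bnd_absorb with (rho + rho).
    - apply Rmult_le_pos; auto. apply Rabs_pos.
    - apply bnd_sub; auto.
    - intros ee Hee. apply (bnd_add (sub (fixmap s (zs s)) (fixmap s (zs s'))) (sub (fixmap s (zs s')) (fixmap s' (zs s')))).
      + intros j n. unfold sub. rewrite H2, H2'. ring.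
      + apply HTc; auto.
      + unfold fixmap. rewrite lsol_sub.
        eapply bnd_weaken; [ apply lsol_bnd | ].
        * eapply ybnd_ext; [ apply (rem_parameter s s' (zs s')); auto | | apply Rle_refl ].
          -- eapply bnd_weaken; eauto. lra.
          -- intros j n. unfold sub. ring.
        * fold Cs. unfold K3. right. ring. }
  exists s0, (2 * K3 * (s0 + 1) + X0), (fun s => scl s (ansatz (zs s))), (fun s => speed (zs s)).
  assert (HKK : 2 * K3 <= 2 * K3 * (s0 + 1) + X0).
  { assert (0 <= K3 * s0) by (apply Rmult_le_pos; lra). lra. }
  assert (HKX : X0 <= 2 * K3 * (s0 + 1) + X0).
  { assert (0 <= K3 * s0) by (apply Rmult_le_pos; lra). lra. }
  split; auto. split; [ lra | ]. split; [ | split ].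
  - assert (H0 : Rabs 0 <= s0) by (rewrite Rabs_R0; lra).
    pose proof (bnd_coefficient d Hd _ _ true O (Hzs0 0 H0)) as H1. fold (speed (zs 0)) in H1.
    rewrite Rabs_R0, !Rmult_0_r in H1. apply Rabs_eq_0. pose proof (Rabs_pos (speed (zs 0))). lra.
  - intros s Hs. destruct (Hzs s Hs) as [H1 H2].
    assert (Hz1 : bnd d (zs s) 1) by (eapply bnd_weaken; eauto; lra).
    split; [ | split; [ | split ] ].
    + eapply bnd_weaken; [ apply bnd_scl, (ansatz_bnd _ 1); auto; lra | ].
      rewrite Rmult_comm. apply Rmult_le_compat_r; auto. apply Rabs_pos.
    + unfold scl. simpl. ring.
    + eapply bnd_weaken with (Rabs s * rho).
      * eapply sum_le_ext; [ | apply (bnd_scl d s _ _ H1) ].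
        intros [|n]; cbv beta; unfold scl; simpl ansatz.
        -- rewrite Rabs_R0. pose proof (kappa_ge_1 d Hd 0). pose proof (Rabs_pos (s * zs s true O)).
           pose proof (Rabs_pos (s * zs s false O)). nra.
        -- lra.
      * pose proof (Rabs_pos s). nra.
    + intros j n. destruct (Req_dec s 0) as [->|Hsn].
      * rewrite !scl_0, (proj1 HNA), (proj1 HNB). unfold zeros. ring.
      * pose proof (lsol_spec (sub (rem s (zs s)) (quad (zs s))) j n) as E.
        fold (fixmap s (zs s)) in E. rewrite H2 in E.
        unfold sub, rem, quad, rescaled in E.
        set (P := NA (scl s (ansatz (zs s))) j n) in *. set (Q := NB (scl s (ansatz (zs s))) j n) in *.
        assert (E' : P + (w1 - speed (zs s)) * Q = s * (lmat n j true * zs s true n + lmat n j false * zs s false n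
           + speed (zs s) * (INR (S n) * D j * perturbation (zs s) j n))).
        { rewrite E. field. auto. }
        rewrite E'. unfold scl. destruct n as [|n].
        -- unfold lmat, perturbation, ansatz, speed. pose proof (Hm0 j) as Hj.
           (* Since (1, 1) is in the kernel of the matrix of mode 0, only the deviation of the
              second component contributes. *)
           replace (m O j true) with (- m O j false) by lra. simpl INR. destruct j; ring.
        -- unfold lmat, perturbation, ansatz. ring.
  - intros s s' Hs Hs'. pose proof (HzL s s' Hs Hs') as HL1. split.
    + destruct (Hzs s' Hs') as [H1' _].
      eapply bnd_weaken; [ apply (bnd_add (scl s (sub (ansatz (zs s)) (ansatz (zs s')))) (scl (s - s') (ansatz (zs s')))) | ].
      * intros j n. unfold sub, scl. ring.
      * apply bnd_scl. rewrite ansatz_sub. apply perturbation_bnd. exact HL1.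
      * apply bnd_scl. apply (ansatz_bnd _ 1); [ lra | ]. eapply bnd_weaken; eauto. lra.
      * pose proof (Rabs_pos (s - s')) as HD0. rewrite Rmult_plus_distr_r, (Rmult_comm X0). apply Rplus_le_compat_r.
        replace (Rabs s * (2 * (K3 * Rabs (s - s')))) with (2 * K3 * Rabs s * Rabs (s - s')) by ring.
        apply Rmult_le_compat_r; auto. apply Rmult_le_compat_l; lra.
    + pose proof (bnd_coefficient d Hd _ _ true O HL1) as H1.
      change (sub (zs s) (zs s') true O) with (speed (zs s) - speed (zs s')) in H1.
      eapply Rle_trans; [ exact H1 | ]. rewrite <- Rmult_assoc. apply Rmult_le_compat_r; auto. apply Rabs_pos.
Qed.

End Bifurcation.

(** * The branch of solutions of the boundary equation *)

Lemma finite_lower_bound (u : nat -> R) (N : nat) : (forall n, 0 < u n) ->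
  exists c, 0 < c /\ forall n, (n < N)%nat -> c <= u n.
Proof.
  intros Hu. induction N as [|N [c [Hc HN]]].
  - exists 1. split; [ lra | intros; lia ].
  - exists (Rmin c (u N)). split; [ apply Rmin_pos; auto | ].
    intros n Hn. destruct (Nat.eq_dec n N) as [->|].
    + apply Rmin_r.
    + eapply Rle_trans; [ apply Rmin_l | apply HN; lia ].
Qed.

Section Branch.
Context (b1 b2 : R) (Hb2 : 0 < b2) (Hb12 : b2 < b1) (Hb1 : b1 < 1).

Definition lambda1 : R := 1 + b2 ^ 2 - b1 ^ 2.

Notation mm := (fun n j i => Mrow b1 b2 n lambda1 j i).
Notation lm := (lmat mm (rad b1 b2)).
Notation ld := (ldet mm (rad b1 b2)).

Lemma Mrow_tt (n : nat) (la : R) : Mrow b1 b2 n la true true =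
  b1 * (INR (S n) * la - 1 + b1 ^ (2 * S n) - INR (S n) * (b2 / b1) ^ 2).
Proof. unfold Mrow, M. rewrite coeff_mat_bij by lia. reflexivity. Qed.

Lemma Mrow_tf (n : nat) (la : R) : Mrow b1 b2 n la true false = b2 * ((b2 / b1) ^ S n - (b1 * b2) ^ S n).
Proof. unfold Mrow, M. rewrite coeff_mat_bij by lia. reflexivity. Qed.

Lemma Mrow_ft (n : nat) (la : R) : Mrow b1 b2 n la false true = - b1 * ((b2 / b1) ^ S n - (b1 * b2) ^ S n).
Proof. unfold Mrow, M. rewrite coeff_mat_bij by lia. reflexivity. Qed.

Lemma Mrow_ff (n : nat) (la : R) : Mrow b1 b2 n la false false =
  b2 * (INR (S n) * la - INR (S n) + 1 - b2 ^ (2 * S n)).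
Proof. unfold Mrow, M. rewrite coeff_mat_bij by lia. reflexivity. Qed.

Lemma Mrow_shift (n : nat) (la nu : R) (j i : bool) :
  Mrow b1 b2 n (la + nu) j i = Mrow b1 b2 n la j i + (if Bool.eqb i j then nu * INR (S n) * rad b1 b2 j else 0).
Proof.
  destruct j, i; rewrite ?Mrow_tt, ?Mrow_tf, ?Mrow_ft, ?Mrow_ff; cbn [Bool.eqb rad]; ring.
Qed.

(** For a general lambda, both row sums of M_1 are a radius times lambda - 1 + b1^2 - b2^2; this
    common factor is what singles out the value [lambda1]. *)
Lemma kernel_at_one (j : bool) : mm O j true + mm O j false = 0.
Proof. destruct j; rewrite ?Mrow_tt, ?Mrow_tf, ?Mrow_ft, ?Mrow_ff; unfold lambda1; simpl; field; lra. Qed.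

Lemma pow_unit (q : R) (n : nat) : 0 <= q <= 1 -> 0 <= q ^ n <= 1.
Proof. intros H. split; [ apply pow_le; lra | ]. rewrite <- (pow1 n). apply pow_incr. auto. Qed.

Lemma unit_facts : 0 < b2 / b1 < 1 /\ 0 < b1 * b2 < 1 /\ 0 < lambda1 < 1.
Proof.
  split; [ apply ratio_bounds; auto | ]. unfold lambda1. split; split; nra.
Qed.

Lemma Mrow_bound (n : nat) (j i : bool) : Rabs (mm n j i) <= 5 * INR (S n).
Proof.
  destruct unit_facts as [Hr [Hp Hl]].
  pose proof (pow_unit (b2 / b1) (S n) ltac:(lra)) as P1. pose proof (pow_unit (b1 * b2) (S n) ltac:(lra)) as P2.
  pose proof (pow_unit b1 (2 * S n) ltac:(lra)) as P3. pose proof (pow_unit b2 (2 * S n) ltac:(lra)) as P4.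
  pose proof (pow_unit (b2 / b1) 2 ltac:(lra)) as P5.
  assert (Hk : 1 <= INR (S n)) by (rewrite S_INR; pose proof (pos_INR n); lra).
  set (k := INR (S n)) in *.
  assert (G : forall b x, 0 <= b <= 1 -> Rabs x <= 5 * k -> Rabs (b * x) <= 5 * k).
  { intros b x Hb Hx. rewrite Rabs_mult, (Rabs_pos_eq b) by lra. pose proof (Rabs_pos x). nra. }
  assert (B1 : 0 <= k * lambda1 <= k) by nra.
  assert (B2 : 0 <= k * (b2 / b1) ^ 2 <= k) by nra.
  destruct j, i; rewrite ?Mrow_tt, ?Mrow_tf, ?Mrow_ft, ?Mrow_ff; fold k.
  - apply G; [ lra | ]. apply Rabs_le. lra.
  - apply G; [ lra | ]. apply Rabs_le. lra.
  - rewrite Ropp_mult_distr_l_reverse, Rabs_Ropp. apply G; [ lra | ]. apply Rabs_le. lra.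
  - apply G; [ lra | ]. apply Rabs_le. lra.
Qed.

Lemma lmat_bound (n : nat) (j i : bool) : Rabs (lm n j i) <= 5 * INR (S n).
Proof.
  destruct n as [|n]; [ | apply Mrow_bound ]. destruct i; [ | apply Mrow_bound ].
  simpl. pose proof (rad_bounds b1 b2 Hb2 Hb12 j). rewrite Rabs_pos_eq; lra.
Qed.

Context (HE : ~ exceptional_set b1 b2).

(** For n >= 1 the determinant is P_(n+1) at [lambda1], nonzero because b2 is not exceptional. For n
    = 0 it expresses transversality: the derivative in the speed is not in the range of M_1. *)
Lemma ldet_neq_0_branch (n : nat) : ld n <> 0.
Proof.
  destruct n as [|n]; unfold ldet, lmat.
  - rewrite Mrow_ff, Mrow_tf. unfold lambda1. simpl.
    match goal with |- ?x <> 0 =>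
      replace x with (b2 * (1 - b1 * b1) * (b1 * b1 - b2 * b2) / b1) by (field; lra) end.
    assert (0 < b2 * (1 - b1 * b1) * (b1 * b1 - b2 * b2) / b1); [ | lra ].
    apply Rdiv_lt_0_compat; [ | lra ]. repeat apply Rmult_lt_0_compat; nra.
  - intros H. apply HE. split; [ auto | ]. exists (S (S n)). split; [ lia | ]. exact H.
Qed.

(** For mode k the diagonal entries behave like b1 A k and - b2 B k with A, B > 0, while the
    off-diagonal ones stay bounded; the determinant is therefore of order k^2. *)
Lemma ldet_asymptotics : exists c N, 0 < c /\ forall n, (N <= n)%nat -> c * (INR (S n) * INR (S n)) <= Rabs (ld n).
Proof.
  destruct unit_facts as [Hr [Hp Hl]].
  set (A := lambda1 - (b2 / b1) ^ 2).
  assert (HA : 0 < A).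
  { unfold A, lambda1. replace (1 + b2 ^ 2 - b1 ^ 2 - (b2 / b1) ^ 2) with ((1 - b1 * b1) * (1 - b2 / b1 * (b2 / b1))) by (field; lra).
    apply Rmult_lt_0_compat; nra. }
  set (B := b1 * b1 - b2 * b2). assert (HB : 0 < B) by (unfold B; nra).
  exists (b1 * b2 * A * B / 8).
  (* Beyond this N, x = k A and y = k B are at least 2 and x y is at least 8, so (x - 1)(y - 1) - 1
     >= x y / 4 - 1 >= x y / 8. *)
  destruct (nfloor_ex (2 / A + 2 / B + 8 / (A * B) + 1)) as [N [_ HN]].
  { assert (0 < 2 / A) by (apply Rdiv_lt_0_compat; lra). assert (0 < 2 / B) by (apply Rdiv_lt_0_compat; lra).
    assert (0 < 8 / (A * B)) by (apply Rdiv_lt_0_compat; [ lra | apply Rmult_lt_0_compat; auto ]). lra. }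
  exists (S N). split.
  { assert (0 < b1 * b2 * A * B) by (repeat apply Rmult_lt_0_compat; lra). lra. }
  intros [|n] Hn; [ lia | ].
  assert (Hk : INR N + 1 <= INR (S (S n))) by (rewrite <- S_INR; apply le_INR; lia).
  unfold ldet, lmat. rewrite Mrow_tt, Mrow_tf, Mrow_ft, Mrow_ff.
  pose proof (pow_unit (b2 / b1) (S (S n)) ltac:(lra)) as P1. pose proof (pow_unit (b1 * b2) (S (S n)) ltac:(lra)) as P2.
  pose proof (pow_unit b1 (2 * S (S n)) ltac:(lra)) as P3. pose proof (pow_unit b2 (2 * S (S n)) ltac:(lra)) as P4.
  set (k := INR (S (S n))) in *. set (p1 := (b2 / b1) ^ S (S n)) in *. set (p2 := (b1 * b2) ^ S (S n)) in *.
  set (p3 := b1 ^ (2 * S (S n))) in *. set (p4 := b2 ^ (2 * S (S n))) in *.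
  assert (I1 : 0 < 2 / A) by (apply Rdiv_lt_0_compat; lra). assert (I2 : 0 < 2 / B) by (apply Rdiv_lt_0_compat; lra).
  assert (I3 : 0 < 8 / (A * B)) by (apply Rdiv_lt_0_compat; [ lra | apply Rmult_lt_0_compat; auto ]).
  assert (K1 : 2 <= k * A).
  { replace 2 with (2 / A * A) by (field; lra). apply Rmult_le_compat_r; lra. }
  assert (K2 : 2 <= k * B).
  { replace 2 with (2 / B * B) by (field; lra). apply Rmult_le_compat_r; lra. }
  assert (K3 : 8 <= (k * A) * (k * B)).
  { assert (H8 : 8 <= k * (A * B)).
    { replace 8 with (8 / (A * B) * (A * B)) by (field; split; lra).
      apply Rmult_le_compat_r; [ apply Rlt_le, Rmult_lt_0_compat; auto | lra ]. }
    assert (1 <= k) by lra. replace (k * A * (k * B)) with (k * (k * (A * B))) by ring. nra. }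
  set (x := k * A) in *. set (y := k * B) in *.
  match goal with |- _ <= Rabs ?z => replace z with (- (b1 * b2 * ((x - 1 + p3) * (y - 1 + p4) - (p1 - p2) * (p1 - p2)))) end.
  2: { unfold x, y, A, B, lambda1. ring. }
  rewrite Rabs_Ropp. eapply Rle_trans; [ | apply Rle_abs ].
  replace (b1 * b2 * A * B / 8 * (k * k)) with (b1 * b2 * (x * y / 8)) by (unfold x, y; field).
  apply Rmult_le_compat_l; [ lra | ].
  assert (x / 2 * (y / 2) <= (x - 1 + p3) * (y - 1 + p4)) by (apply Rmult_le_compat; lra).
  assert ((p1 - p2) * (p1 - p2) <= 1) by nra. lra.
Qed.

Lemma ldet_lower_bound : exists c, 0 < c /\ forall n, c * (INR (S n) * INR (S n)) <= Rabs (ld n).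
Proof.
  destruct ldet_asymptotics as [c [N [Hc H]]].
  assert (Hp : forall n, 0 < INR (S n) * INR (S n)).
  { intros n. pose proof (lt_0_INR (S n) ltac:(lia)). apply Rmult_lt_0_compat; auto. }
  destruct (finite_lower_bound (fun n => Rabs (ld n) / (INR (S n) * INR (S n))) N) as [c' [Hc' H']].
  { intros n. apply Rdiv_lt_0_compat; auto. apply Rabs_pos_lt, ldet_neq_0_branch. }
  exists (Rmin c c'). split; [ apply Rmin_pos; auto | ]. intros n. specialize (Hp n).
  destruct (le_lt_dec N n) as [Hn|Hn].
  - eapply Rle_trans; [ | apply (H n Hn) ]. apply Rmult_le_compat_r; [ lra | apply Rmin_l ].
  - specialize (H' n Hn). apply (Rmult_le_compat_r (INR (S n) * INR (S n))) in H'; [ | lra ].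
    unfold Rdiv in H'. rewrite Rmult_assoc, Rinv_l, Rmult_1_r in H' by lra.
    eapply Rle_trans; [ | exact H' ]. apply Rmult_le_compat_r; [ lra | apply Rmin_r ].
Qed.

Lemma exists_weight : exists d, 0 < d /\ b2 / b1 * (1 + 2 * d) < 1 /\ b1 * b1 * (1 + 2 * d) < 1.
Proof.
  destruct unit_facts as [Hr [Hp Hl]].
  exists (Rmin ((1 - b2 / b1) / 4) ((1 - b1 * b1) / 4)).
  pose proof (Rmin_l ((1 - b2 / b1) / 4) ((1 - b1 * b1) / 4)) as M1.
  pose proof (Rmin_r ((1 - b2 / b1) / 4) ((1 - b1 * b1) / 4)) as M2.
  assert (H0 : 0 < Rmin ((1 - b2 / b1) / 4) ((1 - b1 * b1) / 4)) by (apply Rmin_pos; nra).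
  set (x := Rmin _ _) in *. split; auto. split; nra.
Qed.

(** Joins the outer and inner components, obtained separately, into one remainder acting on pairs of
    sequences, with common constants. *)
Lemma combine_rows (d : R) (E : seqs -> bool -> tfun) (al be : bool -> bool -> nat -> R) : 0 < d ->
  (forall j, exists c a, nicec d (fun x => E x j) (fun _ _ => RtoC a) c /\
    forall i n t u, c i n t u = (al j i n * e (Z.of_nat (S n)) t + be j i n * e (- Z.of_nat (S n)) t)%C) ->
  exists L r, 0 < L /\ 0 < r /\
    (forall x A, A <= r -> bnd d x A -> forall j, wiener d (E x j) L) /\
    quadratic d (fun x j n => ycoef (E x j) n - row (al j) (be j) x n) L r.
Proof.
  intros Hd H.
  assert (G : forall j, exists L r, 0 < L /\ 0 < r /\
    (forall x A, A <= r -> bnd d x A -> wiener d (E x j) L) /\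
    (forall n, ycoef (E zeros j) n = 0) /\
    (forall x y A ee, A <= r -> bnd d x A -> bnd d y A -> bnd d (sub x y) ee ->
       sum_le (fun n => (1 + d * INR (S n)) *
         Rabs ((ycoef (E x j) n - row (al j) (be j) x n) - (ycoef (E y j) n - row (al j) (be j) y n))) (L * A * ee))).
  { intros j. destruct (H j) as [c [a [Hn Hc]]].
    apply (nicec_coefficients d Hd (fun x => E x j) _ c (al j) (be j) a Hn); auto. }
  destruct (G true) as [L1 [r1 [HL1 [Hr1 [W1 [Z1 Q1]]]]]]. destruct (G false) as [L2 [r2 [HL2 [Hr2 [W2 [Z2 Q2]]]]]].
  exists (L1 + L2), (Rmin r1 r2). split; [ lra | ]. split; [ apply Rmin_pos; auto | ].
  pose proof (Rmin_l r1 r2). pose proof (Rmin_r r1 r2).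
  split; [ | split ].
  - intros x A HA Hx [|]; eapply wiener_weaken; [ apply (W1 x A) | | apply (W2 x A) | ]; auto; lra.
  - intros [|] n; rewrite ?Z1, ?Z2; unfold row, zeros; ring.
  - intros x y A ee HA Hx Hy Hxy.
    specialize (Q1 x y A ee ltac:(lra) Hx Hy Hxy). specialize (Q2 x y A ee ltac:(lra) Hx Hy Hxy).
    eapply sum_le_ext; [ | replace ((L1 + L2) * A * ee) with (L1 * A * ee + L2 * A * ee) by ring; apply (sum_le_plus _ _ _ _ Q1 Q2) ].
    intros n. cbv beta. unfold sub. rewrite <- Rmult_plus_distr_l. lra.
Qed.

Lemma vortex_branch : exists d a K (xs : R -> seqs) (Om : R -> R),
  0 < d /\ 0 < a /\ 0 <= K /\ Om 0 = (b1 ^ 2 - b2 ^ 2) / 2 /\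
  b2 / b1 * (1 + 2 * d) < 1 /\ b1 * b1 * (1 + 2 * d) < 1 /\
  (forall s, Rabs s <= a ->
     bnd d (xs s) (K * Rabs s) /\ xs s true O = s /\
     bnd d (fun j n => match n with O => 0 | S _ => xs s j n end) (Rabs s / 2) /\
     forall j t, Im (Aop b1 b2 (xs s) j t 0 + RtoC (2 * Om s) * Bop b1 b2 (xs s) j t 0) = 0) /\
  (forall s s', Rabs s <= a -> Rabs s' <= a ->
     bnd d (sub (xs s) (xs s')) (K * Rabs (s - s')) /\ Rabs (Om s - Om s') <= K * Rabs (s - s')).
Proof.
  destruct exists_weight as [d [Hd [Hq1 Hq2]]].
  destruct (combine_rows d (Aop b1 b2) (fun j => alA b1 b2 j) (fun j => beA b1 b2 j) Hd
    (nicec_A d b1 b2 Hd Hb2 Hb12 Hb1 Hq1 Hq2)) as [LA [rA [HLA [HrA [WA QA]]]]].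
  destruct (combine_rows d (Bop b1 b2) (fun j => alB b1 b2 j) (fun j => beB b1 b2 j) Hd
    (nicec_B d b1 b2 Hd)) as [LB [rB [HLB [HrB [WB QB]]]]].
  set (r := Rmin rA rB). assert (Hr : 0 < r) by (apply Rmin_pos; auto).
  assert (HrA' : r <= rA) by apply Rmin_l. assert (HrB' : r <= rB) by apply Rmin_r.
  assert (QM : forall N L L' r0, L <= L' -> r <= r0 -> quadratic d N L r0 -> quadratic d N L' r).
  { intros N L L' r0 HL Hr0 [H1 H2]. split; auto. intros x y A ee HA Hx Hy Hxy.
    eapply ybnd_weaken; [ apply (H2 x y A ee); auto; lra | ].
    pose proof (bnd_nonneg d _ _ Hx). pose proof (bnd_nonneg d _ _ Hxy).
    apply Rmult_le_compat_r; auto. apply Rmult_le_compat_r; auto. }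
  apply (QM _ _ (LA + LB)) in QA; [ | lra | auto ]. apply (QM _ _ (LA + LB)) in QB; [ | lra | auto ].
  destruct ldet_lower_bound as [c0 [Hc0 Hdet]].
  destruct (bifurcation d Hd mm (rad b1 b2) (b1 ^ 2 - b2 ^ 2) _ _ (LA + LB) r ltac:(lra) Hr QA QB kernel_at_one
     ltac:(intros j; pose proof (rad_bounds b1 b2 Hb2 Hb12 j); lra) 5 c0 ltac:(lra) Hc0 lmat_bound Hdet)
    as [s0 [K [xs [nu [Hs0 [HK [Hnu [HX HL]]]]]]]].
  (* The speed is recovered from 2 Omega = w1 - nu; the bound r/(K + 1) keeps the coefficients in
     the ball where [Aop] and [Bop] have a Wiener bound. *)
  exists d, (Rmin s0 (r / (K + 1))), K, xs, (fun s => (b1 ^ 2 - b2 ^ 2 - nu s) / 2).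
  assert (Ha : 0 < Rmin s0 (r / (K + 1))) by (apply Rmin_pos; auto; apply Rdiv_lt_0_compat; lra).
  pose proof (Rmin_l s0 (r / (K + 1))) as M1. pose proof (Rmin_r s0 (r / (K + 1))) as M2.
  set (a := Rmin s0 (r / (K + 1))) in *.
  split; auto. split; auto. split; auto. split; [ rewrite Hnu; field | ]. split; auto. split; auto. split.
  - intros s Hs. destruct (HX s ltac:(lra)) as [X1 [X2 [X3 X4]]].
    split; auto. split; auto. split; auto. intros j t.
    set (Om := (b1 ^ 2 - b2 ^ 2 - nu s) / 2).
    assert (HKs : K * Rabs s <= r).
    { assert (H : Rabs s <= r / (K + 1)) by lra. apply (Rmult_le_compat_l K) in H; auto.
      eapply Rle_trans; [ exact H | ]. apply (Rmult_le_reg_r (K + 1)); [ lra | ]. field_simplify; [ nra | lra ]. }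
    pose proof (WA (xs s) _ (Rle_trans _ _ _ HKs HrA') X1 j) as VA.
    pose proof (WB (xs s) _ (Rle_trans _ _ _ HKs HrB') X1 j) as VB.
    pose proof (wiener_add d _ _ _ _ VA (wiener_scal d _ _ (2 * Om) VB)) as V.
    (* It suffices to cancel the sine coefficients, which is what the abstract bifurcation result
       provides. *)
    apply (Im_eq_0 d Hd _ _ V). intros n.
    rewrite (ycoef_plus d Hd _ (fun t u => RtoC (2 * Om) * Bop b1 b2 (xs s) j t u)%C _ _ n VA (wiener_scal d _ _ (2 * Om) VB)).
    rewrite (ycoef_scal d Hd _ LB _ n VB).
    specialize (X4 j n). pose proof (row_M b1 b2 Hb2 Hb12 Om j (xs s) n) as RM.
    replace (1 - 2 * Om) with (lambda1 + nu s) in RM by (unfold Om, lambda1; field).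
    rewrite !Mrow_shift in RM.
    assert (E : b1 ^ 2 - b2 ^ 2 - nu s = 2 * Om) by (unfold Om; field). rewrite E in X4.
    destruct j; cbn [Bool.eqb rad] in *; lra.
  - intros s s' Hs Hs'. destruct (HL s s' ltac:(lra) ltac:(lra)) as [L1 L2]. split; auto.
    replace ((b1 ^ 2 - b2 ^ 2 - nu s) / 2 - (b1 ^ 2 - b2 ^ 2 - nu s') / 2) with (- / 2 * (nu s - nu s')) by field.
    rewrite Rabs_mult, Rabs_Ropp, (Rabs_pos_eq (/ 2)) by lra. pose proof (Rabs_pos (nu s - nu s')). lra.
Qed.

End Branch.

(** * Regularity of the boundary parametrizations *)

Lemma sum_le_shrink (x : seqs) (d A : R) (j : bool) (g : nat -> R) (K : R) : 0 < d -> 0 <= K ->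
  (forall n, Rabs (g n) <= K * kappa d n) -> bnd d x A ->
  sum_le (fun n => Rabs (x j n) * Rabs (g n)) (K * A).
Proof.
  intros Hd HK Hg Hx.
  eapply sum_le_ext; [ | apply (sum_le_scal _ _ K HK (bnd_component d Hd x A j Hx)) ].
  intros n. cbv beta. specialize (Hg n). pose proof (Rabs_pos (x j n)).
  replace (K * (kappa d n * Rabs (x j n))) with (Rabs (x j n) * (K * kappa d n)) by ring.
  apply Rmult_le_compat_l; auto.
Qed.

Lemma Csum_weighted (x : seqs) (d A : R) (j : bool) (g : nat -> C) (K : R) : 0 < d -> 0 <= K ->
  (forall n, Cmod (g n) <= K * kappa d n) -> bnd d x A ->
  Csum (fun n => x j n * g n)%C (Cser (fun n => x j n * g n)%C) /\ Cmod (Cser (fun n => x j n * g n)%C) <= K * A.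
Proof.
  intros Hd HK Hg Hx.
  assert (Hs : sum_le (fun n => Rabs (x j n) * Rabs (Cmod (g n))) (K * A)).
  { apply (sum_le_shrink x d A j (fun n => Cmod (g n)) K); auto.
    intros n. rewrite Rabs_pos_eq; auto. apply Cmod_ge_0. }
  assert (Hm : forall n, Cmod (x j n * g n) <= Rabs (x j n) * Rabs (Cmod (g n))).
  { intros n. rewrite Cmod_mult, Cmod_R. apply Rmult_le_compat_l; [ apply Rabs_pos | apply Rle_abs ]. }
  split; [ exact (Csum_Cser _ _ _ Hm Hs) | exact (Cser_bound _ _ _ Hm Hs) ].
Qed.

Lemma Cser_weighted_combination (x : seqs) (d A : R) (j : bool) (f g h : nat -> C) (c : C) (Kf Kg Kh : R) :
  0 < d -> 0 <= Kf -> 0 <= Kg -> 0 <= Kh ->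
  (forall n, Cmod (f n) <= Kf * kappa d n) -> (forall n, Cmod (g n) <= Kg * kappa d n) ->
  (forall n, Cmod (h n) <= Kh * kappa d n) -> bnd d x A ->
  (Cser (fun n => x j n * f n) - Cser (fun n => x j n * g n) - c * Cser (fun n => x j n * h n))%C =
  Cser (fun n => x j n * (f n - g n - c * h n))%C.
Proof.
  intros Hd HKf HKg HKh Hf Hg Hh Hx. symmetry. apply Cser_unique.
  destruct (Csum_weighted x d A j f Kf Hd HKf Hf Hx) as [S1 _].
  destruct (Csum_weighted x d A j g Kg Hd HKg Hg Hx) as [S2 _].
  destruct (Csum_weighted x d A j h Kh Hd HKh Hh Hx) as [S3 _].
  replace (Cser (fun n => x j n * f n) - Cser (fun n => x j n * g n) - c * Cser (fun n => x j n * h n))%C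
    with ((Cser (fun n => x j n * f n) + - (1) * Cser (fun n => x j n * g n)) + - c * Cser (fun n => x j n * h n))%C by ring.
  eapply Csum_ext; [ | apply (Csum_plus _ _ _ _ (Csum_plus _ _ _ _ S1 (Csum_scal (- (1))%C _ _ S2)) (Csum_scal (- c)%C _ _ S3)) ].
  intros n. cbv beta. ring.
Qed.

Lemma kappa_bounds (d : R) (n : nat) : 0 < d ->
  1 <= 1 * kappa d n /\ INR n <= 1 * kappa d n /\ INR n * INR (S n) <= / d * kappa d n.
Proof.
  intros Hd. unfold kappa. rewrite S_INR. pose proof (pos_INR n).
  assert (H1 : 0 <= d * (INR n + 1)) by (apply Rmult_le_pos; lra).
  assert (H2 : INR n + 1 <= (INR n + 1) * (1 + d * (INR n + 1))) by nra.
  repeat split; try lra.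
  replace (/ d * ((INR n + 1) * (1 + d * (INR n + 1)))) with ((INR n + 1) * (/ d + (INR n + 1))) by (field; lra).
  pose proof (Rinv_0_lt_compat d Hd). nra.
Qed.

Lemma cis_taylor (x : R) : Cmod (cis x - 1 - Ci * x) <= 2 * (x * x).
Proof.
  assert (Hc : forall y, 0 <= 1 - cos y <= y * y / 2 /\ 1 - cos y <= Rabs y).
  { intros y. pose proof (COS_bound y). split; [ split; [ lra | ] | ].
    - replace y with (2 * (y / 2)) at 1 by field. rewrite cos_2a_sin.
      pose proof (cis_diff_le (y / 2) 0) as H1. rewrite cis_0, Rminus_0_r in H1.
      pose proof (im_le_Cmod (cis (y / 2) - 1)) as H2.
      replace (Im (cis (y / 2) - 1)) with (sin (y / 2)) in H2 by (simpl; ring).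
      assert (H3 : Rabs (sin (y / 2)) <= Rabs (y / 2)) by lra.
      apply Rsqr_le_abs_1 in H3. unfold Rsqr in H3. nra.
    - pose proof (cis_diff_le y 0) as H1. rewrite cis_0, Rminus_0_r in H1.
      pose proof (re_le_Cmod (cis y - 1)) as H2.
      replace (Re (cis y - 1)) with (cos y - 1) in H2 by (simpl; ring).
      rewrite Rabs_minus_sym in H2. pose proof (Rle_abs (1 - cos y)). lra. }
  assert (Hs : Rabs (sin x - x) <= x * x).
  { destruct (MVT_gen (fun y => sin y - y) 0 x (fun y => cos y - 1)) as [c [Hc1 Hc2]].
    - intros y _. auto_derive; auto. ring.
    - intros y _. apply continuity_pt_minus; [ apply continuity_sin | apply derivable_continuous_pt, derivable_pt_id ].
    - rewrite sin_0, !Rminus_0_r in Hc2. rewrite Hc2, Rabs_mult.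
      assert (Rabs c <= Rabs x).
      { unfold Rmin, Rmax in Hc1. destruct (Rle_dec 0 x); unfold Rabs; destruct (Rcase_abs c), (Rcase_abs x); lra. }
      destruct (Hc c) as [_ Hc3]. rewrite Rabs_minus_sym, Rabs_pos_eq by (apply Hc).
      replace (x * x) with (Rabs x * Rabs x) by (rewrite <- Rabs_mult; apply Rabs_pos_eq; nra).
      apply Rmult_le_compat_r; [ apply Rabs_pos | lra ]. }
  eapply Rle_trans; [ apply Cmod_le_re_im | ].
  replace (Re (cis x - 1 - Ci * x)) with (- (1 - cos x)) by (simpl; ring).
  replace (Im (cis x - 1 - Ci * x)) with (sin x - x) by (simpl; ring).
  destruct (Hc x) as [[H1 H2] _]. rewrite Rabs_Ropp, Rabs_pos_eq by auto. nra.
Qed.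

Lemma e_taylor (m : Z) (s t : R) : Cmod (e m s - e m t - (s - t) * (Ci * IZR m * e m t)) <= 2 * (IZR m * IZR m) * ((s - t) * (s - t)).
Proof.
  replace (e m s - e m t - (s - t) * (Ci * IZR m * e m t))%C with (e m t * (cis (IZR m * (s - t)) - 1 - Ci * (IZR m * (s - t))%R))%C.
  - rewrite Cmod_mult, Cmod_e, Rmult_1_l. eapply Rle_trans; [ apply cis_taylor | ]. right. ring.
  - rewrite RtoC_mult, RtoC_minus. unfold e. replace (IZR m * s) with (IZR m * t + IZR m * (s - t)) by ring.
    rewrite cis_plus. ring.
Qed.

(** A global quadratic remainder adds up over the modes, which replaces termwise differentiation of
    series. *)
Lemma is_derive_of_quadratic (h : R -> R) (t l K : R) : 0 <= K ->
  (forall s, Rabs (h s - h t - (s - t) * l) <= K * ((s - t) * (s - t))) -> is_derive h t l.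
Proof.
  intros HK H. apply is_derive_Reals. intros eps He.
  exists (mkposreal (eps / (K + 1)) ltac:(apply Rdiv_lt_0_compat; lra)).
  intros k Hk Hk2. simpl in Hk2. specialize (H (t + k)).
  replace (t + k - t) with k in H by ring.
  replace ((h (t + k) - h t) / k - l) with ((h (t + k) - h t - k * l) / k) by (field; auto).
  unfold Rdiv. rewrite Rabs_mult, Rabs_inv. pose proof (Rabs_pos_lt k Hk) as Hp.
  apply (Rmult_lt_reg_r (Rabs k)); auto. rewrite Rmult_assoc, Rinv_l, Rmult_1_r by lra.
  eapply Rle_lt_trans; [ exact H | ].
  replace (k * k) with (Rabs k * Rabs k) by (rewrite <- Rabs_mult; apply Rabs_pos_eq; nra).
  rewrite <- Rmult_assoc. apply Rmult_lt_compat_r; auto.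
  apply (Rmult_lt_compat_l (K + 1)) in Hk2; [ | lra ].
  replace ((K + 1) * (eps / (K + 1))) with eps in Hk2 by (field; lra). nra.
Qed.

Lemma curve_derive_of_quadratic (g : R -> C) (t : R) (l : C) (K : R) : 0 <= K ->
  (forall s, Cmod (g s - g t - (s - t) * l) <= K * ((s - t) * (s - t))) ->
  @ex_derive R_AbsRing C_R_NormedModule g t /\ curve_derive g t = l.
Proof.
  intros HK H.
  assert (H1 : is_derive (fun s => Re (g s)) t (Re l)).
  { apply is_derive_of_quadratic with K; auto. intros s.
    eapply Rle_trans; [ | apply (H s) ]. eapply Rle_trans; [ | apply re_le_Cmod ].
    right. f_equal. unfold Re, Im. simpl. ring. }
  assert (H2 : is_derive (fun s => Im (g s)) t (Im l)).
  { apply is_derive_of_quadratic with K; auto. intros s.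
    eapply Rle_trans; [ | apply (H s) ]. eapply Rle_trans; [ | apply im_le_Cmod ].
    right. f_equal. unfold Re, Im. simpl. ring. }
  split.
  - exists l. split.
    + apply is_linear_scal_l.
    + intros x0 Hx0. pose proof (is_filter_lim_locally_unique (V := AbsRing_NormedModule R_AbsRing) _ _ Hx0) as Ex. subst x0. intros [eps He].
      exists (mkposreal (eps / (K + 1)) ltac:(apply Rdiv_lt_0_compat; lra)).
      intros y Hy. simpl in Hy. unfold ball in Hy; simpl in Hy. unfold AbsRing_ball in Hy.
      unfold abs, minus, plus, opp in Hy; simpl in Hy. rewrite <- Cmod_norm.
      change (Cmod (g y - g t - scal (minus y t) l) <= eps * Rabs (y - t)).
      replace (scal (minus y t) l : C) with ((y - t)%R * l)%C.
      * rewrite RtoC_minus. eapply Rle_trans; [ apply H | ].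
        replace ((y - t) * (y - t)) with (Rabs (y - t) * Rabs (y - t)) by (rewrite <- Rabs_mult; apply Rabs_pos_eq, Rle_0_sqr).
        rewrite <- Rmult_assoc. apply Rmult_le_compat_r; [ apply Rabs_pos | ].
        assert (Hy' : (K + 1) * Rabs (y - t) < eps).
        { apply (Rmult_lt_compat_l (K + 1)) in Hy; [ | lra ].
          replace ((K + 1) * (eps / (K + 1))) with eps in Hy by (field; lra). exact Hy. }
        pose proof (Rabs_pos (y - t)) as Hyp. revert Hy' Hyp. generalize (Rabs (y - t)). intros q Hy' Hyp. simpl. nra.
      * apply injective_projections; unfold scal, minus, plus, opp; simpl; unfold scal, mult; simpl; unfold mult; simpl; ring.
  - apply injective_projections; [ exact (is_derive_unique _ _ _ H1) | exact (is_derive_unique _ _ _ H2) ].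
Qed.

Section Regularity.
Context (d : R) (Hd : 0 < d) (x : seqs) (A : R) (Hx : bnd d x A) (j : bool).

Lemma A_nonneg : 0 <= A. Proof. apply (bnd_nonneg d x A Hx). Qed.

(** Mode n has remainder at most 2 n^2 (s - t)^2, and n^2 is at most [kappa d n] / d. *)
Lemma fser_taylor (s t : R) :
  Cmod (fser x j s - fser x j t - (s - t) * (Ci * fsser x j t)) <= 2 / d * A * ((s - t) * (s - t)).
Proof.
  assert (Hi : 0 < / d) by (apply Rinv_0_lt_compat; auto).
  assert (B1 : forall t n, Cmod (e (- Z.of_nat n) t) <= 1 * kappa d n).
  { intros t0 n. rewrite Cmod_e. apply kappa_bounds; auto. }
  assert (B2 : forall n, Cmod (RtoC (- INR n) * e (- Z.of_nat n) t) <= 1 * kappa d n).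
  { intros n. rewrite Cmod_mult, Cmod_e, Cmod_R, Rabs_Ropp, Rabs_pos_eq, Rmult_1_r by apply pos_INR.
    apply kappa_bounds; auto. }
  unfold fser, fsser.
  replace ((s - t) * (Ci * Cser (fun n => x j n * (RtoC (- INR n) * e (- Z.of_nat n) t))))%C with
    (((s - t) * Ci) * Cser (fun n => x j n * (RtoC (- INR n) * e (- Z.of_nat n) t)))%C by ring.
  rewrite (Cser_weighted_combination x d A j _ _ _ ((s - t) * Ci)%C 1 1 1 Hd Rle_0_1 Rle_0_1 Rle_0_1 (B1 s) (B1 t) B2 Hx).
  set (h2 := (s - t) * (s - t)). assert (Hh : 0 <= h2) by apply Rle_0_sqr.
  replace (2 / d * A * h2) with (2 * h2 * / d * A) by (field; lra).
  apply (Csum_weighted x d A j); auto.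
  - apply Rmult_le_pos; lra.
  - intros n. replace ((s - t) * Ci * (RtoC (- INR n) * e (- Z.of_nat n) t))%C with
      ((s - t) * (Ci * IZR (- Z.of_nat n) * e (- Z.of_nat n) t))%C by (rewrite opp_IZR, <- INR_IZR_INZ; ring).
    eapply Rle_trans; [ apply e_taylor | ]. fold h2. rewrite opp_IZR, <- INR_IZR_INZ.
    destruct (kappa_bounds d n Hd) as [_ [_ H3]]. rewrite S_INR in H3. pose proof (pos_INR n).
    replace (2 * (- INR n * - INR n) * h2) with (2 * h2 * (INR n * INR n)) by ring.
    rewrite (Rmult_assoc (2 * h2) (/ d)). apply Rmult_le_compat_l; [ lra | ]. nra.
Qed.

(** The complex derivative f'(w), the sum of - n a_n w^(-n-1). *)
Definition fderiv (t : R) : C := Cser (fun n => x j n * (RtoC (- INR n) * e (- Z.of_nat (S n)) t))%C.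

Lemma fderiv_spec (t : R) : (fderiv t * cis t)%C = fsser x j t.
Proof.
  unfold fderiv, fsser. symmetry. apply Cser_unique.
  assert (B : forall n, Cmod (RtoC (- INR n) * e (- Z.of_nat (S n)) t) <= 1 * kappa d n).
  { intros n. rewrite Cmod_mult, Cmod_e, Cmod_R, Rabs_Ropp, Rabs_pos_eq, Rmult_1_r by apply pos_INR.
    apply kappa_bounds; auto. }
  destruct (Csum_weighted x d A j _ 1 Hd Rle_0_1 B Hx) as [HS _].
  rewrite Cmult_comm. eapply Csum_ext; [ | apply (Csum_scal (cis t) _ _ HS) ].
  intros n. cbv beta. replace (e (- Z.of_nat n) t) with (e 1 t * e (- Z.of_nat (S n)) t)%C.
  - rewrite e_1. ring.
  - rewrite e_add. f_equal. lia.
Qed.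

Lemma fderiv_bound (t : R) : Cmod (fderiv t) <= A.
Proof.
  rewrite <- (Rmult_1_l A). apply (Csum_weighted x d A j _ 1 Hd Rle_0_1); auto.
  intros n. rewrite Cmod_mult, Cmod_e, Cmod_R, Rabs_Ropp, Rabs_pos_eq, Rmult_1_r by apply pos_INR.
  apply kappa_bounds; auto.
Qed.

Lemma e_chord (n : nat) (t u : R) : Cmod (e (- Z.of_nat n) t - e (- Z.of_nat n) u) <= INR n * Cmod (cis t - cis u).
Proof.
  assert (E : forall s, e (- Z.of_nat n) s = (Cconj (cis s) ^ n)%C).
  { intros s. rewrite <- cis_opp, <- cis_INR. unfold e. rewrite opp_IZR, <- INR_IZR_INZ. f_equal. ring. }
  rewrite !E. eapply Rle_trans; [ apply Cpow_diff_le; rewrite Cmod_conj_cis; lra | ].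
  right. f_equal. rewrite <- (Cmod_conj (cis t - cis u)). f_equal.
  unfold Cconj, Cminus, Cplus, Copp. simpl. f_equal. ring.
Qed.

Lemma fderiv_lipschitz (t u : R) : Cmod (fderiv t - fderiv u) <= / d * A * Cmod (cis t - cis u).
Proof.
  assert (Hi : 0 < / d) by (apply Rinv_0_lt_compat; auto).
  assert (B : forall t n, Cmod (RtoC (- INR n) * e (- Z.of_nat (S n)) t) <= 1 * kappa d n).
  { intros t0 n. rewrite Cmod_mult, Cmod_e, Cmod_R, Rabs_Ropp, Rabs_pos_eq, Rmult_1_r by apply pos_INR.
    apply kappa_bounds; auto. }
  replace (fderiv t - fderiv u)%C with (fderiv t - fderiv u - 0 * fderiv u)%C by ring.
  unfold fderiv. rewrite (Cser_weighted_combination x d A j _ _ _ 0%C 1 1 1 Hd Rle_0_1 Rle_0_1 Rle_0_1 (B t) (B u) (B u) Hx).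
  pose proof (Cmod_ge_0 (cis t - cis u)) as Hc.
  replace (/ d * A * Cmod (cis t - cis u)) with ((Cmod (cis t - cis u) * / d) * A) by ring.
  apply (Csum_weighted x d A j); auto.
  - apply Rmult_le_pos; lra.
  - intros n.
    replace (RtoC (- INR n) * e (- Z.of_nat (S n)) t - RtoC (- INR n) * e (- Z.of_nat (S n)) u
       - 0 * (RtoC (- INR n) * e (- Z.of_nat (S n)) u))%C with
      (RtoC (- INR n) * (e (- Z.of_nat (S n)) t - e (- Z.of_nat (S n)) u))%C by ring.
    rewrite Cmod_mult, Cmod_R, Rabs_Ropp, Rabs_pos_eq by apply pos_INR.
    pose proof (e_chord (S n) t u) as H. destruct (kappa_bounds d n Hd) as [_ [_ H3]]. pose proof (pos_INR n).
    apply Rle_trans with (INR n * (INR (S n) * Cmod (cis t - cis u))).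
    + apply Rmult_le_compat_l; auto.
    + rewrite <- Rmult_assoc, (Rmult_comm _ (Cmod _)), Rmult_assoc. apply Rmult_le_compat_l; auto.
Qed.

Lemma fser_bound (t : R) : Cmod (fser x j t) <= A.
Proof.
  rewrite <- (Rmult_1_l A). apply (Csum_weighted x d A j _ 1 Hd Rle_0_1); auto.
  intros n. rewrite Cmod_e. apply kappa_bounds; auto.
Qed.

Lemma Lub_Rbar_bounded (P : R -> Prop) (B : R) : (exists r, P r) -> (forall r, P r -> 0 <= r <= B) ->
  is_finite (Lub_Rbar P) /\ 0 <= real (Lub_Rbar P) <= B.
Proof.
  intros [r0 Hr0] HB. destruct (Lub_Rbar_correct P) as [H1 H2].
  assert (U : Rbar_le (Lub_Rbar P) B) by (apply H2; intros r Hr; simpl; apply HB; auto).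
  pose proof (H1 r0 Hr0) as L. specialize (HB r0 Hr0).
  destruct (Lub_Rbar P) as [l| |]; simpl in *; try contradiction.
  split; [ reflexivity | lra ].
Qed.

Lemma Rpower_ratio_le (rho al : R) : 0 < al < 1 -> 0 < rho <= 2 -> 0 < rho / Rpower rho al <= 2.
Proof.
  intros Hal Hrho. assert (E : rho / Rpower rho al = Rpower rho (1 - al)).
  { unfold Rdiv. rewrite <- Rpower_Ropp. rewrite <- (Rpower_1 rho) at 1 by lra. rewrite <- Rpower_plus. f_equal. }
  rewrite E. split; [ apply exp_pos | ].
  apply Rle_trans with (Rpower 2 (1 - al)).
  - apply Rle_Rpower_l; lra.
  - rewrite <- (Rpower_1 2) at 2 by lra. apply Rle_Rpower; lra.
Qed.

(** f' is Lipschitz for the chord distance rho, and rho <= 2 gives rho / rho^alpha = rho^(1 - alpha)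
    <= 2. The bound is linear in A, so applied to a difference of two branches it gives continuity
    in the Hölder norm. *)
Lemma C1_holder_of_fser (alpha : R) (f : C -> C) : 0 < alpha < 1 -> (forall t, f (cis t) = fser x j t) ->
  in_C1_holder alpha f /\ 0 <= C1_holder_norm alpha f <= (2 + 2 * / d) * A.
Proof.
  intros Hal Hf. pose proof A_nonneg as HA. assert (Hi : 0 < / d) by (apply Rinv_0_lt_compat; auto).
  assert (D : forall t, @ex_derive R_AbsRing C_R_NormedModule (fun u => f (cis u)) t /\
    curve_derive (fun u => f (cis u)) t = (Ci * fsser x j t)%C).
  { intros t. apply curve_derive_of_quadratic with (2 / d * A).
    - apply Rmult_le_pos; auto. apply Rdiv_le_0_compat; lra.
    - intros s. rewrite !Hf. apply fser_taylor. }
  assert (HCi : Ci <> 0).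
  { intros H. apply (f_equal snd) in H. simpl in H. lra. }
  assert (CD : forall t, circle_derive f t = fderiv t).
  { intros t. unfold circle_derive. rewrite (proj2 (D t)), <- fderiv_spec. field.
    split; [ apply cis_neq_0 | exact HCi ]. }
  destruct (Lub_Rbar_bounded (fun r => exists t, r = Cmod (f (cis t))) A) as [F1 B1].
  { exists (Cmod (f (cis 0))), 0. reflexivity. }
  { intros r [t ->]. rewrite Hf. split; [ apply Cmod_ge_0 | apply fser_bound ]. }
  destruct (Lub_Rbar_bounded (fun r => exists t, r = Cmod (circle_derive f t)) A) as [F2 B2].
  { exists (Cmod (circle_derive f 0)), 0. reflexivity. }
  { intros r [t ->]. rewrite CD. split; [ apply Cmod_ge_0 | apply fderiv_bound ]. }
  destruct (Lub_Rbar_bounded (fun r => exists t u, cis t <> cis u /\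
    r = Cmod (circle_derive f t - circle_derive f u) / Rpower (Cmod (cis t - cis u)) alpha) (2 * / d * A)) as [F3 B3].
  (* The supremum of an empty set would be minus infinity; the points 1 and -1 supply one
     quotient. *)
  { eexists. exists 0, PI. split; [ | reflexivity ].
    intros H. apply (f_equal fst) in H. simpl in H. rewrite cos_0, cos_PI in H. lra. }
  { intros r [t [u [Hne ->]]]. rewrite !CD.
    assert (Hp : 0 < Cmod (cis t - cis u)).
    { apply Cmod_gt_0. intros H. apply Hne. replace (cis t) with ((cis t - cis u) + cis u)%C by ring. rewrite H. ring. }
    assert (Hp2 : Cmod (cis t - cis u) <= 2).
    { eapply Rle_trans; [ apply Cmod_minus_le | ]. rewrite !Cmod_cis. lra. }
    pose proof (Rpower_ratio_le _ alpha Hal (conj Hp Hp2)) as Hr.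
    assert (HR : 0 < Rpower (Cmod (cis t - cis u)) alpha) by apply exp_pos.
    split; [ apply Rdiv_le_0_compat; [ apply Cmod_ge_0 | auto ] | ].
    apply Rle_trans with (/ d * A * (Cmod (cis t - cis u) / Rpower (Cmod (cis t - cis u)) alpha)).
    - unfold Rdiv. rewrite <- Rmult_assoc. apply Rmult_le_compat_r; [ apply Rlt_le, Rinv_0_lt_compat; auto | apply fderiv_lipschitz ].
    - replace (2 * / d * A) with (/ d * A * 2) by ring. apply Rmult_le_compat_l; [ apply Rmult_le_pos; lra | lra ]. }
  split.
  - split; [ intros t; apply D | ]. split; [ exact F1 | ]. split; [ exact F2 | exact F3 ].
  - unfold C1_holder_norm, sup_norm, holder_seminorm. lra.
Qed.

End Regularity.

(** * Extension of the boundary perturbations to the plane *)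

(** A 1-Lipschitz map of the plane into the closed unit disc: [fhat (flip z)]
    extends [sum_n a_n conj(w)^n] from the circle to all of the plane, and equals
    the holomorphic function [sum_n a_n z^{-n}] outside the disc. *)
Definition flip (z : C) : C := if Rle_dec (Cmod z) 1 then Cconj z else (/ z)%C.

Lemma Cconj_minus (a b : C) : Cconj (a - b) = (Cconj a - Cconj b)%C.
Proof. unfold Cconj, Cminus, Cplus, Copp. simpl. f_equal. ring. Qed.

Lemma Cconj_mult (a b : C) : Cconj (a * b) = (Cconj a * Cconj b)%C.
Proof. unfold Cconj, Cmult. simpl. f_equal; ring. Qed.

Lemma Cconj_plus (a b : C) : Cconj (a + b) = (Cconj a + Cconj b)%C.
Proof. unfold Cconj, Cplus. simpl. f_equal. ring. Qed.

Lemma Cconj_inv (z : C) : z <> 0 -> Cconj (/ z) = (/ Cconj z)%C.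
Proof.
  intros Hz. assert (Hc : Cconj z <> 0).
  { intros H. apply Hz. apply Cmod_eq_0. rewrite <- Cmod_conj, H. apply Cmod_0. }
  replace (/ Cconj z)%C with (/ Cconj z * (Cconj (/ z) * Cconj z))%C.
  - field. auto.
  - rewrite <- Cconj_mult. replace (/ z * z)%C with (RtoC 1) by (field; auto).
    replace (Cconj 1) with (RtoC 1) by (unfold Cconj, RtoC; simpl; f_equal; ring). ring.
Qed.

Lemma Cmod_sq (z : C) : Cmod z * Cmod z = fst z * fst z + snd z * snd z.
Proof. pose proof (Cmod2_alt z) as H. unfold Re, Im in H. nra. Qed.

Lemma Cmod_gt_1_neq_0 (z : C) : 1 < Cmod z -> z <> 0.
Proof. intros H E. rewrite E, Cmod_0 in H. lra. Qed.

Lemma flip_le_1 (z : C) : Cmod (flip z) <= 1.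
Proof.
  unfold flip. destruct (Rle_dec (Cmod z) 1) as [H|H]; [ rewrite Cmod_conj; auto | ].
  rewrite Cmod_inv by (apply Cmod_gt_1_neq_0; lra). rewrite <- Rinv_1. apply Rinv_le_contravar; lra.
Qed.

(** In the mixed case, with v = 1/|w|^2 and z.w the real scalar product, |z - w|^2 - |conj z -
    1/w|^2 = (1 - v)(|w|^2 + 1 - 2 z.w), and both factors are nonnegative since |z| <= 1 < |w|. *)
Lemma flip_lipschitz (z w : C) : Cmod (flip z - flip w) <= Cmod (z - w).
Proof.
  assert (Mixed : forall z w, Cmod z <= 1 -> 1 < Cmod w -> Cmod (Cconj z - / w) <= Cmod (z - w)).
  { clear. intros z w Hz Hw. pose proof (Cmod_gt_1_neq_0 w Hw) as Hn.
    apply Rsqr_incr_0_var; [ | apply Cmod_ge_0 ]. unfold Rsqr. rewrite !Cmod_sq.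
    destruct z as [a b], w as [p q]. simpl.
    pose proof (Cmod_sq (a, b)) as Ez. pose proof (Cmod_sq (p, q)) as Ew. simpl in Ez, Ew.
    set (m := p * (p * 1) + q * (q * 1)).
    assert (Em : m = Cmod (p, q) * Cmod (p, q)) by (unfold m; rewrite Ew; ring).
    assert (Hm : 1 < m) by (rewrite Em; nra).
    assert (Hz2 : a * a + b * b <= 1) by (rewrite <- Ez; pose proof (Cmod_ge_0 (a, b)); nra).
    assert (Hi : 0 < / m < 1) by (split; [ apply Rinv_0_lt_compat; lra | rewrite <- Rinv_1; apply Rinv_lt_contravar; lra ]).
    unfold Rdiv. set (v := / m) in *. assert (Hv : m * v = 1) by (unfold v; field; lra).
    assert (Hpq : p * p + q * q = m) by (unfold m; ring).
    assert (Hdot : 2 * (a * p + b * q) <= m + 1).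
    { pose proof (Rle_0_sqr (a - p)). pose proof (Rle_0_sqr (b - q)). unfold Rsqr in *. lra. }
    replace ((a + - (p * v)) * (a + - (p * v)) + (- b + - (- q * v)) * (- b + - (- q * v)))
      with (a * a + b * b - 2 * (a * p + b * q) * v + (p * p + q * q) * v * v) by ring.
    replace ((a + - p) * (a + - p) + (b + - q) * (b + - q))
      with (a * a + b * b - 2 * (a * p + b * q) + (p * p + q * q)) by ring.
    assert (0 <= (1 - v) * (m + 1 - 2 * (a * p + b * q))) by (apply Rmult_le_pos; lra).
    rewrite Hpq, Hv. nra. }
  unfold flip. destruct (Rle_dec (Cmod z) 1) as [Hz|Hz], (Rle_dec (Cmod w) 1) as [Hw|Hw].
  - rewrite <- Cconj_minus, Cmod_conj. lra.
  - apply Mixed; lra.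
  - rewrite Cmod_minus_sym, (Cmod_minus_sym z). apply Mixed; lra.
  - assert (Nz : z <> 0) by (apply Cmod_gt_1_neq_0; lra). assert (Nw : w <> 0) by (apply Cmod_gt_1_neq_0; lra).
    replace (/ z - / w)%C with ((w - z) / (z * w))%C by (field; auto).
    rewrite Cmod_div by (apply Cmult_neq_0; auto). rewrite Cmod_mult, Cmod_minus_sym.
    pose proof (Cmod_ge_0 (z - w)). assert (1 <= Cmod z * Cmod w) by nra.
    apply (Rmult_le_reg_r (Cmod z * Cmod w)); [ lra | ]. unfold Rdiv. rewrite Rmult_assoc, Rinv_l by lra. nra.
Qed.

Lemma flip_conj (z : C) : flip (Cconj z) = Cconj (flip z).
Proof.
  unfold flip. rewrite Cmod_conj. destruct (Rle_dec (Cmod z) 1); [ reflexivity | ].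
  rewrite Cconj_inv; [ reflexivity | apply Cmod_gt_1_neq_0; lra ].
Qed.

Lemma flip_cis (t : R) : flip (cis t) = cis (- t).
Proof.
  unfold flip. rewrite Cmod_cis. destruct (Rle_dec 1 1); [ rewrite cis_opp; reflexivity | lra ].
Qed.

Lemma Cpow_taylor (a b : C) (n : nat) : Cmod a <= 1 -> Cmod b <= 1 ->
  Cmod (b ^ n - a ^ n - (b - a) * (INR n * a ^ (n - 1))) <= INR n * INR n * (Cmod (b - a) * Cmod (b - a)).
Proof.
  intros Ha Hb. induction n as [|n IH].
  - simpl. replace (1 - 1 - (b - a) * (0 * 1))%C with (RtoC 0) by ring. rewrite Cmod_0. lra.
  - replace (S n - 1)%nat with n by lia.
    assert (E : (b ^ S n - a ^ S n - (b - a) * (INR (S n) * a ^ n))%C =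
       (a * (b ^ n - a ^ n - (b - a) * (INR n * a ^ (n - 1))) + (b - a) * (b ^ n - a ^ n))%C).
    { rewrite !Cpow_S, S_INR, RtoC_plus. destruct n as [|n].
      - simpl. ring.
      - replace (S n - 1)%nat with n by lia. rewrite !Cpow_S. ring. }
    rewrite E. eapply Rle_trans; [ apply Cmod_triangle | ]. rewrite !Cmod_mult.
    pose proof (Cpow_diff_le b a n Hb Ha) as H1. pose proof (Cmod_ge_0 (b - a)) as H2.
    pose proof (Cmod_ge_0 (b ^ n - a ^ n - (b - a) * (INR n * a ^ (n - 1)))) as H3.
    pose proof (pos_INR n) as H4. rewrite S_INR. set (h := Cmod (b - a)) in *.
    assert (Cmod a * Cmod (b ^ n - a ^ n - (b - a) * (INR n * a ^ (n - 1))) <= INR n * INR n * (h * h)).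
    { rewrite <- (Rmult_1_l (INR n * INR n * (h * h))). apply Rmult_le_compat; auto. apply Cmod_ge_0. }
    assert (h * Cmod (b ^ n - a ^ n) <= INR n * (h * h)) by (replace (INR n * (h * h)) with (h * (INR n * h)) by ring; apply Rmult_le_compat_l; auto).
    assert (0 <= h * h) by nra. nra.
Qed.

Definition fhat (x : seqs) (j : bool) (v : C) : C := Cser (fun n => x j n * v ^ n)%C.
Definition fhat' (x : seqs) (j : bool) (v : C) : C := Cser (fun n => x j n * (INR n * v ^ (n - 1)))%C.
Definition fext (x : seqs) (j : bool) (z : C) : C := fhat x j (flip z).

Section Extension.
Context (d : R) (Hd : 0 < d) (x : seqs) (A : R) (Hx : bnd d x A) (j : bool).

Lemma Cmod_pow_le_1 (v : C) (n : nat) : Cmod v <= 1 -> Cmod (v ^ n) <= 1.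
Proof.
  intros H. rewrite Cmod_pow, <- (pow1 n). apply pow_incr. split; [ apply Cmod_ge_0 | auto ].
Qed.

Lemma pow_weight (v : C) : Cmod v <= 1 -> forall n, Cmod (v ^ n) <= 1 * kappa d n.
Proof.
  intros H n. eapply Rle_trans; [ apply Cmod_pow_le_1; auto | apply kappa_bounds; auto ].
Qed.

Lemma dpow_weight (v : C) : Cmod v <= 1 -> forall n, Cmod (INR n * v ^ (n - 1)) <= 1 * kappa d n.
Proof.
  intros H n. rewrite Cmod_mult, Cmod_R, Rabs_pos_eq by apply pos_INR.
  apply Rle_trans with (INR n); [ | apply kappa_bounds; auto ].
  pose proof (Cmod_pow_le_1 v (n - 1) H). pose proof (pos_INR n). nra.
Qed.

Lemma fhat_Csum (v : C) : Cmod v <= 1 -> Csum (fun n => x j n * v ^ n)%C (fhat x j v).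
Proof. intros H. apply (Csum_weighted x d A j _ 1 Hd Rle_0_1 (pow_weight v H) Hx). Qed.

Lemma fhat_bound (v : C) : Cmod v <= 1 -> Cmod (fhat x j v) <= A.
Proof.
  intros H. rewrite <- (Rmult_1_l A). apply (Csum_weighted x d A j _ 1 Hd Rle_0_1 (pow_weight v H) Hx).
Qed.

Lemma fhat_lipschitz (v w : C) : Cmod v <= 1 -> Cmod w <= 1 -> Cmod (fhat x j v - fhat x j w) <= A * Cmod (v - w).
Proof.
  intros Hv Hw. replace (fhat x j v - fhat x j w)%C with (fhat x j v - fhat x j w - 0 * fhat x j w)%C by ring.
  unfold fhat. rewrite (Cser_weighted_combination x d A j _ _ _ 0%C 1 1 1 Hd Rle_0_1 Rle_0_1 Rle_0_1
    (pow_weight v Hv) (pow_weight w Hw) (pow_weight w Hw) Hx).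
  rewrite Rmult_comm. apply (Csum_weighted x d A j); auto; [ apply Cmod_ge_0 | ].
  intros n. replace (v ^ n - w ^ n - 0 * w ^ n)%C with (v ^ n - w ^ n)%C by ring.
  eapply Rle_trans; [ apply Cpow_diff_le; auto | ]. rewrite Rmult_comm. apply Rmult_le_compat_l; [ apply Cmod_ge_0 | ].
  pose proof (kappa_bounds d n Hd). lra.
Qed.

Lemma fhat'_bound (v : C) : Cmod v <= 1 -> Cmod (fhat' x j v) <= A.
Proof.
  intros H. rewrite <- (Rmult_1_l A). apply (Csum_weighted x d A j _ 1 Hd Rle_0_1 (dpow_weight v H) Hx).
Qed.

Lemma fhat_taylor (v w : C) : Cmod v <= 1 -> Cmod w <= 1 ->
  Cmod (fhat x j w - fhat x j v - (w - v) * fhat' x j v) <= / d * A * (Cmod (w - v) * Cmod (w - v)).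
Proof.
  intros Hv Hw. assert (Hi : 0 < / d) by (apply Rinv_0_lt_compat; auto).
  unfold fhat, fhat'. rewrite (Cser_weighted_combination x d A j _ _ _ (w - v)%C 1 1 1 Hd Rle_0_1 Rle_0_1 Rle_0_1
    (pow_weight w Hw) (pow_weight v Hv) (dpow_weight v Hv) Hx).
  pose proof (Cmod_ge_0 (w - v)) as Hc. set (h := Cmod (w - v) * Cmod (w - v)).
  assert (Hh : 0 <= h) by apply Rle_0_sqr.
  replace (/ d * A * h) with ((h * / d) * A) by ring.
  apply (Csum_weighted x d A j); auto; [ apply Rmult_le_pos; lra | ].
  intros n. eapply Rle_trans; [ apply Cpow_taylor; auto | ]. fold h.
  rewrite (Rmult_comm _ h), Rmult_assoc. apply Rmult_le_compat_l; auto.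
  destruct (kappa_bounds d n Hd) as [_ [_ H3]]. rewrite S_INR in H3. pose proof (pos_INR n). nra.
Qed.

Lemma fhat_conj (v : C) : Cmod v <= 1 -> fhat x j (Cconj v) = Cconj (fhat x j v).
Proof.
  intros Hv. apply Cser_unique. intros eps He.
  destruct (fhat_Csum v Hv eps He) as [N HN]. exists N. intros n Hn. specialize (HN n Hn).
  assert (E : csum (fun n => x j n * Cconj v ^ n)%C n = Cconj (csum (fun n => x j n * v ^ n)%C n)).
  { clear. induction n as [|n IH].
    - simpl. unfold Cconj, RtoC. simpl. f_equal. ring.
    - rewrite !csum_S, IH, Cconj_plus, Cconj_mult, Cpow_conj. f_equal. f_equal.
      unfold Cconj, RtoC. simpl. f_equal. ring. }
  rewrite E, <- Cconj_minus, Cmod_conj. exact HN.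
Qed.

Lemma fext_bound (z : C) : Cmod (fext x j z) <= A.
Proof. apply fhat_bound, flip_le_1. Qed.

Lemma fext_lipschitz (z w : C) : Cmod (fext x j z - fext x j w) <= A * Cmod (z - w).
Proof.
  eapply Rle_trans; [ apply fhat_lipschitz; apply flip_le_1 | ].
  apply Rmult_le_compat_l; [ apply (bnd_nonneg d x A Hx) | apply flip_lipschitz ].
Qed.

Lemma fext_conj (z : C) : fext x j (Cconj z) = Cconj (fext x j z).
Proof. unfold fext. rewrite flip_conj. apply fhat_conj, flip_le_1. Qed.

Lemma fext_cis (t : R) : fext x j (cis t) = fser x j t.
Proof.
  unfold fext, fhat, fser. rewrite flip_cis. apply Cser_ext. intros n. f_equal.
  rewrite <- cis_INR. unfold e. rewrite opp_IZR, <- INR_IZR_INZ. f_equal. ring.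
Qed.

Lemma real_conj_series_fext : real_conj_series (fext x j).
Proof.
  exists (x j). intros w Hw. apply Csum_is_series.
  unfold fext, flip. destruct (Rle_dec (Cmod w) 1); [ | lra ].
  apply fhat_Csum. rewrite Cmod_conj. lra.
Qed.

Lemma ex_derive_C_of_quadratic (F : C -> C) (w l : C) (del K : R) : 0 < del -> 0 <= K ->
  (forall y, Cmod (y - w) < del -> Cmod (F y - F w - (y - w) * l) <= K * (Cmod (y - w) * Cmod (y - w))) ->
  @ex_derive C_AbsRing C_NormedModule F w.
Proof.
  intros Hdel HK H. exists l. split.
  - apply is_linear_scal_l.
  - intros x0 Hx0. pose proof (is_filter_lim_locally_unique (V := AbsRing_NormedModule C_AbsRing) _ _ Hx0) as Ex. subst x0.
    intros [eps He].
    exists (mkposreal (Rmin del (eps / (K + 1))) ltac:(apply Rmin_pos; auto; apply Rdiv_lt_0_compat; lra)).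
    intros y Hy.
    change (Cmod (y - w) < Rmin del (eps / (K + 1))) in Hy.
    change (Cmod (F y - F w - (y - w) * l) <= eps * Cmod (y - w)).
    pose proof (Rmin_l del (eps / (K + 1))). pose proof (Rmin_r del (eps / (K + 1))).
    eapply Rle_trans; [ apply H; lra | ]. rewrite <- Rmult_assoc. apply Rmult_le_compat_r; [ apply Cmod_ge_0 | ].
    assert (Hy' : (K + 1) * Cmod (y - w) < eps).
    { apply Rlt_le_trans with ((K + 1) * (eps / (K + 1))); [ apply Rmult_lt_compat_l; lra | right; field; lra ]. }
    pose proof (Cmod_ge_0 (y - w)). nra.
Qed.

(** Outside the disc [fext] is [fhat] composed with 1/w, and l is the chain rule. The remainder has
    two parts, from the Taylor formula of [fhat] and from that of 1/w; within distance |w| - 1 the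
    point y stays outside the disc. *)
Lemma fext_holomorphic (b : R) (w : C) : 1 < Cmod w ->
  @ex_derive C_AbsRing C_NormedModule (fun w => b * w + fext x j w)%C w.
Proof.
  intros Hw. pose proof (bnd_nonneg d x A Hx) as HA. assert (Hi : 0 < / d) by (apply Rinv_0_lt_compat; auto).
  set (l := (b - fhat' x j (/ w) * (/ w * / w))%C).
  apply (ex_derive_C_of_quadratic _ w l (Cmod w - 1) (/ d * A + A)); [ lra | | ].
  { assert (0 <= / d * A) by (apply Rmult_le_pos; lra). lra. }
  intros y Hy. assert (Hy1 : 1 < Cmod y).
  { pose proof (Cmod_triangle_rev w y) as H. rewrite Cmod_minus_sym in H. lra. }
  pose proof (Cmod_gt_1_neq_0 w Hw) as Nw. pose proof (Cmod_gt_1_neq_0 y Hy1) as Ny.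
  unfold fext, flip. destruct (Rle_dec (Cmod y) 1); [ lra | ]. destruct (Rle_dec (Cmod w) 1); [ lra | ].
  assert (Bw : Cmod (/ w) <= 1) by (rewrite Cmod_inv by auto; rewrite <- Rinv_1; apply Rinv_le_contravar; lra).
  assert (By : Cmod (/ y) <= 1) by (rewrite Cmod_inv by auto; rewrite <- Rinv_1; apply Rinv_le_contravar; lra).
  assert (Hd1 : Cmod (/ y - / w) <= Cmod (y - w)).
  { pose proof (flip_lipschitz y w) as HF. unfold flip in HF.
    destruct (Rle_dec (Cmod y) 1); [ lra | ]. destruct (Rle_dec (Cmod w) 1); [ lra | auto ]. }
  replace (b * y + fhat x j (/ y) - (b * w + fhat x j (/ w)) - (y - w) * l)%C with
    ((fhat x j (/ y) - fhat x j (/ w) - (/ y - / w) * fhat' x j (/ w))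
     + (y - w) * (y - w) * (/ y * (/ w * / w)) * fhat' x j (/ w))%C by (unfold l; field; auto).
  eapply Rle_trans; [ apply Cmod_triangle | ]. rewrite Rmult_plus_distr_r. apply Rplus_le_compat.
  - eapply Rle_trans; [ apply fhat_taylor; auto | ]. apply Rmult_le_compat_l; [ apply Rmult_le_pos; lra | ].
    apply Rmult_le_compat; auto; apply Cmod_ge_0.
  - rewrite !Cmod_mult. pose proof (fhat'_bound (/ w) Bw) as HB.
    pose proof (Cmod_ge_0 (y - w)). pose proof (Cmod_ge_0 (/ y)). pose proof (Cmod_ge_0 (/ w)).
    pose proof (Cmod_ge_0 (fhat' x j (/ w))).
    set (h := Cmod (y - w) * Cmod (y - w)). assert (0 <= h) by apply Rle_0_sqr.
    assert (P : Cmod (/ y) * (Cmod (/ w) * Cmod (/ w)) <= 1 * (1 * 1)).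
    { apply Rmult_le_compat; auto; [ apply Rmult_le_pos; auto | apply Rmult_le_compat; auto ]. }
    assert (P0 : 0 <= Cmod (/ y) * (Cmod (/ w) * Cmod (/ w))) by (repeat apply Rmult_le_pos; auto).
    rewrite (Rmult_comm A). apply Rmult_le_compat; auto; [ apply Rmult_le_pos; auto | ].
    rewrite <- (Rmult_1_r h) at 2. apply Rmult_le_compat_l; auto. lra.
Qed.

End Extension.

(** * Plane domains and near-identity homeomorphisms *)

(** The uniform structure on [C] is that of a product; its balls and those of [Cmod] are comparable
    up to the factor sqrt 2. *)
Lemma locally_C_iff (P : C -> Prop) (z : C) :
  @locally C_UniformSpace z P <-> exists eps, 0 < eps /\ forall y, Cmod (y - z) < eps -> P y.
Proof.
  split.
  - intros [[eps He] H]. exists eps. split; auto. intros y Hy. apply H.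
    apply C_NormedModule_mixin_compat1. exact Hy.
  - intros [eps [He H]]. assert (Hs : 0 < sqrt 2) by (apply sqrt_lt_R0; lra).
    exists (mkposreal (eps / sqrt 2) ltac:(apply Rdiv_lt_0_compat; auto)).
    intros y Hy. apply H. apply C_NormedModule_mixin_compat2 in Hy. simpl in Hy.
    replace (sqrt 2 * (eps / sqrt 2)) with eps in Hy by (field; lra). exact Hy.
Qed.

Lemma open_C_iff (A : C -> Prop) : open (A : C_UniformSpace -> Prop) <->
  forall z, A z -> exists eps, 0 < eps /\ forall y, Cmod (y - z) < eps -> A y.
Proof. split; intros H z Hz; [ apply locally_C_iff | apply locally_C_iff ]; apply H; auto. Qed.

Lemma filterlim_C_iff (X : Type) (F : (X -> Prop) -> Prop) {FF : Filter F} (f : X -> C) (l : C) :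
  filterlim f F (@locally C_UniformSpace l) <-> forall eps, 0 < eps -> F (fun p => Cmod (f p - l) < eps).
Proof.
  split.
  - intros H eps He. apply (H (fun y => Cmod (y - l) < eps)). apply locally_C_iff. exists eps. auto.
  - intros H P HP. apply locally_C_iff in HP. destruct HP as [eps [He HP]].
    unfold filtermap. generalize (H eps He). apply filter_imp. intros p Hp. apply HP; auto.
Qed.

Lemma continuous_on_lipschitz_comp (T : UniformSpace) (S : T -> Prop) (c : T -> C) (g : C -> C) (K : R) :
  0 <= K -> (forall z w, Cmod (g z - g w) <= K * Cmod (z - w)) ->
  @continuous_on T C_UniformSpace S c -> @continuous_on T C_UniformSpace S (fun p => g (c p)).
Proof.
  intros HK Hg Hc p Hp. specialize (Hc p Hp).
  apply (proj2 (filterlim_C_iff _ _ _ _)).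
  intros eps He.
  assert (H : filterlim c (within S (locally p)) (@locally C_UniformSpace (c p))) by exact Hc.
  apply (proj1 (filterlim_C_iff _ _ _ _)) with (eps := eps / (K + 1)) in H;
    [ | apply Rdiv_lt_0_compat; lra ].
  revert H. apply filter_imp. intros q Hq.
  eapply Rle_lt_trans; [ apply Hg | ].
  apply Rle_lt_trans with (K * (eps / (K + 1))); [ apply Rmult_le_compat_l; lra | ].
  apply (Rmult_lt_reg_r (K + 1)); [ lra | ]. field_simplify; [ nra | lra ].
Qed.

Lemma dist_complete_C (u : nat -> C) (c : R) : 0 <= c ->
  (forall k, Cmod (u k - u (S k)) <= c * (/ 2) ^ k) ->
  exists l, forall k, Cmod (u k - l) <= 2 * c * (/ 2) ^ k.
Proof.
  intros Hc H. set (v := fun n => (u (S n) - u n)%C).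
  assert (Hv : forall n, Cmod (v n) <= c * (/ 2) ^ n) by (intros n; unfold v; rewrite Cmod_minus_sym; apply H).
  assert (E : forall n, rsum (fun k => c * (/ 2) ^ k) n = 2 * c * (1 - (/ 2) ^ n)).
  { induction n as [|n IH]; simpl; [ ring | rewrite IH; field ]. }
  assert (HS : sum_le (fun k => c * (/ 2) ^ k) (2 * c)).
  { intros n. rewrite E. assert (0 < (/ 2) ^ n) by (apply pow_lt; lra). nra. }
  destruct (Csum_of_dominated v _ _ Hv HS) as [s Hs].
  exists (u O + s)%C. intros k. pose proof (Csum_tail v _ _ s k Hv HS Hs) as HT. rewrite E in HT.
  assert (Ec : csum v k = (u k - u O)%C).
  { clear. induction k as [|k IH]; [ simpl; ring | rewrite csum_S, IH; unfold v; ring ]. }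
  rewrite Ec in HT. rewrite Cmod_minus_sym. replace (u O + s - u k)%C with (s - (u k - u O))%C by ring. lra.
Qed.

(** Any constant below 1 makes z + h(z) a homeomorphism of the plane; 1/8 leaves room for
    [normal_displacement], where 8/7 (1/8 + 1/8) <= 1/2 is used. *)
Definition small_lipschitz (h : C -> C) : Prop := forall z w, Cmod (h z - h w) <= / 8 * Cmod (z - w).

Definition near_id (h : C -> C) (z : C) : C := (z + h z)%C.
Definition near_id_inv (h : C -> C) (z : C) : C := epsilon (inhabits (RtoC 0)) (fun w => near_id h w = z).

Section Homeo.
Context (h : C -> C) (Hh : small_lipschitz h).

Notation Psi := (near_id h).
Notation Inv := (near_id_inv h).

Lemma near_id_upper (z w : C) : Cmod (Psi z - Psi w) <= 9 / 8 * Cmod (z - w).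
Proof.
  unfold near_id. replace (z + h z - (w + h w))%C with ((z - w) + (h z - h w))%C by ring.
  eapply Rle_trans; [ apply Cmod_triangle | ]. specialize (Hh z w). lra.
Qed.

Lemma near_id_lower (z w : C) : Cmod (z - w) <= 8 / 7 * Cmod (Psi z - Psi w).
Proof.
  unfold near_id. pose proof (Cmod_triangle (z + h z - (w + h w)) (- (h z - h w))) as H.
  replace (z + h z - (w + h w) + - (h z - h w))%C with (z - w)%C in H by ring.
  rewrite Cmod_opp in H. specialize (Hh z w). lra.
Qed.

(** A preimage of z is a fixed point of w -> z - h(w). The starting point z is moved by |h(z)|,
    hence the radius 2 |h(z)|. *)
Lemma near_id_surjective (z : C) : exists w, Psi w = z.
Proof.
  destruct (banach_fixed_point C (fun x y r => Cmod (x - y) <= r) z (2 * Cmod (h z)) (fun w => z - h w)%C) as [w [_ Hw]].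
  - pose proof (Cmod_ge_0 (h z)). lra.
  - intros x. replace (x - x)%C with (RtoC 0) by ring. rewrite Cmod_0. lra.
  - intros x y r H. rewrite Cmod_minus_sym. auto.
  - intros x y w r s H1 H2. eapply Rle_trans; [ apply (Cmod_minus_triangle x y w) | lra ].
  - intros; lra.
  - intros u c. apply dist_complete_C.
  - replace (z - (z - h z))%C with (h z) by ring. lra.
  - intros x y r _ _ H. replace (z - h x - (z - h y))%C with (- (h x - h y))%C by ring.
    rewrite Cmod_opp. specialize (Hh x y). pose proof (Cmod_ge_0 (x - y)). lra.
  - exists w. apply C_eq_of_small. intros eps He. unfold near_id.
    specialize (Hw eps He). replace (w + h w - z)%C with (- (z - h w - w))%C by ring.
    rewrite Cmod_opp. exact Hw.
Qed.

Lemma near_id_inv_r (z : C) : Psi (Inv z) = z.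
Proof. apply (epsilon_spec (inhabits (RtoC 0)) (fun w => near_id h w = z)). apply near_id_surjective. Qed.

Lemma near_id_injective (z w : C) : Psi z = Psi w -> z = w.
Proof.
  intros H. pose proof (near_id_lower z w) as H1. rewrite H in H1.
  replace (Psi w - Psi w)%C with (RtoC 0) in H1 by ring. rewrite Cmod_0 in H1.
  apply C_eq_of_small. intros. lra.
Qed.

Lemma near_id_inv_l (w : C) : Inv (Psi w) = w.
Proof. apply near_id_injective. apply near_id_inv_r. Qed.

Lemma near_id_inv_lipschitz (z w : C) : Cmod (Inv z - Inv w) <= 8 / 7 * Cmod (z - w).
Proof. pose proof (near_id_lower (Inv z) (Inv w)) as H. rewrite !near_id_inv_r in H. exact H. Qed.

(** [fun z => A (Inv z)] is the image of [A]. *)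
Lemma closure_image (A : C -> Prop) (z : C) : closure (fun z => A (Inv z)) z <-> closure A (Inv z).
Proof.
  split; intros H [eps He].
  - destruct (H (mkposreal (eps * 7 / 8) ltac:(lra))) as [y [Hy1 Hy2]]. simpl in Hy2.
    exists (Inv y). split; auto. pose proof (near_id_inv_lipschitz y z). simpl. lra.
  - destruct (H (mkposreal (eps * 8 / 9) ltac:(lra))) as [y [Hy1 Hy2]]. simpl in Hy2.
    exists (Psi y). rewrite near_id_inv_l. split; auto. pose proof (near_id_upper y (Inv z)) as HU.
    rewrite near_id_inv_r in HU. simpl. lra.
Qed.

Lemma boundary_image (A : C -> Prop) (z : C) : boundary (fun z => A (Inv z)) z <-> boundary A (Inv z).
Proof.
  unfold boundary. rewrite closure_image. rewrite (closure_image (fun y => ~ A y)). reflexivity.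
Qed.

Lemma open_image (A : C -> Prop) : open (A : C_UniformSpace -> Prop) ->
  open ((fun z => A (Inv z)) : C_UniformSpace -> Prop).
Proof.
  rewrite !open_C_iff. intros H z Hz. destruct (H _ Hz) as [eps [He HA]].
  exists (eps * 7 / 8). split; [ lra | ]. intros y Hy. apply HA.
  pose proof (near_id_inv_lipschitz y z). lra.
Qed.

Lemma open_preimage (A : C -> Prop) : open (A : C_UniformSpace -> Prop) ->
  open ((fun z => A (Psi z)) : C_UniformSpace -> Prop).
Proof.
  rewrite !open_C_iff. intros H z Hz. destruct (H _ Hz) as [eps [He HA]].
  exists (eps * 8 / 9). split; [ lra | ]. intros y Hy. apply HA.
  pose proof (near_id_upper y z). lra.
Qed.

Lemma connected_image (A : C -> Prop) : connected A -> connected (fun z => A (Inv z)).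
Proof.
  intros HA U V HU HV Hc [z1 [Hz1 Hu]] [z2 [Hz2 Hv]].
  destruct (HA (fun w => U (Psi w)) (fun w => V (Psi w)) (open_preimage U HU) (open_preimage V HV)) as [w [H1 [H2 H3]]].
  - intros w Hw. apply Hc. rewrite near_id_inv_l. auto.
  - exists (Inv z1). rewrite near_id_inv_r. auto.
  - exists (Inv z2). rewrite near_id_inv_r. auto.
  - exists (Psi w). rewrite near_id_inv_l. auto.
Qed.

Lemma domain_image (A : C -> Prop) : domain A -> domain (fun z => A (Inv z)).
Proof.
  intros [[w Hw] [HO HC]]. split; [ | split ].
  - exists (Psi w). rewrite near_id_inv_l. auto.
  - apply open_image; auto.
  - apply connected_image; auto.
Qed.

Lemma simply_connected_image (A : C -> Prop) : simply_connected_domain A -> simply_connected_domain (fun z => A (Inv z)).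
Proof.
  intros [HD HA]. split; [ apply domain_image; auto | ].
  intros c Hc HcA Hloop.
  destruct (HA (fun t => Inv (c t))) as [H [H1 [H2 [H3 [H4 H5]]]]].
  - apply (continuous_on_lipschitz_comp R_UniformSpace _ c Inv (8 / 7)); auto; [ lra | apply near_id_inv_lipschitz ].
  - intros t Ht. apply HcA; auto.
  - rewrite Hloop. reflexivity.
  - exists (fun p => Psi (H p)). split; [ | split; [ | split; [ | split ] ] ].
    + apply (continuous_on_lipschitz_comp _ _ H Psi (9 / 8)); auto; [ lra | apply near_id_upper ].
    + intros p Hp. rewrite near_id_inv_l. auto.
    + intros t Ht. rewrite H3 by auto. apply near_id_inv_r.
    + intros s Hs. rewrite H4 by auto. reflexivity.
    + intros t Ht. rewrite H5 by auto. reflexivity.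
Qed.

End Homeo.

(** * Discs and annuli *)

(** If U and V had no common point in A, the function equal to -1 on U and 1 on V along a path would
    be continuous, contradicting the intermediate value theorem. Clamping the parameter to [0, 1]
    defines it on the whole line. *)
Lemma path_connected_connected (A : C -> Prop) :
  (forall z w, A z -> A w -> exists g : R -> C,
     (forall t eps, 0 < eps -> exists del, 0 < del /\ forall s, Rabs (s - t) < del -> Cmod (g s - g t) < eps) /\
     (forall t, 0 <= t <= 1 -> A (g t)) /\ g 0 = z /\ g 1 = w) -> connected A.
Proof.
  intros HP U V HU HV Hc [z [Hz HzU]] [w [Hw HwV]]. apply NNPP. intros Hno.
  destruct (HP z w Hz Hw) as [g [Hg [HgA [Hg0 Hg1]]]].
  rewrite open_C_iff in HU, HV.
  set (clamp := fun t => Rmax 0 (Rmin 1 t)).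
  assert (Hcl : forall t, 0 <= clamp t <= 1).
  { intros t. unfold clamp, Rmax, Rmin. destruct (Rle_dec 1 t); destruct (Rle_dec 0 _); lra. }
  assert (Hcl1 : forall s t, Rabs (clamp s - clamp t) <= Rabs (s - t)).
  { intros s t. unfold clamp, Rmax, Rmin.
    destruct (Rle_dec 1 s), (Rle_dec 1 t); repeat (destruct (Rle_dec 0 _)); unfold Rabs; repeat (destruct (Rcase_abs _)); lra. }
  set (k := fun t => if excluded_middle_informative (U (g (clamp t))) then -1 else 1).
  assert (Hk : continuity k).
  { intros t eps He.
    assert (Hloc : exists del, 0 < del /\ forall s, Rabs (s - t) < del -> k s = k t).
    { destruct (Hc (g (clamp t)) (HgA _ (Hcl t))) as [Hu|Hv].
      - destruct (HU _ Hu) as [e1 [He1 H1]]. destruct (Hg (clamp t) e1 He1) as [del [Hdel H2]].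
        exists del. split; auto. intros s Hs. unfold k.
        assert (Us : U (g (clamp s))) by (apply H1, H2; specialize (Hcl1 s t); lra).
        destruct (excluded_middle_informative (U (g (clamp s)))), (excluded_middle_informative (U (g (clamp t)))); tauto.
      - destruct (HV _ Hv) as [e1 [He1 H1]]. destruct (Hg (clamp t) e1 He1) as [del [Hdel H2]].
        exists del. split; auto. intros s Hs. unfold k.
        assert (Vs : V (g (clamp s))) by (apply H1, H2; specialize (Hcl1 s t); lra).
        destruct (excluded_middle_informative (U (g (clamp s)))) as [X|X].
        { exfalso. apply Hno. exists (g (clamp s)). auto. }
        destruct (excluded_middle_informative (U (g (clamp t)))) as [Y|Y]; auto.
        exfalso. apply Hno. exists (g (clamp t)). auto. }
    destruct Hloc as [del [Hdel H]]. exists del. split; auto.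
    intros s [_ Hs]. simpl in *. unfold R_dist in *. rewrite (H s Hs). rewrite Rminus_diag, Rabs_R0. lra. }
  assert (C0 : clamp 0 = 0). { unfold clamp, Rmax, Rmin. destruct (Rle_dec 1 0); destruct (Rle_dec 0 _); lra. }
  assert (C1 : clamp 1 = 1). { unfold clamp, Rmax, Rmin. destruct (Rle_dec 1 1); destruct (Rle_dec 0 _); lra. }
  assert (K0 : k 0 = -1).
  { unfold k. rewrite C0, Hg0. destruct (excluded_middle_informative (U z)); tauto. }
  assert (K1 : k 1 = 1).
  { unfold k. rewrite C1, Hg1. destruct (excluded_middle_informative (U w)); auto.
    exfalso. apply Hno. exists w. auto. }
  destruct (IVT k 0 1 Hk Rlt_0_1) as [t [_ Ht]]; try lra.
  unfold k in Ht. destruct (excluded_middle_informative (U (g (clamp t)))); lra.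
Qed.

Definition disc (b : R) (z : C) : Prop := Cmod z < b.
Definition annulus (b2 b1 : R) (z : C) : Prop := b2 < Cmod z < b1.

Lemma Cmod_lipschitz (z w : C) : Rabs (Cmod z - Cmod w) <= Cmod (z - w).
Proof.
  apply Rabs_le. pose proof (Cmod_triangle_rev z w). pose proof (Cmod_triangle_rev w z).
  rewrite (Cmod_minus_sym w z) in H0. lra.
Qed.

Lemma open_disc (b : R) : open (disc b : C_UniformSpace -> Prop).
Proof.
  apply open_C_iff. intros z Hz. unfold disc in *. exists (b - Cmod z). split; [ lra | ].
  intros y Hy. pose proof (Cmod_triangle_rev y z). lra.
Qed.

Lemma open_annulus (b2 b1 : R) : open (annulus b2 b1 : C_UniformSpace -> Prop).
Proof.
  apply open_C_iff. intros z Hz. unfold annulus in *. exists (Rmin (b1 - Cmod z) (Cmod z - b2)).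
  split; [ apply Rmin_pos; lra | ].
  intros y Hy. pose proof (Cmod_triangle_rev y z). pose proof (Cmod_triangle_rev z y).
  rewrite (Cmod_minus_sym z y) in H0. pose proof (Rmin_l (b1 - Cmod z) (Cmod z - b2)).
  pose proof (Rmin_r (b1 - Cmod z) (Cmod z - b2)). lra.
Qed.

Lemma radial_point (z : C) (r : R) : z <> 0 -> Cmod z + r >= 0 ->
  exists y, Cmod y = Cmod z + r /\ Cmod (y - z) = Rabs r.
Proof.
  intros Hz Hr. pose proof (proj1 (Cmod_gt_0 z) Hz) as Hp.
  exists (z * (1 + r / Cmod z)%R)%C. rewrite Cmod_mult, Cmod_R. split.
  - replace (1 + r / Cmod z) with ((Cmod z + r) * / Cmod z) by (field; lra).
    rewrite Rabs_pos_eq; [ field; lra | ]. apply Rmult_le_pos; [ lra | apply Rlt_le, Rinv_0_lt_compat; lra ].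
  - replace (z * (1 + r / Cmod z)%R - z)%C with (z * (r / Cmod z)%R)%C by (rewrite RtoC_plus; ring).
    rewrite Cmod_mult, Cmod_R. unfold Rdiv. rewrite Rabs_mult, (Rabs_pos_eq (/ Cmod z)) by (apply Rlt_le, Rinv_0_lt_compat; lra).
    field. lra.
Qed.

Lemma closure_disc (b : R) (z : C) : 0 < b -> (closure (disc b) z <-> Cmod z <= b).
Proof.
  intros Hb. split.
  - intros H. apply Rle_plus_epsilon. intros eps He. destruct (H (mkposreal eps He)) as [y [Hy1 Hy2]].
    simpl in Hy2. unfold disc in Hy1. pose proof (Cmod_triangle_rev z y). rewrite Cmod_minus_sym in H0. lra.
  - intros Hz [eps He]. simpl. destruct (Rlt_dec (Cmod z) b) as [H|H].
    + exists z. split; auto. replace (z - z)%C with (RtoC 0) by ring. rewrite Cmod_0. auto.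
    + destruct (radial_point z (- Rmin (eps / 2) b)) as [y [Hy1 Hy2]].
      * intros E. rewrite E, Cmod_0 in H. lra.
      * pose proof (Rmin_r (eps / 2) b). lra.
      * exists y. assert (0 < Rmin (eps / 2) b) by (apply Rmin_pos; lra).
        pose proof (Rmin_l (eps / 2) b). unfold disc. rewrite Hy1, Hy2, Rabs_Ropp, Rabs_pos_eq by lra. lra.
Qed.

Lemma closure_not_disc (b : R) (z : C) : 0 < b -> (closure (fun y => ~ disc b y) z <-> b <= Cmod z).
Proof.
  intros Hb. split.
  - intros H. apply Rle_plus_epsilon. intros eps He. destruct (H (mkposreal eps He)) as [y [Hy1 Hy2]].
    simpl in Hy2. unfold disc in Hy1. pose proof (Cmod_triangle_rev y z). lra.
  - intros Hz [eps He]. exists z. split; [ unfold disc; lra | ].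
    replace (z - z)%C with (RtoC 0) by ring. rewrite Cmod_0. auto.
Qed.

Lemma boundary_disc (b : R) (z : C) : 0 < b -> (boundary (disc b) z <-> Cmod z = b).
Proof. intros Hb. unfold boundary. rewrite closure_disc, closure_not_disc by auto. lra. Qed.

Lemma boundary_annulus (b2 b1 : R) (z : C) : 0 < b2 < b1 ->
  (boundary (annulus b2 b1) z <-> Cmod z = b1 \/ Cmod z = b2).
Proof.
  intros Hb. unfold boundary. split.
  - intros [H1 H2].
    assert (B1 : Cmod z <= b1).
    { apply Rle_plus_epsilon. intros eps He. destruct (H1 (mkposreal eps He)) as [y [Hy1 Hy2]].
      simpl in Hy2. unfold annulus in Hy1. pose proof (Cmod_triangle_rev z y). rewrite Cmod_minus_sym in H. lra. }
    assert (B2 : b2 <= Cmod z).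
    { apply Rle_plus_epsilon. intros eps He. destruct (H1 (mkposreal eps He)) as [y [Hy1 Hy2]].
      simpl in Hy2. unfold annulus in Hy1. pose proof (Cmod_triangle_rev y z). lra. }
    apply NNPP. intros Hn. assert (Hz : annulus b2 b1 z) by (unfold annulus; lra).
    destruct (proj1 (open_C_iff _) (open_annulus b2 b1) z Hz) as [eps [He H]].
    destruct (H2 (mkposreal eps He)) as [y [Hy1 Hy2]]. apply Hy1, H, Hy2.
  - intros Hz. assert (Hz0 : z <> 0) by (intros E; rewrite E, Cmod_0 in Hz; lra).
    split; intros [eps He]; simpl.
    + set (m := Rmin (eps / 2) ((b1 - b2) / 2)). assert (Hm : 0 < m) by (apply Rmin_pos; lra).
      assert (Hm1 : m <= eps / 2) by apply Rmin_l. assert (Hm2 : m <= (b1 - b2) / 2) by apply Rmin_r.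
      destruct Hz as [Hz|Hz].
      * destruct (radial_point z (- m)) as [y [Hy1 Hy2]]; auto; [ lra | ].
        exists y. unfold annulus. rewrite Hy1, Hy2, Rabs_Ropp, Rabs_pos_eq by lra. lra.
      * destruct (radial_point z m) as [y [Hy1 Hy2]]; auto; [ lra | ].
        exists y. unfold annulus. rewrite Hy1, Hy2, Rabs_pos_eq by lra. lra.
    + exists z. split; [ unfold annulus; lra | ].
      replace (z - z)%C with (RtoC 0) by ring. rewrite Cmod_0. auto.
Qed.

Lemma lipschitz_path_continuous (g : R -> C) (K : R) : 0 <= K -> (forall s t, Cmod (g s - g t) <= K * Rabs (s - t)) ->
  forall t eps, 0 < eps -> exists del, 0 < del /\ forall s, Rabs (s - t) < del -> Cmod (g s - g t) < eps.
Proof.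
  intros HK H t eps He. exists (eps / (K + 1)). split; [ apply Rdiv_lt_0_compat; lra | ].
  intros s Hs. eapply Rle_lt_trans; [ apply H | ].
  apply Rle_lt_trans with (K * (eps / (K + 1))); [ apply Rmult_le_compat_l; lra | ].
  apply (Rmult_lt_reg_r (K + 1)); [ lra | ]. field_simplify; [ nra | lra ].
Qed.

Lemma connected_disc (b : R) : connected (disc b).
Proof.
  apply path_connected_connected. intros z w Hz Hw. unfold disc in *.
  exists (fun t => z + RtoC t * (w - z))%C. split; [ | split; [ | split ] ].
  - apply lipschitz_path_continuous with (Cmod (w - z)); [ apply Cmod_ge_0 | ].
    intros s t. replace (z + s * (w - z) - (z + t * (w - z)))%C with (RtoC (s - t) * (w - z))%C by (rewrite RtoC_minus; ring).
    rewrite Cmod_mult, Cmod_R. lra.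
  - intros t Ht. replace (z + t * (w - z))%C with (RtoC (1 - t) * z + RtoC t * w)%C by (rewrite RtoC_minus; ring).
    eapply Rle_lt_trans; [ apply Cmod_triangle | ]. rewrite !Cmod_mult, !Cmod_R, !Rabs_pos_eq by lra.
    destruct (Req_dec t 1) as [->|Ht1]; [ lra | ].
    assert ((1 - t) * Cmod z < (1 - t) * b) by (apply Rmult_lt_compat_l; lra).
    assert (t * Cmod w <= t * b) by (apply Rmult_le_compat_l; lra). lra.
  - ring.
  - ring.
Qed.

Lemma polar (z : C) : z <> 0 -> exists t, z = (Cmod z * cis t)%C.
Proof.
  intros Hz. pose proof (proj1 (Cmod_gt_0 z) Hz) as Hp.
  assert (Hn : RtoC (Cmod z) <> 0) by (apply RtoC_neq_0; auto).
  destruct (unit_circle_cis (z / Cmod z)%C) as [t [_ Ht]].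
  - rewrite Cmod_div, Cmod_R, Rabs_pos_eq by (auto; lra). field. lra.
  - exists t. rewrite <- Ht. field. auto.
Qed.

(** A segment may cross the hole, so radius and argument are interpolated separately. The parameter
    of the radius is clamped to make the path Lipschitz on the whole line. *)
Lemma connected_annulus (b2 b1 : R) : 0 < b2 -> connected (annulus b2 b1).
Proof.
  intros Hb. apply path_connected_connected. intros z w Hz Hw. unfold annulus in *.
  destruct (polar z) as [t Ht]; [ intros E; rewrite E, Cmod_0 in Hz; lra | ].
  destruct (polar w) as [u Hu]; [ intros E; rewrite E, Cmod_0 in Hw; lra | ].
  set (p := Cmod z) in *. set (q := Cmod w) in *.
  assert (Hmod : forall s, 0 <= s <= 1 -> b2 < p + s * (q - p) < b1).
  { intros s Hs. destruct (Rle_dec p q); split; nra. }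
  set (K := Rabs (q - p) + (Rabs p + Rabs (q - p)) * Rabs (u - t)).
  exists (fun s => RtoC (p + Rmax 0 (Rmin 1 s) * (q - p)) * cis (t + s * (u - t)))%C.
  assert (Hcl : forall s, 0 <= s <= 1 -> Rmax 0 (Rmin 1 s) = s).
  { intros s Hs. unfold Rmax, Rmin. destruct (Rle_dec 1 s); destruct (Rle_dec 0 _); lra. }
  split; [ | split; [ | split ] ].
  - apply lipschitz_path_continuous with K.
    { unfold K. pose proof (Rabs_pos (q - p)). pose proof (Rabs_pos p). pose proof (Rabs_pos (u - t)).
      assert (0 <= (Rabs p + Rabs (q - p)) * Rabs (u - t)) by (apply Rmult_le_pos; lra). lra. }
    intros s s'. set (c := Rmax 0 (Rmin 1 s)). set (c' := Rmax 0 (Rmin 1 s')).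
    assert (Hcc : Rabs (c - c') <= Rabs (s - s') /\ 0 <= c' <= 1).
    { unfold c, c', Rmax, Rmin. destruct (Rle_dec 1 s), (Rle_dec 1 s'); repeat (destruct (Rle_dec 0 _));
        unfold Rabs; repeat (destruct (Rcase_abs _)); lra. }
    destruct Hcc as [Hc1 Hc2].
    replace (RtoC (p + c * (q - p)) * cis (t + s * (u - t)) - RtoC (p + c' * (q - p)) * cis (t + s' * (u - t)))%C with
      (RtoC ((c - c') * (q - p)) * cis (t + s * (u - t)) + RtoC (p + c' * (q - p)) * (cis (t + s * (u - t)) - cis (t + s' * (u - t))))%C.
    + eapply Rle_trans; [ apply Cmod_triangle | ]. rewrite !Cmod_mult, !Cmod_R, Cmod_cis, Rabs_mult, Rmult_1_r.
      pose proof (cis_diff_le (t + s * (u - t)) (t + s' * (u - t))) as H1.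
      replace (t + s * (u - t) - (t + s' * (u - t))) with ((s - s') * (u - t)) in H1 by ring. rewrite Rabs_mult in H1.
      assert (H2 : Rabs (p + c' * (q - p)) <= Rabs p + Rabs (q - p)).
      { eapply Rle_trans; [ apply Rabs_triang | ]. rewrite Rabs_mult, (Rabs_pos_eq c') by lra.
        pose proof (Rabs_pos (q - p)). nra. }
      unfold K. rewrite Rmult_plus_distr_r. apply Rplus_le_compat.
      * rewrite Rmult_comm. apply Rmult_le_compat_l; [ apply Rabs_pos | auto ].
      * replace ((Rabs p + Rabs (q - p)) * Rabs (u - t) * Rabs (s - s')) with
          ((Rabs p + Rabs (q - p)) * (Rabs (s - s') * Rabs (u - t))) by ring.
        apply Rmult_le_compat; auto; [ apply Rabs_pos | apply Cmod_ge_0 ].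
    + replace (p + c * (q - p)) with ((c - c') * (q - p) + (p + c' * (q - p))) by ring.
      rewrite (RtoC_plus ((c - c') * (q - p))). ring.
  - intros s Hs. rewrite Hcl by auto. rewrite Cmod_mult, Cmod_cis, Cmod_R, Rmult_1_r, Rabs_pos_eq; [ apply Hmod; auto | ].
    specialize (Hmod s Hs). lra.
  - rewrite Hcl by lra. rewrite !Rmult_0_l, !Rplus_0_r. auto.
  - rewrite Hcl by lra. rewrite !Rmult_1_l. replace (p + (q - p)) with q by ring.
    replace (t + (u - t)) with u by ring. auto.
Qed.

Lemma domain_annulus (b2 b1 : R) : 0 < b2 < b1 -> domain (annulus b2 b1).
Proof.
  intros Hb. split; [ | split ].
  - exists (RtoC ((b1 + b2) / 2)). unfold annulus. rewrite Cmod_R, Rabs_pos_eq; lra.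
  - apply open_annulus.
  - apply connected_annulus; lra.
Qed.

Lemma simply_connected_disc (b : R) : 0 < b -> simply_connected_domain (disc b).
Proof.
  intros Hb. split.
  - split; [ exists (RtoC 0); unfold disc; rewrite Cmod_0; auto | ].
    split; [ apply open_disc | apply connected_disc ].
  - intros c Hc HcA Hloop. exists (fun p => RtoC (1 - snd p) * c (fst p))%C.
    split; [ | split; [ | split; [ | split ] ] ].
    + intros [t s] [Ht Hs]. simpl in Ht, Hs.
      apply (proj2 (filterlim_C_iff _ _ _ _)). intros eps He. simpl fst. simpl snd.
      assert (H : filterlim c (within unit_interval (locally t)) (@locally C_UniformSpace (c t))) by exact (Hc t Ht).
      apply (proj1 (filterlim_C_iff _ _ _ _)) with (eps := eps / 2) in H; [ | lra ].
      destruct H as [del Hdel].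
      assert (He2 : 0 < eps / 2 / (b + 1)) by (repeat apply Rdiv_lt_0_compat; lra).
      exists (mkposreal (Rmin del (eps / 2 / (b + 1))) ltac:(apply Rmin_pos; [ apply cond_pos | exact He2 ])).
      intros [t' s'] [Hb1 Hb2] [Ht' Hs']. simpl in *.
      unfold ball in Hb1, Hb2. simpl in Hb1, Hb2. unfold AbsRing_ball, abs, minus, plus, opp in Hb1, Hb2. simpl in Hb1, Hb2.
      pose proof (Rmin_l del (eps / 2 / (b + 1))) as M1. pose proof (Rmin_r del (eps / 2 / (b + 1))) as M2.
      assert (H1 : Cmod (c t' - c t) < eps / 2).
      { apply Hdel; auto. unfold ball; simpl. unfold AbsRing_ball, abs, minus, plus, opp; simpl. lra. }
      pose proof (HcA t Ht) as HA. unfold disc in HA. destruct Hs' as [Hs1 Hs2].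
      replace (RtoC (1 - s') * c t' - RtoC (1 - s) * c t)%C with
        (RtoC (1 - s') * (c t' - c t) + RtoC (s - s') * c t)%C by (rewrite !RtoC_minus; ring).
      eapply Rle_lt_trans; [ apply Cmod_triangle | ]. rewrite !Cmod_mult, !Cmod_R, (Rabs_pos_eq (1 - s')) by lra.
      assert (H2 : Rabs (s - s') < eps / 2 / (b + 1)).
      { rewrite Rabs_minus_sym. unfold Rminus. lra. }
      assert (H3 : Rabs (s - s') * Cmod (c t) <= eps / 2 / (b + 1) * b).
      { apply Rmult_le_compat; try lra; [ apply Rabs_pos | apply Cmod_ge_0 ]. }
      assert (H4 : eps / 2 / (b + 1) * b < eps / 2).
      { apply (Rmult_lt_reg_r (b + 1)); [ lra | ]. field_simplify; [ nra | lra ]. }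
      pose proof (Cmod_ge_0 (c t' - c t)). nra.
    + intros [t s] [Ht Hs]. simpl in *. unfold disc. rewrite Cmod_mult, Cmod_R, Rabs_pos_eq by (destruct Hs; lra).
      pose proof (HcA t Ht) as HA. unfold disc in HA. destruct Hs. pose proof (Cmod_ge_0 (c t)). nra.
    + intros t Ht. simpl. rewrite Rminus_0_r. ring.
    + intros s Hs. simpl. rewrite Hloop. reflexivity.
    + intros t Ht. simpl. rewrite Rminus_diag. ring.
Qed.

(** * Contour integrals *)

(** Serves the kernel with xi on the same curve as z: at the parameter where xi = z the quotient is
    0/0, a junk value that must not affect the integral. *)
Lemma is_RInt_modify (f g : R -> C) (a b s0 : R) (l : C) : a <= b ->
  @is_RInt C_R_NormedModule f a b l -> (forall u, a < u < b -> u <> s0 -> f u = g u) ->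
  @is_RInt C_R_NormedModule g a b l.
Proof.
  intros Hab Hf Hfg.
  destruct (Rlt_dec a s0) as [H1|H1]; [ destruct (Rlt_dec s0 b) as [H2|H2] | ].
  - assert (Hex : @ex_RInt C_R_CompleteNormedModule f a b) by (exists l; exact Hf).
    destruct (ex_RInt_Chasles_1 (V := C_R_CompleteNormedModule) f a s0 b ltac:(lra) Hex) as [l1 Hl1].
    destruct (ex_RInt_Chasles_2 (V := C_R_CompleteNormedModule) f a s0 b ltac:(lra) Hex) as [l2 Hl2].
    assert (E : l = plus l1 l2).
    { assert (U1 := is_RInt_unique (V := C_R_CompleteNormedModule) _ _ _ _ Hf).
      assert (U2 := is_RInt_unique (V := C_R_CompleteNormedModule) _ _ _ _ (is_RInt_Chasles (V := C_R_NormedModule) _ _ _ _ _ _ Hl1 Hl2)).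
      rewrite <- U1. exact U2. }
    rewrite E. apply (is_RInt_Chasles (V := C_R_NormedModule) g a s0 b).
    + eapply is_RInt_ext; [ | exact Hl1 ]. intros u Hu. rewrite Rmin_left, Rmax_right in Hu by lra. apply Hfg; lra.
    + eapply is_RInt_ext; [ | exact Hl2 ]. intros u Hu. rewrite Rmin_left, Rmax_right in Hu by lra. apply Hfg; lra.
  - eapply is_RInt_ext; [ | exact Hf ]. intros u Hu. rewrite Rmin_left, Rmax_right in Hu by lra. apply Hfg; lra.
  - eapply is_RInt_ext; [ | exact Hf ]. intros u Hu. rewrite Rmin_left, Rmax_right in Hu by lra. apply Hfg; lra.
Qed.

Lemma RInt_cavg (G g : R -> C) (c : C) (s0 : R) : cint G ->
  (forall u, 0 < u < 2 * PI -> u <> s0 -> g u = (c * G u)%C) ->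
  @RInt C_R_CompleteNormedModule g 0 (2 * PI) = (2 * PI * c * cavg G)%C.
Proof.
  intros HG Hg. pose proof PI_RGT_0.
  apply (is_RInt_unique (V := C_R_CompleteNormedModule)).
  apply (is_RInt_modify (fun u => c * G u)%C g _ _ s0); [ lra | | ].
  - replace (2 * PI * c * cavg G)%C with (2 * PI * cavg (fun u => c * G u))%C by (rewrite cavg_scal by auto; ring).
    apply is_RInt_cavg, cint_scal, HG.
  - intros u Hu Hs. symmetry. apply Hg; auto.
Qed.

(** The moving point meets z at a single parameter of a period, so one excluded value suffices. *)
Lemma exists_angle (t : R) : exists s0, forall u, 0 < u < 2 * PI -> u <> s0 -> cis u <> cis t.
Proof.
  destruct (unit_circle_cis (cis t) (Cmod_cis t)) as [s0 [Hs0 E]]. exists s0.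
  intros u Hu Hne H. apply Hne. apply cis_inj; auto; [ lra | ]. rewrite H. exact E.
Qed.

(** * Reversal of the integration variable *)

Section Reflection.
Context (d : R) (Hd : 0 < d).

Lemma wiener_reflect (F : tfun) (A : R) : wiener d F A -> wiener d (fun t u => F t (- u)) A.
Proof.
  induction 1 as [c i j|F G A B HF IF HG IG|F A B HF IF HAB|Fn F A HF IF HL].
  - eapply wiener_ext; [ apply (wiener_atom d c i (- j)) | | ].
    + intros t u. cbv beta. rewrite opp_IZR.
      replace (IZR i * t + - IZR j * u) with (IZR i * t + IZR j * - u) by ring. reflexivity.
    + unfold weight. rewrite Z.abs_opp. lra.
  - apply (wiener_add d (fun t u => F t (- u))); auto.
  - eapply wiener_weaken; eauto.
  - apply wiener_lim with (fun n t u => Fn n t (- u)); auto.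
    intros eps He. destruct (HL eps He) as [n Hn]. exists n. auto.
Qed.

(** The average sees only frequency 0 in u, which u -> -u preserves. It is applied to the inner
    curve, which is traversed clockwise. *)
Lemma cavg_reflect (F : tfun) (A : R) : wiener d F A -> forall t, cavg (fun u => F t (- u)) = cavg (F t).
Proof.
  induction 1 as [c i j|F G A B HF IF HG IG|F A B HF IF HAB|Fn F A HF IF HL]; intros t.
  - rewrite (cavg_ext _ (fun u => c * cis (IZR i * t + IZR (- j) * u))%C).
    + rewrite !cavg_scal by apply cint_cis. rewrite !cavg_cis.
      destruct (Z.eq_dec (- j) 0), (Z.eq_dec j 0); try lia; reflexivity.
    + intros u. rewrite opp_IZR. replace (IZR i * t + - IZR j * u) with (IZR i * t + IZR j * - u) by ring. reflexivity.
  - rewrite (cavg_plus (fun u => F t (- u)) (fun u => G t (- u))).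
    + rewrite IF, IG, (cavg_plus (F t) (G t)); [ reflexivity | eapply wiener_cint; eauto | eapply wiener_cint; eauto ].
    + apply (wiener_cint d Hd _ A t (wiener_reflect F A HF)).
    + apply (wiener_cint d Hd _ B t (wiener_reflect G B HG)).
  - apply IF.
  - assert (W : wiener d F A) by (apply wiener_lim with Fn; auto).
    apply C_eq_of_small. intros eps He. destruct (HL (eps / 4)) as [n Hn]; [ lra | ].
    eapply Rle_trans; [ apply (Cmod_minus_triangle _ (cavg (fun u => Fn n t (- u)))) | ].
    assert (C1 := wiener_cint d Hd _ A t (wiener_reflect F A W)).
    assert (C2 := wiener_cint d Hd _ A t (wiener_reflect (Fn n) A (HF n))).
    assert (C3 := wiener_cint d Hd _ A t W). assert (C4 := wiener_cint d Hd _ A t (HF n)).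
    rewrite (IF n t) at 2. rewrite <- (cavg_sub _ _ C1 C2), <- (cavg_sub _ _ C4 C3).
    replace eps with (2 * (eps / 4) + 2 * (eps / 4)) by field.
    apply Rplus_le_compat; apply cavg_bound.
    + apply (cint_plus _ (fun u => - Fn n t (- u)%R)%C); auto using cint_opp.
    + intros u. rewrite Cmod_minus_sym. apply Hn.
    + apply (cint_plus _ (fun u => - F t u)%C); auto using cint_opp.
    + intros u. apply Hn.
Qed.

End Reflection.

(** * From the equation for averages to the boundary equation *)

Section Equation.
Context (d b1 b2 : R) (Hd : 0 < d) (Hb2 : 0 < b2) (Hb12 : b2 < b1) (Hb1 : b1 < 1)
  (x : seqs) (A : R) (Hx : bnd d x A) (HA : A <= b2 / 8).

Notation Phi := (phi b1 b2 x).
Notation Phib := (phib b1 b2 x).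
Notation Phis := (phis b1 b2 x).

Lemma rad_ge (j : bool) : b2 <= rad b1 b2 j.
Proof. destruct j; simpl; lra. Qed.

Lemma phi_fext (j : bool) (t : R) : Phi j t = (rad b1 b2 j * cis t + fext x j (cis t))%C.
Proof. unfold phi. rewrite e_1, fext_cis. reflexivity. Qed.

(** This is where the reality of the coefficients enters: conjugation amounts to t -> -t. *)
Lemma phib_conj (j : bool) (t : R) : Phib j t = Cconj (Phi j t).
Proof.
  rewrite phi_fext, Cconj_plus, Cconj_mult, <- (fext_conj d Hd x A Hx), <- cis_opp, fext_cis.
  unfold phib. f_equal.
  - rewrite <- (e_1 (- t)), e_opp. f_equal. unfold Cconj, RtoC. simpl. f_equal. ring.
  - unfold fbser, fser. apply Cser_ext. intros n. rewrite e_opp, Z.opp_involutive. reflexivity.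
Qed.

Lemma fsser_bound (j : bool) (t : R) : Cmod (fsser x j t) <= A.
Proof. rewrite <- (fderiv_spec d Hd x A Hx), Cmod_mult, Cmod_cis, Rmult_1_r. apply (fderiv_bound d Hd x A Hx). Qed.

Lemma phis_neq_0 (j : bool) (t : R) : Phis j t <> 0.
Proof.
  intros H. pose proof (fsser_bound j t) as HB. pose proof (rad_ge j).
  unfold phis in H. pose proof (Cmod_triangle (rad b1 b2 j * e 1 t + fsser x j t) (- fsser x j t)) as HT.
  rewrite H, Cmod_opp, Cmod_0 in HT.
  assert (E : (0 + - fsser x j t)%C = (rad b1 b2 j * e 1 t)%C) by (rewrite <- H; ring).
  rewrite E, Cmod_mult, Cmod_e, Cmod_R, Rabs_pos_eq in HT by lra. lra.
Qed.

Lemma phi_derive (j : bool) (t : R) :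
  @ex_derive R_AbsRing C_R_NormedModule (Phi j) t /\ curve_derive (Phi j) t = (Ci * Phis j t)%C.
Proof.
  pose proof (bnd_nonneg d x A Hx) as HA0. pose proof (rad_ge j) as Hr.
  assert (Hi : 0 < / d) by (apply Rinv_0_lt_compat; auto).
  apply curve_derive_of_quadratic with (2 * rad b1 b2 j + 2 / d * A).
  - assert (0 <= 2 / d * A) by (apply Rmult_le_pos; auto; apply Rdiv_le_0_compat; lra). lra.
  - intros s. unfold phi, phis.
    replace (rad b1 b2 j * e 1 s + fser x j s - (rad b1 b2 j * e 1 t + fser x j t) - (s - t) * (Ci * (rad b1 b2 j * e 1 t + fsser x j t)))%C
      with (rad b1 b2 j * (e 1 s - e 1 t - (s - t) * (Ci * IZR 1 * e 1 t)) + (fser x j s - fser x j t - (s - t) * (Ci * fsser x j t)))%C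
      by ring.
    eapply Rle_trans; [ apply Cmod_triangle | ]. rewrite Rmult_plus_distr_r. apply Rplus_le_compat.
    + rewrite Cmod_mult, Cmod_R, Rabs_pos_eq by lra. pose proof (e_taylor 1 s t) as HT.
      replace (2 * rad b1 b2 j * ((s - t) * (s - t))) with (rad b1 b2 j * (2 * (1 * 1) * ((s - t) * (s - t)))) by ring.
      apply Rmult_le_compat_l; auto. lra.
    + apply (fser_taylor d Hd x A Hx).
Qed.

Lemma phis_lipschitz (j : bool) (t u : R) : Cmod (Phis j t - Phis j u) <= (rad b1 b2 j + / d * A + A) * Rabs (t - u).
Proof.
  pose proof (bnd_nonneg d x A Hx) as HA0. pose proof (rad_ge j) as Hr.
  assert (Hi : 0 < / d) by (apply Rinv_0_lt_compat; auto).
  unfold phis. rewrite <- !(fderiv_spec d Hd x A Hx), !e_1.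
  replace (rad b1 b2 j * cis t + fderiv x j t * cis t - (rad b1 b2 j * cis u + fderiv x j u * cis u))%C with
    ((rad b1 b2 j + fderiv x j u) * (cis t - cis u) + (fderiv x j t - fderiv x j u) * cis t)%C by ring.
  pose proof (cis_diff_le t u) as H1. pose proof (fderiv_lipschitz d Hd x A Hx j t u) as H2.
  pose proof (fderiv_bound d Hd x A Hx j u) as H3.
  eapply Rle_trans; [ apply Cmod_triangle | ]. rewrite !Cmod_mult, Cmod_cis, Rmult_1_r.
  pose proof (Cmod_triangle (rad b1 b2 j) (fderiv x j u)) as H4. rewrite Cmod_R, Rabs_pos_eq in H4 by lra.
  pose proof (Cmod_ge_0 (cis t - cis u)) as H5. pose proof (Rabs_pos (t - u)) as H6.
  assert (H7 : 0 <= / d * A) by (apply Rmult_le_pos; lra).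
  assert (Cmod (rad b1 b2 j + fderiv x j u) * Cmod (cis t - cis u) <= (rad b1 b2 j + A) * Rabs (t - u)).
  { apply Rmult_le_compat; auto; try apply Cmod_ge_0. lra. }
  assert (/ d * A * Cmod (cis t - cis u) <= / d * A * Rabs (t - u)) by (apply Rmult_le_compat_l; auto). lra.
Qed.

Lemma dpow_telescope (n : nat) (t u : R) : (dpow n t u * (e 1 t - e 1 u))%C = (e (Z.of_nat n) t - e (Z.of_nat n) u)%C.
Proof.
  assert (H : forall N, (N <= n)%nat ->
    (csum (fun k => e (Z.of_nat k) t * e (Z.of_nat (n - 1 - k)) u) N * (e 1 t - e 1 u))%C =
    (e (Z.of_nat N) t * e (Z.of_nat (n - N)) u - e (Z.of_nat n) u)%C).
  { induction N as [|N IH]; intros HN.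
    - change (csum (fun k => e (Z.of_nat k) t * e (Z.of_nat (n - 1 - k)) u)%C 0) with (RtoC 0).
      rewrite Nat.sub_0_r. change (Z.of_nat 0) with 0%Z. rewrite e_0. ring.
    - rewrite csum_S, Cmult_plus_distr_r, IH by lia.
      replace (Z.of_nat (S N)) with (Z.of_nat N + 1)%Z by lia.
      replace (Z.of_nat (n - N)) with (Z.of_nat (n - S N) + 1)%Z by lia.
      replace (n - 1 - N)%nat with (n - S N)%nat by lia. rewrite <- !e_add. ring. }
  unfold dpow. rewrite (H n) by lia. rewrite Nat.sub_diag. change (Z.of_nat 0) with 0%Z. rewrite e_0. ring.
Qed.

Lemma Cmod_dpow (n : nat) (t u : R) : Cmod (dpow n t u) <= 1 * kappa d n.
Proof.
  eapply Rle_trans; [ apply (csum_le _ (fun _ => 1 * 1)) | ].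
  - intros k. rewrite Cmod_mult, !Cmod_e. lra.
  - rewrite rsum_scal. assert (E : rsum (fun _ => 1) n = INR n).
    { induction n as [|n IH]; [ reflexivity | rewrite S_INR; simpl; rewrite IH; ring ]. }
    rewrite E. pose proof (kappa_bounds d n Hd). lra.
Qed.

Lemma df_bound (j : bool) (t u : R) : Cmod (df x j t u) <= A.
Proof.
  rewrite <- (Rmult_1_l A). unfold df.
  apply (Csum_weighted x d A j (fun n => - (e (-1) t * e (-1) u * dpow n (- t)%R (- u)%R))%C 1 Hd Rle_0_1); auto.
  intros n. rewrite Cmod_opp, !Cmod_mult, !Cmod_e, !Rmult_1_l, <- (Rmult_1_l (kappa d n)). apply Cmod_dpow.
Qed.

Lemma difference_quotients (j : bool) (t u : R) :
  (dfb x j t u * (e 1 t - e 1 u))%C = (fbser x j t - fbser x j u)%C /\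
  (df x j t u * (e 1 t - e 1 u))%C = (fser x j t - fser x j u)%C.
Proof.
  assert (Be : forall m t n, Cmod (e m t) <= 1 * kappa d n).
  { intros m t0 n. rewrite Cmod_e. apply kappa_bounds; auto. }
  split.
  - destruct (Csum_weighted x d A j (fun n => dpow n t u) 1 Hd Rle_0_1 (fun n => Cmod_dpow n t u) Hx) as [HS _].
    replace (fbser x j t - fbser x j u)%C with (fbser x j t - fbser x j u - 0 * fbser x j u)%C by ring.
    unfold fbser. rewrite (Cser_weighted_combination x d A j _ _ _ 0%C 1 1 1 Hd Rle_0_1 Rle_0_1 Rle_0_1
      (fun n => Be (Z.of_nat n) t n) (fun n => Be (Z.of_nat n) u n) (fun n => Be (Z.of_nat n) u n) Hx).
    symmetry. apply Cser_unique. rewrite Cmult_comm.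
    eapply Csum_ext; [ | apply (Csum_scal (e 1 t - e 1 u)%C _ _ HS) ].
    intros n. cbv beta. pose proof (dpow_telescope n t u) as E.
    replace ((e 1 t - e 1 u) * (x j n * dpow n t u))%C with (x j n * (dpow n t u * (e 1 t - e 1 u)))%C by ring.
    rewrite E. ring.
  - assert (Bd : forall n, Cmod (- (e (-1) t * e (-1) u * dpow n (- t)%R (- u)%R)) <= 1 * kappa d n).
    { intros n. rewrite Cmod_opp, !Cmod_mult, !Cmod_e, !Rmult_1_l, <- (Rmult_1_l (kappa d n)). apply Cmod_dpow. }
    destruct (Csum_weighted x d A j _ 1 Hd Rle_0_1 Bd Hx) as [HS _].
    replace (fser x j t - fser x j u)%C with (fser x j t - fser x j u - 0 * fser x j u)%C by ring.
    unfold fser. rewrite (Cser_weighted_combination x d A j _ _ _ 0%C 1 1 1 Hd Rle_0_1 Rle_0_1 Rle_0_1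
      (fun n => Be (- Z.of_nat n)%Z t n) (fun n => Be (- Z.of_nat n)%Z u n) (fun n => Be (- Z.of_nat n)%Z u n) Hx).
    symmetry. apply Cser_unique. rewrite Cmult_comm.
    eapply Csum_ext; [ | apply (Csum_scal (e 1 t - e 1 u)%C _ _ HS) ].
    intros n. cbv beta. pose proof (dpow_telescope n (- t) (- u)) as E. rewrite !e_opp in E.
    replace ((e 1 t - e 1 u) * (x j n * - (e (-1) t * e (-1) u * dpow n (- t)%R (- u)%R)))%C with
      (x j n * (dpow n (- t)%R (- u)%R * (e (- (1)) t - e (- (1)) u)))%C.
    + rewrite E. ring.
    + change (- (1))%Z with (-1)%Z. rewrite !e_m1. pose proof (e_neq_0 1 t). pose proof (e_neq_0 1 u). field. auto.
Qed.

(** At [z = xi] the left-hand side is a junk value. *)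
Lemma ker_spec (j k : bool) (t u : R) : j <> k \/ cis u <> cis t ->
  ((Cconj (Phi j t) - Cconj (Phi k u)) / (Phi j t - Phi k u))%C = ker b1 b2 x j k t u.
Proof.
  intros Hne. rewrite <- !phib_conj. unfold ker. destruct (Bool.eqb j k) eqn:E; [ | reflexivity ].
  apply Bool.eqb_prop in E. subst k. destruct Hne as [Hne|Hne]; [ destruct Hne; auto | ].
  destruct (difference_quotients j t u) as [E1 E2].
  assert (Hw : (e 1 t - e 1 u)%C <> 0).
  { rewrite !e_1. intros H. apply Hne. replace (cis u) with (cis t - (cis t - cis u))%C by ring. rewrite H. ring. }
  pose proof (rad_ge j) as Hr.
  assert (Hk : (rad b1 b2 j + df x j t u)%C <> 0).
  { intros H. pose proof (df_bound j t u) as HB.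
    assert (E : df x j t u = (- rad b1 b2 j)%C).
    { replace (df x j t u) with (rad b1 b2 j + df x j t u - rad b1 b2 j)%C by ring. rewrite H. ring. }
    rewrite E, Cmod_opp, Cmod_R, Rabs_pos_eq in HB by lra. lra. }
  pose proof (e_neq_0 1 t). pose proof (e_neq_0 1 u).
  assert (EN : (Phib j t - Phib j u)%C = ((e 1 t - e 1 u) * (dfb x j t u - rad b1 b2 j * (e (-1) t * e (-1) u)))%C).
  { unfold phib. rewrite !e_m1.
    replace (rad b1 b2 j * / e 1 t + fbser x j t - (rad b1 b2 j * / e 1 u + fbser x j u))%C with
      (rad b1 b2 j * (/ e 1 t - / e 1 u) + (fbser x j t - fbser x j u))%C by ring.
    rewrite <- E1. field. auto. }
  assert (ED : (Phi j t - Phi j u)%C = ((e 1 t - e 1 u) * (rad b1 b2 j + df x j t u))%C).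
  { unfold phi.
    replace (rad b1 b2 j * e 1 t + fser x j t - (rad b1 b2 j * e 1 u + fser x j u))%C with
      (rad b1 b2 j * (e 1 t - e 1 u) + (fser x j t - fser x j u))%C by ring.
    rewrite <- E2. ring. }
  rewrite EN, ED. field. repeat split; auto.
Qed.

Definition outer_curve (t : R) : C := Phi true t.
(** Clockwise, so that the patch lies to the left of the curve. *)
Definition inner_curve (t : R) : C := Phi false (- t).

Lemma inner_derive (t : R) : @ex_derive R_AbsRing C_R_NormedModule inner_curve t /\
  curve_derive inner_curve t = (- (Ci * Phis false (- t)))%C.
Proof.
  pose proof (bnd_nonneg d x A Hx) as HA0. pose proof (rad_ge false) as Hr.
  assert (Hi : 0 < / d) by (apply Rinv_0_lt_compat; auto).
  apply curve_derive_of_quadratic with (2 * rad b1 b2 false + 2 / d * A).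
  - assert (0 <= 2 / d * A) by (apply Rmult_le_pos; auto; apply Rdiv_le_0_compat; lra). lra.
  - intros s. unfold inner_curve, phi, phis. set (j := false) in *. set (s' := - s). set (t' := - t).
    replace (rad b1 b2 j * e 1 s' + fser x j s' - (rad b1 b2 j * e 1 t' + fser x j t') - (s - t) * - (Ci * (rad b1 b2 j * e 1 t' + fsser x j t')))%C
      with (rad b1 b2 j * (e 1 s' - e 1 t' - (s' - t') * (Ci * IZR 1 * e 1 t')) + (fser x j s' - fser x j t' - (s' - t') * (Ci * fsser x j t')))%C
      by (unfold s', t'; rewrite !RtoC_opp; ring).
    replace ((s - t) * (s - t)) with ((s' - t') * (s' - t')) by (unfold s', t'; ring).
    eapply Rle_trans; [ apply Cmod_triangle | ]. rewrite Rmult_plus_distr_r. apply Rplus_le_compat.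
    + rewrite Cmod_mult, Cmod_R, Rabs_pos_eq by lra. pose proof (e_taylor 1 s' t') as HT.
      replace (2 * rad b1 b2 j * ((s' - t') * (s' - t'))) with (rad b1 b2 j * (2 * (1 * 1) * ((s' - t') * (s' - t')))) by ring.
      apply Rmult_le_compat_l; auto. lra.
    + apply (fser_taylor d Hd x A Hx).
Qed.

Context (HI : forall j k, exists L, wiener d (fun t u => ker b1 b2 x j k t u * Phis k u)%C L)
  (HJ : forall j k, exists L, wiener d (fun t u => Phi k u * Phib k u * Phis k u * / (1 - Phi j t * Phi k u))%C L).

Lemma outer_integral_I (j : bool) (t : R) :
  contour_integral outer_curve (fun xi => (Cconj (Phi j t) - Cconj xi) / (Phi j t - xi))%C
  = (2 * PI * Ci * Iop b1 b2 x j true t)%C.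
Proof.
  destruct (exists_angle t) as [s0 Hs0]. destruct (HI j true) as [L HL].
  apply (RInt_cavg (fun u => ker b1 b2 x j true t u * Phis true u)%C _ Ci s0 (wiener_cint d Hd _ L t HL)).
  intros u Hu Hs. unfold outer_curve. rewrite ker_spec by (right; auto).
  change (curve_derive (fun t => Phi true t) u) with (curve_derive (Phi true) u).
  rewrite (proj2 (phi_derive true u)). ring.
Qed.

Lemma inner_integral_I (j : bool) (t : R) :
  contour_integral inner_curve (fun xi => (Cconj (Phi j t) - Cconj xi) / (Phi j t - xi))%C
  = (- (2 * PI * Ci * Iop b1 b2 x j false t))%C.
Proof.
  destruct (exists_angle (- t)) as [s0 Hs0]. destruct (HI j false) as [L HL].
  unfold Iop. rewrite <- (cavg_reflect d Hd _ L HL t).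
  replace (- (2 * PI * Ci * cavg (fun u => ker b1 b2 x j false t (- u)%R * Phis false (- u)%R)))%C with
    (2 * PI * (- Ci) * cavg (fun u => ker b1 b2 x j false t (- u)%R * Phis false (- u)%R))%C by ring.
  apply (RInt_cavg _ _ _ s0 (wiener_cint d Hd _ L t (wiener_reflect d _ L HL))).
  intros u Hu Hs. rewrite (proj2 (inner_derive u)). unfold inner_curve.
  rewrite ker_spec.
  - ring.
  - right. intros H. apply (Hs0 u Hu Hs). rewrite <- (Ropp_involutive u), cis_opp, H, <- cis_opp. reflexivity.
Qed.

Lemma outer_integral_J (j : bool) (t : R) :
  contour_integral outer_curve (fun xi => RtoC (Cmod xi ^ 2) / (1 - Phi j t * xi))%C
  = (2 * PI * Ci * Jop b1 b2 x j true t)%C.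
Proof.
  destruct (HJ j true) as [L HL].
  apply (RInt_cavg (fun u => Phi true u * Phib true u * Phis true u * / (1 - Phi j t * Phi true u))%C _ Ci 0 (wiener_cint d Hd _ L t HL)).
  intros u Hu Hs. unfold outer_curve. rewrite Cmod2_conj, <- phib_conj.
  change (curve_derive (fun t => Phi true t) u) with (curve_derive (Phi true) u).
  rewrite (proj2 (phi_derive true u)). unfold Cdiv. ring.
Qed.

Lemma inner_integral_J (j : bool) (t : R) :
  contour_integral inner_curve (fun xi => RtoC (Cmod xi ^ 2) / (1 - Phi j t * xi))%C
  = (- (2 * PI * Ci * Jop b1 b2 x j false t))%C.
Proof.
  destruct (HJ j false) as [L HL].
  unfold Jop. rewrite <- (cavg_reflect d Hd _ L HL t).
  set (G := fun u => (Phi false (- u)%R * Phib false (- u)%R * Phis false (- u)%R * / (1 - Phi j t * Phi false (- u)%R))%C).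
  replace (- (2 * PI * Ci * cavg G))%C with (2 * PI * (- Ci) * cavg G)%C by ring.
  apply (RInt_cavg _ _ _ 0 (wiener_cint d Hd _ L t (wiener_reflect d _ L HL))).
  intros u Hu Hs. rewrite (proj2 (inner_derive u)). unfold inner_curve.
  rewrite Cmod2_conj, <- phib_conj. unfold Cdiv. ring.
Qed.

(** With tangent i [phis] on the outer curve and - i [phis] at -t on the inner one, the real part in
    the boundary equation is minus, respectively plus, the imaginary part assumed to vanish. *)
Lemma V_state_equation_of_branch (Om : R) :
  (forall j t, Im (Aop b1 b2 x j t 0 + RtoC (2 * Om) * Bop b1 b2 x j t 0) = 0) ->
  V_state_equation Om [outer_curve; inner_curve].
Proof.
  intros H. assert (HPI : RtoC PI <> 0) by (apply RtoC_neq_0, PI_RGT_0).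
  assert (HCi : Ci <> 0) by (intros E; apply (f_equal snd) in E; simpl in E; lra).
  assert (G : forall j t, (2 * Om * Cconj (Phi j t)
     + 1 / (2 * Ci * PI) * contours_integral [outer_curve; inner_curve] (fun xi => (Cconj (Phi j t) - Cconj xi) / (Phi j t - xi))
     - 1 / (2 * Ci * PI) * contours_integral [outer_curve; inner_curve] (fun xi => RtoC (Cmod xi ^ 2) / (1 - Phi j t * xi)))%C
     = (2 * Om * Phib j t + (Iop b1 b2 x j true t - Iop b1 b2 x j false t - Jop b1 b2 x j true t + Jop b1 b2 x j false t))%C).
  { intros j t. unfold contours_integral. simpl map. simpl fold_right.
    rewrite outer_integral_I, inner_integral_I, outer_integral_J, inner_integral_J, <- phib_conj. field. split; auto. }
  intros c [<-|[<-|[]]] t; cbv zeta.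
  - change (outer_curve t) with (Phi true t). rewrite G.
    change (curve_derive outer_curve t) with (curve_derive (Phi true) t). rewrite (proj2 (phi_derive true t)).
    specialize (H true t). unfold Aop, Bop in H.
    match type of H with Im ?a = 0 => match goal with |- Re ?b = 0 => replace b with (Ci * a)%C end end.
    + simpl. unfold Im in H. simpl in H. lra.
    + rewrite RtoC_mult. ring.
  - change (inner_curve t) with (Phi false (- t)). rewrite G, (proj2 (inner_derive t)).
    specialize (H false (- t)). unfold Aop, Bop in H.
    match type of H with Im ?a = 0 => match goal with |- Re ?b = 0 => replace b with (- (Ci * a))%C end end.
    + simpl. unfold Im in H. simpl in H. lra.
    + rewrite RtoC_mult. ring.
Qed.

End Equation.

(** * The perturbed domains *)

(** A solution of w + h(w) = z in the set where h and g agree also solves w + g(w) = z, and that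
    solution is unique. It allows the extension of each single curve to be exchanged for the blended
    one. *)
Lemma near_id_inv_agree (S : C -> Prop) (h g : C -> C) (z : C) :
  small_lipschitz h -> small_lipschitz g -> (forall w, S w -> h w = g w) -> S (near_id_inv h z) ->
  near_id_inv g z = near_id_inv h z.
Proof.
  intros Hh Hg HS HI. apply (near_id_injective g Hg). rewrite near_id_inv_r by auto.
  unfold near_id at 1. rewrite <- HS by auto. symmetry. apply (near_id_inv_r h Hh).
Qed.

Lemma near_id_inv_conj (h : C -> C) (z : C) : small_lipschitz h -> (forall w, h (Cconj w) = Cconj (h w)) ->
  near_id_inv h (Cconj z) = Cconj (near_id_inv h z).
Proof.
  intros Hh Hc. apply (near_id_injective h Hh). rewrite near_id_inv_r by auto.
  unfold near_id. rewrite Hc, <- Cconj_plus. f_equal. symmetry. apply (near_id_inv_r h Hh).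
Qed.

Definition cutoff (b2 b1 r : R) : R := Rmax 0 (Rmin 1 ((r - b2) / (b1 - b2))).

Lemma cutoff_spec (b2 b1 : R) : b2 < b1 ->
  (forall r, 0 <= cutoff b2 b1 r <= 1) /\
  (forall r, b1 <= r -> cutoff b2 b1 r = 1) /\ (forall r, r <= b2 -> cutoff b2 b1 r = 0) /\
  (forall r s, Rabs (cutoff b2 b1 r - cutoff b2 b1 s) <= Rabs (r - s) / (b1 - b2)).
Proof.
  intros H. assert (Hi : 0 < / (b1 - b2)) by (apply Rinv_0_lt_compat; lra). unfold cutoff. repeat split.
  - apply Rmax_l.
  - apply Rmax_lub; [ lra | apply Rmin_l ].
  - intros r Hr. rewrite Rmin_left; [ apply Rmax_right; lra | ].
    replace 1 with ((b1 - b2) / (b1 - b2)) by (field; lra). apply Rmult_le_compat_r; lra.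
  - intros r Hr. apply Rmax_left. eapply Rle_trans; [ apply Rmin_r | ].
    assert (0 <= (b2 - r) * / (b1 - b2)) by (apply Rmult_le_pos; lra). unfold Rdiv. lra.
  - intros r s. set (p := (r - b2) / (b1 - b2)). set (q := (s - b2) / (b1 - b2)).
    replace (Rabs (r - s) / (b1 - b2)) with (Rabs (p - q)).
    + unfold Rmax, Rmin. destruct (Rle_dec 1 p), (Rle_dec 1 q);
        repeat match goal with |- context [Rle_dec ?a ?b] => destruct (Rle_dec a b) end;
        unfold Rabs; repeat match goal with |- context [Rcase_abs ?a] => destruct (Rcase_abs a) end; lra.
    + unfold Rdiv. rewrite <- (Rabs_pos_eq (/ (b1 - b2))) by lra. rewrite <- Rabs_mult. f_equal. unfold p, q. field. lra.
Qed.

Section Domains.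
(** 2 A / (b1 - b2) + A / b2 is the Lipschitz constant of [blend]: the slope of the cutoff times the
    difference of the two shifts, plus the constant of the shifts. The condition b1 + A < 1 keeps
    the patch inside the unit disc. *)
Context (d b1 b2 : R) (Hd : 0 < d) (Hb2 : 0 < b2) (Hb12 : b2 < b1) (Hb1 : b1 < 1)
  (x : seqs) (A : R) (Hx : bnd d x A)
  (HA : A * (2 / (b1 - b2) + / b2) <= / 8) (HA1 : b1 + A < 1).

Notation b := (rad b1 b2).

Lemma A_over_b2 : A * / b2 <= / 8.
Proof.
  pose proof (bnd_nonneg d x A Hx). assert (0 <= A * (2 / (b1 - b2))).
  { apply Rmult_le_pos; auto. apply Rdiv_le_0_compat; lra. }
  lra.
Qed.

Lemma A_le_b2 : A <= b2 / 8.
Proof.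
  pose proof A_over_b2 as H. apply Rmult_le_reg_r with (/ b2); [ apply Rinv_0_lt_compat; auto | ].
  replace (b2 / 8 * / b2) with (/ 8) by (field; lra). exact H.
Qed.

(** The perturbation of curve j transported from the unit circle to the circle of radius b_j. *)
Definition shift (j : bool) (z : C) : C := fext x j (z / b j)%C.

Lemma rad_pos (j : bool) : 0 < b j.
Proof. pose proof (rad_ge b1 b2 Hb12 j). lra. Qed.

Lemma shift_lipschitz (j : bool) (z w : C) : Cmod (shift j z - shift j w) <= A * / b2 * Cmod (z - w).
Proof.
  unfold shift. eapply Rle_trans; [ apply (fext_lipschitz d Hd x A Hx) | ].
  pose proof (rad_pos j) as Hp. pose proof (rad_ge b1 b2 Hb12 j) as Hr.
  replace (z / b j - w / b j)%C with ((z - w) * / b j)%C by (unfold Cdiv; ring).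
  rewrite Cmod_mult, Cmod_inv, Cmod_R, Rabs_pos_eq by (try apply RtoC_neq_0; lra).
  pose proof (bnd_nonneg d x A Hx). rewrite Rmult_assoc. apply Rmult_le_compat_l; auto.
  rewrite Rmult_comm. apply Rmult_le_compat_r; [ apply Cmod_ge_0 | apply Rinv_le_contravar; auto ].
Qed.

Lemma shift_small (j : bool) : small_lipschitz (shift j).
Proof.
  intros z w. eapply Rle_trans; [ apply shift_lipschitz | ].
  apply Rmult_le_compat_r; [ apply Cmod_ge_0 | apply A_over_b2 ].
Qed.

Lemma shift_bound (j : bool) (z : C) : Cmod (shift j z) <= A.
Proof. apply (fext_bound d Hd x A Hx). Qed.

Lemma shift_conj (j : bool) (z : C) : shift j (Cconj z) = Cconj (shift j z).
Proof.
  unfold shift. rewrite <- (fext_conj d Hd x A Hx). f_equal. unfold Cdiv. rewrite Cconj_mult. f_equal.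
  rewrite Cconj_inv by (apply RtoC_neq_0, rad_pos). f_equal. unfold Cconj, RtoC. simpl. f_equal. ring.
Qed.

Lemma near_id_shift (j : bool) (w : C) : near_id (shift j) (b j * w) = (b j * w + fext x j w)%C.
Proof.
  unfold near_id, shift. do 2 f_equal. assert (RtoC (b j) <> 0) by (apply RtoC_neq_0, rad_pos). field. auto.
Qed.

Definition region (j : bool) (z : C) : Prop := disc (b j) (near_id_inv (shift j) z).

Lemma closure_region (j : bool) (z : C) : closure (region j) z <-> Cmod (near_id_inv (shift j) z) <= b j.
Proof.
  unfold region. rewrite (closure_image _ (shift_small j) (disc (b j))). apply closure_disc, rad_pos.
Qed.

(** The predicate Q lets one statement serve both the boundary (r = 1) and the exterior (1 < r). *)
Lemma scaled_preimage (j : bool) (z : C) (Q : R -> Prop) :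
  Q (Cmod (near_id_inv (shift j) z) / b j) <-> exists w, Q (Cmod w) /\ z = (b j * w + fext x j w)%C.
Proof.
  pose proof (rad_pos j) as Hp. assert (N : RtoC (b j) <> 0) by (apply RtoC_neq_0; auto). split.
  - intros H. exists (near_id_inv (shift j) z / b j)%C. split.
    + rewrite Cmod_div, Cmod_R, Rabs_pos_eq by (auto; lra). exact H.
    + rewrite <- near_id_shift. replace (b j * (near_id_inv (shift j) z / b j))%C with (near_id_inv (shift j) z) by (field; auto).
      symmetry. apply near_id_inv_r, shift_small.
  - intros [w [Hw ->]]. rewrite <- near_id_shift, near_id_inv_l by apply shift_small.
    rewrite Cmod_mult, Cmod_R, Rabs_pos_eq by lra. replace (b j * Cmod w / b j) with (Cmod w) by (field; lra). auto.
Qed.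

(** The conformal map and the homeomorphism carrying the disc to the region have the same formula up
    to scaling. Holomorphy outside the disc comes from [fext], injectivity and the image from the
    homeomorphism. *)
Lemma exterior_parametrization_region (j : bool) :
  exterior_parametrization (fun w => b j * w + fext x j w)%C (region j).
Proof.
  pose proof (rad_pos j) as Hp. assert (N : RtoC (b j) <> 0) by (apply RtoC_neq_0; auto). split; [ | split ].
  - apply (simply_connected_image _ (shift_small j)), simply_connected_disc; auto.
  - intros z. unfold region. rewrite (boundary_image _ (shift_small j) (disc (b j))), boundary_disc by auto.
    rewrite <- (scaled_preimage j z (fun r => r = 1)). split; intros H.
    + rewrite H. field. lra.
    + apply Rmult_eq_reg_r with (/ b j); [ | apply Rgt_not_eq, Rinv_0_lt_compat; auto ].
      unfold Rdiv in H. rewrite H. field. lra.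
  - exists (fun w => b j * w + fext x j w)%C. split; [ reflexivity | ]. split; [ | split; [ | split ] ].
    + apply (continuous_on_lipschitz_comp C_UniformSpace _ (fun w => w) (fun w => b j * w + fext x j w)%C (b j + A)).
      * pose proof (bnd_nonneg d x A Hx). lra.
      * intros z w. replace (b j * z + fext x j z - (b j * w + fext x j w))%C with
          (b j * (z - w) + (fext x j z - fext x j w))%C by ring.
        eapply Rle_trans; [ apply Cmod_triangle | ].
        rewrite Cmod_mult, Cmod_R, Rabs_pos_eq by lra. pose proof (fext_lipschitz d Hd x A Hx j z w). lra.
      * intros w _ Q HQ. unfold filtermap. apply filter_le_within. exact HQ.
    + intros w Hw. apply (fext_holomorphic d Hd x A Hx); auto.
    + intros w1 w2 _ _ H. rewrite <- !near_id_shift in H. apply (near_id_injective _ (shift_small j)) in H.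
      replace w1 with (b j * w1 / b j)%C by (field; auto). rewrite H. field. auto.
    + intros z. rewrite closure_region, <- (scaled_preimage j z (fun r => 1 < r)). split; intros H.
      * apply Rnot_le_lt in H. apply Rmult_lt_reg_r with (b j); auto.
        replace (Cmod (near_id_inv (shift j) z) / b j * b j) with (Cmod (near_id_inv (shift j) z)) by (field; lra). lra.
      * apply Rlt_not_le. apply Rmult_lt_reg_r with (/ b j); [ apply Rinv_0_lt_compat; auto | ].
        rewrite Rinv_r by lra. exact H.
Qed.

(** A single homeomorphism of the plane taking the annulus to the patch. *)
Definition blend (z : C) : C :=
  (shift false z + cutoff b2 b1 (Cmod z) * (shift true z - shift false z))%C.

Lemma blend_small : small_lipschitz blend.
Proof.
  destruct (cutoff_spec b2 b1 Hb12) as [C1 [_ [_ C2]]]. intros z w. unfold blend.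
  set (p := cutoff b2 b1 (Cmod z)). set (q := cutoff b2 b1 (Cmod w)).
  replace (shift false z + p * (shift true z - shift false z) - (shift false w + q * (shift true w - shift false w)))%C
    with (RtoC (1 - p) * (shift false z - shift false w) + RtoC p * (shift true z - shift true w)
      + RtoC (p - q) * (shift true w - shift false w))%C by (rewrite !RtoC_minus; ring).
  pose proof (C1 (Cmod z) : 0 <= p <= 1) as Hp. pose proof (C2 (Cmod z) (Cmod w)) as Hq. fold p q in Hq.
  pose proof (Cmod_lipschitz z w) as HL. set (D := Cmod (z - w)) in *.
  assert (HD : 0 <= D) by apply Cmod_ge_0. pose proof (bnd_nonneg d x A Hx) as HA0.
  pose proof (shift_lipschitz false z w) as S1. pose proof (shift_lipschitz true z w) as S2. fold D in S1, S2.
  assert (S3 : Cmod (shift true w - shift false w) <= 2 * A).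
  { eapply Rle_trans; [ apply Cmod_minus_le | ].
    pose proof (shift_bound true w). pose proof (shift_bound false w). lra. }
  assert (S4 : Rabs (p - q) <= D * / (b1 - b2)).
  { eapply Rle_trans; [ apply Hq | ]. apply Rmult_le_compat_r; [ apply Rlt_le, Rinv_0_lt_compat; lra | auto ]. }
  eapply Rle_trans; [ apply Cmod_triangle | ].
  eapply Rle_trans; [ apply Rplus_le_compat_r, Cmod_triangle | ].
  rewrite !Cmod_mult, !Cmod_R, (Rabs_pos_eq (1 - p)), (Rabs_pos_eq p) by lra.
  assert (T1 : (1 - p) * Cmod (shift false z - shift false w) <= (1 - p) * (A * / b2 * D)) by (apply Rmult_le_compat_l; lra).
  assert (T2 : p * Cmod (shift true z - shift true w) <= p * (A * / b2 * D)) by (apply Rmult_le_compat_l; lra).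
  assert (T3 : Rabs (p - q) * Cmod (shift true w - shift false w) <= D * / (b1 - b2) * (2 * A)).
  { apply Rmult_le_compat; auto; [ apply Rabs_pos | apply Cmod_ge_0 ]. }
  assert (T4 : A * (2 / (b1 - b2) + / b2) * D <= / 8 * D) by (apply Rmult_le_compat_r; auto).
  replace (A * (2 / (b1 - b2) + / b2) * D) with (D * / (b1 - b2) * (2 * A) + A * / b2 * D) in T4 by (field; lra).
  lra.
Qed.

Lemma blend_outer (z : C) : b1 <= Cmod z -> blend z = shift true z.
Proof. intros H. unfold blend. destruct (cutoff_spec b2 b1 Hb12) as [_ [C1 _]]. rewrite C1 by auto. ring. Qed.

Lemma blend_inner (z : C) : Cmod z <= b2 -> blend z = shift false z.
Proof. intros H. unfold blend. destruct (cutoff_spec b2 b1 Hb12) as [_ [_ [C1 _]]]. rewrite C1 by auto. ring. Qed.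

Lemma blend_circle (j : bool) (z : C) : Cmod z = b j -> blend z = shift j z.
Proof. intros H. destruct j; simpl in H; [ apply blend_outer | apply blend_inner ]; lra. Qed.

Lemma blend_conj (z : C) : blend (Cconj z) = Cconj (blend z).
Proof.
  unfold blend. rewrite Cmod_conj, !shift_conj, <- Cconj_minus, Cconj_plus, Cconj_mult. do 2 f_equal.
  unfold Cconj, RtoC. simpl. f_equal. ring.
Qed.

Lemma blend_bound (z : C) : Cmod (blend z) <= A.
Proof.
  destruct (cutoff_spec b2 b1 Hb12) as [C1 _]. specialize (C1 (Cmod z)). unfold blend.
  set (p := cutoff b2 b1 (Cmod z)) in *.
  replace (shift false z + p * (shift true z - shift false z))%C with
    (RtoC (1 - p) * shift false z + p * shift true z)%C by (rewrite RtoC_minus; ring).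
  eapply Rle_trans; [ apply Cmod_triangle | ].
  rewrite !Cmod_mult, !Cmod_R, !Rabs_pos_eq by lra.
  pose proof (shift_bound true z). pose proof (shift_bound false z).
  assert ((1 - p) * Cmod (shift false z) <= (1 - p) * A) by (apply Rmult_le_compat_l; lra).
  assert (p * Cmod (shift true z) <= p * A) by (apply Rmult_le_compat_l; lra). lra.
Qed.

Notation Inv := (near_id_inv blend).

(** [blend] and [shift true] are known to agree only for |w| >= b1, so both implications go through
    the complement, where the two inverses coincide. *)
Lemma region_true_iff (z : C) : region true z <-> Cmod (Inv z) < b1.
Proof.
  unfold region, disc. change (b true) with b1. split; intros H; apply Rnot_le_lt; intros Hc.
  - rewrite (near_id_inv_agree (fun w => b1 <= Cmod w) blend (shift true) z blend_small (shift_small true) blend_outer Hc) in H. lra.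
  - rewrite (near_id_inv_agree (fun w => b1 <= Cmod w) (shift true) blend z (shift_small true) blend_small
      (fun w Hw => eq_sym (blend_outer w Hw)) Hc) in H. lra.
Qed.

Lemma closure_region_true_iff (z : C) : closure (region true) z <-> Cmod (Inv z) <= b1.
Proof.
  assert (E : region true = (fun z => disc b1 (Inv z))).
  { apply functional_extensionality. intros w. apply propositional_extensionality, region_true_iff. }
  rewrite E, (closure_image _ blend_small (disc b1)). apply closure_disc. lra.
Qed.

Lemma closure_region_false_iff (z : C) : closure (region false) z <-> Cmod (Inv z) <= b2.
Proof.
  rewrite closure_region. change (b false) with b2. split; intros H.
  - rewrite (near_id_inv_agree (fun w => Cmod w <= b2) (shift false) blend z (shift_small false) blend_small
      (fun w Hw => eq_sym (blend_inner w Hw)) H). auto.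
  - rewrite (near_id_inv_agree (fun w => Cmod w <= b2) blend (shift false) z blend_small (shift_small false) blend_inner H). auto.
Qed.

Lemma patch_eq_annulus_image :
  (fun z => region true z /\ ~ closure (region false) z) = (fun z => annulus b2 b1 (Inv z)).
Proof.
  apply functional_extensionality. intros z. apply propositional_extensionality.
  rewrite region_true_iff, closure_region_false_iff. unfold annulus. lra.
Qed.

Lemma closure_region_true_unit_disc (z : C) : closure (region true) z -> unit_disc z.
Proof.
  rewrite closure_region_true_iff. intros H. unfold unit_disc.
  rewrite <- (near_id_inv_r blend blend_small z). unfold near_id.
  eapply Rle_lt_trans; [ apply Cmod_triangle | ]. pose proof (blend_bound (Inv z)). lra.
Qed.

Notation Phi := (phi b1 b2 x).
Notation Phis := (phis b1 b2 x).

Lemma phi_blend (j : bool) (t : R) : Phi j t = near_id blend (b j * cis t)%C.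
Proof.
  rewrite phi_fext, <- near_id_shift by exact Hd || exact Hx. unfold near_id. rewrite (blend_circle j); [ reflexivity | ].
  rewrite Cmod_mult, Cmod_cis, Cmod_R, Rabs_pos_eq; [ ring | pose proof (rad_pos j); lra ].
Qed.

Lemma Inv_phi (j : bool) (t : R) : Inv (Phi j t) = (b j * cis t)%C.
Proof. rewrite phi_blend. apply near_id_inv_l, blend_small. Qed.

(** [phis] is w phi'(w), an outward normal. A step c along it is a radial step c in the annulus up
    to two errors |c| b_j / 8, one from the Lipschitz constant of [blend] and one from the series in
    [phis], both enlarged by 8/7. *)
Lemma normal_displacement (j : bool) (t c : R) :
  Cmod (Inv (Phi j t + c * Phis j t)%C - (1 + c) * (b j * cis t))%C <= Rabs c * b j / 2.
Proof.
  pose proof (rad_pos j) as Hp. pose proof (rad_ge b1 b2 Hb12 j) as Hr. pose proof A_le_b2 as HA'.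
  set (w := (b j * cis t)%C). rewrite <- (near_id_inv_l blend blend_small ((1 + c) * w)%C).
  eapply Rle_trans; [ apply (near_id_inv_lipschitz blend blend_small) | ].
  rewrite phi_blend. fold w. unfold near_id, phis. rewrite e_1. fold w.
  replace (w + blend w + c * (w + fsser x j t) - ((1 + c) * w + blend ((1 + c) * w)))%C with
    ((blend w - blend ((1 + c) * w)) + c * fsser x j t)%C by ring.
  pose proof (blend_small w ((1 + c) * w)%C) as H1.
  replace (w - (1 + c) * w)%C with (- (c * w))%C in H1 by ring.
  assert (Hw : Cmod w = b j).
  { unfold w. rewrite Cmod_mult, Cmod_cis, Cmod_R, Rabs_pos_eq by lra. ring. }
  rewrite Cmod_opp, Cmod_mult, Cmod_R, Hw in H1.
  pose proof (Cmod_triangle (blend w - blend ((1 + c) * w)) (c * fsser x j t)) as H2.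
  rewrite Cmod_mult, Cmod_R in H2. pose proof (fsser_bound d Hd x A Hx j t) as H3.
  pose proof (Rabs_pos c) as H4.
  assert (Rabs c * Cmod (fsser x j t) <= Rabs c * (b j / 8)) by (apply Rmult_le_compat_l; lra).
  assert (0 <= Rabs c * b j) by (apply Rmult_le_pos; lra). lra.
Qed.

(** The sign [sg] is the orientation: 1 for the outer and -1 for the inner curve. *)
Lemma Jordan_curve_of_phi (j : bool) (c : R -> C) (sg : R) : sg = 1 \/ sg = -1 ->
  (forall t, c t = Phi j (sg * t)) ->
  (forall t, @ex_derive R_AbsRing C_R_NormedModule c t /\ curve_derive c t = (sg * (Ci * Phis j (sg * t)%R))%C) ->
  C1_Jordan_curve c.
Proof.
  intros Hsg Hc HD. pose proof (bnd_nonneg d x A Hx) as HA0. pose proof (rad_pos j) as Hp.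
  assert (Hi : 0 < / d) by (apply Rinv_0_lt_compat; auto).
  assert (Ha : Rabs sg = 1).
  { destruct Hsg; subst sg; [ apply Rabs_R1 | rewrite Rabs_left; lra ]. }
  assert (Hcis : forall t u, cis (sg * t) = cis (sg * u) -> cis t = cis u).
  { intros t u H. destruct Hsg; subst sg.
    - rewrite !Rmult_1_l in H. auto.
    - rewrite <- (Ropp_involutive t), <- (Ropp_involutive u), !(cis_opp (- _)).
      replace (- t) with (-1 * t) by ring. replace (- u) with (-1 * u) by ring. rewrite H. reflexivity. }
  assert (HN : RtoC sg <> 0).
  { intros E. apply RtoC_inj in E. destruct Hsg; lra. }
  split; [ | split; [ | split; [ | split ] ] ].
  - intros t. rewrite !Hc, !phi_blend. do 2 f_equal. destruct Hsg; subst sg; unfold cis.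
    + rewrite !Rmult_1_l, cos_plus, sin_plus, cos_2PI, sin_2PI. f_equal; ring.
    + replace (-1 * (t + 2 * PI)) with (- (t + 2 * PI)) by ring. replace (-1 * t) with (- t) by ring.
      rewrite !cos_neg, !sin_neg, cos_plus, sin_plus, cos_2PI, sin_2PI. f_equal; ring.
  - intros t. apply HD.
  - intros t. apply (proj2 (filterlim_C_iff _ _ _ _)). intros eps He.
    set (L := b j + / d * A + A). assert (HL : 0 < L).
    { assert (0 <= / d * A) by (apply Rmult_le_pos; lra). unfold L. lra. }
    exists (mkposreal (eps / L) (Rdiv_lt_0_compat _ _ He HL)). intros u Hu.
    change (Rabs (u - t) < eps / L) in Hu. rewrite (proj2 (HD u)), (proj2 (HD t)).
    replace (sg * (Ci * Phis j (sg * u)%R) - sg * (Ci * Phis j (sg * t)%R))%C with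
      (sg * Ci * (Phis j (sg * u)%R - Phis j (sg * t)%R))%C by ring.
    rewrite !Cmod_mult, Cmod_R, Ha, Cmod_Ci, !Rmult_1_l.
    eapply Rle_lt_trans; [ apply (phis_lipschitz d b1 b2 Hd Hb2 Hb12 x A Hx) | ].
    rewrite <- Rmult_minus_distr_l, Rabs_mult, Ha, Rmult_1_l. fold L.
    apply Rlt_le_trans with (L * (eps / L)); [ apply Rmult_lt_compat_l; auto | right; field; lra ].
  - intros t. rewrite (proj2 (HD t)). apply Cmult_neq_0; auto. apply Cmult_neq_0.
    + intros E. apply (f_equal snd) in E. simpl in E. lra.
    + apply (phis_neq_0 d b1 b2 Hd Hb2 Hb12 x A Hx A_le_b2).
  - intros t u Ht Hu H. rewrite !Hc in H. apply (f_equal Inv) in H. rewrite !Inv_phi in H.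
    apply cis_inj; auto. apply Hcis. assert (NB : RtoC (b j) <> 0) by (apply RtoC_neq_0; auto).
    replace (cis (sg * t)) with (b j * cis (sg * t) / b j)%C by (field; auto). rewrite H. field. auto.
Qed.

Context (HI : forall j k, exists L, wiener d (fun t u => ker b1 b2 x j k t u * Phis k u)%C L)
  (HJ : forall j k, exists L, wiener d (fun t u => Phi k u * phib b1 b2 x k u * Phis k u * / (1 - Phi j t * Phi k u))%C L).

Notation boundary_curves := [outer_curve b1 b2 x; inner_curve b1 b2 x].

Lemma positive_boundary_patch : positive_boundary (fun z => annulus b2 b1 (Inv z)) boundary_curves.
Proof.
  assert (Dout : forall t, curve_derive (outer_curve b1 b2 x) t = (Ci * Phis true t)%C).
  { intros t. apply (phi_derive d b1 b2 Hd Hb2 Hb12 x A Hx true t). }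
  assert (Din : forall t, curve_derive (inner_curve b1 b2 x) t = (- (Ci * Phis false (- t)))%C).
  { intros t. apply (inner_derive d b1 b2 Hd Hb2 Hb12 x A Hx t). }
  assert (HC2 : (Ci * Ci)%C = (-1)%C) by (unfold Ci, Cmult, RtoC; simpl; f_equal; ring).
  split; [ | split; [ | split ] ].
  - intros c [<-|[<-|[]]].
    + apply (Jordan_curve_of_phi true _ 1); [ lra | | ].
      * intros t. rewrite Rmult_1_l. reflexivity.
      * intros t. rewrite Rmult_1_l, Cmult_1_l. apply (phi_derive d b1 b2 Hd Hb2 Hb12 x A Hx true t).
    + apply (Jordan_curve_of_phi false _ (-1)); [ lra | | ].
      * intros t. unfold inner_curve. f_equal. ring.
      * intros t. replace (-1 * t) with (- t) by ring.
        replace (-1 * (Ci * Phis false (- t)%R))%C with (- (Ci * Phis false (- t)%R))%C by ring.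
        apply (inner_derive d b1 b2 Hd Hb2 Hb12 x A Hx t).
  - constructor; [ | constructor; [ constructor | constructor ] ].
    constructor; [ | constructor ]. intros t u H. apply (f_equal (fun z => Cmod (Inv z))) in H.
    unfold outer_curve, inner_curve in H. rewrite !Inv_phi, !Cmod_mult, !Cmod_cis, !Cmod_R, !Rabs_pos_eq in H by (simpl; lra).
    simpl in H. lra.
  - intros z. rewrite (boundary_image _ blend_small (annulus b2 b1)), boundary_annulus by lra.
    assert (HP : forall j, Cmod (Inv z) = b j <-> exists t, z = Phi j t).
    { intros j. pose proof (rad_pos j) as Hp. split.
      - intros H. destruct (polar (Inv z)) as [t Ht]; [ intros E; rewrite E, Cmod_0 in H; lra | ].
        exists t. rewrite phi_blend, <- H, <- Ht. symmetry. apply near_id_inv_r, blend_small.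
      - intros [t ->]. rewrite Inv_phi, Cmod_mult, Cmod_cis, Cmod_R, Rabs_pos_eq; lra. }
    change b1 with (b true) at 1. change b2 with (b false) at 2. rewrite !HP. split.
    + intros [[t Ht]|[t Ht]].
      * exists (outer_curve b1 b2 x). split; [ left; auto | exists t; auto ].
      * exists (inner_curve b1 b2 x). split; [ right; left; auto | exists (- t) ].
        unfold inner_curve. rewrite Ropp_involutive. auto.
    + intros [c [[<-|[<-|[]]] [t Ht]]]; [ left; exists t; auto | right; exists (- t); auto ].
  (* The normal i c'(t) is - [phis] on the outer curve and + [phis] on the inner one, so c = - eps
     in the first case and c = eps in the second. *)
  - assert (Near : forall j t c, -1 <= c -> (1 + c) * b j - Rabs c * b j / 2 <= Cmod (Inv (Phi j t + c * Phis j t)%C)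
        <= (1 + c) * b j + Rabs c * b j / 2).
    { intros j t c Hc1. pose proof (rad_pos j) as Hp. pose proof (normal_displacement j t c) as H.
      pose proof (Cmod_lipschitz (Inv (Phi j t + c * Phis j t)%C) ((1 + c) * (b j * cis t))%C) as H2.
      assert (E : Cmod ((1 + c) * (b j * cis t))%C = (1 + c) * b j).
      { rewrite <- RtoC_plus, !Cmod_mult, Cmod_cis, !Cmod_R, !Rabs_pos_eq by lra. ring. }
      rewrite E in H2. assert (H3 := Rle_trans _ _ _ H2 H). apply Rabs_le_between in H3. lra. }
    intros c [<-|[<-|[]]] t.
    (* The modulus of the preimage is at least (1 - 3 eps/2) b1, which exceeds b2 as soon as 2 eps
       b1 < b1 - b2; the inner curve is treated alike. *)
    + assert (Hp : 0 < (b1 - b2) / (2 * b1)) by (apply Rdiv_lt_0_compat; lra).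
      exists (mkposreal _ Hp). intros eps [He1 He2]. simpl in He2. rewrite Dout.
      replace (outer_curve b1 b2 x t + eps * (Ci * (Ci * Phis true t)))%C with (Phi true t + RtoC (- eps) * Phis true t)%C.
      2:{ unfold outer_curve. rewrite RtoC_opp.
          replace (eps * (Ci * (Ci * Phis true t)))%C with (eps * ((Ci * Ci) * Phis true t))%C by ring. rewrite HC2. ring. }
      assert (He3 : eps * (2 * b1) < b1 - b2).
      { apply Rmult_lt_reg_r with (/ (2 * b1)); [ apply Rinv_0_lt_compat; lra | ].
        replace (eps * (2 * b1) * / (2 * b1)) with eps by (field; lra). exact He2. }
      assert (He4 : eps <= 1).
      { apply Rnot_lt_le. intros Hc. assert (1 * (2 * b1) < eps * (2 * b1)) by (apply Rmult_lt_compat_r; lra). lra. }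
      pose proof (Near true t (- eps) ltac:(lra)) as HN. rewrite Rabs_Ropp, Rabs_pos_eq in HN by lra.
      change (b true) with b1 in HN. assert (0 < eps * b1) by (apply Rmult_lt_0_compat; lra). unfold annulus. lra.
    + assert (Hp : 0 < (b1 - b2) / (2 * b2)) by (apply Rdiv_lt_0_compat; lra).
      exists (mkposreal _ Hp). intros eps [He1 He2]. simpl in He2. rewrite Din.
      replace (inner_curve b1 b2 x t + eps * (Ci * - (Ci * Phis false (- t)%R)))%C with
        (Phi false (- t) + RtoC eps * Phis false (- t)%R)%C.
      2:{ unfold inner_curve.
          replace (eps * (Ci * - (Ci * Phis false (- t)%R)))%C with (- (eps * ((Ci * Ci) * Phis false (- t)%R)))%C by ring.
          rewrite HC2. ring. }
      assert (He3 : eps * (2 * b2) < b1 - b2).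
      { apply Rmult_lt_reg_r with (/ (2 * b2)); [ apply Rinv_0_lt_compat; lra | ].
        replace (eps * (2 * b2) * / (2 * b2)) with eps by (field; lra). exact He2. }
      pose proof (Near false (- t) eps ltac:(lra)) as HN. rewrite Rabs_pos_eq in HN by lra.
      change (b false) with b2 in HN. assert (0 < eps * b2) by (apply Rmult_lt_0_compat; lra). unfold annulus. lra.
Qed.

Lemma V_state_patch (Om : R) :
  (forall j t, Im (Aop b1 b2 x j t 0 + RtoC (2 * Om) * Bop b1 b2 x j t 0) = 0) ->
  V_state Om (fun z => region true z /\ ~ closure (region false) z).
Proof.
  intros H. rewrite patch_eq_annulus_image. split; [ | split; [ | split ] ].
  - apply (domain_image _ blend_small), domain_annulus. lra.
  - intros z Hz. apply closure_region_true_unit_disc. intros eps. destruct (Hz eps) as [y [Hy1 Hy2]].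
    exists y. split; auto. apply region_true_iff. apply Hy1.
  - intros z. rewrite (near_id_inv_conj _ _ blend_small blend_conj). unfold annulus. rewrite Cmod_conj. auto.
  - exists boundary_curves. split; [ apply positive_boundary_patch | ].
    apply (V_state_equation_of_branch d b1 b2 Hd Hb2 Hb12 x A Hx A_le_b2); auto.
Qed.

End Domains.

(** * Assembly of the branch *)

Lemma integrands_wiener (d b1 b2 : R) : 0 < d -> 0 < b2 -> b2 < b1 -> b1 < 1 ->
  b2 / b1 * (1 + 2 * d) < 1 -> b1 * b1 * (1 + 2 * d) < 1 ->
  exists r, 0 < r /\ forall x A, A <= r -> bnd d x A -> forall j k,
    (exists L, wiener d (fun t u => ker b1 b2 x j k t u * phis b1 b2 x k u)%C L) /\
    (exists L, wiener d (fun t u => phi b1 b2 x k u * phib b1 b2 x k u * phis b1 b2 x k u * / (1 - phi b1 b2 x j t * phi b1 b2 x k u))%C L).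
Proof.
  intros Hd Hb2 Hb12 Hb1 Hq1 Hq2.
  assert (H : forall j k, exists r, 0 < r /\ forall x A, A <= r -> bnd d x A ->
    (exists L, wiener d (fun t u => ker b1 b2 x j k t u * phis b1 b2 x k u)%C L) /\
    (exists L, wiener d (fun t u => phi b1 b2 x k u * phib b1 b2 x k u * phis b1 b2 x k u * / (1 - phi b1 b2 x j t * phi b1 b2 x k u))%C L)).
  { intros j k.
    assert (HI : integrable d (fun x t u => ker b1 b2 x j k t u * phis b1 b2 x k u)%C).
    { destruct j, k.
      - apply (nicec_Ijj d b1 b2 Hd Hb2 Hb12 true).
      - apply (nicec_I12 d b1 b2 Hd Hb2 Hb12 Hq1).
      - apply (nicec_I21 d b1 b2 Hd Hb2 Hb12 Hq1).
      - apply (nicec_Ijj d b1 b2 Hd Hb2 Hb12 false). }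
    destruct HI as [r [Hr HI]].
    destruct (proj2 (nicec_J d b1 b2 Hd Hb2 Hb12 Hb1 Hq2 j k)) as [r' [Hr' HJ]].
    exists (Rmin r r'). split; [ apply Rmin_pos; auto | ]. intros x A HA Hx.
    pose proof (Rmin_l r r'). pose proof (Rmin_r r r').
    split; [ apply (HI x A) | apply (HJ x A) ]; auto; lra. }
  destruct (H true true) as [r1 [R1 H1]], (H true false) as [r2 [R2 H2]],
    (H false true) as [r3 [R3 H3]], (H false false) as [r4 [R4 H4]].
  exists (Rmin (Rmin r1 r2) (Rmin r3 r4)). split; [ repeat apply Rmin_pos; auto | ].
  intros x A HA Hx. pose proof (Rmin_l (Rmin r1 r2) (Rmin r3 r4)). pose proof (Rmin_r (Rmin r1 r2) (Rmin r3 r4)).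
  pose proof (Rmin_l r1 r2). pose proof (Rmin_r r1 r2). pose proof (Rmin_l r3 r4). pose proof (Rmin_r r3 r4).
  intros [|] [|]; [ apply (H1 x A) | apply (H2 x A) | apply (H3 x A) | apply (H4 x A) ]; auto; lra.
Qed.

Lemma fser_sub (d : R) (x y : seqs) (A B : R) (j : bool) (t : R) : 0 < d -> bnd d x A -> bnd d y B ->
  (fser x j t - fser y j t)%C = fser (sub x y) j t.
Proof.
  intros Hd Hx Hy. unfold fser. symmetry. apply Cser_unique.
  assert (W : forall n, Cmod (e (- Z.of_nat n) t) <= 1 * kappa d n).
  { intros n. rewrite Cmod_e. apply kappa_bounds; auto. }
  destruct (Csum_weighted x d A j _ 1 Hd Rle_0_1 W Hx) as [S1 _].
  destruct (Csum_weighted y d B j _ 1 Hd Rle_0_1 W Hy) as [S2 _].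
  set (X := Cser (fun n => x j n * e (- Z.of_nat n) t)%C) in *.
  set (Y := Cser (fun n => y j n * e (- Z.of_nat n) t)%C) in *.
  replace (X - Y)%C with (X + - (1) * Y)%C by ring.
  eapply Csum_ext; [ | apply (Csum_plus _ _ _ _ S1 (Csum_scal (- (1))%C _ _ S2)) ].
  intros n. cbv beta. unfold sub. rewrite RtoC_minus. ring.
Qed.

(** Nontriviality: at w = 1 the constant coefficient s dominates the remaining ones, whose sum is at
    most |s|/2 along the branch. *)
Lemma fext_1_lower (d : R) (x : seqs) (A B s : R) : 0 < d -> bnd d x A -> x true O = s ->
  bnd d (fun j n => match n with O => 0 | S _ => x j n end) B -> Rabs s - B <= Cmod (fext x true 1).
Proof.
  intros Hd Hx Hs Hy. set (y := fun j n => match n with O => 0 | S _ => x j n end) in *.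
  replace (RtoC 1) with (cis 0) by (unfold cis; rewrite cos_0, sin_0; reflexivity).
  rewrite (fext_cis x true 0).
  assert (E : (fser x true 0 - fser y true 0)%C = RtoC s).
  { rewrite (fser_sub d x y A B) by auto. apply Cser_unique.
    replace (RtoC s) with (sub x y true O * e (- Z.of_nat 0) 0)%C.
    - apply (Csum_single (fun n => sub x y true n * e (- Z.of_nat n) 0)%C O).
      intros [|n] Hn; [ destruct Hn; auto | ]. unfold sub, y. rewrite Rminus_diag. ring.
    - unfold sub, y. change (- Z.of_nat 0)%Z with 0%Z. rewrite Hs, Rminus_0_r, e_0. ring. }
  pose proof (fser_bound d Hd y B Hy true 0) as HB.
  pose proof (Cmod_minus_le (fser x true 0) (fser y true 0)) as HT. rewrite E, Cmod_R in HT. lra.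
Qed.

Theorem theorem3 (alpha b1 b2 : R)
    (halpha : 0 < alpha < 1)
    (hb1 : 0 < b1 < 1)
    (hb2 : 0 < b2 < b1)
    (hE : ~ exceptional_set b1 b2) :
  V_states_bifurcate alpha b1 b2 ((b1 ^ 2 - b2 ^ 2) / 2).
Proof.
  rename halpha into Hal, hE into HE. destruct hb1 as [_ Hb1], hb2 as [Hb2 Hb12].
  destruct (vortex_branch b1 b2 Hb2 Hb12 Hb1 HE) as [d [a [K [xs [Om [Hd [Ha [HK [HOm [Hq1 [Hq2 [HB HL]]]]]]]]]]]].
  destruct (integrands_wiener d b1 b2 Hd Hb2 Hb12 Hb1 Hq1 Hq2) as [r [Hr HW]].
  set (q := 2 / (b1 - b2) + / b2).
  assert (Hq : 0 < q).
  { apply Rplus_lt_0_compat; [ apply Rdiv_lt_0_compat; lra | apply Rinv_0_lt_compat; auto ]. }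
  (* The three bounds ensure, in this order, that the integrands lie in the algebra, that the patch
     stays in the unit disc, and that the homeomorphism is close enough to the identity. *)
  set (r0 := Rmin r (Rmin ((1 - b1) / 2) (/ 8 / q))).
  assert (Hr0 : 0 < r0 /\ r0 <= r /\ r0 <= (1 - b1) / 2 /\ r0 <= / 8 / q).
  { unfold r0. assert (0 < / 8 / q) by (apply Rdiv_lt_0_compat; lra).
    pose proof (Rmin_l r (Rmin ((1 - b1) / 2) (/ 8 / q))). pose proof (Rmin_r r (Rmin ((1 - b1) / 2) (/ 8 / q))).
    pose proof (Rmin_l ((1 - b1) / 2) (/ 8 / q)). pose proof (Rmin_r ((1 - b1) / 2) (/ 8 / q)).
    split; [ repeat apply Rmin_pos; lra | lra ]. }
  destruct Hr0 as [Hr0 [Hr1 [Hr2 Hr3]]].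
  set (a' := Rmin a (r0 / (K + 1))).
  assert (Ha' : 0 < a') by (apply Rmin_pos; auto; apply Rdiv_lt_0_compat; lra).
  assert (Hs : forall s, - a' < s < a' -> Rabs s <= a /\ K * Rabs s <= r0).
  { intros s Hs. assert (Hs' : Rabs s <= a') by (apply Rabs_le; lra). pose proof (Rabs_pos s).
    assert (H1 : a' <= a) by apply Rmin_l. assert (H2 : a' <= r0 / (K + 1)) by apply Rmin_r.
    split; [ lra | ]. assert (H3 : (K + 1) * Rabs s <= (K + 1) * (r0 / (K + 1))) by (apply Rmult_le_compat_l; lra).
    replace ((K + 1) * (r0 / (K + 1))) with r0 in H3 by (field; lra). lra. }
  (* One neighbourhood serves the continuity of the speed and of both boundary perturbations, all of
     which are Lipschitz in s. *)
  assert (Near : forall s0 c, - a' < s0 < a' -> 0 <= c -> forall eps : posreal,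
    locally s0 (fun s => - a' < s < a' /\ c * Rabs (s - s0) < eps)).
  { intros s0 c Hs0 Hc eps. assert (Hrad : 0 < Rmin (Rmin (a' - s0) (a' + s0)) (eps / (c + 1))).
    { repeat apply Rmin_pos; try lra. apply Rdiv_lt_0_compat; [ apply cond_pos | lra ]. }
    exists (mkposreal _ Hrad). intros s Hss. change (Rabs (s - s0) < Rmin (Rmin (a' - s0) (a' + s0)) (eps / (c + 1))) in Hss.
    pose proof (Rmin_l (Rmin (a' - s0) (a' + s0)) (eps / (c + 1))). pose proof (Rmin_r (Rmin (a' - s0) (a' + s0)) (eps / (c + 1))).
    pose proof (Rmin_l (a' - s0) (a' + s0)). pose proof (Rmin_r (a' - s0) (a' + s0)).
    split.
    - assert (Hss' : Rabs (s - s0) < Rmin (a' - s0) (a' + s0)) by lra. apply Rabs_lt_between in Hss'. lra.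
    - assert (H3 : (c + 1) * Rabs (s - s0) < (c + 1) * (eps / (c + 1))) by (apply Rmult_lt_compat_l; lra).
      replace ((c + 1) * (eps / (c + 1))) with (pos eps) in H3 by (field; lra). pose proof (Rabs_pos (s - s0)). lra. }
  assert (Hcurve : forall j, C1_holder_curve alpha a' (fun s => fext (xs s) j)).
  { intros j. split.
    - intros s Hss. destruct (HB s (proj1 (Hs s Hss))) as [Hx _].
      apply (C1_holder_of_fser d Hd (xs s) _ Hx j alpha _ Hal). intros t. apply fext_cis.
    - intros s0 Hs0. set (c := (2 + 2 * / d) * K).
      assert (Hi : 0 < / d) by (apply Rinv_0_lt_compat; auto).
      assert (Hc : 0 <= c) by (apply Rmult_le_pos; lra).
      apply filterlim_locally. intros eps. apply filter_imp with (2 := Near s0 c Hs0 Hc eps).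
      intros s [Hss Hlt]. destruct (Hs s Hss) as [S1 _], (Hs s0 Hs0) as [S2 _].
      destruct (HB s S1) as [X1 _], (HB s0 S2) as [X2 _]. destruct (HL s s0 S1 S2) as [X3 _].
      (* On the circle the difference of two extensions is the series of the difference of
         coefficients, so the norm estimate applies to it directly. *)
      destruct (C1_holder_of_fser d Hd _ _ X3 j alpha (fun w => fext (xs s) j w - fext (xs s0) j w)%C Hal) as [_ [N1 N2]].
      { intros t. rewrite !fext_cis. apply (fser_sub d _ _ _ _ j t Hd X1 X2). }
      change (Rabs (C1_holder_norm alpha (fun w => fext (xs s) j w - fext (xs s0) j w)%C - 0) < eps).
      rewrite Rminus_0_r, Rabs_pos_eq by auto. eapply Rle_lt_trans; [ apply N2 | ].
      rewrite <- Rmult_assoc. exact Hlt. }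
  exists a', Om, (fun s => fext (xs s) true), (fun s => fext (xs s) false).
  split; auto. split; [ | split; [ apply Hcurve | split; [ apply Hcurve | split; [ exact HOm | split; [ | split ] ] ] ] ].
  - intros s0 Hs0. apply filterlim_locally. intros eps. apply filter_imp with (2 := Near s0 K Hs0 HK eps).
    intros s [Hss Hlt]. change (Rabs (Om s - Om s0) < eps).
    destruct (HL s s0 (proj1 (Hs s Hss)) (proj1 (Hs s0 Hs0))) as [_ H]. lra.
  - intros w _. destruct (HB 0 (proj1 (Hs 0 ltac:(lra)))) as [Hx _].
    assert (Z : forall j, fext (xs 0) j w = 0).
    { intros j. apply Cmod_eq_0. apply Rle_antisym; [ | apply Cmod_ge_0 ].
      eapply Rle_trans; [ apply (fext_bound d Hd _ _ Hx) | ]. rewrite Rabs_R0. lra. }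
    split; apply Z.
  - intros s Hss Hne. exists (RtoC 1). split; [ apply Cmod_1 | left ]. intros E.
    destruct (HB s (proj1 (Hs s Hss))) as [Hx [H0 [Ht _]]].
    pose proof (fext_1_lower d _ _ _ _ Hd Hx H0 Ht) as H. rewrite E, Cmod_0 in H.
    pose proof (Rabs_pos_lt s Hne). lra.
  - intros s Hss. destruct (Hs s Hss) as [S1 S2]. destruct (HB s S1) as [Hx [_ [_ Heq]]].
    set (A := K * Rabs s) in *.
    assert (HA1 : b1 + A < 1) by lra.
    assert (HAq : A * (2 / (b1 - b2) + / b2) <= / 8).
    { fold q. replace (/ 8) with (/ 8 / q * q) by (field; lra). apply Rmult_le_compat_r; lra. }
    split; [ apply (real_conj_series_fext d Hd _ A Hx) | ].
    split; [ apply (real_conj_series_fext d Hd _ A Hx) | ].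
    exists (region b1 b2 (xs s) true), (region b1 b2 (xs s) false).
    split; [ apply (exterior_parametrization_region d b1 b2 Hd Hb2 Hb12 _ A Hx HAq) | ].
    split; [ apply (exterior_parametrization_region d b1 b2 Hd Hb2 Hb12 _ A Hx HAq) | ].
    split; [ | split ].
    + intros z Hz. apply (region_true_iff d b1 b2 Hd Hb2 Hb12 _ A Hx HAq).
      apply (closure_region_false_iff d b1 b2 Hd Hb2 Hb12 _ A Hx HAq) in Hz. lra.
    + apply (closure_region_true_unit_disc d b1 b2 Hd Hb2 Hb12 _ A Hx HAq HA1).
    + assert (HAr : A <= r) by lra.
      apply (V_state_patch d b1 b2 Hd Hb2 Hb12 Hb1 (xs s) A Hx HAq HA1); auto;
        intros j k; apply (HW (xs s) A HAr Hx j k).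
Qed.
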